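(* Let $\varphi:\mathbb{C}\to\mathbb{R}_+$ be a function in $C^2(\mathbb{C})$ for which there exist two positive constants $m$ and $M$ such that $m\,\omega_0\le \mathrm{i}\,\partial\overline{\partial}\varphi\le M\,\omega_0$ on $\mathbb{C}$, where $\omega_0=\mathrm{i}\,\partial\overline{\partial}|z|^2$. Let $0<p\le 1$. Then there is no Berger-Coburn phenomenon for the Schatten class $S_p(F^2_\varphi(\mathbb{C}),L^2_\varphi(\mathbb{C}))$; that is, there is a function $f\in L^\infty(\mathbb{C})$ such that $H_f\in S_p(F^2_\varphi,L^2_\varphi)$ but $H_{\bar f}\notin S_p(F^2_\varphi,L^2_\varphi)$.
   Context: Let $v$ be the standard Lebesgue measure on $\mathbb{C}$. For a weight $\varphi$ as in the claim, $L^2_\varphi=L^2_\varphi(\mathbb{C})$ is the Hilbert space of (classes of) measurable functions $g:\mathbb{C}\to\mathbb{C}$ with $\|g\|_\varphi=\left(\int_{\mathbb{C}}|g(z)|^2e^{-2\varphi(z)}\,dv(z)\right)^{1/2}<\infty$. The weighted Fock space is $F^2_\varphi=F^2_\varphi(\mathbb{C})=H(\mathbb{C})\cap L^2_\varphi$, where $H(\mathbb{C})$ is the space of entire functions. The condition $m\omega_0\le \mathrm{i}\partial\overline{\partial}\varphi\le M\omega_0$ is understood in the sense of currents; in complex dimension one (the case here) it says that the Laplacian $\Delta\varphi$ is bounded above and below by positive constants (up to changing the constants by a normalization factor). Let $P$ be the orthogonal projection of $L^2_\varphi$ onto $F^2_\varphi$. For $f\in L^\infty(\mathbb{C})$, the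 Hankel operator $H_f:F^2_\varphi\to L^2_\varphi$ is the bounded operator $H_fg=(I-P)(fg)$, $g\in F^2_\varphi$. Here $\bar f$ is the complex conjugate of $f$. For a bounded linear operator $T:H_1\to H_2$ between Hilbert spaces, its singular values are $s_j(T)=\inf\{\|T-K\| : K:H_1\to H_2 \text{ bounded linear},\ \operatorname{rank}K\le j\}$, $j=0,1,2,\dots$. For $0<p<\infty$, $T$ belongs to the Schatten class $S_p(H_1,H_2)$ if $\sum_{j=0}^\infty s_j(T)^p<\infty$. The Berger-Coburn phenomenon is said to hold for $S_p(F^2_\varphi,L^2_\varphi)$ (with bounded symbols) if for every $f\in L^\infty(\mathbb{C})$ one has $H_f\in S_p(F^2_\varphi,L^2_\varphi)\iff H_{\bar f}\in S_p(F^2_\varphi,L^2_\varphi)$. *)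

(* Defs.v *)
(* MathComp-Analysis, with the complex numbers R[i] of mathcomp-real-closed
   over an arbitrary R : realType. *)
From HB Require Import structures.
From mathcomp Require Import all_boot all_order all_algebra.
From mathcomp Require Import complex.
From mathcomp Require Import all_classical all_reals all_analysis.

Set Implicit Arguments.
Unset Strict Implicit.
Unset Printing Implicit Defensive.

Import Order.TTheory GRing.Theory Num.Theory.
Import numFieldNormedType.Exports.
Import ComplexField.Normc.

Local Open Scope classical_set_scope.
Local Open Scope complex_scope.
Local Open Scope ring_scope.

Section LebesgueMeasureC.
Variable R : realType.

Definition C_of_pair (xy : measurableTypeR R * measurableTypeR R) : R[i] := xy.1 +i* xy.2.

(* The sigma-algebra of R[i] is that of R * R (product of the Borel
   sigma-algebras), transported along (x, y) |-> x + iy. *)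
Definition C_measurable : set (set R[i]) :=
  [set A | measurable (C_of_pair @^-1` A)].

Lemma C_measurable0 : C_measurable set0.
Proof. by rewrite /C_measurable /= preimage_set0; exact: measurable0. Qed.

Lemma C_measurableC A : C_measurable A -> C_measurable (~` A).
Proof. by rewrite /C_measurable /= preimage_setC; exact: measurableC. Qed.

Lemma C_measurable_bigcup (F : (set R[i])^nat) :
  (forall i, C_measurable (F i)) -> C_measurable (\bigcup_i F i).
Proof.
by rewrite /C_measurable /= preimage_bigcup => mF; exact: bigcup_measurable.
Qed.

(* R[i]^o is the copy of R[i] carrying the library's topology and R[i]-normed
   module structure; it is used below for continuity and complex derivatives. *)
HB.instance Definition _ := Pointed.copy R[i] R[i]^o.

HB.instance Definition _ := @isMeasurable.Build default_measure_display R[i]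
  C_measurable C_measurable0 C_measurableC C_measurable_bigcup.

Lemma measurable_C_of_pair : measurable_fun setT C_of_pair.
Proof. by move=> _ A mA; rewrite setTI. Qed.

Definition lebesgueC : set R[i] -> \bar R :=
  pushforward (@lebesgue_measure R \x @lebesgue_measure R)%E C_of_pair.

Let lebesgueC0 : lebesgueC set0 = 0%E.
Proof. by rewrite /lebesgueC /pushforward preimage_set0 measure0. Qed.

Let lebesgueC_ge0 A : (0 <= lebesgueC A)%E.
Proof. by rewrite /lebesgueC /pushforward; exact: measure_ge0. Qed.

Let lebesgueC_sigma_additive : semi_sigma_additive lebesgueC.
Proof.
move=> F mF tF mUF; rewrite /lebesgueC /pushforward preimage_bigcup.
apply: measure_semi_sigma_additive; [exact: mF| |].
- apply/trivIsetP => /= i k _ _ ik; rewrite -preimage_setI.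
  by move/trivIsetP : tF => /(_ _ _ _ _ ik) ->//; rewrite preimage_set0.
- by rewrite -preimage_bigcup; exact: mUF.
Qed.

HB.instance Definition _ := isMeasure.Build _ _ _ lebesgueC
  lebesgueC0 lebesgueC_ge0 lebesgueC_sigma_additive.

End LebesgueMeasureC.

Section WeightedFockSpace.
Variable R : realType.
Local Notation C := R[i].
Local Notation mu := (@lebesgueC R).
Implicit Types (phi : C -> R) (f g h : C -> C) (z : C) (p : R).

(* Real directional derivatives: v = 1 gives d/dx and v = i gives d/dy. *)
Definition rderivable (v : C) (phi : C -> R) (z : C) : Prop :=
  derivable (fun t : R => phi (z + t%:C * v)) 0 1.

Definition rderive (v : C) (phi : C -> R) (z : C) : R :=
  derive1 (fun t : R => phi (z + t%:C * v)) 0.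

Definition C1 (phi : C -> R) : Prop :=
  forall v : C, v = 1 \/ v = 'i%C ->
    (forall z, rderivable v phi z) /\ continuous (rderive v phi : C^o -> R).

Definition C2 (phi : C -> R) : Prop :=
  C1 phi /\ C1 (rderive 1 phi) /\ C1 (rderive 'i%C phi).

(* Coefficient of i dz /\ dzbar in i ddbar phi, that is
   d^2 phi / dz dzbar = (phi_xx + phi_yy) / 4; for phi of class C^2, an
   inequality between such (1,1)-currents on the plane is the pointwise
   inequality between these coefficients. *)
Definition ddbar (phi : C -> R) (z : C) : R :=
  4^-1 * (rderive 1 (rderive 1 phi) z + rderive 'i%C (rderive 'i%C phi) z).

Definition entire (g : C -> C) : Prop :=
  forall z : C, derivable (g : C^o -> C^o) z 1.

Definition Linfty (f : C -> C) : Prop :=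
  measurable_fun setT f /\
  (Lnorm mu +oo (fun z => (normc (f z))%:E) < +oo)%E.

Definition normphi (phi : C -> R) (g : C -> C) : \bar R :=
  ((\int[mu]_z (normc (g z) ^+ 2 * expR (- (2 * phi z)))%:E) `^ 2^-1)%E.

(* Elements of the Hilbert space L^2_phi are represented by functions, equality
   in L^2_phi being equality mu-almost everywhere. *)
Definition L2 (phi : C -> R) : set (C -> C) :=
  [set g | measurable_fun setT g /\ (normphi phi g < +oo)%E].

Definition F2 (phi : C -> R) : set (C -> C) :=
  [set g | entire g /\ L2 phi g].

Definition innerphi (phi : C -> R) (g h : C -> C) : C :=
  let k z : C := g z * ((h z)^*)%C * (expR (- (2 * phi z)))%:C in
  Rintegral mu setT (fun z => complex.Re (k z)) +i*
  Rintegral mu setT (fun z => complex.Im (k z)).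

(* The orthogonal projection P of L^2_phi onto F^2_phi: P g is the element u of
   F^2_phi with g - u orthogonal to F^2_phi.  Elements of F^2_phi being
   continuous, u is unique as a function, not only up to null sets. *)
Definition fock_proj (phi : C -> R) (g : C -> C) : C -> C :=
  xget (fun=> 0)
    [set u | F2 phi u /\
             forall h, F2 phi h -> innerphi phi (fun z => g z - u z) h = 0].

Definition hankel (phi : C -> R) (f g : C -> C) : C -> C :=
  fun z => f z * g z - fock_proj phi (fun w => f w * g w) z.

(* Operators F^2_phi -> L^2_phi are represented by maps on functions; only
   their values on F2 phi, up to null sets, are relevant. *)
Definition bounded_linear_op (phi : C -> R) (K : (C -> C) -> C -> C) : Prop :=
  [/\ forall g, F2 phi g -> L2 phi (K g),
      forall (a : C) g h, F2 phi g -> F2 phi h ->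
        {ae mu, forall z, K (fun w => a * g w + h w) z = a * K g z + K h z} &
      exists B : R, forall g, F2 phi g ->
        (normphi phi (K g) <= B%:E * normphi phi g)%E].

Definition rank_le (phi : C -> R) (j : nat) (K : (C -> C) -> C -> C) : Prop :=
  exists2 e : 'I_j -> (C -> C), forall i, L2 phi (e i) &
    forall g, F2 phi g -> exists c : 'I_j -> C,
      {ae mu, forall z, K g z = \sum_(i < j) c i * e i z}.

Definition opnorm (phi : C -> R) (T : (C -> C) -> C -> C) : \bar R :=
  ereal_sup [set normphi phi (T g) | g in
    [set g | F2 phi g /\ (normphi phi g <= 1)%E]].

Definition singular_value (phi : C -> R) (T : (C -> C) -> C -> C) (j : nat) :
    \bar R :=
  ereal_inf [set opnorm phi (fun g z => T g z - K g z) | K in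
    [set K | bounded_linear_op phi K /\ rank_le phi j K]].

(* For bounded linear T; finiteness of the sum forces singular_value phi T 0,
   which is the norm of T, to be finite. *)
Definition Schatten (phi : C -> R) (p : R) (T : (C -> C) -> C -> C) : Prop :=
  (\sum_(0 <= j <oo) (singular_value phi T j `^ p) < +oo)%E.

Definition Berger_Coburn (phi : C -> R) (p : R) : Prop :=
  forall f, Linfty f ->
    (Schatten phi p (hankel phi f) <->
     Schatten phi p (hankel phi (fun z => ((f z)^*)%C))).

End WeightedFockSpace.

(* Main.v *)
Require Import Defs.
From HB Require Import structures.
From mathcomp Require Import all_boot all_order all_algebra.
From mathcomp Require Import complex ring lra.
From mathcomp Require Import all_classical all_reals all_analysis.
From mathcomp Require Import measurable_realfun.

Set Implicit Arguments.
Unset Strict Implicit.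
Unset Printing Implicit Defensive.

Import Order.TTheory GRing.Theory Num.Theory.
Import numFieldNormedType.Exports.
Import ComplexField.Normc.

Local Open Scope classical_set_scope.
Local Open Scope complex_scope.
Local Open Scope ring_scope.

(** The symbol that separates the two Hankel operators is [recip], a smoothing
of 1/z that is equal to 1/z outside the unit disc.

Its own Hankel operator lies in every Schatten class.  Fix [g0] in the Fock
space with [g0 0 = 1].  For [g] in the Fock space the quotient
q = (g - g(0) g0) / z is entire, hence reproduced by the projection P, so that
H g = g(0) H g0 - (I - P)(chi q), where chi = 1 - z [recip] lives in the unit
disc.  There q differs from its Taylor polynomial of degree N - 1 by
O(2^-N) times the norm of [g], because the Taylor remainder, divided by z^N, is
controlled on an annulus of inner radius 2 ([tail_bound]).  The singular values
decay like 2^-N ([hankel_recip_schatten]).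

The Hankel operator of the conjugate is not even of trace class.  Around each
point [a] of a lattice in a quadrant there is an entire [e] with
|e(a)|^2 exp(-2 phi(a)) = 1 whose norm with the weight
exp(-2 phi) (1 + |z - a|^2)^2 is bounded uniformly in [a] ([peak_function]);
this decay makes the family of the [e] a Bessel family ([bessel]).  Pair
H e with the dbar-derivative of eta, the product of conj e, a cut-off around
[a] and exp(-2 phi).  Entire functions are orthogonal to it, so the projection
disappears, and integration by parts leaves the integral of |e|^2 times the
cut-off, exp(-2 phi) and -dbar (conj [recip]) = conj z ^ -2: up to a phase this
is at least a constant times |a|^-2 ([hankel_lower]).  The test functions are a
Bessel family as well, so the sum of these pairings, the trace of a matrix,
would be bounded by the sum of the singular values ([schatten_trace]), which is
finite for an operator in S_p, p <= 1.  But the sum of |a|^-2 over a planar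
lattice diverges.

The analysis behind this is built from Wirtinger derivatives ([wirt]) and the
divergence theorem: Goursat's theorem and the mean value property give the
regularity of entire functions, and L2-bounded sequences that are holomorphic
in the limit have entire weak limits ([weak_limit]); this and a Riesz argument
([riesz]) yield the projection.  The lower bound on the Laplacian of phi enters
through the twisted identity behind the Ohsawa-Takegoshi theorem, which gives
the peak functions; the upper bound enters through the Bochner identity, which
gives the sub-mean value property [submean] and the Caccioppoli estimate
[dbar_eta_bound].  Truncated powers (1 - |z - a|^2)_+^n ([bump]) serve as
cut-offs and as mollifiers throughout: they are stable under multiplication by
|z - a|^2 and under differentiation, so all identities stay algebraic. *)

(** * The complex plane: norm and continuity *)

Section ComplexBasics.
Variable R : realType.
Local Notation C := R[i].
Local Notation Re := (@complex.Re R).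
Local Notation Im := (@complex.Im R).
Implicit Types (z w : C).

Lemma normE z : `|z| = (normc z)%:C.
Proof. by case: z => a b; rewrite normc_def. Qed.
Lemma normc_ge0 z : 0 <= normc z :> R.
Proof. by case: z => a b /=; exact: sqrtr_ge0. Qed.
Lemma normc_sq z : normc z ^+ 2 = Re z ^+ 2 + Im z ^+ 2.
Proof. by case: z => a b /=; rewrite sqr_sqrtr// addr_ge0 ?sqr_ge0. Qed.
Lemma normc_real (x : R) : normc x%:C = `|x|.
Proof. by rewrite /= expr0n/= addr0 sqrtr_sqr. Qed.
Lemma normc_conj z : normc z^* = normc z.
Proof. by case: z => a b /=; rewrite sqrrN. Qed.
Lemma mulJ z : z * z^* = (normc z ^+ 2)%:C.
Proof.
case: z => a b; rewrite normc_sq /=; apply/eqP; rewrite eq_complex /=.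
by apply/andP; split; apply/eqP; ring.
Qed.
Lemma Re_le z : `|Re z| <= normc z.
Proof. by case: z => a b /=; rewrite -sqrtr_sqr ler_sqrt ?addr_ge0 ?sqr_ge0// lerDl sqr_ge0. Qed.
Lemma Im_le z : `|Im z| <= normc z.
Proof. by case: z => a b /=; rewrite -sqrtr_sqr ler_sqrt ?addr_ge0 ?sqr_ge0// lerDr sqr_ge0. Qed.
Lemma normc_le z : normc z <= `|Re z| + `|Im z|.
Proof.
rewrite -(@ler_pXn2r _ 2)// ?nnegrE ?normc_ge0 ?addr_ge0// normc_sq.
rewrite sqrrD !real_normK ?num_real// -addrA [_ *+ 2 + _]addrC addrA lerDl.
by rewrite mulrn_wge0// mulr_ge0.
Qed.
Lemma ReD z w : Re (z + w) = Re z + Re w. Proof. by case: z w => ? ? []. Qed.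
Lemma ImD z w : Im (z + w) = Im z + Im w. Proof. by case: z w => ? ? []. Qed.
Lemma ReN z : Re (- z) = - Re z. Proof. by case: z. Qed.
Lemma ImN z : Im (- z) = - Im z. Proof. by case: z. Qed.
Lemma ReM z w : Re (z * w) = Re z * Re w - Im z * Im w. Proof. by case: z w => ? ? []. Qed.
Lemma ImM z w : Im (z * w) = Re z * Im w + Im z * Re w. Proof. by case: z w => ? ? []. Qed.
Lemma ReJ z : Re z^* = Re z. Proof. by case: z. Qed.
Lemma ImJ z : Im z^* = - Im z. Proof. by case: z. Qed.
Lemma conjM z w : (z * w)^* = z^* * w^*. Proof. exact: rmorphM. Qed.
Lemma conjD z w : (z + w)^* = z^* + w^*. Proof. exact: rmorphD. Qed.
Lemma conjN z : (- z)^* = - z^*. Proof. exact: rmorphN. Qed.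
Lemma conjB z w : (z - w)^* = z^* - w^*. Proof. exact: rmorphB. Qed.
Lemma conjX z n : (z ^+ n)^* = z^* ^+ n. Proof. exact: rmorphXn. Qed.
Lemma conj1 : (1 : C)^* = 1. Proof. exact: rmorph1. Qed.
Lemma conj0 : (0 : C)^* = 0. Proof. exact: rmorph0. Qed.
Lemma conjR (x : R) : (x%:C)^* = x%:C. Proof. exact: conjc_real. Qed.
Lemma complexP z w : Re z = Re w -> Im z = Im w -> z = w.
Proof. by case: z w => a b [c d] /= -> ->. Qed.
Lemma ReRM (x : R) z : Re (x%:C * z) = x * Re z.
Proof. by rewrite ReM /= mul0r subr0. Qed.
Lemma ImRM (x : R) z : Im (x%:C * z) = x * Im z.
Proof. by rewrite ImM /= mul0r addr0. Qed.
Lemma normcX z n : normc (z ^+ n) = normc z ^+ n.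
Proof. by elim: n => [|n IH]; rewrite ?expr0 ?normc1// !exprS normcM IH. Qed.
Lemma normc_dist z w : normc (z - w) = normc (w - z).
Proof. by rewrite -normcN opprB. Qed.
Lemma le_normcB z w : normc (z - w) <= normc z + normc w.
Proof. by rewrite -(normcN w); exact: le_normcD. Qed.
Lemma le_normc_sum (I : Type) (r : seq I) (P : pred I) (f : I -> C) :
  normc (\sum_(i <- r | P i) f i) <= \sum_(i <- r | P i) normc (f i).
Proof.
elim/big_rec2: _ => [|i y x Pi xy]; first by rewrite normc0.
by rewrite (le_trans (le_normcD _ _))// lerD2l.
Qed.
Lemma normc_gt0 z : (0 < normc z) = (z != 0).
Proof.
rewrite lt_def normc_ge0 andbT; congr (~~ _); apply/eqP/eqP => [/eq0_normc//|->].
exact: normc0.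
Qed.
Lemma lerB_normc z w : normc z - normc w <= normc (z - w).
Proof. by rewrite lerBlDr -{1}(subrK w z) le_normcD. Qed.
End ComplexBasics.

Section GenericContinuity.
Variable K : numFieldType.
Implicit Types F G : K^o -> K^o.
Lemma gctnD F G : continuous F -> continuous G -> continuous (fun z : K^o => F z + G z : K^o).
Proof. by move=> cF cG z; exact: (cvgD (cF z) (cG z)). Qed.
Lemma gctnN F : continuous F -> continuous (fun z : K^o => - F z : K^o).
Proof. by move=> cF z; exact: (cvgN (cF z)). Qed.
Lemma gctnM F G : continuous F -> continuous G -> continuous (fun z : K^o => F z * G z : K^o).
Proof. by move=> cF cG z; exact: (cvgM (cF z) (cG z)). Qed.
Lemma gctnV F : continuous F -> (forall z, F z != 0) -> continuous (fun z : K^o => (F z)^-1 : K^o).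
Proof. by move=> cF F0 z; exact: (cvgV (F0 z) (cF z)). Qed.
Lemma gctn_comp (T U V : topologicalType) (f : U -> V) (g : T -> U) :
  continuous f -> continuous g -> continuous (fun z => f (g z)).
Proof. by move=> cf cg z; apply: continuous_comp; [exact: cg|exact: cf]. Qed.
End GenericContinuity.

Section Continuity.
Variable R : realType.
Local Notation C := R[i].
Local Notation Re := (@complex.Re R).
Local Notation Im := (@complex.Im R).
Implicit Types (z w : C) (F G : C -> C).

(** Made opaque after this section: what it unfolds to is an implication between neighbourhoods, which proof search would try to use. *)
Definition ctn F := continuous (F : C^o -> C^o).

Lemma nbhsC_ball z (P : set C) :
  nbhs (z : C^o) P <-> exists2 d : R, 0 < d & forall w, normc (w - z) < d -> P w.
Proof.
split.
- move/nbhs_ballP => [e e0 Pe]; exists (Re e).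
    by move: e0; rewrite /= ltcE => /andP[].
  move=> w wz; apply: Pe; rewrite /ball/= -opprB normrN normE ltcE /=.
  by move: e0; rewrite /= ltcE /= => /andP[-> _].
- move=> [d d0 Pd]; apply/nbhs_ballP; exists d%:C; first by rewrite /= ltcR.
  by move=> w; rewrite /ball /= -opprB normrN normE ltcR => /Pd.
Qed.

Lemma cvgCP (T : Type) (f : T -> C) (A : set_system T) {FF : Filter A} (l : C) :
  (f : T -> C^o) @ A --> (l : C^o) <->
  forall e : R, 0 < e -> \forall x \near A, normc (f x - l) < e.
Proof.
split.
- move=> fl e e0; have := fl [set w | normc (w - l) < e]; apply.
  by apply/nbhsC_ball; exists e.
- move=> H P /nbhsC_ball[d d0 Pd]; near=> x; apply: Pd; near: x; exact: H.
Unshelve. all: end_near. Qed.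

Lemma ctnP F : ctn F <->
  forall z (e : R), 0 < e -> exists2 d : R, 0 < d &
    forall w, normc (w - z) < d -> normc (F w - F z) < e.
Proof.
split => [cF z e e0|H z].
- have /cvgCP/(_ e e0) := cF z; exact: (nbhsC_ball _ _).1.
- move=> P /nbhsC_ball[e e0 Pe]; have [d d0 Hd] := H z e e0.
  by apply/nbhsC_ball; exists d => // w /Hd /Pe.
Qed.

Lemma continuousRC (u : C -> R) :
  (forall z (e : R), 0 < e -> exists2 d : R, 0 < d &
    forall w, normc (w - z) < d -> `|u w - u z| < e) ->
  continuous (u : C^o -> R).
Proof.
move=> H z P /nbhs_ballP[e /= e0 Pe]; have [d d0 Hd] := H z e e0.
apply/nbhsC_ball; exists d => // w /Hd; rewrite distrC => uwz.
exact: Pe.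
Qed.

Lemma continuous_Re : continuous (Re : C^o -> R).
Proof.
apply: continuousRC => z e e0; exists e => // w; apply: le_lt_trans.
by rewrite -ReN -ReD Re_le.
Qed.
Lemma continuous_Im : continuous (Im : C^o -> R).
Proof.
apply: continuousRC => z e e0; exists e => // w; apply: le_lt_trans.
by rewrite -ImN -ImD Im_le.
Qed.
Lemma continuous_normc : continuous (@normc R : C^o -> R).
Proof.
apply: continuousRC => z e e0; exists e => // w; apply: le_lt_trans.
rewrite ler_norml lerB_normc andbT lerNl opprB normc_dist.
exact: lerB_normc.
Qed.
Lemma ctn_conj : ctn (@conjc R).
Proof.
by apply/ctnP => z e e0; exists e => // w; rewrite -conjB normc_conj.
Qed.
Lemma continuous_RC : continuous (fun x : R => x%:C : C^o).
Proof.
move=> x; apply/cvgCP => e e0; near=> y.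
rewrite -rmorphB normc_real distrC; near: y.
exact: cvgr_dist_lt.
Unshelve. all: end_near. Qed.

Lemma ctn_cst (c : C) : ctn (fun=> c).
Proof. by apply/ctnP => z e e0; exists 1 => // w _; rewrite subrr normc0. Qed.
Lemma ctn_id : ctn (fun z => z).
Proof. by apply/ctnP => z e e0; exists e. Qed.
Lemma ctnD F G : ctn F -> ctn G -> ctn (fun z => F z + G z).
Proof. exact: (@gctnD C). Qed.
Lemma ctnN F : ctn F -> ctn (fun z => - F z).
Proof. exact: (@gctnN C). Qed.
Lemma ctnB F G : ctn F -> ctn G -> ctn (fun z => F z - G z).
Proof. by move=> cF cG; exact: ctnD cF (ctnN cG). Qed.
Lemma ctnM F G : ctn F -> ctn G -> ctn (fun z => F z * G z).
Proof. exact: (@gctnM C). Qed.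
Lemma ctnX F n : ctn F -> ctn (fun z => F z ^+ n).
Proof.
move=> cF; elim: n => [|n IH].
  by under eq_fun do rewrite expr0; exact: ctn_cst.
by under eq_fun do rewrite exprS; exact: ctnM.
Qed.
Lemma ctnV F : ctn F -> (forall z, F z != 0) -> ctn (fun z => (F z)^-1).
Proof. exact: (@gctnV C). Qed.
Lemma ctn_comp F G : ctn F -> ctn G -> ctn (fun z => F (G z)).
Proof. exact: (@gctn_comp C^o C^o C^o). Qed.
Lemma ctnJ F : ctn F -> ctn (fun z => (F z)^*).
Proof. by move=> cF; apply: (ctn_comp ctn_conj). Qed.
Lemma ctnR (u : C -> R) : continuous (u : C^o -> R) -> ctn (fun z => (u z)%:C).
Proof. exact/(@gctn_comp C^o R C^o)/continuous_RC. Qed.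
Lemma ctnRe F : ctn F -> continuous (fun z : C^o => Re (F z)).
Proof. exact/(@gctn_comp C^o C^o R)/continuous_Re. Qed.
Lemma ctnIm F : ctn F -> continuous (fun z : C^o => Im (F z)).
Proof. exact/(@gctn_comp C^o C^o R)/continuous_Im. Qed.
Lemma ctn_normc F : ctn F -> continuous (fun z : C^o => normc (F z)).
Proof. exact/(@gctn_comp C^o C^o R)/continuous_normc. Qed.
Lemma ctnRr (u : C -> R) : ctn (fun z => (u z)%:C) -> continuous (u : C^o -> R).
Proof. by move=> cu; exact: (ctnRe cu). Qed.
Lemma continuous_compR (u : C -> R) (f : R -> R) :
  continuous f -> continuous (u : C^o -> R) -> continuous (fun z : C^o => f (u z)).
Proof. exact: (@gctn_comp C^o R R). Qed.

Lemma continuous_pair : continuous (@C_of_pair R : (R * R)%type -> C^o).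
Proof.
move=> [x y]; apply/cvgCP => e e0.
have e20 : 0 < e / 2 by rewrite divr_gt0.
near=> p.
have -> : e = e / 2 + e / 2 by rewrite -splitr.
apply: (le_lt_trans (normc_le _)).
rewrite /C_of_pair /= ltrD//.
- near: p.
  have : (fst : (R * R)%type -> R) p @[p --> (x, y)] --> x by exact: cvg_fst.
  by move/cvgrPdist_lt => /(_ _ e20); apply: filterS => p; rewrite distrC.
- near: p.
  have : (snd : (R * R)%type -> R) p @[p --> (x, y)] --> y by exact: cvg_snd.
  by move/cvgrPdist_lt => /(_ _ e20); apply: filterS => p; rewrite distrC.
Unshelve. all: end_near. Qed.

Lemma continuous_line z v : continuous (fun t : R => z + t%:C * v : C^o).
Proof.
apply: (@gctn_comp R C^o C^o (fun w => z + w * v) (fun t => t%:C)).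
  apply: ctnD; first exact: ctn_cst.
  by apply: ctnM; [exact: ctn_id|exact: ctn_cst].
exact: continuous_RC.
Qed.

End Continuity.
#[global] Opaque ctn.

(** * Measurable functions and integrals on the plane *)

Section Measurability.
Variable R : realType.
Local Notation C := R[i].
Local Notation Re := (@complex.Re R).
Local Notation Im := (@complex.Im R).
Local Notation RR := (measurableTypeR R * measurableTypeR R)%type.
Implicit Types (z w : C) (F G : C -> C).

(** An open set is the union of the rational rectangles that it contains; this identifies the product sigma-algebra with the Borel sets. *)
Lemma open_measurable2 (U : set (R * R)) :
  open U -> measurable (U : set RR).
Proof.
move=> oU.
pose rect (q : (rat * rat) * (rat * rat)) : set RR :=
  [set` `]ratr q.1.1 : R, ratr q.1.2[%R] `*` [set` `]ratr q.2.1 : R, ratr q.2.2[%R].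
pose F q : set RR := if `[< rect q `<=` U >] then rect q else set0.
have -> : U = \bigcup_q F q.
  apply/seteqP; split => [[x y] Uxy|p [q _]]; last first.
    by rewrite /F; case: asboolP => // qU /qU.
  have : nbhs (x, y) U by exact: open_nbhs_nbhs.
  move=> [[P Q] /= [/nbhs_ballP[e1 /= e10 P1] /nbhs_ballP[e2 /= e20 Q2]] PQ].
  have [q1 q1x] := @rat_in_itvoo R (x - e1) x ltac:(by rewrite ltrBlDr ltrDl).
  have [q2 q2x] := @rat_in_itvoo R x (x + e1) ltac:(by rewrite ltrDl).
  have [q3 q3x] := @rat_in_itvoo R (y - e2) y ltac:(by rewrite ltrBlDr ltrDl).
  have [q4 q4x] := @rat_in_itvoo R y (y + e2) ltac:(by rewrite ltrDl).
  move: q1x q2x q3x q4x; rewrite !in_itv/= => /andP[a1 b1] /andP[a2 b2] /andP[a3 b3] /andP[a4 b4].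
  exists ((q1, q2), (q3, q4)) => //; rewrite /F; case: asboolP => [_|[]].
    by rewrite /rect/=; split => /=; rewrite in_itv/= ?b1 ?a2 ?b3 ?a4.
  move=> [u v] [/=]; rewrite !in_itv/= => /andP[u1 u2] /andP[v1 v2]; apply: PQ; split => /=.
    apply: P1; rewrite /ball/= ltr_norml; apply/andP; split; lra.
  apply: Q2; rewrite /ball/= ltr_norml; apply/andP; split; lra.
apply: countable_bigcupT_measurable => [|q]; first exact: countableP.
rewrite /F; case: asboolP => // _.
by apply: measurableX; exact: measurable_itv.
Qed.

Lemma measurable_Re : measurable_fun setT (Re : C -> R).
Proof.
move=> _ A mA; rewrite setTI /measurable/= /C_measurable/=.
have -> : @C_of_pair R @^-1` (Re @^-1` A) = (fst : RR -> _) @^-1` A by [].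
by rewrite -[X in measurable X]setTI; exact: measurable_fst.
Qed.
Lemma measurable_Im : measurable_fun setT (Im : C -> R).
Proof.
move=> _ A mA; rewrite setTI /measurable/= /C_measurable/=.
have -> : @C_of_pair R @^-1` (Im @^-1` A) = (snd : RR -> _) @^-1` A by [].
by rewrite -[X in measurable X]setTI; exact: measurable_snd.
Qed.

Section gen.
Context d (T : measurableType d).
Implicit Types f g : T -> C.

Lemma measurableCP f : measurable_fun setT f <->
  measurable_fun setT (Re \o f) /\ measurable_fun setT (Im \o f).
Proof.
split=> [mf|[mr mi]].
  by split; apply: measurableT_comp => //; [exact: measurable_Re|exact: measurable_Im].
have -> : f = @C_of_pair R \o (fun x => (Re (f x), Im (f x)) : RR).
  by apply/funext => x /=; case: (f x).
apply: measurableT_comp; first exact: measurable_C_of_pair.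
exact: (@measurable_fun_pair _ _ _ _ _ _ (Re \o f) (Im \o f)).
Qed.
Lemma mRe f : measurable_fun setT f -> measurable_fun setT (fun x => Re (f x)).
Proof. by move/measurableCP => []. Qed.
Lemma mIm f : measurable_fun setT f -> measurable_fun setT (fun x => Im (f x)).
Proof. by move/measurableCP => []. Qed.
Lemma mcD f g : measurable_fun setT f -> measurable_fun setT g ->
  measurable_fun setT (fun x => f x + g x).
Proof.
move=> mf mg; apply/measurableCP; split.
  rewrite (_ : _ \o _ = fun x => Re (f x) + Re (g x)); last by apply/funext => x /=; rewrite ReD.
  by apply: measurable_funD; exact: mRe.
rewrite (_ : _ \o _ = fun x => Im (f x) + Im (g x)); last by apply/funext => x /=; rewrite ImD.
by apply: measurable_funD; exact: mIm.
Qed.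
Lemma mcM f g : measurable_fun setT f -> measurable_fun setT g ->
  measurable_fun setT (fun x => f x * g x).
Proof.
move=> mf mg; apply/measurableCP; split.
  rewrite (_ : _ \o _ = fun x => Re (f x) * Re (g x) - Im (f x) * Im (g x)); last by apply/funext => x /=; rewrite ReM.
  by apply: measurable_funB; apply: measurable_funM; [exact: mRe|exact: mRe|exact: mIm|exact: mIm].
rewrite (_ : _ \o _ = fun x => Re (f x) * Im (g x) + Im (f x) * Re (g x)); last by apply/funext => x /=; rewrite ImM.
by apply: measurable_funD; apply: measurable_funM; [exact: mRe|exact: mIm|exact: mIm|exact: mRe].
Qed.
Lemma mcst (c : C) : measurable_fun setT (fun _ : T => c).
Proof. exact: measurable_cst. Qed.
Lemma mcN f : measurable_fun setT f -> measurable_fun setT (fun x => - f x).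
Proof.
move=> mf; rewrite (_ : (fun x => _) = fun x => (-1) * f x); last by apply/funext => x; rewrite mulN1r.
by apply: mcM => //; exact: mcst.
Qed.
Lemma mcB f g : measurable_fun setT f -> measurable_fun setT g ->
  measurable_fun setT (fun x => f x - g x).
Proof. by move=> mf mg; exact: mcD mf (mcN mg). Qed.
Lemma mcJ f : measurable_fun setT f -> measurable_fun setT (fun x => (f x)^*).
Proof.
move=> mf; apply/measurableCP; split.
  by rewrite (_ : _ \o _ = fun x => Re (f x)); [exact: mRe|apply/funext => x /=; rewrite ReJ].
rewrite (_ : _ \o _ = fun x => - Im (f x)); last by apply/funext => x /=; rewrite ImJ.
by have := measurable_funN (mIm mf).
Qed.
Lemma mcR (u : T -> R) : measurable_fun setT u -> measurable_fun setT (fun x => (u x)%:C).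
Proof. by move=> mu; apply/measurableCP; split => //; exact: measurable_cst. Qed.
Lemma mnormc2 f : measurable_fun setT f -> measurable_fun setT (fun x => normc (f x) ^+ 2).
Proof.
move=> mf; rewrite (_ : (fun x => _) = fun x => Re (f x) ^+ 2 + Im (f x) ^+ 2); last first.
  by apply/funext => x; rewrite normc_sq.
by apply: measurable_funD; apply: measurable_funX; [exact: mRe|exact: mIm].
Qed.
Lemma mnormc f : measurable_fun setT f -> measurable_fun setT (fun x => normc (f x)).
Proof.
move=> mf; rewrite (_ : (fun x => _) = fun x => Num.sqrt (normc (f x) ^+ 2)); last first.
  by apply/funext => x; rewrite sqrtr_sqr ger0_norm ?normc_ge0.
apply: (measurableT_comp _ (mnormc2 mf)).
exact: (continuous_measurable_fun (@sqrt_continuous R)).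
Qed.
Lemma mcsum (I : Type) (r : seq I) (f : I -> T -> C) :
  (forall i, measurable_fun setT (f i)) -> measurable_fun setT (fun x => \sum_(i <- r) f i x).
Proof.
move=> mf; elim: r => [|i r IH].
  by under eq_fun do rewrite big_nil; exact: mcst.
by under eq_fun do rewrite big_cons; exact: mcD.
Qed.
End gen.

Lemma continuous_measurableC (u : C -> R) : continuous (u : C^o -> R) ->
  measurable_fun setT u.
Proof.
move=> cu; apply: (@measurability _ _ _ _ _ _ (@RGenOInfty.G R)).
  exact: RGenOInfty.measurableE.
move=> _ [_ [a ->] <-]; rewrite setTI.
suff : open ((u \o @C_of_pair R) @^-1` `]a, +oo[) by exact: open_measurable2.
have cu2 : continuous (u \o @C_of_pair R : (R * R)%type -> R).
  exact: (@gctn_comp (R * R)%type C^o R _ _ cu (@continuous_pair R)).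
by apply: open_comp => // x _; exact: cu2.
Qed.
Lemma ctn_measurable F : ctn F -> measurable_fun setT F.
Proof.
move=> cF; apply/measurableCP; split; apply: continuous_measurableC.
  exact: ctnRe. exact: ctnIm.
Qed.
End Measurability.

Section Integral.
Variable R : realType.
Local Notation C := R[i].
Local Notation Re := (@complex.Re R).
Local Notation Im := (@complex.Im R).
Local Notation mu := (@lebesgueC R).
Implicit Types (z w : C) (F G : C -> C) (u v : C -> R).

(** [rI] and [intR] concern real functions on the plane, [cI] and [cint] complex ones. *)
Definition rI u := mu.-integrable setT (EFin \o u).
Definition intR u : R := Rintegral mu setT u.
Definition cI F := rI (fun z => Re (F z)) /\ rI (fun z => Im (F z)).
Definition cint F : C := intR (fun z => Re (F z)) +i* intR (fun z => Im (F z)).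

Lemma rI_meas u : rI u -> measurable_fun setT u.
Proof. by case/integrableP => /measurable_EFinP. Qed.
Lemma rID u v : rI u -> rI v -> rI (fun z => u z + v z).
Proof. by move=> iu iv; have := integrableD measurableT iu iv. Qed.
Lemma rIB u v : rI u -> rI v -> rI (fun z => u z - v z).
Proof. by move=> iu iv; have := integrableB measurableT iu iv. Qed.
Lemma rIZ k u : rI u -> rI (fun z => k * u z).
Proof. by move=> iu; have := integrableZl measurableT k iu. Qed.
Lemma rI0 : rI (fun=> 0). Proof. exact: integrable0. Qed.
Lemma rI_sum (I : Type) (r : seq I) (f : I -> C -> R) :
  (forall i, rI (f i)) -> rI (fun x => \sum_(i <- r) f i x).
Proof.
move=> mf; elim: r => [|i r IH].
  by under eq_fun do rewrite big_nil; exact: rI0.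
by under eq_fun do rewrite big_cons; exact: rID.
Qed.
Lemma rI_le u v : measurable_fun setT u -> (forall z, `|u z| <= v z) -> rI v -> rI u.
Proof.
move=> mf uv iv; apply: (le_integrable measurableT _ _ iv).
  exact/measurable_EFinP.
by move=> z _ /=; rewrite lee_fin (le_trans (uv z))// ler_norm.
Qed.
Lemma rI_abs u : rI u -> rI (fun z => `|u z|).
Proof. by move=> iu; have := integrable_abse iu. Qed.
Lemma intRD u v : rI u -> rI v -> intR (fun z => u z + v z) = intR u + intR v.
Proof. exact: RintegralD. Qed.
Lemma intRB u v : rI u -> rI v -> intR (fun z => u z - v z) = intR u - intR v.
Proof. exact: RintegralB. Qed.
Lemma intRZ k u : rI u -> intR (fun z => k * u z) = k * intR u.
Proof. exact: RintegralZl. Qed.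
Lemma intRN u : rI u -> intR (fun z => - u z) = - intR u.
Proof.
move=> iu; rewrite -mulN1r -intRZ//; congr intR.
by apply/funext => z; rewrite mulN1r.
Qed.
Lemma intR_le u v : rI u -> rI v -> (forall z, u z <= v z) -> intR u <= intR v.
Proof. by move=> iu iv uv; apply: le_Rintegral. Qed.
Lemma intR_ge0 u : (forall z, 0 <= u z) -> 0 <= intR u.
Proof. by move=> u0; apply: Rintegral_ge0. Qed.
Lemma intR0 : intR (fun=> 0) = 0. Proof. by rewrite /intR Rintegral_cst// mul0r. Qed.
Lemma intR_sum (I : Type) (r : seq I) (f : I -> C -> R) :
  (forall i, rI (f i)) -> intR (fun x => \sum_(i <- r) f i x) = \sum_(i <- r) intR (f i).
Proof.
move=> mf; elim: r => [|i r IH].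
  by under eq_fun do rewrite big_nil; rewrite big_nil intR0.
by under eq_fun do rewrite big_cons; rewrite big_cons intRD ?IH//; exact: rI_sum.
Qed.

Lemma intRE u : rI u -> (intR u)%:E = (\int[mu]_z (u z)%:E)%E.
Proof. by move=> iu; rewrite /intR /Rintegral fineK//; exact: integrable_fin_num. Qed.

Lemma rI_ge0 u : measurable_fun setT u -> (forall z, 0 <= u z) ->
  (\int[mu]_z (u z)%:E < +oo)%E -> rI u.
Proof.
move=> mu0 u0 ui; apply/integrableP; split; first exact/measurable_EFinP.
by under eq_integral do rewrite /= ger0_norm//.
Qed.

Lemma cI_meas F : cI F -> measurable_fun setT F.
Proof. by move=> [/rI_meas ? /rI_meas ?]; apply/measurableCP. Qed.
Lemma cI_norm F : cI F -> rI (fun z => normc (F z)).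
Proof.
move=> iF; apply: (@rI_le _ (fun z => `|Re (F z)| + `|Im (F z)|)).
- exact: (mnormc (cI_meas iF)).
- by move=> z; rewrite ger0_norm ?normc_ge0// normc_le.
- by apply: rID; apply: rI_abs; case: iF.
Qed.
Lemma cI_le F v : measurable_fun setT F -> (forall z, normc (F z) <= v z) -> rI v -> cI F.
Proof.
move=> mF Fv iv; split; apply: (rI_le _ _ iv).
- exact: mRe. - by move=> z; exact: (le_trans (Re_le _)).
- exact: mIm. - by move=> z; exact: (le_trans (Im_le _)).
Qed.
Lemma cID F G : cI F -> cI G -> cI (fun z => F z + G z).
Proof.
move=> iF iG; apply: (@cI_le _ (fun z => normc (F z) + normc (G z))).
- by apply: mcD; exact: cI_meas. - by move=> z; exact: le_normcD.
- by apply: rID; exact: cI_norm.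
Qed.
Lemma cIZ a F : cI F -> cI (fun z => a * F z).
Proof.
move=> iF; apply: (@cI_le _ (fun z => normc a * normc (F z))).
- by apply: mcM; [exact: mcst|exact: cI_meas]. - by move=> z; rewrite normcM.
- by apply: rIZ; exact: cI_norm.
Qed.
Lemma cIN F : cI F -> cI (fun z => - F z).
Proof. by move=> /(cIZ (-1)); under eq_fun do rewrite mulN1r. Qed.
Lemma cIB F G : cI F -> cI G -> cI (fun z => F z - G z).
Proof. by move=> iF /cIN; exact: cID. Qed.
Lemma cI0 : cI (fun=> 0). Proof. by split; exact: rI0. Qed.
Lemma cIR u : rI u -> cI (fun z => (u z)%:C).
Proof. by split => //; exact: rI0. Qed.
Lemma cI_sum (I : Type) (r : seq I) (f : I -> C -> C) :
  (forall i, cI (f i)) -> cI (fun x => \sum_(i <- r) f i x).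
Proof.
move=> mf; elim: r => [|i r IH].
  by under eq_fun do rewrite big_nil; exact: cI0.
by under eq_fun do rewrite big_cons; exact: cID.
Qed.

Lemma eq_cint F G : F =1 G -> cint F = cint G.
Proof. by move=> /funext ->. Qed.
Lemma cintD F G : cI F -> cI G -> cint (fun z => F z + G z) = cint F + cint G.
Proof.
move=> [F1 F2] [G1 G2]; rewrite /cint; apply: complexP => /=; rewrite -intRD//;
 by congr intR; apply/funext => z; rewrite ?ReD ?ImD.
Qed.
Lemma cintZ a F : cI F -> cint (fun z => a * F z) = a * cint F.
Proof.
move=> [F1 F2]; apply: complexP; rewrite ?ReM ?ImM /=.
- rewrite -!intRZ// -intRB; [|exact: rIZ|exact: rIZ].
  by congr intR; apply/funext => z; rewrite ReM.
- rewrite -!intRZ// -intRD; [|exact: rIZ|exact: rIZ].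
  by congr intR; apply/funext => z; rewrite ImM.
Qed.
Lemma cint0 : cint (fun=> 0) = 0. Proof. by rewrite /cint intR0. Qed.
Lemma cintN F : cI F -> cint (fun z => - F z) = - cint F.
Proof. by move=> iF; rewrite -mulN1r -cintZ//; apply: eq_cint => z; rewrite mulN1r. Qed.
Lemma cintB F G : cI F -> cI G -> cint (fun z => F z - G z) = cint F - cint G.
Proof. by move=> iF iG; rewrite cintD ?cintN//; exact: cIN. Qed.
Lemma cint_sum (I : Type) (r : seq I) (f : I -> C -> C) :
  (forall i, cI (f i)) -> cint (fun x => \sum_(i <- r) f i x) = \sum_(i <- r) cint (f i).
Proof.
move=> mf; elim: r => [|i r IH].
  by under eq_fun do rewrite big_nil; rewrite big_nil cint0.
by under eq_fun do rewrite big_cons; rewrite big_cons cintD ?IH//; exact: cI_sum.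
Qed.
Lemma cintR u : cint (fun z => (u z)%:C) = (intR u)%:C.
Proof. by rewrite /cint /= intR0. Qed.
Lemma cintJ F : cI F -> cint (fun z => (F z)^*) = (cint F)^*.
Proof.
move=> [F1 F2]; apply: complexP; rewrite ?ReJ ?ImJ /=.
  by congr intR; apply/funext => z; rewrite ReJ.
by rewrite -intRN//; congr intR; apply/funext => z; rewrite ImJ.
Qed.
Lemma Re_cint F : Re (cint F) = intR (fun z => Re (F z)). Proof. by []. Qed.

Lemma normc_cint F : cI F -> normc (cint F) <= intR (fun z => normc (F z)).
Proof.
move=> iF; have [->|I0] := eqVneq (cint F) 0.
  by rewrite normc0 intR_ge0// => z; exact: normc_ge0.
pose a := (cint F)^*.
have a0 : 0 < normc a by rewrite normc_conj normc_gt0.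
have h : normc a * normc (cint F) <= normc a * intR (fun z => normc (F z)).
  rewrite normc_conj -expr2 -[_ ^+ 2]/(Re ((normc (cint F) ^+ 2)%:C)) -mulJ mulrC -cintZ//.
  rewrite Re_cint -normc_conj -/a -intRZ; last exact: cI_norm.
  apply: intR_le.
  - by have [] := cIZ a iF.
  - by apply: rIZ; exact: cI_norm.
  - by move=> z; rewrite -normcM (le_trans (ler_norm _))// Re_le.
by rewrite -(ler_pM2l a0).
Qed.
End Integral.

(** * Functions of compact support *)

Section CompactSupport.
Variable R : realType.
Local Notation C := R[i].
Local Notation Re := (@complex.Re R).
Local Notation Im := (@complex.Im R).
Local Notation mu := (@lebesgueC R).
Implicit Types (z w a : C) (F G : C -> C) (u v : C -> R).

Definition sq a (r : R) : set C := [set z | `|Re (z - a)| <= r /\ `|Im (z - a)| <= r].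

Lemma sq_pair a r : @C_of_pair R @^-1` (sq a r) =
  [set` `[Re a - r, Re a + r]] `*` [set` `[Im a - r, Im a + r]].
Proof.
apply/seteqP; split => [[x y]|[x y]] /=; rewrite /sq/= ReD ImD ReN ImN /= !in_itv/= !ler_norml;
  move=> [/andP[a1 a2] /andP[b1 b2]]; split; apply/andP; split; lra.
Qed.
Lemma measurable_sq a r : measurable (sq a r).
Proof.
rewrite /measurable/= /C_measurable/= sq_pair.
by apply: measurableX; exact: measurable_itv.
Qed.
Lemma mu_sq a r : 0 <= r -> mu (sq a r) = ((2 * r) ^+ 2)%:E.
Proof.
move=> r0; rewrite /mu/= /lebesgueC /pushforward sq_pair product_measure1E.
  have lm (b : R) : lebesgue_measure [set` `[b - r, b + r]] = (2 * r)%:E.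
    rewrite lebesgue_measure_itv /= lte_fin.
    have [->|rn0] := eqVneq r 0; first by rewrite addr0 subr0 ltxx mulr0.
    have rp : 0 < r by rewrite lt_def rn0.
    rewrite ifT; last by lra.
    by rewrite -EFinB; congr EFin; ring.
  rewrite expr2 EFinM; congr (_ * _)%E; exact: lm.
all: exact: measurable_itv.
Qed.
(** Balls are replaced by squares in all domination arguments: the measure of a square is a product of two lengths. *)
Definition isq a r : C -> R := \1_(sq a r).
Lemma rI_sq a r : 0 <= r -> rI (isq a r).
Proof.
move=> r0; apply: rI_ge0.
- by apply: measurable_indic; exact: measurable_sq.
- by move=> z; rewrite /isq indicE.
- rewrite integral_indic ?setIT//; last exact: measurable_sq.
  by rewrite (le_lt_trans _ (ltry ((2 * r) ^+ 2)))// -(mu_sq a r0).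
Qed.
Lemma intR_sq a r : 0 <= r -> intR (isq a r) = (2 * r) ^+ 2.
Proof.
move=> r0; rewrite /intR /Rintegral integral_indic ?setIT//; last exact: measurable_sq.
by rewrite -[RHS]/(fine ((2 * r) ^+ 2)%:E) -(mu_sq a r0).
Qed.
Lemma isqE a r z : isq a r z = ((`|Re (z - a)| <= r) && (`|Im (z - a)| <= r))%:R.
Proof.
rewrite /isq indicE; congr (nat_of_bool _)%:R; apply/idP/idP.
  by rewrite inE => -[-> ->].
by move=> /andP[? ?]; rewrite inE.
Qed.
Lemma isq1 a r z : normc (z - a) <= r -> isq a r z = 1.
Proof. by move=> h; rewrite isqE (le_trans (Re_le _) h) (le_trans (Im_le _) h). Qed.
Lemma isq_ge0 a r z : 0 <= isq a r z. Proof. by rewrite isqE. Qed.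
Lemma isq_le1 a r z : isq a r z <= 1. Proof. by rewrite isqE lern1; case: (_ && _). Qed.
Lemma sq_norm a r z : sq a r z -> normc (z - a) ^+ 2 <= 2 * r ^+ 2.
Proof.
move=> [h1 h2]; rewrite normc_sq mulr2n mulrDl mul1r lerD//.
  by rewrite -real_normK ?num_real// lerXn2r ?nnegrE// (le_trans _ h1).
by rewrite -real_normK ?num_real// lerXn2r ?nnegrE// (le_trans _ h2).
Qed.

Lemma continuous_bounded u r : continuous (u : C^o -> R) ->
  exists2 B : R, 0 < B & forall z, normc z <= r -> `|u z| <= B.
Proof.
move=> cu.
have cu2 : continuous (u \o @C_of_pair R : (R * R)%type -> R).
  exact: (@gctn_comp (R * R)%type C^o R _ _ cu (@continuous_pair R)).
have /compact_bounded : compact ((u \o @C_of_pair R) @` ([set` `[- r, r]] `*` [set` `[-r, r]])).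
  apply: (@continuous_compact (R * R)%type R); first exact: continuous_subspaceT.
  by apply: compact_setX; exact: segment_compact.
move=> [M [_ HM]]; exists (`|M| + 1); first by rewrite ltr_wpDl.
move=> z zr; apply: (HM (`|M| + 1)).
  by rewrite (le_lt_trans (ler_norm _))// ltrDl.
exists (Re z, Im z); last by rewrite /=; congr u; case: (z).
by split => /=; rewrite in_itv/= -ler_norml; apply: le_trans zr; [exact: Re_le|exact: Im_le].
Qed.
Lemma ctn_bounded F r : ctn F ->
  exists2 B : R, 0 < B & forall z, normc z <= r -> normc (F z) <= B.
Proof.
move=> /ctn_normc/(continuous_bounded r)[B B0 HB]; exists B => // z /HB.
by rewrite ger0_norm// normc_ge0.
Qed.

Definition csupp (V : nmodType) (F : C -> V) := exists r : R, forall z, r < normc z -> F z = 0.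

Lemma csupp_bounded u : continuous (u : C^o -> R) -> csupp u ->
  exists r B : R, [/\ 0 < r, 0 < B & forall z, `|u z| <= B * isq 0 r z].
Proof.
move=> cu [r ur]; have [B B0 HB] := continuous_bounded (`|r| + 1) cu.
have r10 : 0 < `|r| + 1 by rewrite ltr_wpDl.
exists (`|r| + 1), B; split => // z; have [zr|zr] := leP (normc z) (`|r| + 1).
  by rewrite isq1 ?subr0// mulr1 HB.
rewrite ur ?normr0 ?mulr_ge0 ?isq_ge0 ?ltW//.
by rewrite (le_lt_trans _ zr)// (le_trans (ler_norm _))// lerDl.
Qed.
Lemma rI_csupp u : continuous (u : C^o -> R) -> csupp u -> rI u.
Proof.
move=> cu su; have [r [B [r0 B0 uB]]] := csupp_bounded cu su.
apply: (rI_le (continuous_measurableC cu) uB).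
by apply: rIZ; apply: rI_sq; exact: ltW.
Qed.
Lemma cI_csupp F : ctn F -> csupp F -> cI F.
Proof.
move=> cF [r sF]; split; apply: rI_csupp; [exact: ctnRe| |exact: ctnIm|];
  by exists r => z /sF ->.
Qed.
Lemma csuppMl F G : csupp F -> csupp (fun z => F z * G z).
Proof. by move=> [r H]; exists r => z /H ->; rewrite mul0r. Qed.
Lemma csuppMr F G : csupp G -> csupp (fun z => F z * G z).
Proof. by move=> [r H]; exists r => z /H ->; rewrite mulr0. Qed.
Lemma csuppD (V : nmodType) (F G : C -> V) : csupp F -> csupp G -> csupp (fun z => F z + G z).
Proof.
move=> [r1 H1] [r2 H2]; exists (Num.max r1 r2) => z; rewrite gt_max => /andP[/H1 -> /H2 ->].
by rewrite addr0.
Qed.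
End CompactSupport.

(** * Wirtinger derivatives *)

Section Calculus.
Variable R : realType.
Local Notation C := R[i].
Local Notation Re := (@complex.Re R).
Local Notation Im := (@complex.Im R).
Implicit Types (z w a : C) (F G : C -> C) (u : C -> R) (g : R -> C).

(** Complex-valued functions of a real variable are differentiated componentwise; as a normed space, [C] is a line over itself, which gives no derivatives along [R]. *)
Definition cder g (t : R) (l : C) :=
  is_derive t (1 : R) (fun s => Re (g s)) (Re l) /\
  is_derive t (1 : R) (fun s => Im (g s)) (Im l).

Lemma is_derive_scale (f : R -> R) (t k l : R) : is_derive t (1:R) f l ->
  is_derive t (1 : R) (fun s => k * f s) (k * l).
Proof. by move=> h; exact: (is_deriveZ k h). Qed.
Lemma is_deriveM' (f g : R -> R) (t l l' : R) :
  is_derive t (1:R) f l -> is_derive t (1:R) g l' ->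
  is_derive t (1 : R) (fun s => f s * g s) (f t * l' + g t * l).
Proof. by move=> h1 h2; exact: (is_deriveM h1 h2). Qed.
Lemma is_deriveD' (f g : R -> R) (t l l' : R) :
  is_derive t (1:R) f l -> is_derive t (1:R) g l' ->
  is_derive t (1 : R) (fun s => f s + g s) (l + l').
Proof. by move=> h1 h2; exact: (is_deriveD h1 h2). Qed.
Lemma is_deriveB' (f g : R -> R) (t l l' : R) :
  is_derive t (1:R) f l -> is_derive t (1:R) g l' ->
  is_derive t (1 : R) (fun s => f s - g s) (l - l').
Proof. by move=> h1 h2; exact: (is_deriveB h1 h2). Qed.
Lemma is_derive_comp' (f g : R -> R) (t l l' : R) :
  is_derive (g t) (1:R) f l -> is_derive t (1:R) g l' ->
  is_derive t (1 : R) (fun s => f (g s)) (l * l').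
Proof. by move=> h1 h2; exact: (is_derive1_comp h1 h2). Qed.
Lemma is_derive_fun (f g : R -> R) (t l l' : R) : f =1 g -> l = l' ->
  is_derive t (1:R) f l -> is_derive t (1:R) g l'.
Proof. by move=> /funext -> ->. Qed.
Lemma is_derive_affine (a b t : R) : is_derive t (1:R) (fun s => a + s * b) b.
Proof.
apply: (@is_derive_fun (fun s => a + b * s) _ _ (0 + b * 1)).
- by move=> s; rewrite mulrC.
- by rewrite add0r mulr1.
Qed.

Lemma cderD g h t l l' : cder g t l -> cder h t l' -> cder (fun s => g s + h s) t (l + l').
Proof.
move=> [g1 g2] [h1 h2]; split.
  by apply: (is_derive_fun _ _ (is_deriveD' g1 h1)) => [s|]; rewrite ReD.
by apply: (is_derive_fun _ _ (is_deriveD' g2 h2)) => [s|]; rewrite ImD.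
Qed.
Lemma cderM g h t l l' : cder g t l -> cder h t l' ->
  cder (fun s => g s * h s) t (g t * l' + l * h t).
Proof.
move=> [g1 g2] [h1 h2]; split.
  apply: (is_derive_fun _ _ (is_deriveB' (is_deriveM' g1 h1) (is_deriveM' g2 h2))) => [s|].
    by rewrite ReM.
  by rewrite ReD !ReM; ring.
apply: (is_derive_fun _ _ (is_deriveD' (is_deriveM' g1 h2) (is_deriveM' g2 h1))) => [s|].
  by rewrite ImM.
by rewrite ImD !ImM; ring.
Qed.
Lemma cderJ g t l : cder g t l -> cder (fun s => (g s)^*) t (l^*).
Proof.
move=> [g1 g2]; split.
  by apply: (is_derive_fun _ _ g1) => [s|]; rewrite ReJ.
by apply: (is_derive_fun _ _ (is_derive_scale (-1) g2)) => [s|]; rewrite ImJ mulN1r.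
Qed.
Lemma cder_cst c t : cder (fun=> c) t 0.
Proof. by split; exact: is_derive_cst. Qed.
Lemma cderZ c g t l : cder g t l -> cder (fun s => c * g s) t (c * l).
Proof.
move=> h; have := cderM (cder_cst c t) h.
by rewrite mul0r addr0.
Qed.
Lemma cderR (f : R -> R) t (l : R) : is_derive t (1:R) f l -> cder (fun s => (f s)%:C) t l%:C.
Proof. by split => //; exact: is_derive_cst. Qed.
Lemma cder_id t : cder (fun s => s%:C) t 1.
Proof. by apply: (@cderR id t 1); exact: is_derive_id. Qed.
Lemma cder_affine z v t : cder (fun s => z + s%:C * v) t v.
Proof.
have := cderD (cder_cst z t) (cderM (cder_id t) (cder_cst v t)).
by rewrite mulr0 !add0r mul1r.
Qed.
Lemma cder_comp g (f : R -> R) t l (k : R) :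
  cder g (f t) l -> is_derive t (1:R) f k -> cder (fun s => g (f s)) t (l * k%:C).
Proof.
move=> [g1 g2] fk; split.
  apply: (is_derive_fun _ _ (is_derive_comp' g1 fk)) => [s//|].
  by rewrite ReM /= mulr0 subr0.
apply: (is_derive_fun _ _ (is_derive_comp' g2 fk)) => [s//|].
by rewrite ImM /= mulr0 add0r.
Qed.
Lemma cder_near g h t l : (\forall s \near t, g s = h s) -> cder g t l -> cder h t l.
Proof.
move=> gh [g1 g2]; split.
  by apply: (near_eq_is_derive _ g1); apply: filterS gh => s ->.
by apply: (near_eq_is_derive _ g2); apply: filterS gh => s ->.
Qed.
Lemma cder_uniq g t l l' : cder g t l -> cder g t l' -> l = l'.
Proof.
move=> [a1 a2] [b1 b2]; apply: complexP.
  by rewrite -(@derive_val _ _ _ _ _ _ _ a1) -(@derive_val _ _ _ _ _ _ _ b1).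
by rewrite -(@derive_val _ _ _ _ _ _ _ a2) -(@derive_val _ _ _ _ _ _ _ b2).
Qed.

Lemma is_derive_mvt (f df : R -> R) (L : R) :
  (forall t, is_derive t (1:R) f (df t)) ->
  (forall t, 0 <= t <= 1 -> `|df t| <= L) -> `|f 1 - f 0| <= L.
Proof.
move=> fd fL; have [|c c01 ->] := @MVT R f df 0 1 ltr01 (fun x _ => fd x).
- apply: continuous_subspaceT => x.
  by apply: differentiable_continuous; apply/derivable1_diffP; exact: (@ex_derive _ _ _ _ _ _ _ (fd x)).
- by move: c01; rewrite in_itv/= subr0 mulr1 => /andP[/ltW c0 /ltW c1]; apply: fL; rewrite c0.
Qed.
(** The factor 2 comes from treating real and imaginary parts separately. *)
Lemma cder_mvt g dg (L : R) : (forall t, cder g t (dg t)) ->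
  (forall t, 0 <= t <= 1 -> normc (dg t) <= L) -> normc (g 1 - g 0) <= 2 * L.
Proof.
move=> gd gL; rewrite mulr2n mulrDl mul1r (le_trans (normc_le _))// lerD//.
  rewrite ReD ReN; apply: (is_derive_mvt (fun t => (gd t).1)) => t t01.
  by rewrite (le_trans (Re_le _))// gL.
rewrite ImD ImN; apply: (is_derive_mvt (fun t => (gd t).2)) => t t01.
by rewrite (le_trans (Im_le _))// gL.
Qed.

Definition wdir F z v l := cder (fun t => F (z + t%:C * v)) 0 l.
(** [p] and [q] are the derivatives of [F] with respect to z and conj z; only the two directional derivatives along the axes are required to exist, which is what integration by parts uses. *)
Definition wirt F z p q := wdir F z 1 (p + q) /\ wdir F z 'i%C ('i%C * (p - q)).

Lemma wirtD F G z p q p' q' : wirt F z p q -> wirt G z p' q' ->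
  wirt (fun w => F w + G w) z (p + p') (q + q').
Proof.
move=> [F1 F2] [G1 G2]; split.
  by have := cderD F1 G1; rewrite /wdir addrACA.
have := cderD F2 G2; rewrite /wdir; congr cder; ring.
Qed.
Lemma wirtM F G z p q p' q' : wirt F z p q -> wirt G z p' q' ->
  wirt (fun w => F w * G w) z (F z * p' + p * G z) (F z * q' + q * G z).
Proof.
move=> [F1 F2] [G1 G2]; split.
  have := cderM F1 G1; rewrite /wdir !mul0r !addr0; congr cder; ring.
have := cderM F2 G2; rewrite /wdir !mul0r !addr0; congr cder; ring.
Qed.
Lemma conji : 'i%C^* = - 'i%C :> C. Proof. by apply: complexP => /=; rewrite ?oppr0. Qed.
Lemma wirtJ F z p q : wirt F z p q -> wirt (fun w => (F w)^*) z q^* p^*.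
Proof.
move=> [F1 F2]; split.
  by have := cderJ F1; rewrite /wdir conjD addrC.
have := cderJ F2; rewrite /wdir conjM conjB conji; congr cder; ring.
Qed.
Lemma wirt_cst c z : wirt (fun=> c) z 0 0.
Proof. by split; rewrite /wdir ?addr0 ?subr0 ?mulr0; exact: cder_cst. Qed.
Lemma wirtZ c F z p q : wirt F z p q -> wirt (fun w => c * F w) z (c * p) (c * q).
Proof. by move=> h; have := wirtM (wirt_cst c z) h; rewrite !mul0r !addr0. Qed.
Lemma wirtN F z p q : wirt F z p q -> wirt (fun w => - F w) z (- p) (- q).
Proof.
move=> /(wirtZ (-1)); rewrite !mulN1r.
by under eq_fun do rewrite mulN1r.
Qed.
Lemma wirtB F G z p q p' q' : wirt F z p q -> wirt G z p' q' ->
  wirt (fun w => F w - G w) z (p - p') (q - q').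
Proof. by move=> h /wirtN; exact: wirtD. Qed.
Lemma wirt_id z : wirt (fun w => w) z 1 0.
Proof.
by split; rewrite /wdir ?addr0 ?subr0 ?mulr1; exact: cder_affine.
Qed.
Lemma wirt_sub a z : wirt (fun w => w - a) z 1 0.
Proof. by have := wirtB (wirt_id z) (wirt_cst a z); rewrite !subr0. Qed.
Lemma wirtR u (f : R -> R) z p q (k : R) : wirt (fun w => (u w)%:C) z p q ->
  is_derive (u z) (1:R) f k -> wirt (fun w => (f (u w))%:C) z (k%:C * p) (k%:C * q).
Proof.
move=> [[u1 u1'] [u2 u2']] fk; have uz v : u (z + 0%:C * v) = u z by rewrite mul0r addr0.
have im0 l v : is_derive (0:R) (1:R) (fun s => Im (u (z + s%:C * v))%:C) l -> l = 0.
  move=> h; rewrite -(@derive_val _ _ _ _ _ _ _ h).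
  by have -> : (fun s => Im (u (z + s%:C * v))%:C) = cst 0; [apply/funext|rewrite derive_cst].
split; split.
- have fk' : is_derive (u (z + 0%:C * 1)) (1:R) f k by rewrite uz.
  have := is_derive_comp' fk' u1; apply: is_derive_fun => [s//|].
  by rewrite -mulrDr ReRM.
- by rewrite -mulrDr ImRM (im0 _ _ u1') mulr0; exact: is_derive_cst.
- have fk' : is_derive (u (z + 0%:C * 'i)) (1:R) f k by rewrite uz.
  have := is_derive_comp' fk' u2; apply: is_derive_fun => [s//|].
  by rewrite -mulrBr [in RHS]mulrCA ReRM.
- by rewrite -mulrBr mulrCA ImRM (im0 _ _ u2') mulr0; exact: is_derive_cst.
Qed.
Lemma near_line z v F G : (\forall w \near (z : C^o), F w = G w) ->
  \forall s \near (0 : R), F (z + s%:C * v) = G (z + s%:C * v).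
Proof.
move=> FG; have := @continuous_line R z v 0.
rewrite /continuous_at mul0r addr0 => /(_ _ FG); exact.
Qed.
Lemma wirt_near F G z p q : (\forall w \near (z : C^o), F w = G w) ->
  wirt F z p q -> wirt G z p q.
Proof.
by move=> FG [F1 F2]; split; [apply: cder_near F1|apply: cder_near F2]; exact: near_line.
Qed.
Lemma wirt_eq F G z p q p' q' : F =1 G -> p = p' -> q = q' -> wirt F z p q -> wirt G z p' q'.
Proof. by move=> /funext -> -> ->. Qed.
Lemma i2 : 'i%C * 'i%C = -1 :> C. Proof. by rewrite -expr2 sqr_i. Qed.
Lemma i_neq0 : 'i%C != 0 :> C.
Proof. by rewrite eq_complex /= oner_eq0 andbF. Qed.
Lemma wirt_uniq F z p q p' q' : wirt F z p q -> wirt F z p' q' -> p = p' /\ q = q'.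
Proof.
move=> [F1 F2] [G1 G2]; have e1 := cder_uniq F1 G1; have e2 := cder_uniq F2 G2.
have {}e2 : p - q = p' - q' by apply: (mulfI i_neq0).
have two : (2 : C) != 0 by rewrite pnatr_eq0.
split; apply: (mulfI two).
  have h : (p + q) + (p - q) = (p' + q') + (p' - q') by rewrite e1 e2.
  rewrite (_ : 2 * p = (p + q) + (p - q)); last by ring.
  by rewrite h; ring.
have h : (p + q) - (p - q) = (p' + q') - (p' - q') by rewrite e1 e2.
rewrite (_ : 2 * q = (p + q) - (p - q)); last by ring.
by rewrite h; ring.
Qed.

Lemma wdir_shift F z v (t : R) l : wdir F (z + t%:C * v) v l ->
  cder (fun s => F (z + s%:C * v)) t l.
Proof.
move=> h; have d : is_derive t (1:R) (fun s : R => - t + s * 1) 1 by exact: is_derive_affine.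
have h' : cder (fun s => F (z + t%:C * v + s%:C * v)) (- t + t * 1) l by rewrite mulr1 addNr.
have := @cder_comp _ (fun s : R => - t + s * 1) t l 1 h' d; rewrite mulr1.
by congr cder; apply/funext => s; congr F; rewrite -addrA -mulrDl -rmorphD/= mulr1 addNKr.
Qed.

Lemma leg_mvt F z v (s L : R) dF : (forall t, wdir F (z + t%:C * v) v (dF t)) ->
  (forall t, 0 <= t <= 1 -> normc (dF (t * s)) <= L) ->
  normc (F (z + s%:C * v) - F z) <= 2 * (L * `|s|).
Proof.
move=> hF hL; pose g t := F (z + (t * s)%:C * v).
have gd t : cder g t (dF (t * s) * s%:C).
  apply: (@cder_comp (fun r => F (z + r%:C * v)) (fun r => r * s)).
    by apply: wdir_shift; exact: hF.
  by apply: (is_derive_fun _ _ (is_derive_affine 0 s t)) => [r|//]; rewrite add0r.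
have := cder_mvt gd (L := L * `|s|); rewrite /g mul1r mul0r [0%:C * v]mul0r addr0; apply.
by move=> t t01; rewrite normcM normc_real ler_wpM2r// hL.
Qed.

(** Go from [z] to [z + h] along the two sides of a rectangle, the only directions in which [wirt] gives derivatives. *)
Lemma wirt_mvt F (p q : C -> C) z h (L : R) : (forall w, wirt F w (p w) (q w)) ->
  (forall w, normc (w - z) <= normc h -> normc (p w) <= L /\ normc (q w) <= L) ->
  normc (F (z + h) - F z) <= 8 * (L * normc h).
Proof.
move=> hF hL; have L0 : 0 <= L.
  have [|+ _] := hL z; first by rewrite subrr normc0 normc_ge0.
  by apply: le_trans; exact: normc_ge0.
set z1 := z + (Re h)%:C * 1.
have zh : z + h = z1 + (Im h)%:C * 'i.
  by rewrite /z1 -addrA; congr (_ + _); rewrite {1}(complexE h) mulr1 mulrC.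
have l1 : normc (F z1 - F z) <= 2 * (2 * L * `|Re h|).
  apply: (@leg_mvt F z 1 (Re h) (2 * L) (fun t => p (z + t%:C * 1) + q (z + t%:C * 1))).
    by move=> t; apply: (hF _).1.
  move=> t /andP[t0 t1]; have [|a b] := hL (z + (t * Re h)%:C * 1).
    rewrite addrC addKr mulr1 normc_real normrM ger0_norm//.
    by rewrite (le_trans _ (Re_le h))// ler_piMl.
  by rewrite (le_trans (le_normcD _ _))// mulr2n mulrDl mul1r lerD.
have l2 : normc (F (z + h) - F z1) <= 2 * (2 * L * `|Im h|).
  rewrite zh; apply: (@leg_mvt F z1 'i%C (Im h) (2 * L) (fun t => 'i%C * (p (z1 + t%:C * 'i) - q (z1 + t%:C * 'i)))).
    by move=> t; apply: (hF _).2.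
  move=> t /andP[t0 t1]; have [|a b] := hL (z1 + (t * Im h)%:C * 'i).
    rewrite (_ : _ - z = (Re h)%:C + (t * Im h)%:C * 'i); last by rewrite /z1; ring.
    rewrite -(@ler_pXn2r _ 2)// ?nnegrE ?normc_ge0//.
    rewrite !normc_sq ReD ImD !ReM !ImM /= !(mulr0,mul0r,mulr1,subr0,addr0,add0r) lerD2l exprMn.
    by rewrite ler_piMl ?sqr_ge0// expr_le1.
  rewrite normcM (_ : normc 'i%C = 1) ?mul1r; last by rewrite /= expr0n expr1n add0r sqrtr1.
  by rewrite (le_trans (le_normcB _ _))// mulr2n mulrDl mul1r lerD.
rewrite (_ : F (z + h) - F z = (F (z + h) - F z1) + (F z1 - F z)); last by rewrite addrA subrK.
apply: (le_trans (le_normcD _ _)); apply: (le_trans (lerD l2 l1)).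
rewrite (_ : 2 * (2 * L * _) + _ = 4 * (L * `|Im h|) + 4 * (L * `|Re h|)); last by ring.
rewrite (_ : 8 * _ = 4 * (L * normc h) + 4 * (L * normc h)); last by ring.
by rewrite lerD// ler_wpM2l// ler_wpM2l// ?Re_le ?Im_le.
Qed.

(** Apply the mean value inequality after subtracting the first-order Taylor polynomial. *)
Lemma wirt_taylor F (p q : C -> C) z h (L : R) : (forall w, wirt F w (p w) (q w)) ->
  (forall w, normc (w - z) <= normc h -> normc (p w - p z) <= L /\ normc (q w - q z) <= L) ->
  normc (F (z + h) - F z - p z * h - q z * h^*) <= 8 * (L * normc h).
Proof.
move=> hF hL.
have := @wirt_mvt (fun w => F w - (p z * w + q z * w^*)) (fun w => p w - p z) (fun w => q w - q z) z h L.
rewrite (_ : F (z + h) - _ - _ = F (z + h) - F z - p z * h - q z * h^*); last by rewrite conjD; ring.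
apply => // w.
have := wirtB (hF w) (wirtD (wirtZ (p z) (wirt_id w)) (wirtZ (q z) (wirtJ (wirt_id w)))).
by rewrite !(conj1, conj0) !mulr1 !mulr0 addr0 add0r.
Qed.

Lemma ctn_wirt F (p q : C -> C) : (forall w, wirt F w (p w) (q w)) -> ctn p -> ctn q -> ctn F.
Proof.
move=> hF cp cq; apply/ctnP => z e e0.
have [B1 B10 HB1] := ctn_bounded (normc z + 1) cp.
have [B2 B20 HB2] := ctn_bounded (normc z + 1) cq.
pose B := B1 + B2; have B0 : 0 < B by rewrite addr_gt0.
exists (Num.min 1 (e / (8 * B))); first by rewrite lt_min ltr01 divr_gt0// mulr_gt0.
move=> w; rewrite lt_min => /andP[w1 we].
have wz : z + (w - z) = w by rewrite addrC subrK.
rewrite -{1}wz (le_lt_trans (@wirt_mvt F p q z (w - z) B hF _))//.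
  move=> x xz; have xn : normc x <= normc z + 1.
    rewrite -(subrK z x) addrC (le_trans (le_normcD _ _))// lerD2l (le_trans xz)//; exact: ltW.
  by split; [apply: (le_trans (HB1 _ xn))|apply: (le_trans (HB2 _ xn))];
    rewrite /B ?lerDl ?lerDr; exact: ltW.
by rewrite mulrA -ltr_pdivlMl ?mulr_gt0// mulrC.
Qed.

Lemma wirt_csupp (F p q : C -> C) : (forall w, wirt F w (p w) (q w)) -> csupp F ->
  csupp p /\ csupp q.
Proof.
move=> hF [r Fr].
have H z : r < normc z -> p z = 0 /\ q z = 0.
  move=> rz; apply: (@wirt_uniq F z) => //.
  apply: (@wirt_near (fun=> 0)); last exact: wirt_cst.
  apply/nbhsC_ball; exists (normc z - r); first by rewrite subr_gt0.
  move=> w wz; rewrite Fr//.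
  have := lerB_normc z w; rewrite normc_dist; lra.
by split; exists r => z /H[].
Qed.
End Calculus.

(** * The divergence theorem and complex differentiability *)

Section Divergence.
Variable R : realType.
Local Notation C := R[i].
Local Notation Re := (@complex.Re R).
Local Notation Im := (@complex.Im R).
Local Notation mu := (@lebesgueC R).
Local Notation leb := (@lebesgue_measure R).
Local Notation RR := (measurableTypeR R * measurableTypeR R)%type.
Implicit Types (z w a : C) (F G : C -> C) (u : C -> R).

Lemma is_derive_continuous (f df : R -> R) :
  (forall t, is_derive t (1:R) f (df t)) -> continuous f.
Proof.
move=> fd x; apply: differentiable_continuous; apply/derivable1_diffP.
exact: (@ex_derive _ _ _ _ _ _ _ (fd x)).
Qed.

Lemma FTC_segment (G g : R -> R) (a b : R) : a < b ->
  (forall t, is_derive t (1:R) G (g t)) -> continuous g ->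
  (\int[leb]_(x in `[a, b]) (g x)%:E = (G b - G a)%:E)%E.
Proof.
move=> ab Gg cg; rewrite (@continuous_FTC2 R g G a b ab).
- by rewrite -EFinB.
- exact: continuous_subspaceT.
- have cG := is_derive_continuous Gg; split.
  + by move=> x _; exact: (@ex_derive _ _ _ _ _ _ _ (Gg x)).
  + by apply: cvg_at_right_filter; exact: cG.
  + by apply: cvg_at_left_filter; exact: cG.
- by move=> x _; rewrite derive1E; exact: (@derive_val _ _ _ _ _ _ _ (Gg x)).
Qed.

Lemma int_line0 (G g : R -> R) (r : R) : (forall t, is_derive t (1:R) G (g t)) ->
  continuous g -> (forall t, r < `|t| -> G t = 0 /\ g t = 0) ->
  (\int[leb]_t (g t)%:E = 0)%E.
Proof.
move=> Gg cg H; pose s : R := `|r| + 1; have s0 : 0 < s by rewrite ltr_wpDl.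
have rs : r < s by rewrite (le_lt_trans (ler_norm r))// ltrDl.
transitivity (\int[leb]_(t in [set` `[(- s)%R, s]]) (g t)%:E)%E.
  rewrite [RHS]integral_mkcond; apply: eq_integral => t _.
  rewrite patchE; case: ifPn => // /negP tn.
  have : s < `|t|.
    rewrite ltNge; apply/negP => ts; apply: tn.
    by rewrite inE/= in_itv/= -ler_norml.
  by move=> st; have [_ ->] := H t (lt_trans rs st).
rewrite (FTC_segment _ Gg cg); last by lra.
have Hs x : s <= `|x| -> G x = 0 by move=> sx; case: (H x (lt_le_trans rs sx)).
by rewrite !Hs ?subr0// ?normrN ger0_norm// ltW.
Qed.

Lemma intC_pair u : rI u -> ((intR u)%:E = \int[leb \x leb]_p (u (C_of_pair p))%:E)%E /\
  (leb \x leb)%E.-integrable setT (EFin \o (u \o @C_of_pair R)).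
Proof.
move=> iu; have mu_ := rI_meas iu.
have mup : measurable_fun setT (EFin \o (u \o @C_of_pair R)).
  by apply/measurable_EFinP; apply: measurableT_comp => //; exact: measurable_C_of_pair.
have ip : (leb \x leb)%E.-integrable setT (EFin \o (u \o @C_of_pair R)).
  apply/integrableP; split => //.
  case/integrableP: iu => _; rewrite /mu /= /lebesgueC.
  rewrite ge0_integral_pushforward//.
  - exact: measurable_C_of_pair.
  - by apply/measurable_EFinP; apply: measurableT_comp.
split => //; rewrite intRE//.
have := @integral_pushforward _ _ RR C R (@C_of_pair R) (@measurable_C_of_pair R) (leb \x leb)%E setT (EFin \o u).
rewrite preimage_setT; apply => //.
Qed.

Lemma continuous_pair1 u (y : R) : continuous (u : C^o -> R) ->
  continuous (fun x : R => u (x%:C + y%:C * 'i)).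
Proof.
move=> cu; have := @continuous_line R (y%:C * 'i) 1.
move=> /(@gctn_comp R C^o R u _ cu) h x.
by have := h x; under eq_fun do rewrite mulr1 addrC.
Qed.
Lemma continuous_pair2 u (x : R) : continuous (u : C^o -> R) ->
  continuous (fun y : R => u (x%:C + y%:C * 'i)).
Proof.
move=> cu; exact: (@gctn_comp R C^o R u _ cu (@continuous_line R x%:C 'i)).
Qed.
Lemma C_of_pairE (x y : R) : C_of_pair (x, y) = x%:C + y%:C * 'i.
Proof. by apply: complexP; rewrite ?ReD ?ImD ?ReRM ?ImRM /=; ring. Qed.

Lemma normc_pair (x y : R) : `|x| <= normc (x%:C + y%:C * 'i) /\ `|y| <= normc (x%:C + y%:C * 'i).
Proof.
by rewrite -C_of_pairE; split; [exact: (Re_le (x +i* y))|exact: (Im_le (x +i* y))].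
Qed.

(** On every horizontal line the integral of a derivative of a compactly supported function vanishes; conclude by Fubini. *)
Lemma intR_dx (U d : C -> R) : (forall z, is_derive (0:R) (1:R) (fun t => U (z + t%:C * 1)) (d z)) ->
  continuous (d : C^o -> R) -> csupp U -> csupp d -> intR d = 0.
Proof.
move=> Ud cd [r1 U0] [r2 d0].
have id : rI d by apply: rI_csupp => //; exists r2.
have [e ip] := intC_pair id; apply: EFin_inj; rewrite e.
rewrite -(integral21_prod_meas1 ip) /fubini_G /=.
rewrite (_ : (fun x => _) = cst 0%E) ?integral0//.
apply/funext => y /=.
under eq_integral do rewrite C_of_pairE.
apply: (@int_line0 (fun x => U (x%:C + y%:C * 'i)) _ (Num.max r1 r2)).
- move=> x; have h : is_derive (- x + x * 1) (1:R) (fun t => U (x%:C + y%:C * 'i + t%:C * 1)) (d (x%:C + y%:C * 'i)).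
    by rewrite mulr1 addNr; exact: Ud.
  have := @is_derive_comp' _ (fun t => U (x%:C + y%:C * 'i + t%:C * 1)) (fun s => - x + s * 1) x _ _ h (is_derive_affine (- x) 1 x).
  apply: is_derive_fun => [s|]; last by rewrite mulr1.
  by congr U; rewrite !mulr1 rmorphD rmorphN /=; ring.
- exact: continuous_pair1.
- move=> t; rewrite gt_max => /andP[t1 t2]; have [h _] := normc_pair t y.
  by rewrite U0 ?d0//; exact: lt_le_trans h.
Qed.
Lemma intR_dy (U d : C -> R) : (forall z, is_derive (0:R) (1:R) (fun t => U (z + t%:C * 'i)) (d z)) ->
  continuous (d : C^o -> R) -> csupp U -> csupp d -> intR d = 0.
Proof.
move=> Ud cd [r1 U0] [r2 d0].
have id : rI d by apply: rI_csupp => //; exists r2.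
have [e ip] := intC_pair id; apply: EFin_inj; rewrite e.
rewrite -(integral12_prod_meas1 ip) /fubini_F /=.
rewrite (_ : (fun x => _) = cst 0%E) ?integral0//.
apply/funext => x /=.
under eq_integral do rewrite C_of_pairE.
apply: (@int_line0 (fun y => U (x%:C + y%:C * 'i)) _ (Num.max r1 r2)).
- move=> y; have h : is_derive (- y + y * 1) (1:R) (fun t => U (x%:C + y%:C * 'i + t%:C * 'i)) (d (x%:C + y%:C * 'i)).
    by rewrite mulr1 addNr; exact: Ud.
  have := @is_derive_comp' _ (fun t => U (x%:C + y%:C * 'i + t%:C * 'i)) (fun s => - y + s * 1) y _ _ h (is_derive_affine (- y) 1 y).
  apply: is_derive_fun => [s|]; last by rewrite mulr1.
  by congr U; rewrite !mulr1 rmorphD rmorphN /=; ring.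
- exact: continuous_pair2.
- move=> t; rewrite gt_max => /andP[t1 t2]; have [_ h] := normc_pair x t.
  by rewrite U0 ?d0//; exact: lt_le_trans h.
Qed.

Lemma csupp_comp (V W : nmodType) (f : V -> W) (F : C -> V) : f 0 = 0 -> csupp F -> csupp (fun z => f (F z)).
Proof. by move=> f0 [r H]; exists r => z /H ->. Qed.

(** This is the only form of integration by parts that is used: each later identity is a derivative of a suitable compactly supported product. *)
Theorem divergence F (p q : C -> C) : (forall z, wirt F z (p z) (q z)) ->
  ctn p -> ctn q -> csupp F -> cint p = 0 /\ cint q = 0.
Proof.
move=> hF cp cq sF; have [sp sq_] := wirt_csupp hF sF.
have ip := cI_csupp cp sp; have iq := cI_csupp cq sq_.
have e1 : cint (fun z => p z + q z) = 0.
  apply: complexP => /=.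
    apply: (@intR_dx (fun z => Re (F z))).
    - by move=> z; exact: (hF z).1.1.
    - exact: (ctnRe (ctnD cp cq)).
    - exact: csupp_comp.
    - by apply: csupp_comp => //; exact: csuppD.
  apply: (@intR_dx (fun z => Im (F z))).
  - by move=> z; exact: (hF z).1.2.
  - exact: (ctnIm (ctnD cp cq)).
  - exact: csupp_comp.
  - by apply: csupp_comp => //; exact: csuppD.
have sm : csupp (fun z => 'i%C * (p z - q z)).
  by apply: csuppMr; apply: csuppD => //; apply: csupp_comp => //; rewrite oppr0.
have cm : ctn (fun z => 'i%C * (p z - q z)).
  by apply: ctnM; [exact: ctn_cst|exact: ctnB].
have e2 : cint (fun z => 'i%C * (p z - q z)) = 0.
  apply: complexP => /=.
    apply: (@intR_dy (fun z => Re (F z))).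
    - by move=> z; exact: (hF z).2.1.
    - exact: (ctnRe cm).
    - exact: csupp_comp.
    - exact: csupp_comp.
  apply: (@intR_dy (fun z => Im (F z))).
  - by move=> z; exact: (hF z).2.2.
  - exact: (ctnIm cm).
  - exact: csupp_comp.
  - exact: csupp_comp.
move: e1 e2; rewrite cintD// cintZ; last exact: cIB.
rewrite cintB// => e1 /(canRL (mulKf (i_neq0 R))); rewrite mulr0 => e2.
have two : (2 : C) != 0 by rewrite pnatr_eq0.
split; apply: (mulfI two).
  rewrite (_ : 2 * _ = (cint p + cint q) + (cint p - cint q)); last by ring.
  by rewrite e1 e2 mulr0 addr0.
rewrite (_ : 2 * _ = (cint p + cint q) - (cint p - cint q)); last by ring.
by rewrite e1 e2 mulr0 subr0.
Qed.
End Divergence.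

Section ComplexDerivative.
Variable R : realType.
Local Notation C := R[i].
Implicit Types (z w a : C) (F G g : C -> C).

(** Complex differentiability with an explicit derivative and without limits; equivalent to derivability along 1 in the normed line [C]. *)
Definition cdiff F z l := forall e : R, 0 < e -> exists2 d : R, 0 < d &
  forall h, normc h < d -> normc (F (z + h) - F z - l * h) <= e * normc h.

Lemma cdiff_derive F z l : cdiff F z l -> is_derive (z : C^o) (1 : C^o) (F : C^o -> C^o) l.
Proof.
move=> hF.
have cv : (fun h : C^o => h^-1 *: ((F \o shift z) (h *: (1:C^o)) - F z) : C^o) @ (0 : C^o)^' --> (l : C^o).
  apply/(@cvgCP R C^o) => e e0; have [d d0 Hd] := hF (e / 2) ltac:(by rewrite divr_gt0).
  rewrite near_withinE; apply/nbhsC_ball; exists d => // h; rewrite subr0 => hd h0 /=.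
  rewrite (_ : _ - l = h^-1 * (F (z + h) - F z - l * h)).
    rewrite normcM normcV mulrC ltr_pdivrMr ?normc_gt0//.
    apply: (le_lt_trans (Hd _ hd)); rewrite ltr_pM2r ?normc_gt0//.
    by rewrite ltr_pdivrMr// ltr_pMr// ltr1n.
  rewrite mulrBr mulrCA mulVf// mulr1.
  by rewrite -[LHS]/(h^-1 * (F (h * 1 + z) - F z) - l) mulr1 [h + z]addrC.
apply: DeriveDef; first by apply/cvg_ex; exists l; exact: cv.
exact: (cvg_lim _ cv).
Qed.

Lemma derive_cdiff F z : derivable (F : C^o -> C^o) z 1 -> exists l, cdiff F z l.
Proof.
move=> /cvg_ex[l hl]; exists l => e e0.
have /(@cvgCP R C^o)/(_ e e0) := hl.
rewrite near_withinE => /nbhsC_ball[d d0 Hd]; exists d => // h hd.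
have [->|h0] := eqVneq h 0; first by rewrite addr0 subrr mulr0 subr0 normc0 mulr0.
have := Hd h; rewrite subr0 => /(_ hd h0) /=.
rewrite (_ : _ - l = h^-1 * (F (z + h) - F z - l * h)).
  by rewrite normcM normcV mulrC ltr_pdivrMr ?normc_gt0// => /ltW.
rewrite mulrBr mulrCA mulVf// mulr1.
by rewrite -[LHS]/(h^-1 * (F (h * 1 + z) - F z) - l) mulr1 [h + z]addrC.
Qed.

Lemma cdiff_dir F z l v : cdiff F z l -> wdir F z v (l * v).
Proof.
move=> hF.
have key (f : C -> R) : (forall x y, f (x - y) = f x - f y) ->
   (forall (t : R) x, f (t%:C * x) = t * f x) -> (forall x, `|f x| <= normc x) ->
   is_derive (0:R) (1:R) (fun t => f (F (z + t%:C * v))) (f (l * v)).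
  move=> fB fZ fle.
  have cv : (fun h : R => h^-1 *: (((fun t => f (F (z + t%:C * v))) \o shift 0) (h *: (1:R)) - f (F (z + 0%:C * v)))) @ (0 : R)^' --> f (l * v).
    apply/cvgrPdist_le => e e0.
    have n1 : 0 < normc v + 1 by rewrite ltr_wpDl// normc_ge0.
    have [d d0 Hd] := hF (e / (normc v + 1)) ltac:(by rewrite divr_gt0).
    rewrite near_withinE; apply/nbhs_ballP; exists (d / (normc v + 1)) => /=; first by rewrite divr_gt0.
    move=> t; rewrite /ball/= sub0r normrN ltr_pdivlMr// => td t0.
    rewrite /shift/= addr0 -[t *: 1]/(t * 1) mulr1 mul0r addr0 -[_ *: _]/(t^-1 * _) -fB.
    have tC0 : t%:C != 0 :> C by rewrite (inj_eq (@complexI R)).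
    rewrite -normrN opprB.
    rewrite (_ : t^-1 * _ - _ = t^-1 * f (F (z + t%:C * v) - F z - l * (t%:C * v))); last first.
      by rewrite (fB _ (l * (t%:C * v))) [l * (t%:C * v)]mulrCA fZ mulrBr mulKf.
    rewrite normrM normfV ler_pdivrMl ?normr_gt0//.
    apply: (le_trans (fle _)); have tv : normc (t%:C * v) <= `|t| * (normc v + 1).
      by rewrite normcM normc_real ler_wpM2l// lerDl.
    apply: (le_trans (Hd _ (le_lt_trans tv td))).
    apply: (le_trans (ler_wpM2l (ltW (divr_gt0 e0 n1)) tv)).
    rewrite (_ : _ * (`|t| * _) = `|t| * e)//; field; exact: lt0r_neq0.
  apply: DeriveDef; first by apply/cvg_ex; exists (f (l * v)); exact: cv.
  exact: (cvg_lim _ cv).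
split; apply: key.
- by move=> x y; rewrite ReD ReN. - by move=> t x; rewrite ReRM. - exact: Re_le.
- by move=> x y; rewrite ImD ImN. - by move=> t x; rewrite ImRM. - exact: Im_le.
Qed.

Lemma cdiff_wirt F z l : cdiff F z l -> wirt F z l 0.
Proof.
move=> hF; split; first by have := cdiff_dir 1 hF; rewrite mulr1 addr0.
by have := cdiff_dir 'i%C hF; rewrite subr0 mulrC.
Qed.

Lemma cdiff_ctn F : (forall z, exists l, cdiff F z l) -> ctn F.
Proof.
move=> hF; apply/ctnP => z e e0; have [l hl] := hF z; have [d d0 Hd] := hl 1 ltr01.
have n1 : 0 < normc l + 1 by rewrite ltr_wpDl// normc_ge0.
exists (Num.min d (e / (normc l + 1))); first by rewrite lt_min d0 divr_gt0.
move=> w; rewrite lt_min => /andP[wd we].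
have := Hd _ wd; rewrite (addrC z) subrK mul1r => h.
rewrite (_ : F w - F z = (F w - F z - l * (w - z)) + l * (w - z)); last by rewrite subrK.
apply: (le_lt_trans (le_normcD _ _)); rewrite normcM.
apply: (@le_lt_trans _ _ ((normc l + 1) * normc (w - z))).
  by rewrite mulrDl mul1r addrC lerD2l.
by rewrite mulrC -ltr_pdivlMr.
Qed.
End ComplexDerivative.

(** * Goursat's theorem *)

Section Primitive.
Variable R : realType.
Local Notation leb := (@lebesgue_measure R).

(** The integral from 0 to x is a difference of two integrals from a base point to the left of 0 and x; the base point - (|x| + 1) may vary with x because the difference does not depend on it. *)
Lemma exists_primitive (f : R -> R) : continuous f ->
  exists F : R -> R, forall t, is_derive t (1:R) F (f t).
Proof.
move=> cf.
have fi (a b : R) : leb.-integrable [set` `[a, b]] (EFin \o f).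
  by apply: continuous_compact_integrable; [exact: segment_compact|exact: continuous_subspaceT].
pose P (T x : R) := Rintegral leb [set` `[(- T), x]] f - Rintegral leb [set` `[(- T), 0]] f.
have PT (T T' x : R) : 0 < T -> T <= T' -> - T < x -> P T x = P T' x.
  move=> T0 TT' Tx; have h (y : R) : - T < y -> Rintegral leb [set` `[- T, y]] f =
      Rintegral leb [set` `[- T', y]] f - Rintegral leb [set` `[- T', - T]] f.
    move=> Ty; rewrite Rintegral_itvB//; last 2 first.
      by rewrite bnd_simp; lra.
      by rewrite bnd_simp; lra.
    rewrite Rintegral_itv_obnd_cbnd//.
    by apply: integrableS (fi (- T) y) => //; apply: subset_itvr; rewrite bnd_simp.
  by rewrite /P !h//; [ring|lra].
have Pd (T x : R) : - T < x -> is_derive x (1:R) (P T) (f x).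
  move=> Tx; have xu : x < x + 1 by rewrite ltrDl.
  have [d e] := @continuous_FTC1_closed R f (- T) x (x + 1) xu (fi _ _) Tx (cf x).
  have h : is_derive x (1:R) (fun y => Rintegral leb [set` `[(- T), y]] f) (f x).
    exact: (DeriveDef d (etrans (esym (derive1E _ _)) e)).
  have := is_deriveB' h (is_derive_cst (Rintegral leb [set` `[(- T), 0]] f) x 1).
  by rewrite subr0.
exists (fun x => P (`|x| + 1) x) => t.
have tT : - (`|t| + 2) < t by have := ler_norm (- t); rewrite normrN; lra.
apply: (near_eq_is_derive _ (Pd (`|t| + 2) t tT)).
have := @nbhsx_ballx _ _ t 1 ltr01; apply: filterS => x; rewrite /ball/= => xt.
have xl : `|x| < `|t| + 1.
  by rewrite -(subrK t x) (le_lt_trans (ler_normD _ _))// addrC ltrD2l distrC.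
apply/esym/PT.
- by rewrite ltr_wpDl.
- by lra.
- by have := ler_norm (- x); rewrite normrN; lra.
Qed.

Lemma exists_cprimitive (f : R -> R[i]) : continuous (fun t => complex.Re (f t)) ->
  continuous (fun t => complex.Im (f t)) -> exists F, forall t, cder F t (f t).
Proof.
move=> c1 c2; have [F1 h1] := exists_primitive c1; have [F2 h2] := exists_primitive c2.
by exists (fun t => F1 t +i* F2 t) => t; split => /=.
Qed.
End Primitive.

Section Goursat.
Variable R : realType.
Local Notation C := R[i].
Local Notation Re := (@complex.Re R).
Local Notation Im := (@complex.Im R).
Implicit Types (z w : C).

Lemma cder_mvt_seg (g dg : R -> C) (a b L : R) : (forall t, cder g t (dg t)) ->
  (forall t, a <= t <= b -> normc (dg t) <= L) -> a <= b -> normc (g b - g a) <= 2 * (L * (b - a)).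
Proof.
move=> gd gL ab.
have hd t : cder (fun s => g (a + s * (b - a))) t (dg (a + t * (b - a)) * (b - a)%:C).
  by apply: cder_comp; [exact: gd|exact: is_derive_affine].
have := cder_mvt hd (L := L * (b - a)); rewrite mul1r mul0r addr0 (addrC a) subrK; apply.
move=> t /andP[t0 t1]; rewrite normcM normc_real ger0_norm ?subr_ge0//.
rewrite ler_wpM2r ?subr_ge0// gL// lerDl mulr_ge0 ?subr_ge0//=.
by rewrite -lerBrDl ler_piMl ?subr_ge0.
Qed.

Variable g : C -> C.
Hypothesis gd : forall z, exists l, cdiff g z l.

Let cg : ctn g. Proof. exact: cdiff_ctn. Qed.
Local Notation pt x y := ((x : R)%:C + (y : R)%:C * 'i%C).

Let hX y : exists F, forall x, cder F x (g (pt x y)).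
Proof. by apply: exists_cprimitive; apply: (continuous_pair1 (u := fun z => _ (g z))); [exact: ctnRe|exact: ctnIm]. Qed.
Let hY x : exists F, forall y, cder F y (g (pt x y)).
Proof. by apply: exists_cprimitive; apply: (continuous_pair2 (u := fun z => _ (g z))); [exact: ctnRe|exact: ctnIm]. Qed.
Let X y : R -> C := sval (cid (hX y)).
Let Y x : R -> C := sval (cid (hY x)).
Let dX y x : cder (X y) x (g (pt x y)). Proof. by rewrite /X; case: cid. Qed.
Let dY x y : cder (Y x) y (g (pt x y)). Proof. by rewrite /Y; case: cid. Qed.

(** The integral of [g] along the boundary of the rectangle with sides [a, b] and [c, d], written with primitives of [g] on horizontal and vertical lines. *)
Let I (a b c d : R) : C := (X c b - X c a) + 'i%C * (Y b d - Y b c)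
  - (X d b - X d a) - 'i%C * (Y a d - Y a c).

Let I_split a m b c n d : I a b c d = (I a m c n + I m b c n) + (I a m n d + I m b n d).
Proof. by rewrite /I; ring. Qed.

(** Compare [g] with its first-order Taylor polynomial at the point [z] of the rectangle: the polynomial has the primitive [Q], so only the error, at most [e] times the size, contributes on each side. *)
Let I_small (z : C) (e : R) : 0 < e -> exists2 r : R, 0 < r & forall a b c d : R,
  a <= Re z <= b -> c <= Im z <= d -> (b - a) + (d - c) < r ->
  normc (I a b c d) <= 4 * (e * ((b - a) + (d - c)) ^+ 2).
Proof.
move=> e0; have [l hl] := gd z; have [r r0 Hr] := hl e e0; exists r => // a b c d.
move=> /andP[az zb] /andP[cz zd] D.
set s := (b - a) + (d - c) in D *.
(* the primitive of the Taylor polynomial g(z) + l (w - z) *)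
pose Q (w : C) : C := g z * w + l * ((w - z) * (w - z) / 2).
have herr (x y : R) : a <= x <= b -> c <= y <= d ->
    normc (g (pt x y) - (g z + l * (pt x y - z))) <= e * s.
  move=> /andP[ax xb] /andP[cy yd]; have nz : normc (pt x y - z) <= s.
    rewrite (le_trans (normc_le _))// /s.
    rewrite !(ReD, ImD, ReN, ImN) ReRM ImRM /= !(mulr0, mulr1, addr0, add0r).
    by apply: lerD; rewrite ler_norml; apply/andP; split; lra.
  have := Hr _ (le_lt_trans nz D).
  rewrite (addrC z) subrK opprD addrA => /le_trans; apply.
  by rewrite ler_wpM2l// ltW.
have dQ v w : wdir Q w v (v * (g z + l * (w - z))).
  have := cderD (cderZ (g z) (cder_affine w v 0))
    (cderZ l (cderZ 2^-1 (cderM (cder_affine (w - z) v 0) (cder_affine (w - z) v 0)))).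
  rewrite /wdir !mul0r !addr0.
  have -> : g z * v + l * (2^-1 * ((w - z) * v + v * (w - z))) = v * (g z + l * (w - z)).
    rewrite (_ : (w - z) * v + v * (w - z) = 2 * (v * (w - z))); last by ring.
    by rewrite mulKf ?pnatr_eq0//; ring.
  congr cder; apply/funext => t; rewrite /Q; ring.
have leg1 (y : R) : c <= y <= d -> normc ((X y b - X y a) - (Q (pt b y) - Q (pt a y))) <= 2 * (e * s * (b - a)).
  move=> ycd; rewrite (_ : _ - _ = (X y b - Q (pt b y)) - (X y a - Q (pt a y))); last by ring.
  apply: (@cder_mvt_seg (fun x => X y x - Q (pt x y)) (fun x => g (pt x y) - (g z + l * (pt x y - z)))); [| |by lra].
    move=> t; apply: cderD; first exact: dX.
    have h : wdir Q (y%:C * 'i + t%:C * 1) 1 (g z + l * (pt t y - z)).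
      by rewrite -[X in wdir _ _ _ X]mul1r mulr1 (addrC (y%:C * 'i)); exact: dQ.
    have := cderZ (-1) (wdir_shift h); rewrite mulN1r; congr cder.
    by apply/funext => x; rewrite mulN1r mulr1 addrC.
  by move=> t tab; exact: herr.
have leg2 (x : R) : a <= x <= b -> normc ('i%C * (Y x d - Y x c) - (Q (pt x d) - Q (pt x c))) <= 2 * (e * s * (d - c)).
  move=> xab; rewrite (_ : _ - _ = ('i%C * Y x d - Q (pt x d)) - ('i%C * Y x c - Q (pt x c))); last by ring.
  apply: (@cder_mvt_seg (fun y => 'i%C * Y x y - Q (pt x y)) (fun y => 'i%C * (g (pt x y) - (g z + l * (pt x y - z))))); [| |by lra].
    move=> t; rewrite mulrBr; apply: cderD; first by apply: cderZ; exact: dY.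
    have h : wdir Q (x%:C + t%:C * 'i) 'i%C ('i%C * (g z + l * (pt x t - z))) by exact: dQ.
    have := cderZ (-1) (wdir_shift h); rewrite mulN1r; congr cder.
    by apply/funext => y; rewrite mulN1r.
  move=> t tcd; rewrite normcM (_ : normc 'i%C = 1) ?mul1r; last by rewrite /= expr0n expr1n add0r sqrtr1.
  exact: herr.
have ab : a <= b by lra.
have cd : c <= d by lra.
have ca : c <= c <= d by rewrite lexx.
have da : c <= d <= d by rewrite cd lexx.
have aa : a <= a <= b by rewrite lexx.
have ba : a <= b <= b by rewrite ab lexx.
have := leg1 c ca; have := leg1 d da; have := leg2 a aa; have := leg2 b ba.
set E4 := (X c b - X c a) - _; set E3 := (X d b - X d a) - _.
set E2 := 'i%C * (Y a d - Y a c) - _; set E1 := 'i%C * (Y b d - Y b c) - _.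
move=> H1 H2 H3 H4.
have -> : I a b c d = (E4 + E1) - (E3 + E2) by rewrite /I /E1 /E2 /E3 /E4; ring.
apply: (le_trans (le_normcB _ _)).
apply: (le_trans (lerD (le_normcD _ _) (le_normcD _ _))).
apply: (le_trans (lerD (lerD H4 H1) (lerD H3 H2))).
by rewrite le_eqVlt; apply/orP; left; apply/eqP; rewrite /s; ring.
Qed.

(** Bisection: one of the four quarters carries at least a quarter of the integral, so the integral over the n-th rectangle is at least 4^-n times the first one, while [I_small] at the limit point makes it o(4^-n). *)
Let goursat (a b c d : R) : a <= b -> c <= d -> I a b c d = 0.
Proof.
move=> ab cd; apply/eqP; apply: contraT; rewrite -normc_gt0 => I0.
set eta : R := normc (I a b c d) in I0.
pose W n : R := (b - a) / 2 ^+ n; pose H n : R := (d - c) / 2 ^+ n.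
pose J n (p : R * R) := I p.1 (p.1 + W n) p.2 (p.2 + H n).
have W0 n : 0 <= W n by rewrite /W divr_ge0 ?subr_ge0 ?exprn_ge0.
have H0 n : 0 <= H n by rewrite /H divr_ge0 ?subr_ge0 ?exprn_ge0.
have WS n : W n = W n.+1 + W n.+1 by rewrite /W exprS; field; rewrite expf_neq0 ?pnatr_eq0.
have HS n : H n = H n.+1 + H n.+1 by rewrite /H exprS; field; rewrite expf_neq0 ?pnatr_eq0.
pose good n (p : R * R) := eta / 4 ^+ n <= normc (J n p).
have step n p : good n p -> exists q : R * R, [/\ good n.+1 q, p.1 <= q.1, q.1 + W n.+1 <= p.1 + W n, p.2 <= q.2 & q.2 + H n.+1 <= p.2 + H n].
  move=> gp; apply: contrapT => /forallNP nq.
  have bad q1 q2 : p.1 <= q1 -> q1 + W n.+1 <= p.1 + W n -> p.2 <= q2 -> q2 + H n.+1 <= p.2 + H n ->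
    normc (J n.+1 (q1, q2)) < eta / 4 ^+ n.+1.
    move=> a1 a2 a3 a4; rewrite ltNge; apply/negP => h; apply: (nq (q1, q2)); by split.
  have w1 := W0 n.+1; have h1 := H0 n.+1; have ws := WS n; have hs := HS n.
  have b1 := bad p.1 p.2 ltac:(lra) ltac:(lra) ltac:(lra) ltac:(lra).
  have b2 := bad (p.1 + W n.+1) p.2 ltac:(lra) ltac:(lra) ltac:(lra) ltac:(lra).
  have b3 := bad p.1 (p.2 + H n.+1) ltac:(lra) ltac:(lra) ltac:(lra) ltac:(lra).
  have b4 := bad (p.1 + W n.+1) (p.2 + H n.+1) ltac:(lra) ltac:(lra) ltac:(lra) ltac:(lra).
  move: gp; rewrite /good leNgt => /negP; apply.
  rewrite /J WS HS !addrA (@I_split p.1 (p.1 + W n.+1) _ p.2 (p.2 + H n.+1)).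
  apply: (le_lt_trans (le_normcD _ _)).
  apply: (le_lt_trans (lerD (le_normcD _ _) (le_normcD _ _))).
  apply: (lt_le_trans (ltrD (ltrD b1 b2) (ltrD b3 b4))).
  by rewrite le_eqVlt; apply/orP; left; apply/eqP; rewrite exprS; field; rewrite expf_neq0 ?pnatr_eq0.
have start : good 0%N (a, c).
  by rewrite /good /J /W /H /= !expr0 !divr1 !(addrC _ (_ - _)) !subrK.
pose P n := {p : R * R | good n p}.
pose nxt n (p : P n) : P n.+1 := let q := cid (step n (sval p) (svalP p)) in
  exist _ (sval q) (let: And5 h _ _ _ _ := svalP q in h).
pose sq := fix F n : P n := if n is m.+1 then nxt m (F m) else exist _ (a, c) start.
pose x n := (sval (sq n)).1; pose y n := (sval (sq n)).2.
have xyS n : [/\ x n <= x n.+1, x n.+1 + W n.+1 <= x n + W n, y n <= y n.+1 & y n.+1 + H n.+1 <= y n + H n].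
  by rewrite /x /y /= /nxt; case: cid => q [] /=.
have mono n k : x n <= x (n + k)%N /\ x (n + k)%N + W (n + k)%N <= x n + W n /\ y n <= y (n + k)%N /\ y (n + k)%N + H (n + k)%N <= y n + H n.
  elim: k => [|k [i1 [i2 [i3 i4]]]]; first by rewrite addn0.
  by rewrite addnS; have [a1 a2 a3 a4] := xyS (n + k)%N; repeat split; lra.
have between n k : x k <= x n + W n /\ y k <= y n + H n.
  have [nk|/ltnW nk] := leqP n k.
    have [_ [h1 [_ h2]]] := mono n (k - n)%N; rewrite subnKC// in h1 h2.
    by have := W0 k; have := H0 k; split; lra.
  have [h1 [_ [h2 _]]] := mono k (n - k)%N; rewrite subnKC// in h1 h2.
  by have := W0 n; have := H0 n; split; lra.
pose xs := sup (range x); pose ys := sup (range y).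
have hx n : x n <= xs <= x n + W n.
  apply/andP; split.
    apply: ub_le_sup; last by exists n.
    by exists (x 0%N + W 0%N) => _ [k _ <-]; have [] := between 0%N k.
  apply: sup_le_ub; first by exists (x 0%N), 0%N.
  by move=> _ [k _ <-]; have [] := between n k.
have hy n : y n <= ys <= y n + H n.
  apply/andP; split.
    apply: ub_le_sup; last by exists n.
    by exists (y 0%N + H 0%N) => _ [k _ <-]; have [] := between 0%N k.
  apply: sup_le_ub; first by exists (y 0%N), 0%N.
  by move=> _ [k _ <-]; have [] := between n k.
pose s : R := (b - a) + (d - c); have s0 : 0 <= s by rewrite addr_ge0 ?subr_ge0.
pose e : R := eta / (8 * (s ^+ 2 + 1)).
have s21 : 0 < s ^+ 2 + 1 by rewrite ltr_wpDl// sqr_ge0.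
have e0 : 0 < e by rewrite divr_gt0// mulr_gt0.
have [r r0 Hr] := @I_small (xs +i* ys) e e0.
have [n sn] : exists n, s / 2 ^+ n < r.
  have [n hn] : exists n : nat, s / r < n%:R.
    by exists (Num.truncn (s / r)).+1; apply: truncnS_gt.
  exists n; rewrite ltr_pdivrMr ?exprn_gt0// mulrC -ltr_pdivrMr//.
  by apply: (lt_le_trans hn); rewrite -natrX ler_nat ltnW// ltn_expl.
have Wn : (x n + W n - x n) + (y n + H n - y n) = s / 2 ^+ n.
  by rewrite !(addrC _ (W n)) !(addrC _ (H n)) !addrK /W /H -mulrDl.
have := Hr (x n) (x n + W n) (y n) (y n + H n) (hx n) (hy n).
rewrite Wn => /(_ sn) hle.
suff : 4 * (e * (s / 2 ^+ n) ^+ 2) < normc (I (x n) (x n + W n) (y n) (y n + H n)) by rewrite ltNge hle.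
apply: lt_le_trans (svalP (sq n)).
have key : 4 * (e * s ^+ 2) < eta.
  rewrite (_ : 4 * _ = eta * (4 * s ^+ 2) / (8 * (s ^+ 2 + 1))); last by rewrite /e; ring.
  rewrite ltr_pdivrMr ?mulr_gt0// ltr_pM2l//; have := sqr_ge0 s; lra.
have p2 : (2 : R) ^+ n != 0 by rewrite expf_neq0// pnatr_eq0.
have -> : (4 : R) ^+ n = (2 ^+ n) ^+ 2 by rewrite -exprM mulnC exprM expr2 -natrM.
rewrite (_ : 4 * _ = 4 * (e * s ^+ 2) / (2 ^+ n) ^+ 2); last by field.
by rewrite ltr_pM2r// invr_gt0 exprn_gt0// exprn_gt0.
Qed.

Let goursat' (a b c d : R) : I a b c d = 0.
Proof.
have sw1 : I a b c d = - I b a c d by rewrite /I; ring.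
have sw2 x y : I x y c d = - I x y d c by rewrite /I; ring.
have h x y : x <= y -> I x y c d = 0.
  move=> xy; have [cd|/ltW dc] := leP c d; first exact: goursat.
  by rewrite sw2 goursat// oppr0.
have [ab|/ltW ba] := leP a b; first exact: h.
by rewrite sw1 h// oppr0.
Qed.

(** Integrate from 0 along two sides of a rectangle; by Goursat both orders agree, so each partial derivative can be read off. *)
Lemma holo_primitive : exists G, forall z, wirt G z (g z) 0.
Proof.
pose G z := X 0 (Re z) - X 0 0 + 'i%C * (Y (Re z) (Im z) - Y (Re z) 0).
have GE z : G z = X (Im z) (Re z) - X (Im z) 0 + 'i%C * (Y 0 (Im z) - Y 0 0).
  apply/eqP; rewrite -subr_eq0 -(goursat' 0 (Re z) 0 (Im z)); apply/eqP; rewrite /I /G; ring.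
exists G => z; have zE : g z = g (pt (Re z) (Im z)).
  by congr g; rewrite {1}(complexE z) mulrC.
split; rewrite /wdir ?addr0 ?subr0.
- have h : cder (fun x => X (Im z) x - X (Im z) 0 + 'i%C * (Y 0 (Im z) - Y 0 0)) (Re z + 0 * 1) (g z).
    rewrite mul0r addr0 -[g z]addr0; apply: cderD; last exact: cder_cst.
    rewrite -[g z]subr0; apply: cderD; last by rewrite oppr0; exact: cder_cst.
    by rewrite zE; exact: dX.
  have := @cder_comp _ (fun x => X (Im z) x - X (Im z) 0 + 'i%C * (Y 0 (Im z) - Y 0 0)) (fun t => Re z + t * 1) 0 (g z) 1 h (is_derive_affine _ _ _).
  rewrite mulr1; congr cder; apply/funext => t; rewrite GE.
  by rewrite !mulr1 ReD ImD /= addr0.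
- have h : cder (fun y => X 0 (Re z) - X 0 0 + 'i%C * (Y (Re z) y - Y (Re z) 0)) (Im z + 0 * 1) ('i%C * g z).
    rewrite mul0r addr0 -['i%C * g z]add0r; apply: cderD; first exact: cder_cst.
    apply: cderZ; rewrite -[g z]subr0; apply: cderD; last by rewrite oppr0; exact: cder_cst.
    by rewrite zE; exact: dY.
  have := @cder_comp _ (fun y => X 0 (Re z) - X 0 0 + 'i%C * (Y (Re z) y - Y (Re z) 0)) (fun t => Im z + t * 1) 0 ('i%C * g z) 1 h (is_derive_affine _ _ _).
  rewrite mulr1; congr cder; apply/funext => t; rewrite /G.
  by rewrite ReD ImD ReRM ImRM /= !(mulr0, addr0, mulr1).
Qed.
End Goursat.

(** * Functions of class C^2 and truncated bumps *)

Section PosPart.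
Variable R : realType.
Implicit Types t : R.
(** The positive part; its n-th power is of class C^(n-1). *)
Definition pp t : R := Num.max t 0.
Lemma pp_ge0 t : 0 <= pp t. Proof. by rewrite /pp le_max lexx orbT. Qed.
Lemma pp_pos t : 0 <= t -> pp t = t. Proof. by move=> t0; rewrite /pp max_l. Qed.
Lemma pp_neg t : t <= 0 -> pp t = 0. Proof. by move=> t0; rewrite /pp max_r. Qed.
(** The algebraic fact that keeps truncated powers closed under multiplication by their argument. *)
Lemma pp_mul t n : t * pp t ^+ n.+1 = pp t ^+ n.+2.
Proof.
have [t0|/ltW t0] := leP 0 t; first by rewrite pp_pos// -exprS.
by rewrite pp_neg// !exprS !mul0r mulr0.
Qed.
Lemma continuous_pp : continuous pp.
Proof.
move=> t; apply/cvgrPdist_lt => e e0; apply/nbhs_ballP; exists e => //= x; rewrite /ball/=.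
apply: le_lt_trans; rewrite ler_norml; have [a b] : - `|t - x| <= t - x /\ t - x <= `|t - x|.
  by apply/andP; rewrite -ler_norml.
have c := normr_ge0 (t - x); rewrite /pp /Num.max; case: ltP => u; case: ltP => v; apply/andP; split; lra.
Qed.
Lemma is_derive_pp2 t : is_derive t (1:R) (fun x => pp x ^+ 2) (2 * pp t).
Proof.
have cv : (fun h : R => h^-1 *: (((fun x => pp x ^+ 2) \o shift t) (h *: (1:R)) - pp t ^+ 2)) @ (0 : R)^' --> 2 * pp t.
  apply/cvgrPdist_le => e e0.
  rewrite near_withinE; apply/nbhs_ballP; exists e => //= h; rewrite /ball/= sub0r normrN => he h0.
  rewrite /shift/= -[h *: 1]/(h * 1) mulr1 -[_ *: _]/(h^-1 * _) (addrC h).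
  rewrite (_ : _ - _ = - (h^-1 * (pp (t + h) ^+ 2 - pp t ^+ 2 - 2 * pp t * h))); last by field.
  rewrite normrN normrM normfV ler_pdivrMl ?normr_gt0//.
  apply: (@le_trans _ _ (`|h| * `|h|)); last by rewrite ler_wpM2l// ltW.
  rewrite -normrM -expr2 (ger0_norm (sqr_ge0 h)) ler_norml.
  have [t0|/ltW t0] := leP 0 t; have [th|/ltW th] := leP 0 (t + h).
  - rewrite !pp_pos//; have := sqr_ge0 h; nra.
  - by rewrite (pp_pos t0) (pp_neg th); nra.
  - by rewrite (pp_neg t0) (pp_pos th); nra.
  - by rewrite !pp_neg//; have := sqr_ge0 h; nra.
apply: DeriveDef; first by apply/cvg_ex; exists (2 * pp t); exact: cv.
exact: (cvg_lim _ cv).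
Qed.
Lemma is_derive_ppX n t : is_derive t (1:R) (fun x => pp x ^+ n.+2) (n.+2%:R * pp t ^+ n.+1).
Proof.
elim: n => [|n IH]; first by rewrite expr1; exact: is_derive_pp2.
apply: (is_derive_fun _ _ (is_deriveM' (is_derive_id t 1) IH)) => [x|] /=.
  by rewrite pp_mul.
rewrite (_ : n.+3%:R = n.+2%:R + 1); last by rewrite natr1.
rewrite mulr1 mulrCA pp_mul; move: (_ ^+ _) n.+2%:R => P k; ring.
Qed.
End PosPart.

Section Wirtinger2.
Variable R : realType.
Local Notation C := R[i].
Implicit Types (z w a : C) (F G : C -> C) (u : C -> R).

(** Chosen derivatives, meaningful at points where [wirt] holds for some pair; they allow to speak of derivatives of derivatives without naming them. *)
Definition dz F z : C := xget 0 [set p | exists q, wirt F z p q].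
Definition db F z : C := xget 0 [set q | exists p, wirt F z p q].
Lemma dzE F z p q : wirt F z p q -> dz F z = p.
Proof. by move=> h; rewrite /dz; case: xgetP => [x _ [y /wirt_uniq/(_ h)[]]//|/(_ p)[]]; exists q. Qed.
Lemma dbE F z p q : wirt F z p q -> db F z = q.
Proof. by move=> h; rewrite /db; case: xgetP => [x _ [y /wirt_uniq/(_ h)[]]//|/(_ q)[]]; exists p. Qed.
Definition diff F := forall z, wirt F z (dz F z) (db F z).
Lemma diffE F (p q : C -> C) : (forall z, wirt F z (p z) (q z)) -> [/\ diff F, dz F = p & db F = q].
Proof.
move=> h; have hp : dz F = p by apply/funext => z; exact: dzE (h z).
have hq : db F = q by apply/funext => z; exact: dbE (h z).
by split => // z; rewrite hp hq.
Qed.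

(** The symmetry of the mixed derivatives is part of the definition, not a theorem; it is immediate for all functions built below. *)
Definition C2C F := [/\ diff F, diff (dz F), diff (db F), db (dz F) = dz (db F) &
  [/\ ctn (dz (dz F)), ctn (dz (db F)) & ctn (db (db F))]].
Lemma C2_dz F : C2C F -> ctn (dz F).
Proof. by move=> [_ h1 _ e [c1 c2 _]]; apply: (ctn_wirt h1 c1); rewrite e. Qed.
Lemma C2_db F : C2C F -> ctn (db F).
Proof. by move=> [_ _ h1 e [_ c1 c2]]; apply: (ctn_wirt h1). Qed.
Lemma C2_ctn F : C2C F -> ctn F.
Proof. by move=> h; have [d _ _ _ _] := h; apply: (ctn_wirt d); [exact: C2_dz|exact: C2_db]. Qed.

Lemma C2P F (p q pp r qq : C -> C) : (forall z, wirt F z (p z) (q z)) ->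
  (forall z, wirt p z (pp z) (r z)) -> (forall z, wirt q z (r z) (qq z)) ->
  ctn pp -> ctn r -> ctn qq -> C2C F /\ [/\ dz F = p, db F = q, dz (dz F) = pp, dz (db F) = r & db (db F) = qq].
Proof.
move=> /diffE[d1 e1 e2] /diffE[d2 e3 e4] /diffE[d3 e5 e6] c1 c2 c3.
by rewrite /C2C e1 e2 e3 e4 e5 e6; do 2 split.
Qed.

Lemma C2_cst c : C2C (fun=> c).
Proof.
by have [] := @C2P (fun=> c) (fun=> 0) (fun=> 0) (fun=> 0) (fun=> 0) (fun=> 0)
  (wirt_cst c) (wirt_cst 0) (wirt_cst 0) (@ctn_cst R 0) (@ctn_cst R 0) (@ctn_cst R 0).
Qed.
Lemma C2_id : C2C (fun z => z).
Proof.
by have [] := @C2P (fun z => z) (fun=> 1) (fun=> 0) (fun=> 0) (fun=> 0) (fun=> 0)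
  (@wirt_id R) (wirt_cst 1) (wirt_cst 0) (@ctn_cst R 0) (@ctn_cst R 0) (@ctn_cst R 0).
Qed.
Lemma C2D F G : C2C F -> C2C G -> C2C (fun z => F z + G z).
Proof.
move=> [d1 d2 d3 e [c1 c2 c3]] [d1' d2' d3' e' [c1' c2' c3']].
have d2e z := d2 z; rewrite e in d2e; have d2e' z := d2' z; rewrite e' in d2e'.
by have [] := C2P (fun z => wirtD (d1 z) (d1' z)) (fun z => wirtD (d2e z) (d2e' z)) (fun z => wirtD (d3 z) (d3' z))
  (ctnD c1 c1') (ctnD c2 c2') (ctnD c3 c3').
Qed.
Lemma C2M F G : C2C F -> C2C G -> C2C (fun z => F z * G z).
Proof.
move=> hF hG; have [d1 d2 d3 e [c1 c2 c3]] := hF; have [d1' d2' d3' e' [c1' c2' c3']] := hG.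
have d2e z := d2 z; rewrite e in d2e; have d2e' z := d2' z; rewrite e' in d2e'.
have cF := C2_ctn hF; have cG := C2_ctn hG; have cFz := C2_dz hF; have cGz := C2_dz hG.
have cFb := C2_db hF; have cGb := C2_db hG.
have [] := @C2P (fun z => F z * G z) (fun z => F z * dz G z + dz F z * G z) (fun z => F z * db G z + db F z * G z)
  (fun z => (F z * dz (dz G) z + dz F z * dz G z) + (dz F z * dz G z + dz (dz F) z * G z))
  (fun z => (F z * dz (db G) z + dz F z * db G z) + (db F z * dz G z + dz (db F) z * G z))
  (fun z => (F z * db (db G) z + db F z * db G z) + (db F z * db G z + db (db F) z * G z)).
- by move=> z; exact: wirtM.
- move=> z; apply: (wirt_eq _ _ _ (wirtD (wirtM (d1 z) (d2e' z)) (wirtM (d2e z) (d1' z)))) => [//|//|].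
  by ring.
- move=> z; exact: (wirtD (wirtM (d1 z) (d3' z)) (wirtM (d3 z) (d1' z))).
- by apply: ctnD; apply: ctnD; apply: ctnM.
- by apply: ctnD; apply: ctnD; apply: ctnM.
- by apply: ctnD; apply: ctnD; apply: ctnM.
- by [].
Qed.
Lemma C2J F : C2C F -> C2C (fun z => (F z)^*).
Proof.
move=> [d1 d2 d3 e [c1 c2 c3]]; have d2e z := d2 z; rewrite e in d2e.
by have [] := C2P (fun z => wirtJ (d1 z)) (fun z => wirtJ (d3 z)) (fun z => wirtJ (d2e z))
  (ctnJ c3) (ctnJ c2) (ctnJ c1).
Qed.
Lemma C2Z c F : C2C F -> C2C (fun z => c * F z).
Proof. exact/C2M/C2_cst. Qed.
Lemma C2_sub a : C2C (fun z => z - a).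
Proof. by apply: C2D; [exact: C2_id|exact: C2_cst]. Qed.
(** The chain rule for a real function of one real variable; continuity of the derivatives is only required along [u]. *)
Lemma C2R u (f f1 f2 : R -> R) : C2C (fun z => (u z)%:C) ->
  (forall z, is_derive (u z) (1:R) f (f1 (u z))) -> (forall z, is_derive (u z) (1:R) f1 (f2 (u z))) ->
  continuous ((fun z => f1 (u z)) : C^o -> R) -> continuous ((fun z => f2 (u z)) : C^o -> R) -> C2C (fun z => (f (u z))%:C).
Proof.
move=> hu ff f12 cf1 cf2; have [d1 d2 d3 e [c1 c2 c3]] := hu.
have d2e z := d2 z; rewrite e in d2e.
have cu : continuous (u : C^o -> R) by apply: ctnRr; exact: C2_ctn.
have cz := C2_dz hu; have cb := C2_db hu.
set U := fun z => (u z)%:C in d1 d2 d3 e c1 c2 c3 d2e cz cb hu.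
have cff1 : ctn (fun z => (f1 (u z))%:C) by exact: ctnR.
have cff2 : ctn (fun z => (f2 (u z))%:C) by exact: ctnR.
have [] := @C2P (fun z => (f (u z))%:C) (fun z => (f1 (u z))%:C * dz U z) (fun z => (f1 (u z))%:C * db U z)
  (fun z => (f1 (u z))%:C * dz (dz U) z + ((f2 (u z))%:C * dz U z) * dz U z)
  (fun z => (f1 (u z))%:C * dz (db U) z + ((f2 (u z))%:C * dz U z) * db U z)
  (fun z => (f1 (u z))%:C * db (db U) z + ((f2 (u z))%:C * db U z) * db U z).
- by move=> z; exact: wirtR.
- move=> z; apply: (wirt_eq _ _ _ (wirtM (wirtR (d1 z) (f12 z)) (d2e z))) => [//|//|]; ring.
- move=> z; apply: (wirt_eq _ _ _ (wirtM (wirtR (d1 z) (f12 z)) (d3 z))) => [//|//|]; ring.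
- exact: (ctnD (ctnM cff1 c1) (ctnM (ctnM cff2 cz) cz)).
- exact: (ctnD (ctnM cff1 c2) (ctnM (ctnM cff2 cz) cb)).
- exact: (ctnD (ctnM cff1 c3) (ctnM (ctnM cff2 cb) cb)).
- by [].
Qed.

Definition dist2 a z : R := normc (z - a) ^+ 2.
Lemma dist2_ge0 a z : 0 <= dist2 a z. Proof. exact: sqr_ge0. Qed.
Lemma dist2E a z : (dist2 a z)%:C = (z - a) * (z - a)^*. Proof. by rewrite mulJ. Qed.
Lemma dist2_self a : dist2 a a = 0. Proof. by rewrite /dist2 subrr normc0 expr0n. Qed.
Lemma wirt_dist2 a z : wirt (fun w => (dist2 a w)%:C) z (z - a)^* (z - a).
Proof.
apply: (wirt_eq _ _ _ (wirtM (wirt_sub a z) (wirtJ (wirt_sub a z)))) => [w||].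
- by rewrite dist2E. - by rewrite conj0 mulr0 add0r mul1r. - by rewrite conj1 mulr1 mul0r addr0.
Qed.
Lemma C2_dist2 a : C2C (fun z => (dist2 a z)%:C).
Proof.
under eq_fun do rewrite dist2E.
by apply: C2M; [exact: C2_sub|apply: C2J; exact: C2_sub].
Qed.
Lemma continuous_dist2 a : continuous (dist2 a : C^o -> R).
Proof. exact/ctnRr/C2_ctn/C2_dist2. Qed.

Definition bump a (s : R) n z : R := pp (1 - s * dist2 a z) ^+ n.
Lemma bump_ge0 a s n z : 0 <= bump a s n z. Proof. by rewrite exprn_ge0// pp_ge0. Qed.
Lemma bump_le1 a s n z : 0 <= s -> bump a s n z <= 1.
Proof.
move=> s0; rewrite /bump exprn_ile1 ?pp_ge0//.
by rewrite /pp ge_max ler01 andbT lerBlDr lerDl mulr_ge0// dist2_ge0.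
Qed.
Lemma is_derive_aff1 (s t : R) : is_derive t (1:R) (fun x => 1 - s * x) (- s).
Proof.
apply: (is_derive_fun _ _ (is_derive_affine 1 (- s) t)) => [x|//].
by rewrite mulrN mulrC.
Qed.
Lemma wirt_bump a s n z : wirt (fun w => (bump a s n.+2 w)%:C) z
  ((- (n.+2%:R * s * bump a s n.+1 z))%:C * (z - a)^*) ((- (n.+2%:R * s * bump a s n.+1 z))%:C * (z - a)).
Proof.
apply: (@wirtR R (dist2 a) (fun t => pp (1 - s * t) ^+ n.+2)); first exact: wirt_dist2.
have := @is_derive_comp' R (fun x => pp x ^+ n.+2) (fun t => 1 - s * t) _ _ _ (is_derive_ppX _ _) (is_derive_aff1 s (dist2 a z)).
by apply: is_derive_fun => [//|]; rewrite /bump; ring.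
Qed.
Lemma continuous_bump a s n : continuous (bump a s n : C^o -> R).
Proof.
apply: (@continuous_compR R (dist2 a) (fun t => pp (1 - s * t) ^+ n)); last exact: continuous_dist2.
move=> t; apply: (continuous_comp (f := fun t => pp (1 - s * t)) (g := fun x : R => x ^+ n)); last exact: exprn_continuous.
apply: (continuous_comp (f := fun t => 1 - s * t) (g := @pp R)); last exact: continuous_pp.
apply: continuousB; first exact: cst_continuous.
by apply: continuousM; [exact: cst_continuous|exact: cvg_id].
Qed.
Lemma C2_bump a s n : C2C (fun z => (bump a s n.+3 z)%:C).
Proof.
have sD m (t : R) : is_derive t (1:R) (fun x => pp (1 - s * x) ^+ m.+2) (- (m.+2%:R * s * pp (1 - s * t) ^+ m.+1)).
  have := @is_derive_comp' R (fun x => pp x ^+ m.+2) (fun t => 1 - s * t) _ _ _ (is_derive_ppX _ _) (is_derive_aff1 s t).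
  by apply: is_derive_fun => [//|]; ring.
apply: (@C2R (dist2 a) (fun t => pp (1 - s * t) ^+ n.+3) (fun t => - (n.+3%:R * s) * pp (1 - s * t) ^+ n.+2)
  (fun t => - (n.+3%:R * s) * - (n.+2%:R * s * pp (1 - s * t) ^+ n.+1))).
- exact: C2_dist2.
- by move=> z; apply: (is_derive_fun _ _ (sD n.+1 _)) => [//|]; ring.
- apply/ctnRr; under eq_fun do rewrite rmorphM /=.
  by apply: ctnM; [exact: ctn_cst|apply: ctnR; exact: continuous_bump].
- apply/ctnRr.
  rewrite (_ : (fun z => _) = fun z => (n.+3%:R * s * (n.+2%:R * s))%:C * (bump a s n.+1 z)%:C); last first.
    by apply/funext => z; rewrite -rmorphM; congr (_%:C); rewrite /bump; ring.
  by apply: ctnM; [exact: ctn_cst|apply: ctnR; exact: continuous_bump].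
Qed.
Lemma bump0 a s n z : 1 <= s * dist2 a z -> bump a s n.+1 z = 0.
Proof. by move=> h; rewrite /bump pp_neg ?expr0n// subr_le0. Qed.
Lemma csupp_bump a s n : 0 < s -> csupp (bump a s n.+1).
Proof.
move=> s0; exists (normc a + (1 + s^-1)) => z h; apply: bump0.
have zn : 1 + s^-1 < normc (z - a) by have := lerB_normc z a; lra.
have si : 0 < s^-1 by rewrite invr_gt0.
have s1 : 1 <= normc (z - a) by lra.
rewrite /dist2 -ler_pdivrMl// mulr1 (le_trans _ (_ : normc (z - a) <= _))//; first by lra.
by rewrite expr2 ler_peMl// (le_trans _ s1).
Qed.
Lemma csupp_bumpC a s n : 0 < s -> csupp (fun z => (bump a s n.+1 z)%:C).
Proof. by move=> s0; have [r H] := csupp_bump a n s0; exists r => z /H ->. Qed.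
End Wirtinger2.

Section RealContinuity.
Variable R : realType.
Implicit Types f g : R[i] -> R.
Lemma ctnRN f : ctn (fun z => (f z)%:C) -> ctn (fun z => (- f z)%:C).
Proof. by move=> /ctnN; congr ctn; apply/funext => z; rewrite rmorphN. Qed.
Lemma ctnRM f g : ctn (fun z => (f z)%:C) -> ctn (fun z => (g z)%:C) -> ctn (fun z => (f z * g z)%:C).
Proof. by move=> h1 h2; have := ctnM h1 h2; congr ctn; apply/funext => z; rewrite rmorphM. Qed.
Lemma ctnRD f g : ctn (fun z => (f z)%:C) -> ctn (fun z => (g z)%:C) -> ctn (fun z => (f z + g z)%:C).
Proof. by move=> h1 h2; have := ctnD h1 h2; congr ctn; apply/funext => z; rewrite rmorphD. Qed.
Lemma ctnRX f n : ctn (fun z => (f z)%:C) -> ctn (fun z => (f z ^+ n)%:C).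
Proof. by move=> h1; have := @ctnX R _ n h1; congr ctn; apply/funext => z; rewrite rmorphXn. Qed.
Lemma ctnRV f : ctn (fun z => (f z)%:C) -> (forall z, f z != 0) -> ctn (fun z => ((f z)^-1)%:C).
Proof.
move=> h1 f0; have := ctnV h1; rewrite (_ : (fun z => _^-1) = fun z => ((f z)^-1)%:C); last first.
  by apply/funext => z; rewrite fmorphV.
by apply => z; rewrite (inj_eq (@complexI R)).
Qed.
End RealContinuity.

Ltac ctn_real := first [ assumption | exact: continuous_bump | exact: continuous_dist2 | exact: continuous_Re ].
Ltac ctn_tac := match goal with
  | H : ctn ?F |- ctn ?F => exact H
  | H : ctn ?F |- ctn (fun z => ?F z) => exact H
  | |- ctn (fun _ => ?c) => exact: ctn_cst
  | |- ctn (fun z => z) => exact: ctn_id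
  | |- ctn (fun z => @?f z + @?g z) => apply: (@ctnD _ f g); ctn_tac
  | |- ctn (fun z => - @?f z) => apply: (@ctnN _ f); ctn_tac
  | |- ctn (fun z => @?f z * @?g z) => apply: (@ctnM _ f g); ctn_tac
  | |- ctn (fun z => (@?f z)^*) => apply: (@ctnJ _ f); ctn_tac
  | |- ctn (fun z => @?f z ^+ ?n) => apply: (@ctnX _ f n); ctn_tac
  | |- ctn (fun z => (- @?f z)%:C) => apply: (@ctnRN _ f); ctn_tac
  | |- ctn (fun z => (@?f z * @?g z)%:C) => apply: (@ctnRM _ f g); ctn_tac
  | |- ctn (fun z => (@?f z + @?g z)%:C) => apply: (@ctnRD _ f g); ctn_tac
  | |- ctn (fun z => (@?f z ^+ ?n)%:C) => apply: (@ctnRX _ f n); ctn_tac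
  | |- ctn (fun z => (@?f z)%:C) => apply: (@ctnR _ f); ctn_real
  | |- _ => idtac
  end.

(** * Local integrability and mollifiers *)

Section Mollifier.
Variable R : realType.
Local Notation C := R[i].
Implicit Types (z a h : C) (F G K : C -> C) (u : C -> R).

Definition locI (w : C -> C) := measurable_fun setT w /\ forall r, rI (fun z : C => normc (w z) * isq 0 r z).

Lemma isq_sub (a b : C) (r r' : R) z : normc (a - b) + r <= r' -> isq a r z <= isq b r' z.
Proof.
move=> rr; rewrite !isqE; case: andP => [[h1 h2]|_ /=]; last by rewrite ler0n.
rewrite (_ : (_ && _) = true)//; apply/andP; split.
  rewrite (_ : z - b = (a - b) + (z - a)); last by ring.
  by rewrite ReD (le_trans (ler_normD _ _))// (le_trans _ rr)// lerD// Re_le.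
rewrite (_ : z - b = (a - b) + (z - a)); last by ring.
by rewrite ImD (le_trans (ler_normD _ _))// (le_trans _ rr)// lerD// Im_le.
Qed.

Lemma locI_sq (w : C -> C) a r : locI w -> rI (fun z => normc (w z) * isq a r z).
Proof.
move=> [mw iw]; apply: rI_le (iw (normc a + r)).
  apply: measurable_funM; first exact: mnormc.
  by apply: measurable_indic; exact: measurable_sq.
move=> z; rewrite ger0_norm ?mulr_ge0 ?normc_ge0 ?isq_ge0//.
by rewrite ler_wpM2l ?normc_ge0// isq_sub// subr0.
Qed.
Lemma ctn_locI F : ctn F -> locI F.
Proof.
move=> cF; have mF := ctn_measurable cF; split => // r; have [B B0 HB] := ctn_bounded (`|r| + `|r|) cF.
have rr : 0 <= `|r| by [].
apply: (@rI_le _ _ (fun z => B * isq 0 `|r| z)).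
- apply: measurable_funM; first exact: mnormc.
  by apply: measurable_indic; exact: measurable_sq.
- move=> z; rewrite ger0_norm ?mulr_ge0 ?normc_ge0 ?isq_ge0//.
  apply: (@le_trans _ _ (normc (F z) * isq 0 `|r| z)).
    by rewrite ler_wpM2l ?normc_ge0// isq_sub// subrr normc0 add0r ler_norm.
  rewrite isqE; case: andP => [[h1 h2]|_]; last by rewrite !mulr0.
  rewrite !mulr1 HB// (le_trans (normc_le _))//; rewrite subr0 in h1 h2.
  exact: lerD.
- by apply: rIZ; exact: rI_sq.
Qed.
Lemma locI_mul (w : C -> C) K : locI w -> ctn K -> csupp K -> cI (fun z => w z * K z).
Proof.
move=> lw cK sK; have mw := lw.1.
have [r [B [r0 B0 KB]]] : exists r B : R, [/\ 0 < r, 0 < B & forall z, `|normc (K z)| <= B * isq 0 r z].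
  apply: csupp_bounded; first exact: ctn_normc.
  by have [r H] := sK; exists r => z /H ->; rewrite normc0.
apply: (@cI_le _ _ (fun z => B * (normc (w z) * isq 0 r z))).
- by apply: mcM => //; exact: ctn_measurable.
- move=> z; have := KB z; rewrite ger0_norm ?normc_ge0// => h.
  by rewrite normcM mulrCA ler_wpM2l ?normc_ge0.
- by apply: rIZ; exact: locI_sq.
Qed.

Lemma wirt_shift F a z p q : wirt F (z - a) p q -> wirt (fun w => F (w - a)) z p q.
Proof.
move=> [h1 h2]; split.
  by move: h1; rewrite /wdir; congr cder; apply/funext => t; congr F; ring.
by move: h2; rewrite /wdir; congr cder; apply/funext => t; congr F; ring.
Qed.
Lemma ctn_shift F a : ctn F -> ctn (fun w => F (w - a)).
Proof. by move=> cF; apply: (ctn_comp cF); exact: (C2_ctn (C2_sub a)). Qed.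
Lemma csupp_shift (V : nmodType) (F : C -> V) a : csupp F -> csupp (fun w => F (w - a)).
Proof.
move=> [r H]; exists (r + normc a) => z h; apply: H.
by have := lerB_normc z a; lra.
Qed.
Lemma C2_shift F a : C2C F -> C2C (fun w => F (w - a)) /\
  [/\ dz (fun w => F (w - a)) = (fun w => dz F (w - a)), db (fun w => F (w - a)) = (fun w => db F (w - a))
  & dz (dz (fun w => F (w - a))) = fun w => dz (dz F) (w - a)].
Proof.
move=> [d1 d2 d3 e [c1 c2 c3]]; have d2e z := d2 z; rewrite e in d2e.
have [h [e1 e2 e3 _ _]] := C2P (fun z => @wirt_shift F a z _ _ (d1 _)) (fun z => @wirt_shift (dz F) a z _ _ (d2e _)) (fun z => @wirt_shift (db F) a z _ _ (d3 _))
  (ctn_shift c1) (ctn_shift c2) (ctn_shift c3).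
by [].
Qed.
Lemma csupp_dz F : diff F -> csupp F -> csupp (dz F) /\ csupp (db F).
Proof. by move=> d; exact: wirt_csupp. Qed.

Lemma csuppC_bounded F : ctn F -> csupp F -> exists2 B : R, 0 < B & forall z, normc (F z) <= B.
Proof.
move=> cF [r sF]; have [B B0 HB] := ctn_bounded r cF; exists B => // z.
by have [zr|zr] := leP (normc z) r; [exact: HB|rewrite sF// normc0 ltW].
Qed.

(** The first derivatives are Lipschitz because the second ones are bounded; outside a fixed square everything vanishes. *)
Lemma C2_taylor F : C2C F -> csupp F -> exists B r : R, [/\ 0 < B, 0 < r &
  forall z h, normc h <= 1 ->
    normc (F (z + h) - F z - dz F z * h - db F z * h^*) <= B * normc h ^+ 2 * isq 0 r z].
Proof.
move=> [d1 d2 d3 e [c1 c2 c3]] sF; have [sz sb] := csupp_dz d1 sF.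
have [szz szb] := csupp_dz d2 sz; have [sbz sbb] := csupp_dz d3 sb.
have [B1 B10 H1] := csuppC_bounded c1 szz.
have [B2 B20 H2] := csuppC_bounded c2 sbz.
have [B3 B30 H3] := csuppC_bounded c3 sbb.
pose B := B1 + B2 + B3; have B0 : 0 < B by rewrite !addr_gt0.
have [r sF'] := sF; have [r1 sz'] := sz; have [r2 sb'] := sb.
pose r3 : R := `|r| + `|r1| + `|r2| + 1.
have r30 : 0 < r3 by rewrite ltr_wpDl// !addr_ge0.
exists (64 * B), r3; split => // [|z h h1]; first by rewrite mulr_gt0.
have [zr|zr] := leP (normc z) r3; last first.
  have := ler_norm r; have := ler_norm r1; have := ler_norm r2.
  have := normr_ge0 r; have := normr_ge0 r1; have := normr_ge0 r2.
  rewrite /r3 in zr => a1 a2 a3 a4 a5 a6.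
  rewrite [F z]sF'; last by lra.
  rewrite sz'; last by lra.
  rewrite sb'; last by lra.
  rewrite sF'; last by have := lerB_normc z (- h); rewrite opprK normcN; lra.
  by rewrite !mul0r !subr0 normc0 mulr_ge0 ?isq_ge0// mulr_ge0 ?sqr_ge0// ltW// mulr_gt0.
rewrite isq1 ?subr0// mulr1.
have lip (p pz pb : C -> C) w : (forall x, wirt p x (pz x) (pb x)) -> (forall x, normc (pz x) <= B) ->
   (forall x, normc (pb x) <= B) -> normc (w - z) <= normc h -> normc (p w - p z) <= 8 * (B * normc h).
  move=> hp b1 b2 wz; have := @wirt_mvt R p pz pb z (w - z) B hp (fun x _ => conj (b1 x) (b2 x)).
  rewrite (addrC z) subrK => /le_trans; apply.
  by rewrite ler_wpM2l// ler_wpM2l// ltW.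
have := @wirt_taylor R F _ _ z h (8 * (B * normc h)) d1.
rewrite (_ : 8 * (8 * (B * normc h) * normc h) = 64 * B * normc h ^+ 2); last by ring.
apply => w wz; split.
  apply: (lip _ _ _ w d2) => // x; rewrite ?e /B.
    by have := H1 x; lra.
  by have := H2 x; lra.
apply: (lip _ _ _ w d3) => // x; rewrite /B.
  by have := H2 x; lra.
by have := H3 x; lra.
Qed.

(** Second-order expansion of a convolution with a smooth kernel, uniform in the function: this makes convolutions differentiable without exchanging limits and integrals. *)
Lemma kernel_taylor F : C2C F -> csupp F -> exists B r : R, [/\ 0 < B, 0 < r &
  forall w : C -> C, locI w -> forall z h, normc h <= 1 ->
  normc (cint (fun x => w x * F (x - (z + h))) - cint (fun x => w x * F (x - z))
     + h * cint (fun x => w x * dz F (x - z)) + h^* * cint (fun x => w x * db F (x - z)))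
  <= B * normc h ^+ 2 * intR (fun x => normc (w x) * isq z r x)].
Proof.
move=> hF sF; have [d1 d2 d3 e [c1 c2 c3]] := hF; have [sz sb] := csupp_dz d1 sF.
have cz := C2_dz hF; have cb := C2_db hF; have cF := C2_ctn hF.
have [B [r [B0 r0 H]]] := C2_taylor hF sF; exists B, r; split => // w lw z h h1.
have i1 := locI_mul lw (ctn_shift (a := z + h) cF) (csupp_shift (z + h) sF).
have i2 := locI_mul lw (ctn_shift (a := z) cF) (csupp_shift z sF).
have i3 := locI_mul lw (ctn_shift (a := z) cz) (csupp_shift z sz).
have i4 := locI_mul lw (ctn_shift (a := z) cb) (csupp_shift z sb).
rewrite -!cintZ// -cintB// -cintD//; [|exact: cIB|exact: cIZ].
rewrite -cintD//; [|by apply: cID; [exact: cIB|exact: cIZ]|exact: cIZ].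
have iT : cI (fun x => w x * F (x - (z + h)) - w x * F (x - z) + h * (w x * dz F (x - z)) + h^* * (w x * db F (x - z))).
  by apply: cID; [apply: cID; [exact: cIB|exact: cIZ]|exact: cIZ].
apply: (le_trans (normc_cint iT)); rewrite -intRZ; last exact: locI_sq.
apply: intR_le; first exact: cI_norm.
  by apply: rIZ; exact: locI_sq.
move=> x; rewrite (_ : _ + _ = w x * (F ((x - z) + - h) - F (x - z) - dz F (x - z) * (- h) - db F (x - z) * (- h)^*)); last first.
  by rewrite conjN opprD addrA; ring.
rewrite normcM mulrCA ler_wpM2l ?normc_ge0//.
have := H (x - z) (- h); rewrite normcN => /(_ h1) /le_trans; apply.
by rewrite !isqE subr0.
Qed.

(** The factor n + 1 normalises: all these functions have the same integral [mass], which is pi. *)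
Definition rho n a z : R := n.+1%:R * bump a 1 n z.
Lemma rho_ge0 n a z : 0 <= rho n a z. Proof. by rewrite mulr_ge0 ?bump_ge0. Qed.
Lemma rho_shift n a z : rho n a z = rho n 0 (z - a).
Proof. by rewrite /rho /bump /dist2 subr0. Qed.
Lemma rho_sym n a z : rho n a z = rho n z a.
Proof. by rewrite /rho /bump /dist2 normc_dist. Qed.
Lemma continuous_rho n a : continuous (rho n a : C^o -> R).
Proof.
apply: ctnRr; under eq_fun do rewrite /rho rmorphM /=.
by apply: ctnM; [exact: ctn_cst|apply: ctnR; exact: continuous_bump].
Qed.
Lemma csupp_rho n a : csupp (rho n.+1 a).
Proof.
by have [r H] := @csupp_bump R a 1 n ltr01; exists r => z zr; rewrite /rho H// mulr0.
Qed.
Lemma rI_rho n a : rI (rho n.+1 a).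
Proof. by apply: rI_csupp; [exact: continuous_rho|exact: csupp_rho]. Qed.
Lemma C2_rho n a : C2C (fun z => (rho n.+3 a z)%:C).
Proof. by under eq_fun do rewrite /rho rmorphM /=; apply: C2Z; exact: C2_bump. Qed.
Lemma csupp_rhoC n a : csupp (fun z => (rho n.+1 a z)%:C).
Proof. by apply: csupp_comp => //; exact: csupp_rho. Qed.

Lemma bump_mul n a z : dist2 a z * bump a 1 n.+1 z = bump a 1 n.+1 z - bump a 1 n.+2 z.
Proof. by rewrite /bump mul1r -pp_mul; ring. Qed.

(** The difference of two consecutive mollifiers is a dbar-derivative of a compactly supported function; hence functions annihilating such derivatives have the same integral against all mollifiers. *)
Lemma wirt_conjbump n a z : wirt (fun w => (w - a)^* * (bump a 1 n.+2 w)%:C) z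
  ((z - a)^* * ((- (n.+2%:R * 1 * bump a 1 n.+1 z))%:C * (z - a)^*))
  ((rho n.+2 a z)%:C - (rho n.+1 a z)%:C).
Proof.
apply: (wirt_eq _ _ _ (wirtM (wirtJ (wirt_sub a z)) (wirt_bump a 1 n z))) => [//||].
  by rewrite conj0 mul0r addr0.
rewrite conj1 mul1r mulrCA [(z - a)^* * _]mulrC -dist2E -rmorphM -rmorphB -rmorphD; congr (_%:C).
rewrite mulrC mulrN mulr1 (mulrCA _ n.+2%:R) bump_mul /rho.
by rewrite (_ : n.+3%:R = n.+2%:R + 1 :> R) ?natr1//; ring.
Qed.

Lemma rho_step (G G' : C -> C) a n : (forall z, wirt G z (G' z) 0) -> ctn G' ->
  cint (fun z => G z * (rho n.+2 a z)%:C) = cint (fun z => G z * (rho n.+1 a z)%:C).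
Proof.
move=> hG cG'; have cG : ctn G by apply: (ctn_wirt hG cG'); exact: ctn_cst.
have cb m : ctn (fun w => (bump a 1 m w)%:C) by apply: ctnR; exact: continuous_bump.
have cj : ctn (fun w => (w - a)^*) by apply: ctnJ; exact: (C2_ctn (C2_sub a)).
have cr m : ctn (fun w => (rho m a w)%:C) by apply: ctnR; exact: continuous_rho.
have := @divergence R (fun z => G z * ((z - a)^* * (bump a 1 n.+2 z)%:C)) _ _ (fun z => wirtM (hG z) (wirt_conjbump n a z)).
case.
- ctn_tac.
- by ctn_tac; exact: cr.
- by apply: csuppMr; apply: csuppMr; exact: csupp_bumpC.
- move=> _; rewrite (_ : (fun z => _) = fun z => G z * (rho n.+2 a z)%:C - G z * (rho n.+1 a z)%:C); last first.
    by apply/funext => z; ring.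
  rewrite cintB.
  + by move/eqP; rewrite subr_eq0 => /eqP.
  + by apply: locI_mul; [exact: ctn_locI|exact: cr|exact: csupp_rhoC].
  + by apply: locI_mul; [exact: ctn_locI|exact: cr|exact: csupp_rhoC].
Qed.

Definition mass : R := intR (rho 1 (0 : C)).

Lemma rho_mass n a : intR (rho n.+1 a) = intR (rho 1 a).
Proof.
elim: n => // n IH; rewrite -IH; apply: (@complexI R); rewrite -!cintR.
have := @rho_step (fun=> 1) (fun=> 0) a n (fun z => wirt_cst 1 z) (@ctn_cst R 0).
by under eq_fun do rewrite mul1r; under [in RHS]eq_fun do rewrite mul1r.
Qed.

Lemma zero_deriv_cst F : (forall z, wirt F z 0 0) -> forall z w, F z = F w.
Proof.
move=> hF z w; have := @wirt_mvt R F (fun=> 0) (fun=> 0) w (z - w) 0 hF.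
rewrite (addrC w) subrK mul0r mulr0 => /(_ _)/Wrap[].
  by move=> x _; rewrite normc0.
move=> h; apply/eqP; rewrite -subr_eq0; apply/eqP/eq0_normc/eqP.
by rewrite eq_le normc_ge0 h.
Qed.

(** A second-order remainder bound in which the conj h term is absent says that the function is complex differentiable. *)
Lemma quad_wirt F z p q (B : R) : (forall h, normc h <= 1 -> normc (F (z + h) - F z + h * p + h^* * q) <= B * normc h ^+ 2) ->
  q = 0 -> cdiff F z (- p).
Proof.
move=> hF q0 e e0; have B1 : 0 < `|B| + 1 by rewrite ltr_wpDl.
exists (Num.min 1 (e / (`|B| + 1))); first by rewrite lt_min ltr01 divr_gt0.
move=> h; rewrite lt_min => /andP[/ltW h1]; rewrite ltr_pdivlMr// => h2.
have := hF h h1; rewrite q0 mulr0 addr0 (_ : F (z + h) - F z + h * p = F (z + h) - F z - - p * h); last by ring.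
move=> /le_trans; apply; rewrite expr2 mulrA ler_wpM2r ?normc_ge0//.
apply: (le_trans _ (ltW h2)); rewrite mulrC ler_wpM2l ?normc_ge0//.
by rewrite (le_trans (ler_norm B))// lerDl.
Qed.

Lemma quad_ctn (F p q : C -> C) (B : C -> R) : (forall z h, normc h <= 1 -> normc (F (z + h) - F z + h * p z + h^* * q z) <= B z * normc h ^+ 2) ->
  ctn F.
Proof.
move=> hF; apply/ctnP => z e e0.
pose L : R := `|B z| + normc (p z) + normc (q z) + 1.
have L0 : 0 < L by rewrite ltr_wpDl// !addr_ge0 ?normc_ge0.
exists (Num.min 1 (e / L)); first by rewrite lt_min ltr01 divr_gt0.
move=> w; rewrite lt_min => /andP[/ltW h1]; rewrite ltr_pdivlMr// => h2.
have := hF z _ h1; rewrite (addrC z) subrK => h3.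
apply: (le_lt_trans _ h2); set h := w - z in h1 h2 h3 *.
rewrite (_ : F w - F z = (F w - F z + h * p z + h^* * q z) - (h * p z + h^* * q z)); last by ring.
apply: (le_trans (le_normcB _ _)); apply: (le_trans (lerD h3 (le_normcD _ _))).
rewrite !normcM normc_conj /L.
have : B z * normc h ^+ 2 <= `|B z| * normc h.
  apply: (@le_trans _ _ (`|B z| * normc h ^+ 2)); first by rewrite ler_wpM2r ?sqr_ge0// ler_norm.
  by rewrite ler_wpM2l// expr2 ler_piMl// normc_ge0.
have := normc_ge0 h; nra.
Qed.

(** Translation invariance without change of variables: the derivative of the integral with respect to the centre is the integral of a derivative. *)
Lemma mass_cst a : intR (rho 1 a) = mass.
Proof.
rewrite /mass -(rho_mass 2 a) -(rho_mass 2 0); apply: (@complexI R); rewrite -!cintR.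
have hK := C2_rho 0 0; have sK := csupp_rhoC 2 0.
have [B [r [B0 r0 H]]] := kernel_taylor hK sK.
set K := fun z => (rho 3 0 z)%:C in hK sK H.
have l1 : locI (fun=> 1) by apply: ctn_locI; exact: ctn_cst.
have [d1 _ _ _ _] := hK; have [sz sb] := csupp_dz d1 sK.
have dv z : cint (fun x => 1 * dz K (x - z)) = 0 /\ cint (fun x => 1 * db K (x - z)) = 0.
  have E (f : C -> C) : cint (fun x => 1 * f x) = cint f by apply: eq_cint => x; rewrite mul1r.
  rewrite (E (fun x => dz K (x - z))) (E (fun x => db K (x - z))).
  apply: (@divergence R (fun x => K (x - z))).
  - by move=> x; apply: wirt_shift; exact: d1.
  - by apply: ctn_shift; exact: C2_dz.
  - by apply: ctn_shift; exact: C2_db.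
  - exact: csupp_shift.
have cd z : cdiff (fun y => cint (fun x => 1 * K (x - y))) z 0.
  rewrite -oppr0 -(dv z).1.
  apply: (@quad_wirt _ _ _ (cint (fun x => 1 * db K (x - z))) (B * intR (fun x => normc (1 : C) * isq z r x))); last exact: (dv z).2.
  by move=> h h1; rewrite mulrAC; exact: H.
have := zero_deriv_cst (fun z => cdiff_wirt (cd z)) a 0.
rewrite /K; under eq_cint do rewrite mul1r -rho_shift.
by move=> ->; apply: eq_cint => x; rewrite mul1r -rho_shift.
Qed.
Lemma rho_int n a : intR (rho n.+1 a) = mass.
Proof. by rewrite rho_mass mass_cst. Qed.
Lemma mass_ge1 : 1 <= mass.
Proof.
rewrite -(_ : intR (isq (0 : C) 2^-1) = 1); last first.
  by rewrite intR_sq ?invr_ge0// mulfV ?expr1n// pnatr_eq0.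
apply: intR_le; [exact: rI_sq|exact: rI_rho|move=> z].
rewrite isqE; case: andP => [[h1 h2]|_]; last exact: rho_ge0.
have := sq_norm (conj h1 h2); rewrite -/(dist2 0 z) => h.
rewrite /rho /bump expr1 mul1r /pp; apply: (@le_trans _ _ (2 * (1 - dist2 0 z))).
  by rewrite /= in h *; lra.
by rewrite ler_wpM2l// le_max lexx.
Qed.
Lemma mass_gt0 : 0 < mass. Proof. exact: lt_le_trans mass_ge1. Qed.
Lemma mass_neq0 : mass%:C != 0 :> C.
Proof. by rewrite (inj_eq (@complexI R)) gt_eqF ?mass_gt0. Qed.
End Mollifier.

(** * Sequences, Fatou and Cauchy-Schwarz *)

Section Sequences.
Variable R : realType.
Local Notation C := R[i].
Local Notation Re := (@complex.Re R).
Local Notation Im := (@complex.Im R).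
Local Notation mu := (@lebesgueC R).

Definition cvgC (s : nat -> C) (l : C) := forall e : R, 0 < e -> exists N : nat, forall n, (N <= n)%N -> normc (s n - l) <= e.
Definition cauchyC (s : nat -> C) := forall e : R, 0 < e -> exists N : nat, forall n m, (N <= n)%N -> (N <= m)%N -> normc (s n - s m) <= e.

Lemma cvgC_uniq s l l' : cvgC s l -> cvgC s l' -> l = l'.
Proof.
move=> h h'; apply/eqP; rewrite -subr_eq0; apply: contraT; rewrite -normc_gt0 => e0.
set e : R := normc (l - l') in e0.
have [N HN] := h (e / 3) ltac:(by rewrite divr_gt0); have [N' HN'] := h' (e / 3) ltac:(by rewrite divr_gt0).
have := HN (maxn N N') (leq_maxl _ _); have := HN' (maxn N N') (leq_maxr _ _).
set x := s _ => a b; have : e <= normc (x - l') + normc (x - l).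
  rewrite /e (_ : l - l' = (x - l') - (x - l)); last by ring.
  exact: le_normcB.
move=> c; exfalso; lra.
Qed.
Lemma cvgC_cst l : cvgC (fun=> l) l.
Proof. by move=> e e0; exists 0%N => n _; rewrite subrr normc0 ltW. Qed.
Lemma cvgC_eq s t l : s =1 t -> cvgC s l -> cvgC t l.
Proof. by move=> /funext ->. Qed.
Lemma cvgCD s t l m : cvgC s l -> cvgC t m -> cvgC (fun n => s n + t n) (l + m).
Proof.
move=> hs ht e e0; have e2 : 0 < e / 2 by rewrite divr_gt0.
have [N HN] := hs _ e2; have [M HM] := ht _ e2; exists (maxn N M) => n; rewrite geq_max => /andP[a b].
rewrite (_ : _ - _ = (s n - l) + (t n - m)); last by ring.
by rewrite (le_trans (le_normcD _ _))// (splitr e) lerD ?HN ?HM.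
Qed.
Lemma cvgCZ c s l : cvgC s l -> cvgC (fun n => c * s n) (c * l).
Proof.
move=> hs e e0; have c1 : 0 < normc c + 1 by rewrite ltr_wpDl// normc_ge0.
have [N HN] := hs (e / (normc c + 1)) ltac:(by rewrite divr_gt0); exists N => n /HN h.
rewrite -mulrBr normcM; apply: (@le_trans _ _ ((normc c + 1) * normc (s n - l))).
  by rewrite ler_wpM2r ?normc_ge0// lerDl.
by rewrite mulrC -ler_pdivlMr.
Qed.
Lemma cvgCB s t l m : cvgC s l -> cvgC t m -> cvgC (fun n => s n - t n) (l - m).
Proof.
move=> hs ht; have := cvgCD hs (cvgCZ (-1) ht); rewrite mulN1r.
by apply: cvgC_eq => n; rewrite mulN1r.
Qed.
Lemma cvgC_le s l (B : R) : cvgC s l -> (forall n, normc (s n) <= B) -> normc l <= B.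
Proof.
move=> hs sB; apply/ler_addgt0Pr => e e0; have [N HN] := hs e e0.
have := HN N (leqnn _); rewrite normc_dist => h.
rewrite -(subrK (s N) l) (le_trans (le_normcD _ _))// addrC lerD//.
Qed.
Lemma cauchyC_cvg s : cauchyC s -> exists l, cvgC s l.
Proof.
move=> hs; have key (f : C -> R) : (forall x y, `|f x - f y| <= normc (x - y)) ->
    exists l : R, forall e, 0 < e -> exists N : nat, forall n, (N <= n)%N -> `|f (s n) - l| <= e.
  move=> fle; have : cvgn (fun n => f (s n)).
    apply: cauchy_cvg; apply: cauchy_exP => e e0.
    have [N HN] := hs (e / 2) ltac:(by rewrite divr_gt0); exists (f (s N)).
    exists N => // n /= Nn; rewrite /ball/= (le_lt_trans (fle _ _))//.
    by rewrite (le_lt_trans (HN _ _ _ Nn))// ltr_pdivrMr// ltr_pMr// ltr1n.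
  move=> /cvg_ex[l /cvgrPdist_le hl]; exists l => e e0; have [N _ HN] := hl e e0.
  by exists N => n Nn; rewrite distrC; exact: HN.
have [a ha] := key Re ltac:(by move=> x y; rewrite -ReN -ReD Re_le).
have [b hb] := key Im ltac:(by move=> x y; rewrite -ImN -ImD Im_le).
exists (a +i* b) => e e0; have e2 : 0 < e / 2 by rewrite divr_gt0.
have [N HN] := ha _ e2; have [M HM] := hb _ e2; exists (maxn N M) => n; rewrite geq_max => /andP[nN nM].
rewrite (le_trans (normc_le _))// (splitr e) ReD ImD ReN ImN /= lerD ?HN ?HM//.
Qed.
Lemma cvgC_normc_lim s l : cvgC s l -> (fun n => normc (s n) : R) @ \oo --> normc l.
Proof.
move=> h; apply/cvgrPdist_le => e e0; have [N HN] := h e e0; exists N => // n /= Nn.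
apply: le_trans (HN n Nn); rewrite ler_norml; apply/andP; split.
  by have := lerB_normc (s n) l; lra.
by have := lerB_normc l (s n); rewrite normc_dist.
Qed.

Lemma bernoulli (x : R) n : 0 <= x -> 1 + n%:R * x <= (1 + x) ^+ n.
Proof.
move=> x0; elim: n => [|n IH]; first by rewrite mul0r addr0 expr0.
rewrite exprS; apply: (@le_trans _ _ ((1 + x) * (1 + n%:R * x))); last first.
  by rewrite ler_wpM2l// addr_ge0.
rewrite -natr1 mulrDl mul1r mulrDr mulr1 mulrDl mul1r.
have : 0 <= x * (n%:R * x) by rewrite !mulr_ge0.
lra.
Qed.
Lemma pow_tail (q : R) : 0 <= q < 1 -> forall e, 0 < e -> exists N : nat, forall n, (N <= n)%N -> n.+1%:R * q ^+ n <= e.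
Proof.
move=> /andP[q0 q1] e e0; pose s : R := Num.sqrt (Num.max q 4^-1).
have m0 : 0 < Num.max q 4^-1 :> R by rewrite lt_max invr_gt0 ltr0n orbT.
have m1 : Num.max q 4^-1 < 1 :> R by rewrite gt_max q1 invf_lt1 ?ltr1n ?ltr0n.
have s0 : 0 < s by rewrite sqrtr_gt0.
have s1 : s < 1 by rewrite -sqrtr1 ltr_sqrt.
have ss : s ^+ 2 = Num.max q 4^-1 by rewrite sqr_sqrtr// ltW.
pose x : R := s^-1 - 1; have x0 : 0 < x by rewrite subr_gt0 invf_gt1.
have sx n : s ^+ n * (1 + n%:R * x) <= 1.
  apply: (@le_trans _ _ (s ^+ n * (1 + x) ^+ n)).
    by rewrite ler_wpM2l ?exprn_ge0 ?(ltW s0)// bernoulli// ltW.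
  by rewrite /x addrC subrK -exprMn mulfV ?expr1n// gt_eqF.
pose L : R := 1 + x^-1; have L0 : 0 < L by rewrite addr_gt0// invr_gt0.
have nL n : n.+1%:R <= L * (1 + n%:R * x).
  rewrite (_ : L * _ = n%:R + 1 + n%:R * x + x^-1); last by rewrite /L; field; rewrite gt_eqF.
  rewrite -natr1.
  have : 0 <= n%:R * x by rewrite mulr_ge0// ltW.
  have : 0 < x^-1 by rewrite invr_gt0.
  lra.
have [N HN] : exists N : nat, L / (e * x) < N%:R.
  by exists (Num.truncn (L / (e * x))).+1; apply: truncnS_gt.
exists N => n Nn.
have qn : q ^+ n <= s ^+ n * s ^+ n.
  rewrite -expr2 -exprM mulnC exprM ss lerXn2r ?nnegrE// ?(ltW m0)//.
  by rewrite le_max lexx.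
have sn0 : 0 <= s ^+ n by rewrite exprn_ge0// ltW.
apply: (@le_trans _ _ (L * s ^+ n)).
  apply: (@le_trans _ _ (n.+1%:R * (s ^+ n * s ^+ n))); first by rewrite ler_wpM2l.
  rewrite mulrA ler_wpM2r//; apply: (@le_trans _ _ (L * (1 + n%:R * x) * s ^+ n)); first by rewrite ler_wpM2r.
  by rewrite -mulrA ler_piMr ?(ltW L0)// mulrC.
have d0 : 0 < 1 + n%:R * x by rewrite ltr_wpDr// mulr_ge0// ltW.
have : s ^+ n <= (1 + n%:R * x)^-1 by rewrite -[leRHS]mul1r ler_pdivlMr.
move=> h; apply: (@le_trans _ _ (L * (1 + n%:R * x)^-1)); first by rewrite ler_wpM2l// ltW.
rewrite ler_pdivrMr//; move: HN; rewrite ltr_pdivrMr ?mulr_gt0// => HN.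
have : N%:R * (e * x) <= n%:R * (e * x) by rewrite ler_wpM2r ?mulr_ge0 ?ler_nat// ltW.
rewrite (_ : e * (1 + n%:R * x) = e + n%:R * (e * x)); last by ring.
by lra.
Qed.

Lemma fatou_le (u_ : nat -> C -> R) (u : C -> R) (B : R) :
  (forall n, rI (u_ n)) -> (forall n z, 0 <= u_ n z) -> (forall n, intR (u_ n) <= B) ->
  measurable_fun setT u -> (forall z, (fun n => u_ n z) @ \oo --> u z) -> rI u /\ intR u <= B.
Proof.
move=> iu u0 uB mu_ ul.
have ue z : 0 <= u z.
  by rewrite -(cvg_lim _ (ul z))//; apply: limr_ge; [apply: cvgP (ul z)|near=> n; exact: u0].
have leB : (\int[mu]_z (u z)%:E <= B%:E)%E.
  rewrite (eq_integral (fun z => limn_einf (fun n => (u_ n z)%:E))); last first.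
    move=> z _; apply/esym/(cvg_limn_einf_sup _).1.
    by apply: cvg_EFin; [exact: nearW|exact: ul].
  apply: (le_trans (fatou mu measurableT _ _)).
  - by move=> n; apply/measurable_EFinP; exact: rI_meas.
  - by move=> n z _; rewrite lee_fin.
  - rewrite (_ : (fun n => _) = fun n => (intR (u_ n))%:E); last first.
      by apply/funext => n; rewrite intRE.
    rewrite limn_einf_lim; apply: lime_le; first exact: is_cvg_einfs.
    near=> n; apply: (@le_trans _ _ (intR (u_ n))%:E); last by rewrite lee_fin.
    by apply: ereal_inf_lbound; exists n => /=.
have iu' : rI u by apply: rI_ge0 => //; rewrite (le_lt_trans leB)// ltry.
by split => //; rewrite -lee_fin intRE.
Unshelve. all: end_near. Qed.

(** Cauchy-Schwarz in a form that does not need square roots of the integrands: integrate the nonnegative quadratic polynomial A - 2tX + t^2 D and take its discriminant. *)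
Lemma pointwise_CS (A D X : C -> R) : measurable_fun setT X -> (forall z, 0 <= A z) -> (forall z, 0 <= D z) ->
  (forall z, X z ^+ 2 <= A z * D z) -> rI A -> rI D -> rI X /\ (intR X) ^+ 2 <= intR A * intR D.
Proof.
move=> mX A0 D0 XAD iA iD.
have amgm z : `|X z| <= A z + D z.
  rewrite -(@ler_pXn2r _ 2)// ?nnegrE ?addr_ge0// real_normK ?num_real//.
  apply: (le_trans (XAD z)); rewrite sqrrD -subr_ge0 (_ : _ - _ = A z ^+ 2 + D z ^+ 2 + A z * D z); last by ring.
  by rewrite !addr_ge0 ?sqr_ge0// mulr_ge0.
have iX : rI X by apply: (rI_le mX amgm); exact: rID.
split => //; set a := intR A; set d := intR D; set x := intR X.
have a0 : 0 <= a by exact: intR_ge0.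
have d0 : 0 <= d by exact: intR_ge0.
have key t : 0 <= a - 2 * t * x + t ^+ 2 * d.
  have -> : a - 2 * t * x + t ^+ 2 * d = intR (fun z => A z - (2 * t) * X z + t ^+ 2 * D z).
    rewrite intRD; [|by apply: rIB => //; exact: rIZ|exact: rIZ].
    by rewrite intRB//; [rewrite !intRZ|exact: rIZ].
  apply: intR_ge0 => z; have := XAD z; have := A0 z; have := D0 z.
  set y := X z; set b := A z; set c := D z => c0 b0 y2.
  have : `|2 * t * y| <= b + t ^+ 2 * c.
    have s0 : 0 <= t ^+ 2 * c by apply: mulr_ge0 => //; exact: sqr_ge0.
    rewrite -(@ler_pXn2r _ 2)// ?nnegrE ?addr_ge0// real_normK ?num_real//.
    have h : 4 * t ^+ 2 * y ^+ 2 <= 4 * t ^+ 2 * (b * c) by rewrite ler_wpM2l// mulr_ge0// sqr_ge0.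
    rewrite (_ : (2 * t * y) ^+ 2 = 4 * t ^+ 2 * y ^+ 2); last by ring.
    apply: (le_trans h); rewrite -subr_ge0 (_ : _ - _ = (b - t ^+ 2 * c) ^+ 2) ?sqr_ge0//; ring.
  by have := ler_norm (2 * t * y); lra.
have [d00|dn] := eqVneq d 0.
  rewrite d00 mulr0; have [->|x0] := eqVneq x 0; first by rewrite expr0n.
  have := key ((a + 1) / (2 * x)); rewrite d00 mulr0 addr0 (_ : 2 * _ * x = a + 1); last by field.
  by lra.
have dp : 0 < d by rewrite lt_def dn.
have := key (x / d); rewrite (_ : _ + _ = (a * d - x ^+ 2) / d); last by field.
by rewrite pmulr_lge0 ?invr_gt0// subr_ge0.
Qed.
End Sequences.

Section SigmaFinite.
Variable R : realType.
Lemma lebesgueC_sigma_finite : sigma_finite setT (@lebesgueC R).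
Proof.
exists (fun n => sq 0 n%:R).
  apply/seteqP; split => // z _; exists (Num.truncn (normc z)).+1 => //.
  have h : normc z <= (Num.truncn (normc z)).+1%:R by apply: ltW; exact: truncnS_gt.
  by rewrite /sq/= subr0; split; [apply: (le_trans (Re_le _))|apply: (le_trans (Im_le _))].
move=> n; split; first exact: measurable_sq.
by have := mu_sq (0 : R[i]) (ler0n R n) => /= ->; rewrite ltry.
Qed.
HB.instance Definition _ := Measure_isSigmaFinite.Build _ _ _ (@lebesgueC R) lebesgueC_sigma_finite.
End SigmaFinite.

(** * Mean values and regularity of holomorphic functions *)

Section ApproximateIdentity.
Variable R : realType.
Local Notation C := R[i].
Local Notation mass := (@mass R).
Implicit Types (z a h : C) (F G K : C -> C).

Lemma cI_rho (w : C -> C) n a : locI w -> cI (fun z => w z * (rho n.+1 a z)%:C).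
Proof.
move=> lw; apply: locI_mul => //; last exact: csupp_rhoC.
by apply: ctnR; exact: continuous_rho.
Qed.
Lemma cint_rho n a c : cint (fun z => c * (rho n.+1 a z)%:C) = c * mass%:C.
Proof. by rewrite cintZ ?cintR ?rho_int//; apply: cIR; exact: rI_rho. Qed.

(** Split at distance [d] from the centre: inside the function varies by at most [e], outside the mollifier is at most (n + 2)(1 - d^2)^(n+1). *)
Lemma approx_core F a (d e B : R) n : ctn F -> 0 < d -> d <= 1 -> 0 <= e ->
  (forall z, normc (z - a) < d -> normc (F z - F a) <= e) ->
  (forall z, normc (z - a) <= 1 -> normc (F z - F a) <= B) ->
  normc (cint (fun z => F z * (rho n.+1 a z)%:C) - F a * mass%:C)
    <= e * mass + 4 * (B * (n.+2%:R * (1 - d ^+ 2) ^+ n.+1)).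
Proof.
move=> cF d0 d1 e0 He HB; have lF := ctn_locI cF.
have B0 : 0 <= B by apply: le_trans (HB a _); rewrite ?normc_ge0// subrr normc0.
have lc : locI (fun=> F a) by apply: ctn_locI; exact: ctn_cst.
rewrite -(cint_rho n a) -cintB; [|exact: cI_rho|exact: cI_rho].
have i1 : cI (fun z => F z * (rho n.+1 a z)%:C - F a * (rho n.+1 a z)%:C) by apply: cIB; exact: cI_rho.
apply: (le_trans (normc_cint i1)).
have -> : e * mass + 4 * (B * (n.+2%:R * (1 - d ^+ 2) ^+ n.+1)) =
   intR (fun z => e * rho n.+1 a z + B * (n.+2%:R * (1 - d ^+ 2) ^+ n.+1) * isq a 1 z).
  rewrite intRD; [|by apply: rIZ; exact: rI_rho|by apply: rIZ; exact: rI_sq].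
  rewrite (intRZ e (rI_rho n a)) (intRZ _ (rI_sq a ler01)).
  by rewrite rho_int intR_sq// mulr1; ring.
apply: intR_le.
- exact: cI_norm.
- by apply: rID; apply: rIZ; [exact: rI_rho|exact: rI_sq].
move=> z; rewrite -mulrBl normcM normc_real ger0_norm ?rho_ge0//.
have d2 : 0 <= 1 - d ^+ 2 by rewrite subr_ge0 expr_le1// ltW.
have t0 : 0 <= B * (n.+2%:R * (1 - d ^+ 2) ^+ n.+1) * isq a 1 z.
  by rewrite !mulr_ge0 ?isq_ge0// exprn_ge0.
have [zd|zd] := ltP (normc (z - a)) d.
  by rewrite -[leLHS]addr0 lerD// ler_wpM2r ?rho_ge0// He.
have er0 : 0 <= e * rho n.+1 a z by rewrite mulr_ge0// rho_ge0.
have [z1|z1] := leP (normc (z - a)) 1.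
  rewrite isq1// mulr1 -[leLHS]add0r lerD//; apply: ler_pM => //; rewrite ?normc_ge0 ?rho_ge0 ?HB//.
  rewrite /rho ler_wpM2l// /bump lerXn2r ?nnegrE ?pp_ge0//.
  have zz : 0 <= 1 - 1 * dist2 a z by rewrite mul1r subr_ge0 expr_le1// normc_ge0.
  by rewrite pp_pos// mul1r lerB// lerXn2r ?nnegrE ?normc_ge0// ltW.
rewrite /rho bump0 ?mulr0; first exact: addr_ge0.
by rewrite mul1r /dist2 expr_ge1 ?normc_ge0// ltW.
Qed.

Lemma approx_unif F (A : set C) : ctn F ->
  (exists B : R, forall a z, A a -> normc (z - a) <= 1 -> normc (F z - F a) <= B) ->
  (forall e : R, 0 < e -> exists2 d : R, 0 < d & forall a z, A a -> normc (z - a) < d -> normc (F z - F a) <= e) ->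
  forall e : R, 0 < e -> exists N : nat, forall n, (N <= n)%N -> forall a, A a ->
    normc (cint (fun z => F z * (rho n.+1 a z)%:C) - F a * mass%:C) <= e.
Proof.
move=> cF [B HB] He e e0; have m0 := mass_gt0 R.
have e1 : 0 < e / 2 / mass by rewrite !divr_gt0.
have [d0 d00 Hd] := He _ e1; pose d : R := Num.min d0 1.
have dp : 0 < d by rewrite lt_min d00 ltr01.
have d1 : d <= 1 by rewrite ge_min lexx orbT.
pose B' : R := `|B| + 1; have B'0 : 0 < B' by rewrite ltr_wpDl.
have q01 : 0 <= 1 - d ^+ 2 < 1.
  apply/andP; split; first by rewrite subr_ge0 expr_le1// ltW.
  by rewrite ltrBlDr ltrDl exprn_gt0.
have [N HN] := pow_tail q01 (e := e / 2 / (4 * B')) ltac:(by rewrite !divr_gt0// mulr_gt0).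
exists N => n Nn a Aa.
apply: (le_trans (@approx_core F a d (e / 2 / mass) B' n cF dp d1 (ltW e1) _ _)).
- by move=> z zd; apply: Hd => //; apply: (lt_le_trans zd); rewrite ge_min lexx.
- by move=> z z1; apply: (le_trans (HB _ _ Aa z1)); rewrite /B' (le_trans (ler_norm B))// lerDl.
- rewrite divfK ?gt_eqF// [leRHS]splitr lerD2l.
  have := HN n.+1 (leqW Nn); rewrite ler_pdivlMr ?mulr_gt0//.
  by rewrite mulrA mulrC.
Qed.

Lemma approx_id F a : ctn F -> cvgC (fun n => cint (fun z => F z * (rho n.+1 a z)%:C)) (F a * mass%:C).
Proof.
move=> cF e e0; have [||N HN] := @approx_unif F [set a] cF _ _ e e0.
- have [B B0 HB] := ctn_bounded (normc a + 1) cF; exists (B + B) => _ z -> za.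
  rewrite (le_trans (le_normcB _ _))// lerD ?HB//.
    by rewrite -(subrK a z) (le_trans (le_normcD _ _))// addrC lerD2l.
  by rewrite lerDl.
- move=> e' e'0; have /ctnP/(_ a _ e'0)[d d0 Hd] := cF; exists d => // _ z -> zd.
  by apply: ltW; exact: Hd.
- by exists N => n Nn; apply: HN.
Qed.

(** The integrals against all mollifiers coincide by [rho_step], and they converge to the value at the centre. *)
Lemma mean_value (G G' : C -> C) n a : (forall z, wirt G z (G' z) 0) -> ctn G' ->
  cint (fun z => G z * (rho n.+1 a z)%:C) = G a * mass%:C.
Proof.
move=> hG cG'; have cG : ctn G by apply: (ctn_wirt hG cG'); exact: ctn_cst.
have e m : cint (fun z => G z * (rho m.+1 a z)%:C) = cint (fun z => G z * (rho 1 a z)%:C).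
  by elim: m => // m IH; rewrite -IH (rho_step _ _ hG).
apply: (cvgC_uniq _ (approx_id a cG)).
by apply: (cvgC_eq _ (@cvgC_cst R _)) => m; rewrite !e.
Qed.
End ApproximateIdentity.

Section Regularity.
Variable R : realType.
Local Notation C := R[i].
Local Notation mass := (@mass R).
Implicit Types (z a h : C) (F G K : C -> C).

Definition hol F := forall z, exists l, cdiff F z l.

(** A fixed smooth mollifier with its first two z-derivatives. *)
Definition K0 : C -> C := fun z => (rho 6 0 z)%:C.
Definition K1 : C -> C := fun z => (- 42)%:C * ((bump 0 1 5 z)%:C * z^*).
Definition K2 : C -> C := fun z => 210%:C * ((bump 0 1 4 z)%:C * (z^* * z^*)).
Lemma C2_K0 : C2C K0. Proof. exact: C2_rho. Qed.
Lemma C2_K1 : C2C K1.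
Proof. by apply: C2Z; apply: C2M; [exact: C2_bump|apply: C2J; exact: C2_id]. Qed.
Lemma C2_K2 : C2C K2.
Proof. by apply: C2Z; apply: C2M; [exact: C2_bump|apply: C2M; apply: C2J; exact: C2_id]. Qed.
Lemma dz_K0 : dz K0 = K1.
Proof.
apply/funext => z; apply: dzE.
apply: (wirt_eq _ _ _ (wirtZ 7%:C (wirt_bump 0 1 4 z))) => [w||].
- by rewrite /K0 /rho -rmorphM.
- rewrite subr0 mulrA -rmorphM /K1 mulrA -rmorphM; congr (_%:C * _).
  move: (bump _ _ _ _) => b; ring.
- reflexivity.
Qed.
Lemma dz_K1 : dz K1 = K2.
Proof.
apply/funext => z; apply: dzE.
apply: (wirt_eq _ _ _ (wirtZ (- 42)%:C (wirtM (wirt_bump 0 1 3 z) (wirtJ (wirt_id z))))) => [//||].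
- rewrite subr0 conj0 mulr0 add0r /K2; move: (bump 0 1 4 z) => b.
  rewrite (_ : 210 = (- 42) * (- (5 * 1)) :> R); last by ring.
  by rewrite !rmorphN !rmorphM /= !rmorphN; ring.
- reflexivity.
Qed.
Lemma csupp_K0 : csupp K0. Proof. exact: csupp_rhoC. Qed.
Lemma csupp_K1 : csupp K1.
Proof. by apply: csuppMr; apply: csuppMl; exact: csupp_bumpC. Qed.
Lemma csupp_K2 : csupp K2.
Proof. by apply: csuppMr; apply: csuppMl; exact: csupp_bumpC. Qed.

Lemma cint_db0 (G G' : C -> C) K z : (forall z, wirt G z (G' z) 0) -> ctn G' -> C2C K -> csupp K ->
  cint (fun x => G x * db K (x - z)) = 0.
Proof.
move=> hG cG' hK sK; have cG : ctn G by apply: (ctn_wirt hG cG'); exact: ctn_cst.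
have [d1 _ _ _ _] := hK; have cz := ctn_shift (a := z) (C2_dz hK); have cb := ctn_shift (a := z) (C2_db hK).
have cK := ctn_shift (a := z) (C2_ctn hK).
have [|||_] := @divergence R (fun x => G x * K (x - z)) _ _ (fun x => wirtM (hG x) (wirt_shift (d1 (x - z)))).
- ctn_tac.
- ctn_tac.
- by apply: csuppMr; exact: csupp_shift.
- by under eq_fun do rewrite mul0r addr0.
Qed.

Lemma conv_cdiff (G G' : C -> C) K z : (forall z, wirt G z (G' z) 0) -> ctn G' -> C2C K -> csupp K ->
  cdiff (fun y => cint (fun x => G x * K (x - y))) z (- cint (fun x => G x * dz K (x - z))).
Proof.
move=> hG cG' hK sK; have [B [r [B0 r0 H]]] := kernel_taylor hK sK.
have lG : locI G by apply: ctn_locI; apply: (ctn_wirt hG cG'); exact: ctn_cst.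
apply: (@quad_wirt R _ z _ (cint (fun x => G x * db K (x - z))) (B * intR (fun x => normc (G x) * isq z r x))).
  by move=> h h1; rewrite mulrAC; exact: H.
exact: (cint_db0 _ hG).
Qed.

Lemma conv_ctn w K : locI w -> C2C K -> csupp K -> ctn (fun y => cint (fun x => w x * K (x - y))).
Proof.
move=> lw hK sK; have [B [r [B0 r0 H]]] := kernel_taylor hK sK.
apply: (@quad_ctn R _ (fun z => cint (fun x => w x * dz K (x - z))) (fun z => cint (fun x => w x * db K (x - z))) (fun z => B * intR (fun x => normc (w x) * isq z r x))).
by move=> z h h1; rewrite mulrAC; exact: H.
Qed.

Lemma cdiffZ c F z l : cdiff F z l -> cdiff (fun w => c * F w) z (c * l).
Proof.
move=> h e e0; have c1 : 0 < normc c + 1 by rewrite ltr_wpDl// normc_ge0.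
have [d d0 Hd] := h (e / (normc c + 1)) ltac:(by rewrite divr_gt0); exists d => // k /Hd hk.
rewrite (_ : _ - _ = c * (F (z + k) - F z - l * k)); last by ring.
rewrite normcM; apply: (@le_trans _ _ ((normc c + 1) * (e / (normc c + 1) * normc k))).
  by apply: ler_pM => //; rewrite ?normc_ge0// lerDl.
by rewrite mulrA mulrCA mulfV ?gt_eqF// mulr1.
Qed.
Lemma cdiff_eq F G z l l' : F =1 G -> l = l' -> cdiff F z l -> cdiff G z l'.
Proof. by move=> /funext -> ->. Qed.
Lemma wirt_cdiff_val F z l p : cdiff F z l -> wirt F z p 0 -> l = p.
Proof. by move=> /cdiff_wirt h /(wirt_uniq h)[]. Qed.

(** By the mean value property the function is its own convolution with a smooth kernel, whose derivatives can be moved to the kernel. *)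
Lemma C1hol_twice (G G' : C -> C) : (forall z, wirt G z (G' z) 0) -> ctn G' ->
  exists2 G'', (forall z, cdiff G z (G' z)) /\ (forall z, cdiff G' z (G'' z)) & ctn G''.
Proof.
move=> hG cG'; have lG : locI G by apply: ctn_locI; apply: (ctn_wirt hG cG'); exact: ctn_cst.
have m0 := mass_neq0 R.
have GE y : G y = (mass%:C)^-1 * cint (fun x => G x * K0 (x - y)).
  rewrite mulrC; apply: (mulIf m0); rewrite mulfVK// -(mean_value 5 y hG cG').
  by apply: eq_cint => x; rewrite /K0 -rho_shift.
have d1 z : cdiff G z ((mass%:C)^-1 * - cint (fun x => G x * K1 (x - z))).
  apply: (cdiff_eq _ _ (cdiffZ (mass%:C)^-1 (conv_cdiff z hG cG' C2_K0 csupp_K0))) => [y|].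
    by rewrite -GE.
  by rewrite dz_K0.
have G'E z : G' z = - (mass%:C)^-1 * cint (fun x => G x * K1 (x - z)).
  by rewrite -(wirt_cdiff_val (d1 z) (hG z)); ring.
exists (fun z => (mass%:C)^-1 * cint (fun x => G x * K2 (x - z))).
  split => z; first by rewrite G'E mulNr -mulrN.
  apply: (cdiff_eq _ _ (cdiffZ (- (mass%:C)^-1) (conv_cdiff z hG cG' C2_K1 csupp_K1))) => [y|].
    by rewrite -G'E.
  by rewrite dz_K1; ring.
by apply: ctnM; [exact: ctn_cst|exact: (conv_ctn lG C2_K2 csupp_K2)].
Qed.

(** By Goursat, [g] has a primitive, and [g] is continuous; [C1hol_twice] applies to the primitive and then to [g]. *)
Theorem hol_derivative g : hol g -> exists g' g'', [/\ forall z, cdiff g z (g' z), forall z, cdiff g' z (g'' z), ctn g' & ctn g''].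
Proof.
move=> hg; have [G hG] := holo_primitive hg.
have [g' [_ d1] c1] := C1hol_twice hG (cdiff_ctn hg).
have [g'' [_ d2] c2] := C1hol_twice (fun z => cdiff_wirt (d1 z)) c1.
by exists g', g''.
Qed.

Lemma hol_mean g n a : hol g -> cint (fun z => g z * (rho n.+1 a z)%:C) = g a * mass%:C.
Proof.
move=> hg; have [g' [g'' [d1 _ c1 _]]] := hol_derivative hg.
exact: (mean_value _ _ (fun z => cdiff_wirt (d1 z)) c1).
Qed.

(** The product g F has compact support and dbar-derivative g F_zbar, because g is entire. *)
Lemma hol_div g (F p q : C -> C) : hol g -> (forall z, wirt F z (p z) (q z)) -> ctn p -> ctn q -> csupp F ->
  cint (fun z => g z * q z) = 0.
Proof.
move=> hg hF cp cq sF; have [g' [g'' [d1 _ c1 _]]] := hol_derivative hg.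
have cg := cdiff_ctn hg; have cF := ctn_wirt hF cp cq.
have [|||_] := @divergence R (fun x => g x * F x) _ _ (fun x => wirtM (cdiff_wirt (d1 x)) (hF x)).
- ctn_tac.
- ctn_tac.
- exact: csuppMr.
- by under eq_fun do rewrite mul0r addr0.
Qed.
End Regularity.

(** * Weighted L2 spaces and mollification *)

Section WeightedLimits.
Variable R : realType.
Local Notation C := R[i].
Local Notation mu := (@lebesgueC R).
Local Notation mass := (@mass R).
Implicit Types (z a h : C) (F G K w : C -> C) (th : C -> R).

(** Positive and C^1: the C^1 condition makes a weight comparable to its local averages. *)
Definition weight th := (forall z, 0 < th z) /\
  exists p q : C -> C, [/\ forall z, wirt (fun w : C => (th w)%:C) z (p z) (q z), ctn p & ctn q].
Definition L2w th w := measurable_fun setT w /\ rI (fun z => normc (w z) ^+ 2 * th z).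

Lemma weight_ctn th : weight th -> ctn (fun z => (th z)%:C).
Proof. by move=> [_ [p [q [h cp cq]]]]; exact: (ctn_wirt h cp cq). Qed.
Lemma weight_continuous th : weight th -> continuous (th : C^o -> R).
Proof. by move=> /weight_ctn /ctnRr. Qed.
Lemma weight_inv_ctn th : weight th -> ctn (fun z => ((th z)^-1)%:C).
Proof. by move=> wt; apply: ctnRV; [exact: weight_ctn|move=> z; rewrite gt_eqF// wt.1]. Qed.
Lemma weight_meas th : weight th -> measurable_fun setT th.
Proof. by move=> /weight_continuous; exact: continuous_measurableC. Qed.
Lemma rI_inv_sq th a r : weight th -> rI (fun z => (th z)^-1 * isq a r z).
Proof.
move=> wt; have := locI_sq a r (ctn_locI (weight_inv_ctn wt)).
congr rI; apply/funext => z; rewrite normc_real ger0_norm// invr_ge0 ltW//; exact: wt.1.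
Qed.

Lemma L2w_sq th w a r : weight th -> L2w th w -> rI (fun z => normc (w z) * isq a r z) /\
  (intR (fun z => normc (w z) * isq a r z)) ^+ 2 <= intR (fun z => normc (w z) ^+ 2 * th z) * intR (fun z => (th z)^-1 * isq a r z).
Proof.
move=> wt [mw iw]; have t0 z : 0 < th z by exact: wt.1.
apply: pointwise_CS => //.
- by apply: measurable_funM; [exact: mnormc|apply: measurable_indic; exact: measurable_sq].
- by move=> z; rewrite mulr_ge0 ?sqr_ge0// ltW.
- by move=> z; rewrite mulr_ge0 ?isq_ge0// invr_ge0 ltW.
- move=> z; rewrite (_ : _ ^+ 2 * th z * _ = normc (w z) ^+ 2 * isq a r z); last by field; rewrite gt_eqF.
  by rewrite exprMn ler_wpM2l ?sqr_ge0// expr2 ler_piMl ?isq_ge0 ?isq_le1.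
- exact: rI_inv_sq.
Qed.
Lemma L2w_locI th w : weight th -> L2w th w -> locI w.
Proof. by move=> wt lw; split; [exact: lw.1|move=> r; have [] := L2w_sq 0 r wt lw]. Qed.

Lemma L2w_rI th w (k : C -> R) : weight th -> L2w th w -> continuous (k : C^o -> R) -> csupp k ->
  (forall z, 0 <= k z) -> rI (fun z => normc (w z) ^+ 2 * k z).
Proof.
move=> wt [mw iw] ck sk k0; have t0 z : 0 < th z by exact: wt.1.
have [B B0 HB] : exists2 B : R, 0 < B & forall z, normc ((k z / th z)%:C) <= B.
  apply: csuppC_bounded.
    under eq_fun do rewrite rmorphM /=.
    by apply: ctnM; [exact: ctnR|exact: weight_inv_ctn].
  by have [r H] := sk; exists r => z /H ->; rewrite mul0r.
apply: (@rI_le _ _ (fun z => B * (normc (w z) ^+ 2 * th z))).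
- by apply: measurable_funM; [apply: measurable_funX; exact: mnormc|exact: continuous_measurableC].
- move=> z; rewrite ger0_norm; last by apply: mulr_ge0; [exact: sqr_ge0|exact: k0].
  rewrite mulrCA ler_wpM2l ?sqr_ge0//.
  have := HB z; rewrite normc_real ger0_norm; last by apply: divr_ge0 => //; exact: ltW.
  by rewrite ler_pdivrMr.
- exact: rIZ.
Qed.

Lemma jensen th w n a : weight th -> L2w th w ->
  normc (cint (fun z => w z * (rho n.+1 a z)%:C)) ^+ 2 <= mass * intR (fun z => normc (w z) ^+ 2 * rho n.+1 a z).
Proof.
move=> wt lw; have iw := cI_rho n a (L2w_locI wt lw).
apply: (@le_trans _ _ (intR (fun z => normc (w z) * rho n.+1 a z) ^+ 2)).
  rewrite lerXn2r ?nnegrE ?normc_ge0//.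
    by apply: intR_ge0 => z; rewrite mulr_ge0 ?normc_ge0 ?rho_ge0.
  apply: (le_trans (normc_cint iw)); rewrite le_eqVlt; apply/orP; left; apply/eqP; congr intR.
  by apply/funext => z; rewrite normcM normc_real ger0_norm ?rho_ge0.
rewrite -(rho_int n a) mulrC; apply: (pointwise_CS _ _ _ _ _ _).2.
- by apply: measurable_funM; [apply: mnormc; exact: lw.1|apply: continuous_measurableC; exact: continuous_rho].
- by move=> z; rewrite mulr_ge0 ?sqr_ge0 ?rho_ge0.
- by move=> z; exact: rho_ge0.
- by move=> z; rewrite le_eqVlt; apply/orP; left; apply/eqP; ring.
- by apply: (L2w_rI wt lw); [exact: continuous_rho|exact: csupp_rho|move=> z; exact: rho_ge0].
- exact: rI_rho.
Qed.

Lemma rI_wrho th n a : weight th -> rI (fun z => th z * rho n.+1 a z).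
Proof.
move=> wt; apply: rI_csupp; last by have [s H] := csupp_rho n a; exists s => z /H ->; rewrite mulr0.
apply: ctnRr; under eq_fun do rewrite rmorphM /=; apply: ctnM; first exact: weight_ctn.
by apply: ctnR; exact: continuous_rho.
Qed.

(** By compactness the modulus of continuity and the positive lower bound are uniform on a disc; the factor 2 leaves room for the approximation. *)
Lemma weight_approx th r : weight th -> exists N, forall n, (N <= n)%N -> forall a, normc a <= r ->
  intR (fun z => th z * rho n.+1 a z) <= 2 * mass * th a.
Proof.
move=> wt; have ct := weight_ctn wt; have t0 := wt.1; have [p [q [ht cp cq]]] := wt.2.
have [B1 B10 H1] := ctn_bounded (r + 2) cp; have [B2 B20 H2] := ctn_bounded (r + 2) cq.
have [B3 B30 H3] := ctn_bounded r (weight_inv_ctn wt).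
pose L : R := 8 * (B1 + B2); have L0 : 0 < L by rewrite mulr_gt0// addr_gt0.
have lip a z : normc a <= r -> normc (z - a) <= 1 -> normc ((th z)%:C - (th a)%:C) <= L * normc (z - a).
  move=> ar za; have := @wirt_mvt R (fun x => (th x)%:C) p q a (z - a) (B1 + B2) ht.
  rewrite (addrC a) subrK -mulrA; apply => w wa.
  have wr : normc w <= r + 2.
    by rewrite -(subrK a w) (le_trans (le_normcD _ _))//; lra.
  by split; [have := H1 w wr|have := H2 w wr]; lra.
have m0 := mass_gt0 R.
have [||N HN] := @approx_unif R (fun z => (th z)%:C) [set a | normc a <= r] ct _ _ (mass / B3) (divr_gt0 m0 B30).
- exists L => a z ar za; apply: (le_trans (lip _ _ ar za)).
  by rewrite -[leRHS]mulr1 ler_wpM2l// ltW.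
- move=> e e0; exists (Num.min 1 (e / L)); first by rewrite lt_min ltr01 divr_gt0.
  move=> a z ar; rewrite lt_min => /andP[/ltW z1]; rewrite ltr_pdivlMr// => z2.
  by apply: (le_trans (lip _ _ ar z1)); rewrite mulrC ltW.
exists N => n Nn a ar; have := HN n Nn a ar.
rewrite (_ : (fun z => (th z)%:C * (rho n.+1 a z)%:C) = fun z => (th z * rho n.+1 a z)%:C); last by apply/funext => z; rewrite -rmorphM.
rewrite cintR -rmorphM -rmorphB normc_real => h.
have := le_trans (ler_norm _) h => h2.
have := H3 a ar; rewrite normc_real ger0_norm; last by rewrite invr_ge0 ltW.
rewrite invf_ple ?posrE// => h3; have : mass / B3 <= mass * th a by rewrite ler_wpM2l// ltW.
lra.
Qed.

Lemma isq_out (r : R) z : 2 * r < normc z -> isq 0 r z = 0.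
Proof.
rewrite isqE !subr0 => zr; case: andP => [[h1 h2]|//].
by have := normc_le z; lra.
Qed.

Lemma measurable_kernel w n r th : measurable_fun setT w -> measurable_fun setT th ->
  measurable_fun setT (fun x : C * C => ((normc (w x.2) ^+ 2 * rho n x.1 x.2) * (th x.1 * isq 0 r x.1))%:E).
Proof.
move=> mw mt; apply/measurable_EFinP; apply: measurable_funM.
  apply: measurable_funM; first by apply: measurable_funX; apply: mnormc; exact: measurableT_comp.
  rewrite /rho; apply: measurable_funM => //; rewrite /bump; apply: measurable_funX.
  apply: (@measurableT_comp _ _ _ _ _ _ (@pp R)).
    by apply: continuous_measurable_fun; exact: continuous_pp.
  apply: measurable_funB => //; apply: measurable_funM => //; apply: measurable_funX; apply: mnormc.
  by apply: mcB; [exact: measurable_snd|exact: measurable_fst].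
apply: measurable_funM; first exact: measurableT_comp.
by apply: measurableT_comp; [apply: measurable_indic; exact: measurable_sq|exact: measurable_fst].
Qed.

(** Apply [jensen] pointwise, exchange the integrals by Tonelli and compare the average of the weight with the weight. *)
Lemma conv_L2 th w n r : weight th -> L2w th w ->
  (forall x, normc x <= 2 * r + 1 -> intR (fun z => th z * rho n.+1 x z) <= 2 * mass * th x) ->
  let v z := cint (fun x => w x * (rho n.+1 z x)%:C) in
  measurable_fun setT v ->
  rI (fun z => normc (v z) ^+ 2 * (th z * isq 0 r z)) /\
  intR (fun z => normc (v z) ^+ 2 * (th z * isq 0 r z)) <= 2 * mass ^+ 2 * intR (fun z => normc (w z) ^+ 2 * th z).
Proof.
move=> wt lw H v mv; have m0 := mass_gt0 R; have t0 z : 0 < th z := wt.1 z.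
have mt := weight_meas wt.
pose u (z : C) : R := normc (v z) ^+ 2 * (th z * isq 0 r z).
have ti0 z : 0 <= th z * isq 0 r z by rewrite mulr_ge0 ?isq_ge0// ltW.
have u0 z : 0 <= u z by apply: mulr_ge0 => //; exact: sqr_ge0.
have mu' : measurable_fun setT u.
  apply: measurable_funM; first by apply: measurable_funX; exact: mnormc.
  by apply: measurable_funM => //; apply: measurable_indic; exact: measurable_sq.
have iwr z : rI (fun x => normc (w x) ^+ 2 * rho n.+1 z x).
  by apply: (L2w_rI wt lw); [exact: continuous_rho|exact: csupp_rho|move=> x; exact: rho_ge0].
pose k (x : C * C) := ((normc (w x.2) ^+ 2 * rho n.+1 x.1 x.2) * (th x.1 * isq 0 r x.1))%:E.
have k0 x : (0 <= k x)%E.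
  by rewrite lee_fin; apply: mulr_ge0 => //; apply: mulr_ge0; [exact: sqr_ge0|exact: rho_ge0].
have leT : (\int[mu]_z (u z)%:E <= (2 * mass ^+ 2 * intR (fun z => normc (w z) ^+ 2 * th z))%:E)%E.
  apply: (@le_trans _ _ (\int[mu]_z (mass%:E * \int[mu]_x k (z, x)))%E).
    apply: ge0_le_integral => //.
    - by move=> z _; rewrite lee_fin.
    - exact/measurable_EFinP.
    - apply: emeasurable_funM; first exact: measurable_cst.
      exact: (measurable_fun_fubini_tonelli_F (m2 := mu) k (measurable_kernel n.+1 r lw.1 mt) k0).
    - move=> z _; rewrite (_ : \int[mu]_x k (z, x) = (intR (fun x => normc (w x) ^+ 2 * rho n.+1 z x) * (th z * isq 0 r z))%:E)%E.
        rewrite -EFinM lee_fin [leRHS]mulrA; apply: ler_wpM2r; [exact: ti0|exact: (jensen n z wt lw)].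
      rewrite mulrC -intRZ// intRE; last exact: rIZ.
      by apply: eq_integral => x _; rewrite /k mulrC.
  rewrite ge0_integralZl//; last 3 first.
  - exact: (measurable_fun_fubini_tonelli_F (m2 := mu) k (measurable_kernel n.+1 r lw.1 mt) k0).
  - by move=> z _; exact: integral_ge0.
  - by rewrite lee_fin ltW.
  rewrite [X in (_ * X <= _)%E](_ : _ = \int[mu]_y \int[mu]_x k (x, y))%E; last exact: (fubini_tonelli (m1 := mu) (m2 := mu) k (measurable_kernel n.+1 r lw.1 mt) k0).
  apply: (@le_trans _ _ (mass%:E * \int[mu]_y (2 * mass * (normc (w y) ^+ 2 * th y))%:E)%E).
    apply: lee_wpmul2l; first by rewrite lee_fin ltW.
    apply: ge0_le_integral.
    - exact: measurableT.
    - by move=> z _; apply: integral_ge0 => x _; exact: k0.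
    - exact: (measurable_fun_fubini_tonelli_G (m1 := mu) k (measurable_kernel n.+1 r lw.1 mt) k0).
    - apply/measurable_EFinP; apply: measurable_funM => //; apply: measurable_funM => //.
      by apply: measurable_funX; apply: mnormc; exact: lw.1.
    - move=> y _.
      have iy := rI_wrho n y wt.
      have [yr|yr] := leP (normc y) (2 * r + 1).
        apply: (@le_trans _ _ (normc (w y) ^+ 2 * intR (fun z => th z * rho n.+1 y z))%:E).
          rewrite -intRZ// intRE; last exact: rIZ.
          apply: ge0_le_integral => //.
          + exact: (measurableT_comp (measurable_kernel n.+1 r lw.1 mt) (measurable_pair2 y)).
          + by apply/measurable_EFinP; apply: rI_meas; exact: rIZ.
          + move=> z _; rewrite /k lee_fin /= -mulrA ler_wpM2l ?sqr_ge0// rho_sym mulrCA mulrA.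
            by rewrite ler_piMr ?isq_le1// mulr_ge0 ?rho_ge0// ltW.
        by rewrite lee_fin mulrCA ler_wpM2l ?sqr_ge0// H.
      rewrite (_ : \int[mu]_x k (x, y) = 0)%E.
        by rewrite lee_fin; apply: mulr_ge0; [rewrite mulr_ge0// ltW|apply: mulr_ge0; [exact: sqr_ge0|rewrite ltW]].
      apply: integral0_eq => z _; rewrite /k /=; have [zr|zr] := leP (normc z) (2 * r).
        have := lerB_normc y z => d; rewrite /rho bump0 ?mulr0 ?mul0r//.
        by rewrite mul1r /dist2 expr_ge1 ?normc_ge0//; lra.
      by rewrite isq_out// !mulr0.
  rewrite -intRE; last by apply: rIZ; exact: lw.2.
  rewrite -EFinM lee_fin intRZ; last exact: lw.2.
  by rewrite le_eqVlt; apply/orP; left; apply/eqP; ring.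
have iu : rI u by apply: rI_ge0 => //; rewrite (le_lt_trans leT)// ltry.
by split => //; rewrite -lee_fin intRE.
Qed.
End WeightedLimits.

(** * Weak limits of asymptotically holomorphic functions *)

Section WeakLimit.
Variable R : realType.
Local Notation C := R[i].
Local Notation mass := (@mass R).
Implicit Types (z a h : C) (F G K w : C -> C) (th : C -> R).

Lemma hol_ctn F : hol F -> ctn F. Proof. exact: cdiff_ctn. Qed.

(** The mollifiers differ by dbar-derivatives, so along a sequence that is asymptotically holomorphic they see the same limit. *)
Lemma rho_cvg (w_ : nat -> C -> C) a l n : (forall i, locI (w_ i)) ->
  (forall K, C2C K -> csupp K -> cvgC (fun i => cint (fun x => w_ i x * db K x)) 0) ->
  cvgC (fun i => cint (fun x => w_ i x * (rho n.+3 a x)%:C)) l <-> cvgC (fun i => cint (fun x => w_ i x * (rho n.+2 a x)%:C)) l.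
Proof.
move=> lw hw; pose K (x : C) : C := (x - a)^* * (bump a 1 n.+3 x)%:C.
have cK : C2C K by apply: C2M; [apply: C2J; exact: C2_sub|exact: C2_bump].
have sK : csupp K by apply: csuppMr; exact: csupp_bumpC.
have h := hw K cK sK.
have {}h : cvgC (fun i => cint (fun x => w_ i x * (rho n.+3 a x)%:C) - cint (fun x => w_ i x * (rho n.+2 a x)%:C)) 0.
  apply: (cvgC_eq _ h) => i; rewrite -cintB; [|exact: cI_rho|exact: cI_rho].
  apply: eq_cint => x; rewrite -mulrBr; congr (_ * _).
  exact: (dbE (wirt_conjbump n.+1 a x)).
split => h2.
  by rewrite -[l]subr0; apply: (cvgC_eq _ (cvgCB h2 h)) => i; rewrite opprB addrC subrK.
by rewrite -[l]add0r; apply: (cvgC_eq _ (cvgCD h h2)) => i; rewrite subrK.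
Qed.

Lemma rI_mono th F (B : R) : (forall z, 0 <= th z) -> measurable_fun setT th -> measurable_fun setT F ->
  (forall r : R, rI (fun z => normc (F z) ^+ 2 * (th z * isq 0 r z)) /\
    intR (fun z => normc (F z) ^+ 2 * (th z * isq 0 r z)) <= B) ->
  rI (fun z => normc (F z) ^+ 2 * th z) /\ intR (fun z => normc (F z) ^+ 2 * th z) <= B.
Proof.
move=> t0 mt mF H; apply: (fatou_le (u_ := fun n z => normc (F z) ^+ 2 * (th z * isq 0 n%:R z))).
- by move=> n; exact: (H _).1.
- by move=> n z; apply: mulr_ge0; [exact: sqr_ge0|rewrite mulr_ge0// isq_ge0].
- by move=> n; exact: (H _).2.
- by apply: measurable_funM => //; apply: measurable_funX; exact: mnormc.
- move=> z; apply: (@cvg_near_cst _ _ _ _ _ _).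
  exists (Num.truncn (normc z)).+1 => // n /= zn; rewrite isq1 ?mulr1// subr0.
  apply: ltW; apply: (lt_le_trans (truncnS_gt _)); by rewrite ler_nat.
Qed.

(** Up to the factor [mass], W is the limit of the mollified functions w_n * K0.  It is holomorphic because [kernel_taylor] passes to the limit and the conj h term tends to 0; finer and finer mollifiers give the same W, so Fatou bounds its norm.  The constant 2 is the loss in [weight_approx]. *)
Theorem weak_limit th (w_ : nat -> C -> C) (B : R) : weight th -> (forall n, L2w th (w_ n)) ->
  (forall n, intR (fun z => normc (w_ n z) ^+ 2 * th z) <= B) ->
  (forall K, ctn K -> csupp K -> cauchyC (fun n => cint (fun x => w_ n x * K x))) ->
  (forall K, C2C K -> csupp K -> cvgC (fun i => cint (fun x => w_ i x * db K x)) 0) ->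
  exists W, [/\ hol W, forall n a, cvgC (fun i => cint (fun x => w_ i x * (rho n.+2 a x)%:C)) (W a * mass%:C),
    rI (fun z => normc (W z) ^+ 2 * th z) & intR (fun z => normc (W z) ^+ 2 * th z) <= 2 * B].
Proof.
move=> wt lw hB hc hdb; have lI n := L2w_locI wt (lw n).
have m0 := mass_gt0 R; have mn := mass_neq0 R; have t0 z : 0 < th z := wt.1 z.
have [l0 H0] : exists l0 : C -> C, forall z, cvgC (fun i => cint (fun x => w_ i x * @K0 R (x - z))) (l0 z).
  suff H z : exists l, cvgC (fun i => cint (fun x => w_ i x * @K0 R (x - z))) l by
   have [f Hf] := choice H; exists f.
  apply: cauchyC_cvg; apply: (hc (fun x => @K0 R (x - z))); last exact: (csupp_shift z (@csupp_K0 R)).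
  by apply: (ctn_shift (a := z)); exact: (C2_ctn (@C2_K0 R)).
have [l1 H1] : exists l1 : C -> C, forall z, cvgC (fun i => cint (fun x => w_ i x * dz (@K0 R) (x - z))) (l1 z).
  suff H z : exists l, cvgC (fun i => cint (fun x => w_ i x * dz (@K0 R) (x - z))) l by
   have [f Hf] := choice H; exists f.
  apply: cauchyC_cvg; rewrite dz_K0; apply: (hc (fun x => @K1 R (x - z))); last exact: (csupp_shift z (@csupp_K1 R)).
  by apply: (ctn_shift (a := z)); exact: (C2_ctn (@C2_K1 R)).
have H2 z : cvgC (fun i => cint (fun x => w_ i x * db (@K0 R) (x - z))) 0.
  have [cK [_ dbK _]] := C2_shift z (@C2_K0 R); rewrite -[db _]/(db _).
  have := hdb _ cK (csupp_shift z (@csupp_K0 R)); apply: cvgC_eq => i.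
  by rewrite dbK.
have [A [r [A0 r0 HK]]] := kernel_taylor (@C2_K0 R) (@csupp_K0 R).
pose J z := B * intR (fun x => (th x)^-1 * isq z r x) + 1.
have HJ i z : intR (fun x => normc (w_ i x) * isq z r x) <= J z.
  have [_ h] := L2w_sq z r wt (lw i); rewrite /J; set X := intR _ in h *; set Y := intR _ in h.
  have j0 : 0 <= intR (fun x => (th x)^-1 * isq z r x).
    by apply: intR_ge0 => x; rewrite mulr_ge0 ?isq_ge0// invr_ge0 ltW.
  have : Y * intR (fun x => (th x)^-1 * isq z r x) <= B * intR (fun x => (th x)^-1 * isq z r x).
    by rewrite ler_wpM2r// hB.
  by have := sqr_ge0 (X - 2^-1); nra.
have dl0 z : cdiff l0 z (- l1 z).
  apply: (@quad_wirt R l0 z (l1 z) 0 (A * J z)) => // h h1.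
  have c := cvgCD (cvgCD (cvgCB (H0 (z + h)) (H0 z)) (cvgCZ h (H1 z))) (cvgCZ h^* (H2 z)).
  apply: (cvgC_le c) => i; apply: (le_trans (HK _ (lI i) z h h1)).
  by rewrite mulrAC ler_wpM2r ?sqr_ge0// ler_wpM2l// ltW.
have cvl n a : cvgC (fun i => cint (fun x => w_ i x * (rho n.+2 a x)%:C)) (l0 a).
  have h6 : cvgC (fun i => cint (fun x => w_ i x * (rho 6 a x)%:C)) (l0 a).
    by apply: (cvgC_eq _ (H0 a)) => i; apply: eq_cint => x; rewrite /K0 -rho_shift.
  have st k := rho_cvg a (l0 a) k lI hdb.
  have h2 := (st 0).1 ((st 1).1 ((st 2).1 ((st 3).1 h6))).
  by elim: n => [//|n IH]; apply/(st n).
pose W z := (mass%:C)^-1 * l0 z.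
have hW : hol W by move=> z; exists ((mass%:C)^-1 * - l1 z); exact: cdiffZ.
have WE a : W a * mass%:C = l0 a by rewrite /W mulrC mulVKf.
exists W; have mW : measurable_fun setT W by apply: ctn_measurable; exact: hol_ctn.
have [iW leW] : rI (fun z => normc (W z) ^+ 2 * th z) /\ intR (fun z => normc (W z) ^+ 2 * th z) <= 2 * B.
  apply: rI_mono => //; [by move=> z; exact: ltW|exact: weight_meas|move=> s].
  have [N HN] := weight_approx (2 * s + 1) wt.
  pose v i z := cint (fun x => w_ i x * (rho N.+3.+1 z x)%:C).
  have cv i : ctn (v i).
    rewrite (_ : v i = fun z => cint (fun x => w_ i x * (fun y => (rho N.+4 0 y)%:C) (x - z))).
      exact: (conv_ctn (K := fun y => (rho N.+4 0 y)%:C) (lI i) (C2_rho _ _) (csupp_rhoC _ _)).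
    by apply/funext => z; apply: eq_cint => x; rewrite rho_shift.
  have bd i := conv_L2 wt (lw i) (HN N.+3 ltac:(by rewrite !leqW)) (ctn_measurable (cv i)).
  have [||||| iF leF] := @fatou_le R (fun i z => normc (v i z) ^+ 2 * (th z * isq 0 s z))
     (fun z => normc (l0 z) ^+ 2 * (th z * isq 0 s z)) (2 * mass ^+ 2 * B).
  - by move=> i; have [] := bd i.
  - by move=> i z; apply: mulr_ge0; [exact: sqr_ge0|rewrite mulr_ge0 ?isq_ge0// ltW].
  - move=> i; have [_ /le_trans] := bd i; apply.
    by rewrite ler_wpM2l// mulr_ge0// sqr_ge0.
  - apply: measurable_funM.
      apply: measurable_funX; apply: mnormc; apply: ctn_measurable; apply: hol_ctn => z.
      by exists (- l1 z).
    by apply: measurable_funM; [exact: weight_meas|apply: measurable_indic; exact: measurable_sq].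
  - move=> z; apply: cvgM; last exact: cvg_cst.
    have h := cvgC_normc_lim (cvl N.+2 z).
    rewrite expr2 (_ : (fun n => _) = fun n => (normc (v n z) : R) * normc (v n z)); last by apply/funext.
    exact: cvgM.
  have lE z : normc (l0 z) ^+ 2 * (th z * isq 0 s z) = mass ^+ 2 * (normc (W z) ^+ 2 * (th z * isq 0 s z)).
    by rewrite -WE normcM normc_real ger0_norm ?ltW// exprMn; ring.
  have iW : rI (fun z => normc (W z) ^+ 2 * (th z * isq 0 s z)).
    have := rIZ (mass ^- 2) iF; congr rI; apply/funext => z.
    by rewrite lE mulKf// expf_eq0 gt_eqF.
  split => //; have : mass ^+ 2 * intR (fun z => normc (W z) ^+ 2 * (th z * isq 0 s z)) <= mass ^+ 2 * (2 * B).
    rewrite -intRZ// mulrCA mulrA; apply: le_trans leF.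
    by rewrite le_eqVlt; apply/orP; left; apply/eqP; congr intR; apply/funext => z; rewrite lE.
  by rewrite ler_pM2l// exprn_gt0.
by split => // n a; rewrite WE.
Qed.
End WeakLimit.

(** * Weighted inner products and a Riesz argument *)

Section WeightedInnerProduct.
Variable R : realType.
Local Notation C := R[i].
Local Notation Re := (@complex.Re R).
Implicit Types (z a h : C) (u v : C -> C) (ka : C -> R).

(** Allows weights that are not known to be differentiable, such as [kappa] below. *)
Definition pweight ka := (forall z, 0 <= ka z) /\ measurable_fun setT ka.
Definition wdot ka u v : C := cint (fun z => u z * (v z)^* * (ka z)%:C).
Definition wnorm2 ka u : R := intR (fun z => normc (u z) ^+ 2 * ka z).

Lemma weight_pweight ka : weight ka -> pweight ka.
Proof. by move=> wt; split => [z|]; [apply: ltW; exact: wt.1|exact: weight_meas]. Qed.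
Lemma wnorm2_ge0 ka u : pweight ka -> 0 <= wnorm2 ka u.
Proof. by move=> [k0 _]; apply: intR_ge0 => z; apply: mulr_ge0 => //; exact: sqr_ge0. Qed.
Lemma wdot_cI ka u v : pweight ka -> L2w ka u -> L2w ka v -> cI (fun z => u z * (v z)^* * (ka z)%:C).
Proof.
move=> [k0 mk] [mu iu] [mv iv].
apply: (@cI_le _ _ (fun z => normc (u z) ^+ 2 * ka z + normc (v z) ^+ 2 * ka z)); last exact: rID.
  by apply: mcM; [apply: mcM => //; exact: mcJ|exact: mcR].
move=> z; rewrite !normcM normc_conj normc_real ger0_norm// -mulrDl ler_wpM2r//.
by have := sqr_ge0 (normc (u z) - normc (v z)); have := sqr_ge0 (normc (u z) + normc (v z)); nra.
Qed.
Lemma wdot_CS ka u v : pweight ka -> L2w ka u -> L2w ka v -> normc (wdot ka u v) ^+ 2 <= wnorm2 ka u * wnorm2 ka v.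
Proof.
move=> pk lu lv; have iuv := wdot_cI pk lu lv; have [k0 mk] := pk; have [mu iu] := lu; have [mv iv] := lv.
apply: (@le_trans _ _ (intR (fun z => normc (u z) * normc (v z) * ka z) ^+ 2)).
  rewrite lerXn2r ?nnegrE ?normc_ge0//.
    by apply: intR_ge0 => z; apply: mulr_ge0 => //; apply: mulr_ge0; exact: normc_ge0.
  apply: (le_trans (normc_cint iuv)); rewrite le_eqVlt; apply/orP; left; apply/eqP; congr intR.
  by apply/funext => z; rewrite !normcM normc_conj normc_real ger0_norm.
apply: (pointwise_CS _ _ _ _ iu iv).2.
- by apply: measurable_funM => //; apply: measurable_funM; exact: mnormc.
- by move=> z; apply: mulr_ge0 => //; exact: sqr_ge0.
- by move=> z; apply: mulr_ge0 => //; exact: sqr_ge0.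
- by move=> z; rewrite le_eqVlt; apply/orP; left; apply/eqP; ring.
Qed.
Lemma L2w_lin ka u v (s : C) : pweight ka -> L2w ka u -> L2w ka v -> L2w ka (fun z => u z + s * v z).
Proof.
move=> [k0 mk] [mu iu] [mv iv]; have m : measurable_fun setT (fun z => u z + s * v z).
  by apply: mcD => //; apply: mcM => //; exact: mcst.
split => //; apply: (@rI_le _ _ (fun z => 2 * (normc (u z) ^+ 2 * ka z) + 2 * normc s ^+ 2 * (normc (v z) ^+ 2 * ka z))).
- by apply: measurable_funM => //; apply: measurable_funX; exact: mnormc.
- move=> z; rewrite ger0_norm; last by apply: mulr_ge0 => //; exact: sqr_ge0.
  rewrite !mulrA -mulrDl ler_wpM2r//; have := le_normcD (u z) (s * v z); rewrite normcM.
  have := normc_ge0 (u z + s * v z); set x := normc (_ + _); set y := normc (u z); set t := normc s; set r := normc (v z).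
  move=> x0 h; have : x ^+ 2 <= (y + t * r) ^+ 2 by rewrite lerXn2r ?nnegrE// (le_trans x0).
  by have := sqr_ge0 (y - t * r); lra.
- by apply: rID; exact: rIZ.
Qed.
Lemma L2w_Z ka v (s : C) : pweight ka -> L2w ka v -> L2w ka (fun z => s * v z).
Proof.
move=> pk lv; have l0 : L2w ka (fun=> 0).
  split; first exact: mcst.
  by under eq_fun do rewrite normc0 expr0n /= mul0r; exact: rI0.
by have := L2w_lin s pk l0 lv; under eq_fun do rewrite add0r.
Qed.
Lemma L2w_B ka u v : pweight ka -> L2w ka u -> L2w ka v -> L2w ka (fun z => u z - v z).
Proof. by move=> pk lu lv; have := L2w_lin (-1) pk lu lv; under eq_fun do rewrite mulN1r. Qed.
Lemma wdot_linl ka u v (w : C -> C) (s : C) : pweight ka -> L2w ka u -> L2w ka v -> L2w ka w ->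
  wdot ka (fun z => u z + s * v z) w = wdot ka u w + s * wdot ka v w.
Proof.
move=> pk lu lv lw; rewrite /wdot -cintZ; last exact: wdot_cI.
rewrite -cintD; [|exact: wdot_cI|by apply: cIZ; exact: wdot_cI].
by apply: eq_cint => z; ring.
Qed.
Lemma wdotJ ka u v : pweight ka -> L2w ka u -> L2w ka v -> wdot ka v u = (wdot ka u v)^*.
Proof.
move=> pk lu lv; rewrite /wdot -cintJ; last exact: wdot_cI.
apply: eq_cint => z.
by apply: complexP; rewrite !(ReM, ImM, ReJ, ImJ) /=; ring.
Qed.
Lemma wdot_linr ka u v (w : C -> C) (s : C) : pweight ka -> L2w ka u -> L2w ka v -> L2w ka w ->
  wdot ka w (fun z => u z + s * v z) = wdot ka w u + s^* * wdot ka w v.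
Proof.
move=> pk lu lv lw; rewrite (wdotJ (u := (fun z => u z + s * v z)))//; last exact: L2w_lin.
by rewrite wdot_linl// conjD conjM -!wdotJ.
Qed.
Lemma wdot_Bl ka u v (w : C -> C) : pweight ka -> L2w ka u -> L2w ka v -> L2w ka w ->
  wdot ka (fun z => u z - v z) w = wdot ka u w - wdot ka v w.
Proof.
move=> pk lu lv lw; rewrite -[- _]mulN1r -wdot_linl//.
by apply: eq_cint => z; rewrite mulN1r.
Qed.
Lemma wdot_Br ka u v (w : C -> C) : pweight ka -> L2w ka u -> L2w ka v -> L2w ka w ->
  wdot ka w (fun z => u z - v z) = wdot ka w u - wdot ka w v.
Proof.
move=> pk lu lv lw; have := wdot_linr (-1) pk lu lv lw; rewrite conjN conj1 mulN1r => <-.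
by apply: eq_cint => z; rewrite mulN1r.
Qed.
Lemma wdot_self ka u : wdot ka u u = (wnorm2 ka u)%:C.
Proof.
rewrite /wdot /wnorm2 -cintR; apply: eq_cint => z.
by rewrite rmorphM /= -mulJ.
Qed.
Lemma wnorm2_lin ka u v (s : C) : pweight ka -> L2w ka u -> L2w ka v ->
  wnorm2 ka (fun z => u z + s * v z) = wnorm2 ka u + 2 * Re (s * wdot ka v u) + normc s ^+ 2 * wnorm2 ka v.
Proof.
move=> pk lu lv; have lw := L2w_lin s pk lu lv; apply: (@complexI R).
rewrite -wdot_self wdot_linl// !wdot_linr// !wdot_self (wdotJ pk lv lu) mulrDr.
have -> : s * (s^* * (wnorm2 ka v)%:C) = (normc s ^+ 2 * wnorm2 ka v)%:C.
  by rewrite mulrA mulJ -rmorphM.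
rewrite !rmorphD /=; set x := wdot ka v u.
have -> : (2 * Re (s * x))%:C = s * x + s^* * x^*.
  by rewrite -conjM; apply: complexP; rewrite ?ReD ?ImD ?ReJ ?ImJ /=; ring.
ring.
Qed.
Lemma wnorm2_Z ka v (s : C) : pweight ka -> L2w ka v -> wnorm2 ka (fun z => s * v z) = normc s ^+ 2 * wnorm2 ka v.
Proof.
by move=> pk lv; rewrite /wnorm2 -intRZ; [congr intR; apply/funext => z; rewrite normcM exprMn; ring|exact: lv.2].
Qed.

(** Minimise |T x|^2 - 2 Re L(x).  The bound on [L] makes the functional bounded below, and a minimising sequence represents [L] up to errors 1/n and is Cauchy.  Limits are taken later, of what is tested against kernels. *)
Theorem riesz (X : Type) (T : X -> C -> C) (L : X -> C) ka (K : R) (x0 : X) : pweight ka ->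
  (forall x y (s : C), exists z : X, (forall w : C, T z w = T x w + s * T y w) /\ L z = L x + s * L y) ->
  (forall x, L2w ka (T x)) -> 0 < K -> (forall x, normc (L x) ^+ 2 <= K * wnorm2 ka (T x)) ->
  exists x_ : nat -> X, [/\ forall n, wnorm2 ka (T (x_ n)) <= 4 * K,
    forall n m, wnorm2 ka (fun z => T (x_ n) z - T (x_ m) z) <= 2 * (K / n.+1%:R + K / m.+1%:R) &
    forall n y, normc (wdot ka (T y) (T (x_ n)) - L y) ^+ 2 <= K / n.+1%:R * wnorm2 ka (T y)].
Proof.
move=> pk lin lT K0 LK; pose J x := wnorm2 ka (T x) - 2 * Re (L x).
have q0 x := wnorm2_ge0 (T x) pk.
have Jge x : - K <= J x.
  rewrite /J; have := LK x; have := Re_le (L x); have := ler_norm (Re (L x)); have := q0 x.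
  have := normc_ge0 (L x); set q := wnorm2 _ _; set r := Re _; set l := normc _ => l0 qq h1 h2 h3.
  have h : (2 * l) ^+ 2 <= (K + q) ^+ 2.
    by have := sqr_ge0 (K - q); lra.
  have : 2 * l <= K + q by rewrite -(@ler_pXn2r _ 2)// nnegrE; lra.
  by lra.
pose A := range J; have hA : has_inf A.
  by split; [exists (J x0); exists x0|exists (- K) => _ [x _ <-]].
have [x_ Hx] : exists x_ : nat -> X, forall n, J (x_ n) <= inf A + K / n.+1%:R.
  suff H n : exists x, J x <= inf A + K / n.+1%:R by have [f Hf] := choice H; exists f.
  have e0 : 0 < K / n.+1%:R by rewrite divr_gt0.
  by have [_ [x _ <-] h] := inf_adherent e0 hA; exists x; exact: ltW.
have Jinf x : inf A <= J x by apply: ge_inf; [exact: hA.2|exists x].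
have E n y : normc (wdot ka (T y) (T (x_ n)) - L y) ^+ 2 <= K / n.+1%:R * wnorm2 ka (T y).
  set eps := K / n.+1%:R; have e0 : 0 < eps by rewrite divr_gt0.
  (* compare with the variation x_n - t conj(D) y; optimising in t gives the bound *)
  set D := wdot _ _ _ - _; have key (t : R) : 2 * t * normc D ^+ 2 <= eps + t ^+ 2 * normc D ^+ 2 * wnorm2 ka (T y).
    have [z [Tz Lz]] := lin (x_ n) y (- t%:C * D^*).
    have := Jinf z; rewrite /J Lz (_ : T z = fun w => T (x_ n) w + (- t%:C * D^*) * T y w); last exact/funext.
    rewrite wnorm2_lin// ReD.
    have := Hx n; rewrite /J -/eps; set q := wnorm2 ka (T (x_ n)); set r := Re (L (x_ n)).
    have -> : Re (- t%:C * D^* * wdot ka (T y) (T (x_ n))) = Re (- t%:C * D^* * L y) - t * normc D ^+ 2.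
      have -> : wdot ka (T y) (T (x_ n)) = D + L y by rewrite /D subrK.
      rewrite mulrDr ReD addrC; congr (_ + _); by rewrite -mulrA (mulrC D^*) mulJ -rmorphN ReRM /= mulNr.
    rewrite !normcM normcN normc_real normc_conj exprMn real_normK ?num_real//.
    set w := Re (_ * L y); set d := normc D ^+ 2; set Q := wnorm2 _ (T y).
    by lra.
  have := q0 y; rewrite le_eqVlt => /orP[/eqP Q0|Qp].
    have D0 := sqr_ge0 (normc D).
    rewrite -Q0 mulr0; apply/ler_addgt0Pr => e ep; rewrite add0r.
    have := key (eps / e); rewrite -Q0 mulr0 addr0 => h.
    have : eps / e * normc D ^+ 2 <= eps.
      have h0 : 0 <= eps / e * normc D ^+ 2 by apply: mulr_ge0; [apply: divr_ge0; exact: ltW|exact: D0].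
      by lra.
    by rewrite mulrAC ler_pdivrMr// ler_pM2l.
  have := key (wnorm2 ka (T y))^-1; rewrite (_ : _ ^+ 2 * _ * wnorm2 ka (T y) = (wnorm2 ka (T y))^-1 * normc D ^+ 2); last by field; rewrite gt_eqF.
  move=> h; have : (wnorm2 ka (T y))^-1 * normc D ^+ 2 <= eps by lra.
  by rewrite mulrC ler_pdivrMr.
exists x_; split => //.
- move=> n; have := E n (x_ n); rewrite wdot_self.
  have eK : K / n.+1%:R <= K by rewrite ler_pdivrMr// ler_peMr ?ler1n// ltW.
  have := LK (x_ n); have := q0 (x_ n); set q := wnorm2 _ _; set l := L _ => qq h1 h2.
  have h3 : normc (q%:C - l) ^+ 2 <= K * q by apply: (le_trans h2); rewrite ler_wpM2r.
  have h4 : q <= normc (q%:C - l) + normc l.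
    by have := le_normcD (q%:C - l) l; rewrite subrK normc_real ger0_norm.
  have := normc_ge0 l; have := normc_ge0 (q%:C - l); move: h1 h3 h4.
  move: (normc l) (normc (q%:C - l)) => b c h1 h3 h4 c0 b0.
  have [qK|qK] := leP q (4 * K); first by [].
  have : q ^+ 2 <= (c + b) ^+ 2 by rewrite lerXn2r ?nnegrE// addr_ge0.
  have := sqr_ge0 (c - b) => h5 h6.
  have h7 : q ^+ 2 <= 4 * K * q by lra.
  have qp : 0 < q by lra.
  by move: h7; rewrite expr2 ler_pM2r// leNgt qK.
- move=> n m; have [z [Tz Lz]] := lin (x_ n) (x_ m) (-1).
  have e : T z = fun w => T (x_ n) w - T (x_ m) w.
    by apply/funext => w; rewrite Tz mulN1r.
  rewrite -e; have h1 := E n z; have h2 := E m z.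
  have h : (wnorm2 ka (T z))%:C = (wdot ka (T z) (T (x_ n)) - L z) - (wdot ka (T z) (T (x_ m)) - L z).
    rewrite -wdot_self {2}(_ : T z = fun w => T (x_ n) w + (-1) * T (x_ m) w); last exact/funext.
    by rewrite wdot_linr// conjN conj1 mulN1r; ring.
  move: h1 h2 h; set c := wdot _ _ _ - _; set d := wdot _ _ _ - _; set q := wnorm2 _ _ => h1 h2 h.
  have := le_normcB c d; rewrite -h normc_real ger0_norm ?q0// => h3.
  move: h1 h2; set ec := K / _; set ed := K / _ => h1 h2.
  have qq : 0 <= q by exact: q0.
  have : q ^+ 2 <= (normc c + normc d) ^+ 2 by rewrite lerXn2r ?nnegrE// addr_ge0 ?normc_ge0.
  have := sqr_ge0 (normc c - normc d) => h5 h6.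
  have h7 : q * q <= 2 * (ec + ed) * q by rewrite -expr2; lra.
  move: qq; rewrite le_eqVlt => /orP[/eqP <-|qp].
    by rewrite mulr_ge0// addr_ge0// divr_ge0// ltW.
  by rewrite -(ler_pM2r qp).
Qed.
End WeightedInnerProduct.

(** * Derivatives of the potential *)

Section PotentialCalculus.
Variable R : realType.
Local Notation C := R[i].
Local Notation Re := (@complex.Re R).
Local Notation Im := (@complex.Im R).
Implicit Types (z a h v : C) (phi : C -> R).

Lemma rderivable_wdir v phi z : rderivable v phi z -> wdir (fun w => (phi w)%:C) z v (rderive v phi z)%:C.
Proof.
move=> h; split => /=; last exact: is_derive_cst.
by rewrite /rderive derive1E; apply: DeriveDef.
Qed.
Lemma rderiveE v phi z l : wdir (fun w => (phi w)%:C) z v l -> rderive v phi z = Re l.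
Proof. by move=> [h _]; rewrite /rderive derive1E; exact: (@derive_val _ _ _ _ _ _ _ h). Qed.

(** The derivative of a real function with respect to z is (d/dx - i d/dy) / 2. *)
Definition dphi phi z : C := (rderive 1 phi z / 2) +i* (- (rderive 'i%C phi z / 2)).
Lemma C1_wirt phi : C1 phi -> (forall z, wirt (fun w => (phi w)%:C) z (dphi phi z) (dphi phi z)^*) /\ ctn (dphi phi).
Proof.
move=> h1; have [d1 c1] := h1 1 (or_introl erefl); have [d2 c2] := h1 'i%C (or_intror erefl); split.
  move=> z; split.
    rewrite (_ : _ + _ = (rderive 1 phi z)%:C); first exact: rderivable_wdir.
    by apply: complexP; rewrite ?ReD ?ImD /=; [field|ring].
  rewrite (_ : _ * _ = (rderive 'i%C phi z)%:C); first exact: rderivable_wdir.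
  by apply: complexP; rewrite ?ReM ?ImM /=; field.
rewrite (_ : dphi phi = fun z => 2^-1%:C * ((rderive 1 phi z)%:C - 'i%C * (rderive 'i%C phi z)%:C)).
  by apply: ctnM; [exact: ctn_cst|apply: ctnB; [exact: ctnR|apply: ctnM; [exact: ctn_cst|exact: ctnR]]].
by apply/funext => z; apply: complexP; rewrite ?ReM ?ImM /=; ring.
Qed.

Lemma Re_laplacian (P Q : C) (a b : R) : Re P = a / 2 -> Im Q = - (b / 2) ->
  Re (2^-1%:C * (P^* - 'i%C * Q^*)) = 4^-1 * (a + b).
Proof.
move=> e1 e2; rewrite ReRM ReD ReN ReM !ReJ !ImJ e1 e2.
by rewrite (_ : Re 'i%C = 0)// (_ : Im 'i%C = 1)//; field.
Qed.

(** Everything below uses [phi] only through these data: [p] is its z-derivative and [r] the dbar-derivative of [p], a quarter of the Laplacian. *)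
Lemma C2_potential phi : C2 phi -> exists p s r : C -> C,
  [/\ forall z, wirt (fun w => (phi w)%:C) z (p z) (p z)^*, forall z, wirt p z (s z) (r z),
      forall z, Re (r z) = ddbar phi z, ctn p & ctn s /\ ctn r].
Proof.
move=> [h [hx hy]]; have [w1 c1] := C1_wirt h; have [wx cx] := C1_wirt hx; have [wy cy] := C1_wirt hy.
set px := dphi (rderive 1 phi) in wx cx; set py := dphi (rderive 'i%C phi) in wy cy.
exists (dphi phi), (fun z => 2^-1%:C * (px z - 'i%C * py z)), (fun z => 2^-1%:C * ((px z)^* - 'i%C * (py z)^*)).
split; [exact: w1| | |exact: c1|].
- move=> z; apply: (wirt_eq _ _ _ (wirtZ 2^-1%:C (wirtB (wx z) (wirtZ 'i%C (wy z))))).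
  + by move=> w; apply: complexP; rewrite ?ReM ?ImM ?ReD ?ImD ?ReN ?ImN ?ReM ?ImM /=; ring.
  + by [].
  + by [].
- by move=> z; exact: Re_laplacian.
- by clearbody px py; split; ctn_tac.
Qed.

(** The normalisation of the curvature hypothesis: the reference form has coefficient 1. *)
Lemma ddbar_normc2 z : ddbar (fun w => normc w ^+ 2) z = 1.
Proof.
have w0 (x : C) : wirt (fun w => (normc w ^+ 2)%:C) x x^* x.
  by apply: (wirt_eq _ _ _ (wirt_dist2 0 x)) => [w||]; rewrite /dist2 ?subr0.
have e1 : rderive 1 (fun w => normc w ^+ 2) = fun w => 2 * Re w.
  by apply/funext => x; rewrite (rderiveE (w0 x).1) ReD ReJ; ring.
have e2 : rderive 'i%C (fun w => normc w ^+ 2) = fun w => 2 * Im w.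
  by apply/funext => x; rewrite (rderiveE (w0 x).2) ReM /= ImD ImN ImJ; ring.
have w1 (x : C) : wirt (fun w => (2 * Re w)%:C) x 1 1.
  apply: (wirt_eq _ _ _ (wirtD (wirt_id x) (wirtJ (wirt_id x)))) => [w||].
  - by apply: complexP; rewrite ?ReD ?ImD ?ReJ ?ImJ /=; ring.
  - by rewrite conj0 addr0.
  - by rewrite conj1 add0r.
have w2 (x : C) : wirt (fun w => (2 * Im w)%:C) x (- 'i%C) 'i%C.
  apply: (wirt_eq _ _ _ (wirtZ 'i%C (wirtB (wirtJ (wirt_id x)) (wirt_id x)))) => [w||].
  - by apply: complexP; rewrite ?ReM ?ImM ?ReD ?ImD ?ReN ?ImN ?ReJ ?ImJ /=; ring.
  - by rewrite conj0 sub0r mulrN1.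
  - by rewrite conj1 subr0 mulr1.
by rewrite /ddbar e1 e2 (rderiveE (w1 z).1) (rderiveE (w2 z).2) /=; field.
Qed.

Lemma wirt_exp (u : C -> R) z p q (k : R) : wirt (fun w => (u w)%:C) z p q ->
  wirt (fun w => (expR (k * u w))%:C) z ((k * expR (k * u z))%:C * p) ((k * expR (k * u z))%:C * q).
Proof.
move=> hu; apply: (@wirtR R u (fun t => expR (k * t))) => //.
have := is_derive_comp' (is_derive_expR (k * u z)) (is_derive_scale k (is_derive_id (u z) (1 : R))).
by apply: is_derive_fun => //; rewrite mulr1 mulrC.
Qed.
Lemma ctn_exp (u : C -> R) (k : R) : ctn (fun z => (u z)%:C) -> ctn (fun z => (expR (k * u z))%:C).
Proof.
move=> cu; apply: ctnR; apply: (@continuous_compR R u (fun t => expR (k * t))); last exact: ctnRr.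
move=> t; apply: (@continuous_comp _ _ _ (fun t : R => k * t) expR); last exact: continuous_expR.
by apply: cvgM; [exact: cvg_cst|exact: cvg_id].
Qed.
End PotentialCalculus.

(** * Orthogonal projection onto the holomorphic functions *)

Section FockProjection.
Variable R : realType.
Local Notation C := R[i].
Local Notation mass := (@mass R).
Implicit Types (z a : C) (F G g h u : C -> C) (th : C -> R).

(** Integration against a test function is an inner product with the function divided by the weight. *)
Lemma wdot_kernel th K : weight th -> ctn K -> csupp K -> exists2 k : C -> C, L2w th k &
  forall w, L2w th w -> cint (fun z => w z * K z) = wdot th w k.
Proof.
move=> wt cK sK; pose k z := (K z)^* * ((th z)^-1)%:C; exists k.
  split; first by apply: ctn_measurable; apply: ctnM; [exact: ctnJ|exact: weight_inv_ctn].
  have ck : ctn (fun z => k z * (k z)^* * (th z)%:C).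
    by apply: ctnM; [apply: ctnM; [|apply: ctnJ]; (apply: ctnM; [exact: ctnJ|exact: weight_inv_ctn])|exact: weight_ctn].
  apply: rI_csupp.
    apply: ctnRr; rewrite (_ : (fun z => _) = fun z => k z * (k z)^* * (th z)%:C) //.
    by apply/funext => z; rewrite rmorphM /= -mulJ.
  by have [r H] := sK; exists r => z /H h; rewrite /k h conj0 mul0r normc0 expr0n /= mul0r.
move=> w lw; apply: eq_cint => z; rewrite /k conjM conjR -!mulrA -rmorphM mulVf ?gt_eqF ?wt.1// mulr1.
by congr (_ * _); apply: complexP; rewrite ?ReJ ?ImJ ?opprK.
Qed.

(** A holomorphic function whose norm vanishes has vanishing means, hence vanishing values. *)
Lemma hol_eq0 th u : weight th -> hol u -> L2w th u -> wnorm2 th u = 0 -> u = fun=> 0.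
Proof.
move=> wt hu lu q0; apply/funext => a; have pk := weight_pweight wt.
have [k lk kE] := @wdot_kernel th (fun z => (rho 1 a z)%:C) wt (ctnR (@continuous_rho R 1 a)) (csupp_rhoC 0 a).
have := wdot_CS pk lu lk; rewrite -kE// (hol_mean 0 a hu) q0 mul0r.
rewrite le_eqVlt ltNge sqr_ge0 orbF expf_eq0 /= => /eqP/eq0_normc/eqP.
by rewrite mulf_eq0 (negPf (mass_neq0 R)) orbF => /eqP.
Qed.

Lemma L2w_kernel_cauchy th (w_ : nat -> C -> C) (e : nat -> R) : weight th -> (forall n, L2w th (w_ n)) ->
  (forall n m, wnorm2 th (fun z => w_ n z - w_ m z) <= e n + e m) ->
  (forall d : R, 0 < d -> exists N : nat, forall n, (N <= n)%N -> e n <= d) ->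
  forall K, ctn K -> csupp K -> cauchyC (fun n => cint (fun x => w_ n x * K x)).
Proof.
move=> wt lw hw he K cK sK d d0; have pk := weight_pweight wt.
have [k lk kE] := wdot_kernel wt cK sK; have q0 := wnorm2_ge0 k pk.
have q1 : 0 < 2 * (wnorm2 th k + 1) by rewrite mulr_gt0// ltr_wpDl.
have [N HN] := he (d ^+ 2 / (2 * (wnorm2 th k + 1))) ltac:(by rewrite divr_gt0// exprn_gt0).
exists N => n m Nn Nm; rewrite !kE//.
have -> : wdot th (w_ n) k - wdot th (w_ m) k = wdot th (fun z => w_ n z + (-1) * w_ m z) k.
  by rewrite wdot_linl// mulN1r.
rewrite -(@ler_pXn2r _ 2)// ?nnegrE ?normc_ge0 ?(ltW d0)//.
have lnm := L2w_lin (-1) pk (lw n) (lw m).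
apply: (le_trans (wdot_CS pk lnm lk)); under eq_fun do rewrite mulN1r.
have h : wnorm2 th (fun z => w_ n z - w_ m z) <= d ^+ 2 / (wnorm2 th k + 1).
  apply: (le_trans (hw n m)); apply: (le_trans (lerD (HN n Nn) (HN m Nm))).
  by rewrite le_eqVlt; apply/orP; left; apply/eqP; field; rewrite gt_eqF// ltr_wpDl.
apply: (@le_trans _ _ (d ^+ 2 / (wnorm2 th k + 1) * wnorm2 th k)); first by rewrite ler_wpM2r.
by rewrite mulrAC ler_pdivrMr ?ltr_wpDl// ler_wpM2l ?sqr_ge0// lerDl.
Qed.

Lemma lim_div_succ (K : R) : 0 < K -> forall d : R, 0 < d -> exists N : nat, forall n, (N <= n)%N -> K / n.+1%:R <= d.
Proof.
move=> K0 d d0; exists (Num.truncn (K / d)) => n Nn; rewrite ler_pdivrMr// mulrC -ler_pdivrMr//.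
by rewrite ltW// (lt_le_trans (truncnS_gt _))// ler_nat.
Qed.

Lemma cdiffD F G z l m : cdiff F z l -> cdiff G z m -> cdiff (fun w => F w + G w) z (l + m).
Proof.
move=> hF hG e e0; have e2 : 0 < e / 2 by rewrite divr_gt0.
have [d d0 Hd] := hF _ e2; have [d' d'0 Hd'] := hG _ e2.
exists (Num.min d d'); first by rewrite lt_min d0.
move=> k; rewrite lt_min => /andP[/Hd h1 /Hd' h2].
rewrite (_ : _ - _ = (F (z + k) - F z - l * k) + (G (z + k) - G z - m * k)); last by ring.
by apply: (le_trans (le_normcD _ _)); apply: (le_trans (lerD h1 h2)); rewrite -mulrDl -splitr.
Qed.
Lemma hol_lin F G (s : C) : hol F -> hol G -> hol (fun z => F z + s * G z).
Proof.
by move=> hF hG z; have [l hl] := hF z; have [m hm] := hG z; exists (l + s * m); apply: cdiffD => //; exact: cdiffZ.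
Qed.
Lemma wirt_hol F (p : C -> C) : (forall z, wirt F z (p z) 0) -> ctn p -> hol F.
Proof. by move=> hF cp z; have [_ [h _] _] := C1hol_twice hF cp; exists (p z). Qed.
Lemma normc_eq0_lim (x : C) (K : R) : (forall n, normc x ^+ 2 <= K / n.+1%:R) -> x = 0.
Proof.
move=> h; apply: eq0_normc; apply/eqP; rewrite -sqrf_eq0 eq_le sqr_ge0 andbT.
have K0 : 0 <= K by have := h 0%N; rewrite divr1; apply: le_trans; exact: sqr_ge0.
have K1 : 0 < K + 1 by rewrite ltr_wpDl.
apply/ler_addgt0Pr => e e0; rewrite add0r; have [N HN] := lim_div_succ K1 e0.
apply: (le_trans (h N)); apply: le_trans (HN N (leqnn N)).
by rewrite ler_wpM2r ?invr_ge0// lerDl.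
Qed.

(** A minimising sequence for the distance to [g] consists of holomorphic functions and is Cauchy, so by [weak_limit] and the mean value property it converges pointwise to an entire function; orthogonality passes to the limit by Fatou. *)
Theorem projection th g : weight th -> L2w th g -> exists u, [/\ hol u, L2w th u &
  forall h, hol h -> L2w th h -> wdot th (fun z => g z - u z) h = 0].
Proof.
move=> wt lg; have pk := weight_pweight wt.
pose X := {h : C -> C | hol h /\ L2w th h}.
pose T (x : X) := proj1_sig x; pose L x := wdot th (T x) g.
have lT x : L2w th (T x) := (proj2_sig x).2; have hT x : hol (T x) := (proj2_sig x).1.
have h0 : hol (fun _ : C => 0 : C) /\ L2w th (fun=> 0).
  split; last by have := L2w_Z 0 pk lg; under eq_fun do rewrite mul0r.
  by move=> z; exists 0 => e e0; exists 1 => // k _; rewrite subrr mul0r subr0 normc0 mulr_ge0 ?normc_ge0// ltW.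
pose K := wnorm2 th g + 1; have q0 := wnorm2_ge0 g pk; have K0 : 0 < K by rewrite ltr_wpDl.
have [||x_ [xB xC xE]] := riesz (X := X) (T := T) (L := L) (exist _ _ h0) pk _ lT K0.
- move=> x y s; have hz : hol (fun w => T x w + s * T y w) /\ L2w th (fun w => T x w + s * T y w).
    by split; [exact: hol_lin|exact: L2w_lin].
  exists (exist (fun h : C -> C => hol h /\ L2w th h) _ hz); split => //; rewrite /L /T /=.
  by rewrite wdot_linl//; exact: lT.
- move=> x; apply: (le_trans (wdot_CS pk (lT x) lg)); rewrite mulrC ler_wpM2r ?wnorm2_ge0//.
  by rewrite /K lerDl.
pose h_ n := T (x_ n).
have xC' n m : wnorm2 th (fun z => h_ n z - h_ m z) <= 2 * K / n.+1%:R + 2 * K / m.+1%:R.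
  by apply: (le_trans (xC n m)); rewrite mulrDr !mulrA.
have K2 : 0 < 2 * K by rewrite mulr_gt0.
have [||||W [hW Wr iW leW]] := @weak_limit R th h_ (4 * K) wt.
- by move=> n; exact: lT.
- exact: xB.
- exact: (L2w_kernel_cauchy wt (fun n => lT (x_ n)) xC' (lim_div_succ K2)).
- move=> F hF sF; have [d1 _ _ _ _] := hF; apply: (cvgC_eq _ (@cvgC_cst R 0)) => i.
  by rewrite (hol_div (hT (x_ i)) d1 (C2_dz hF) (C2_db hF) sF).
have hp a : cvgC (fun n => h_ n a) (W a).
  have := cvgCZ (mass%:C)^-1 (Wr 0 a); rewrite (mulrC (W a)) mulKf ?mass_neq0//.
  by apply: cvgC_eq => n; rewrite (hol_mean 1 a (hT (x_ n))) mulrC mulfK ?mass_neq0.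
have mW : measurable_fun setT W by apply: ctn_measurable; exact: hol_ctn.
have lW : L2w th W by [].
exists W; split => // h hh lh.
have qW n : wnorm2 th (fun z => W z - h_ n z) <= 4 * K / n.+1%:R.
  have [|||||//] := @fatou_le R (fun i z => normc (h_ (i + n)%N z - h_ n z) ^+ 2 * th z)
    (fun z => normc (W z - h_ n z) ^+ 2 * th z) (4 * K / n.+1%:R).
  - by move=> i; have [] := L2w_B pk (lT (x_ (i + n)%N)) (lT (x_ n)).
  - by move=> i z; apply: mulr_ge0; [exact: sqr_ge0|apply: ltW; exact: wt.1].
  - move=> i; apply: (le_trans (xC' _ _)).
    have : 2 * K / (i + n).+1%:R <= 2 * K / n.+1%:R.
      by rewrite ler_pM2l// lef_pV2 ?posrE// ler_nat ltnS leq_addl.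
    have -> : 4 * K / n.+1%:R = 2 * K / n.+1%:R + 2 * K / n.+1%:R by rewrite -mulrDl; congr (_ / _); ring.
    by rewrite lerD2r.
  - by apply: measurable_funM; [apply: measurable_funX; apply: mnormc; apply: mcB => //; exact: (lT _).1|exact: weight_meas].
  - move=> z; apply: cvgM; last exact: cvg_cst.
    have c : cvgC (fun i => h_ (i + n)%N z - h_ n z) (W z - h_ n z).
      move=> e e0; have [N HN] := hp z e e0; exists N => i Ni.
      by rewrite opprB addrA subrK; apply: HN; rewrite (leq_trans Ni)// leq_addr.
    have h1 := cvgC_normc_lim c; under eq_fun do rewrite expr2; rewrite expr2; exact: cvgM.
have [y yE] : exists y : X, T y = h by exists (exist (fun h : C -> C => hol h /\ L2w th h) h (conj hh lh)).
have lgW := L2w_B pk lg lW.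
(* 10 = 2 (1 + 4): the defect of the representative and the distance to the limit *)
have E n : normc (wdot th h (fun z => g z - W z)) ^+ 2 <= 10 * K / n.+1%:R * wnorm2 th h.
  have lWn := L2w_B pk lW (lT (x_ n)).
  have -> : wdot th h (fun z => g z - W z) = - (wdot th h (h_ n) - wdot th h g) - wdot th h (fun z => W z - h_ n z).
    by rewrite !wdot_Br//; [ring|exact: lT].
  have := xE n y; rewrite yE -/(L y) /L yE => h1.
  have := wdot_CS pk lh lWn => h2; have := qW n => h3; have qh := wnorm2_ge0 h pk.
  have := le_normcB (- (wdot th h (h_ n) - wdot th h g)) (wdot th h (fun z => W z - h_ n z)).
  rewrite normcN; move: h1 h2; set A := normc _; set B := normc _; set D := normc _ => h1 h2 h4.
  have D0 : 0 <= D by exact: normc_ge0.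
  have : D ^+ 2 <= (A + B) ^+ 2 by rewrite lerXn2r ?nnegrE// (le_trans D0).
  have h5 : B ^+ 2 <= wnorm2 th h * (4 * K / n.+1%:R) by apply: (le_trans h2); rewrite ler_wpM2l.
  have := sqr_ge0 (A - B); rewrite -!mulrA; move: h1 h5; rewrite -mulrA; move: (n.+1%:R^-1) => i h1 h5.
  by lra.
rewrite (wdotJ pk lh lgW) -conj0; congr (_^*); apply: (@normc_eq0_lim _ (10 * K * wnorm2 th h)) => n.
by rewrite mulrAC.
Qed.
End FockProjection.

(** * The Fock space *)

Section FockSpace.
Variables (R : realType) (phi : R[i] -> R).
Hypothesis phi_C2 : C2 phi.
Local Notation C := R[i].
Local Notation mu := (@lebesgueC R).
Implicit Types (z a : C) (g h u : C -> C).

Definition fweight z : R := expR (- (2 * phi z)).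
Local Notation th := fweight.

Lemma fweight_weight : weight th.
Proof.
split => [z|]; first exact: expR_gt0.
have [p [s [r [hp _ _ cp _]]]] := C2_potential phi_C2.
have cphi : ctn (fun z => (phi z)%:C) := ctn_wirt hp cp (ctnJ cp).
have ce : ctn (fun z => (- 2 * expR (- 2 * phi z))%:C).
  by under eq_fun do rewrite rmorphM /=; apply: ctnM; [exact: ctn_cst|exact: ctn_exp].
exists (fun z => (- 2 * expR (- 2 * phi z))%:C * p z), (fun z => (- 2 * expR (- 2 * phi z))%:C * (p z)^*); split.
- by move=> z; apply: (wirt_eq _ _ _ (wirt_exp (- 2) (hp z))) => [w||]; rewrite /th ?mulNr.
- by apply: ctnM; [exact: ce|exact: cp].
- by apply: ctnM; [exact: ce|exact: ctnJ].
Qed.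
Local Notation wt := fweight_weight.
Local Notation pk := (weight_pweight wt).

Lemma entireP g : entire g <-> hol g.
Proof.
split=> h z; first exact: derive_cdiff.
by have [l hl] := h z; apply: (@ex_derive _ _ _ _ _ _ _ (cdiff_derive hl)).
Qed.

Lemma normphi_pow g : normphi phi g = poweR (\int[mu]_z (normc (g z) ^+ 2 * th z)%:E)%E 2^-1.
Proof. by []. Qed.

Lemma normphiE g : L2w th g -> normphi phi g = (Num.sqrt (wnorm2 th g))%:E.
Proof.
by move=> [mg ig]; rewrite normphi_pow -intRE// poweR_EFin powR12_sqrt//; exact: (wnorm2_ge0 g pk).
Qed.

Lemma L2P g : L2 phi g <-> L2w th g.
Proof.
split=> [[mg ng]|lg]; last by split; [exact: lg.1|rewrite normphiE// ltry].
split => //; apply: rI_ge0.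
- by apply: measurable_funM; [apply: measurable_funX; exact: mnormc|exact: weight_meas wt].
- by move=> z; apply: mulr_ge0; [exact: sqr_ge0|exact: expR_ge0].
- move: ng; rewrite normphi_pow; set I := (\int[mu]_z _)%E.
  have : (0 <= I)%E.
    by apply: integral_ge0 => z _; rewrite lee_fin; apply: mulr_ge0; [exact: sqr_ge0|exact: expR_ge0].
  by case: I => [r| |] // _; rewrite ?ltry// poweRyr// invr_eq0.
Qed.

Lemma F2P g : F2 phi g <-> hol g /\ L2w th g.
Proof. by split=> [[/entireP ? /L2P]|[/entireP ? /L2P]]. Qed.

Lemma innerphiE g h : innerphi phi g h = wdot th g h. Proof. by []. Qed.

(** The property that characterises the projection, free of the ambient definitions of the Fock space. *)
Definition fproj_spec g u := [/\ hol u, L2w th u & forall h, hol h -> L2w th h -> wdot th (fun z => g z - u z) h = 0].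

Lemma fproj_uniq g u u' : L2w th g -> fproj_spec g u -> fproj_spec g u' -> u = u'.
Proof.
move=> lg [hu lu ou] [hu' lu' ou'].
have hd : hol (fun z => u z + (-1) * u' z) by exact: hol_lin.
have ld : L2w th (fun z => u z + (-1) * u' z) by exact: (L2w_lin _ pk).
have d0 : (fun z => u z + (-1) * u' z) = fun=> 0.
  apply: (hol_eq0 wt) => //; apply: (@complexI R); rewrite -wdot_self.
  have := ou _ hd ld; have := ou' _ hd ld.
  set d := fun z => u z + (-1) * u' z.
  rewrite !wdot_Bl//; try exact: pk.
  move=> /eqP; rewrite subr_eq0 => /eqP -> /eqP; rewrite subr_eq0 => /eqP e2.
  by rewrite [LHS](wdot_linl (-1) pk lu lu' ld) e2 mulN1r subrr.
apply/funext => z; apply/eqP; rewrite -subr_eq0; apply/eqP.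
by have := congr1 (@^~ z) d0; rewrite /= mulN1r.
Qed.

Lemma fproj_specP g : L2w th g -> fproj_spec g (fock_proj phi g).
Proof.
move=> lg; have [u [hu lu ou]] := projection wt lg; rewrite /fock_proj; case: xgetP => [v _ [/F2P[hv lv] ov]|/(_ u)[]].
  by split => // h hh lh; rewrite -innerphiE; apply: ov; apply/F2P.
split; first exact/F2P.
by move=> h /F2P[hh lh]; rewrite innerphiE; exact: ou.
Qed.

Lemma fprojE g u : L2w th g -> fproj_spec g u -> fock_proj phi g = u.
Proof. by move=> lg; apply: fproj_uniq => //; exact: fproj_specP. Qed.

Lemma fproj_lin g h (s : C) : L2w th g -> L2w th h ->
  fock_proj phi (fun z => g z + s * h z) = fun z => fock_proj phi g z + s * fock_proj phi h z.
Proof.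
move=> lg lh; have [hu lu ou] := fproj_specP lg; have [hv lv ov] := fproj_specP lh.
apply: fprojE; first exact: (L2w_lin _ pk).
split; last 1 first.
- move=> k hk lk; rewrite (_ : (fun z => _ - _) = fun z => (g z - fock_proj phi g z) + s * (h z - fock_proj phi h z)).
    by rewrite (wdot_linl s pk (L2w_B pk lg lu) (L2w_B pk lh lv) lk) ou// ov// mulr0 addr0.
  by apply/funext => z; ring.
- exact: hol_lin.
- exact: (L2w_lin _ pk).
Qed.

Lemma fproj_fix g : hol g -> L2w th g -> fock_proj phi g = g.
Proof.
move=> hg lg; apply: fprojE => //; split => // h _ lh; rewrite -[RHS](mul0r (wdot th g h)) /wdot -cintZ; last first.
  exact: (wdot_cI pk lg).
by apply: eq_cint => z; rewrite subrr !mul0r.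
Qed.

Lemma fproj_contr g : L2w th g -> wnorm2 th (fun z => g z - fock_proj phi g z) <= wnorm2 th g.
Proof.
move=> lg; have [hu lu ou] := fproj_specP lg; set u := fock_proj phi g in hu lu ou *.
have ld := L2w_B pk lg lu.
have -> : wnorm2 th g = wnorm2 th (fun z => (g z - u z) + 1 * u z).
  by congr (wnorm2 th); apply/funext => z; rewrite mul1r subrK.
rewrite (wnorm2_lin _ pk)// mul1r (wdotJ pk ld lu) ou// conj0 mulr0 addr0 normc1 expr1n mul1r.
by rewrite lerDl wnorm2_ge0//; exact: pk.
Qed.
End FockSpace.

(** * The twisted dbar identity *)

Section TwistedIdentity.
Variable R : realType.
Local Notation C := R[i].
Implicit Types (z a : C).

Lemma conjK (x : C) : (x^*)^* = x.
Proof. by apply: complexP; rewrite ?ReJ ?ImJ ?opprK. Qed.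
Lemma conj2 : (2 : C)^* = 2. Proof. exact: rmorph_nat. Qed.

(** With D = c_z + 2 P c, the weighted adjoint of dbar up to sign, the integrand is the sum of the derivatives of O e c_b conj c, of - O e D conj c and of conj Z e |c|^2.  The term in [r] is the commutator of dbar and D; the terms in [Y] and [Z] come from differentiating the twist [O]. *)
Lemma twisted_identity (O Z Y X e P S r c : C -> C) :
  (forall z, wirt O z (Z z) (Z z)^*) -> (forall z, wirt (fun w => (Z w)^*) z (Y z) (X z)) ->
  (forall z, wirt e z (2 * P z * e z) (2 * (P z)^* * e z)) -> (forall z, wirt P z (S z) (r z)) -> C2C c ->
  ctn e -> ctn Y -> ctn X -> ctn S -> ctn r -> csupp c \/ csupp O ->
  let E z := O z * e z * (db c z * (db c z)^*)
     - O z * e z * ((dz c z + 2 * P z * c z) * (dz c z + 2 * P z * c z)^*)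
     - 2 * r z * O z * e z * (c z * (c z)^*) + Y z * e z * (c z * (c z)^*)
     + (Z z * e z * (c z)^* * db c z + (Z z)^* * e z * c z * (db c z)^*) in
  [/\ ctn E, csupp E & cint E = 0].
Proof.
move=> hO hZ he hP hc ce cY cX cS cr sc E.
have [d1 d2 d3 d12 [cc1 cc2 cc3]] := hc; have cz := C2_dz hc; have cb := C2_db hc; have cc := C2_ctn hc.
have d2' z := d2 z; rewrite d12 in d2'.
have cZb : ctn (fun z => (Z z)^*) := ctn_wirt hZ cY cX.
have cZ : ctn Z by have := ctnJ cZb; under eq_fun do rewrite conjK.
have cO : ctn O := ctn_wirt hO cZ cZb; have cP : ctn P := ctn_wirt hP cS cr.
have cPb := ctnJ cP; have ccb := ctnJ cc; have czb := ctnJ cz; have cbb := ctnJ cb.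
pose D z := dz c z + 2 * P z * c z.
have hD z : wirt D z (dz (dz c) z + 2 * (S z * c z + P z * dz c z)) (dz (db c) z + 2 * (r z * c z + P z * db c z)).
  apply: (wirt_eq _ _ _ (wirtD (d2' z) (wirtZ 2 (wirtM (hP z) (d1 z))))) => [w||].
  - by rewrite /D mulrA.
  - by congr (_ + 2 * _); rewrite addrC.
  - by congr (_ + 2 * _); rewrite addrC.
have cD : ctn D by apply: (ctn_wirt hD); ctn_tac.
have sV (F : C -> C) : csupp (fun z => O z * (F z * (c z)^*)).
  case: sc => s; last exact: csuppMl.
  by apply: csuppMr; apply: csuppMr; apply: csupp_comp s; exact: conj0.
have hcb z := wirtJ (d1 z).
(* the three compactly supported fields; the z-derivatives of the first and the third and the conj z-derivative of the second are used *)
have h1 z := wirtM (hO z) (wirtM (wirtM (he z) (d3 z)) (hcb z)).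
have h2 z := wirtM (hO z) (wirtM (wirtM (he z) (hD z)) (hcb z)).
have h3 z := wirtM (hZ z) (wirtM (wirtM (he z) (d1 z)) (hcb z)).
have sZ : csupp c \/ csupp (fun z => (Z z)^*).
  by case: sc => s; [left|right; have [] := wirt_csupp hO s].
have s3 : csupp (fun z => (Z z)^* * (e z * c z * (c z)^*)).
  case: sZ => s; last exact: csuppMl.
  by apply: csuppMr; apply: csuppMl; exact: csuppMr.
have ctE : ctn E by rewrite /E; ctn_tac.
have [|||i1 _] := divergence h1; [ctn_tac|ctn_tac|exact: sV|].
have [|||_ i2] := divergence h2; [ctn_tac|ctn_tac|exact: sV|].
have [|||i3 _] := divergence h3; [ctn_tac|ctn_tac|exact: s3|].
have [s1 _] := wirt_csupp h1 (sV _); have [_ s2] := wirt_csupp h2 (sV _); have [{}s3 _] := wirt_csupp h3 s3.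
move: i1 i2 i3 s1 s2 s3; set p1 := (fun z => _); set p2 := (fun z => _); set p3 := (fun z => _) => i1 i2 i3 s1 s2 s3.
have c1 : ctn p1 by rewrite /p1; ctn_tac.
have c2 : ctn p2 by rewrite /p2; ctn_tac.
have c3 : ctn p3 by rewrite /p3; ctn_tac.
have EE : E = fun z => p1 z + (p3 z - p2 z).
  apply/funext => z; rewrite /E /p1 /p2 /p3 /D !conjD !conjM conj2; ring.
have s4 : csupp (fun z => - p2 z) by apply: csupp_comp s2; exact: oppr0.
have I1 := cI_csupp c1 s1; have I2 := cI_csupp c2 s2; have I3 := cI_csupp c3 s3.
split => //; first by rewrite EE; apply: csuppD => //; exact: csuppD.
rewrite EE cintD; [rewrite cintB; [|exact: I3|exact: I2]|exact: I1|exact: cIB].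
by rewrite i1 i2 i3 subr0 addr0.
Qed.
End TwistedIdentity.

Section TwistedReal.
Variable R : realType.
Local Notation C := R[i].
Local Notation Re := (@complex.Re R).
Implicit Types (z a : C).

(** The same identity with real twist [om] and weight [ee]; this is the form in which signs can be discussed. *)
Lemma twisted_real (om ee yy : C -> R) (Z X P S r c : C -> C) :
  (forall z, wirt (fun w => (om w)%:C) z (Z z) (Z z)^*) -> (forall z, wirt (fun w => (Z w)^*) z (yy z)%:C (X z)) ->
  (forall z, wirt (fun w => (ee w)%:C) z (2 * P z * (ee z)%:C) (2 * (P z)^* * (ee z)%:C)) ->
  (forall z, wirt P z (S z) (r z)) -> C2C c ->
  ctn (fun z => (ee z)%:C) -> ctn (fun z => (yy z)%:C) -> ctn X -> ctn S -> ctn r -> csupp c \/ csupp om ->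
  let E z := om z * ee z * normc (db c z) ^+ 2
     - om z * ee z * normc (dz c z + 2 * P z * c z) ^+ 2
     - 2 * Re (r z) * om z * ee z * normc (c z) ^+ 2 + yy z * ee z * normc (c z) ^+ 2
     + 2 * ee z * Re (Z z * (c z)^* * db c z) in
  rI E /\ intR E = 0.
Proof.
move=> hO hZ he hP hc ce cY cX cS cr sc E.
have sc' : csupp c \/ csupp (fun z => (om z)%:C).
  by case: sc => s; [left|right; apply: csupp_comp s].
have [cE sE iE] := twisted_identity hO hZ he hP hc ce cY cX cS cr sc'.
move: cE sE iE; set F := (fun z => _) => cE sE iE.
have EF : E = fun z => Re (F z).
  apply/funext => z; rewrite /E /F !mulJ -(mulrA 2 (r z)) -!(mulrA _ _ (ee z)%:C).
  set x := dz c z + _; set u := Z z; set v := db c z; set w := c z; set q := r z.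
  rewrite !ReD !ReN (_ : u * (ee z)%:C * w^* * v = (ee z)%:C * (u * w^* * v)); last by ring.
  rewrite (_ : u^* * (ee z)%:C * w * v^* = (ee z)%:C * (u * w^* * v)^*); last first.
    by rewrite !conjM conjK; ring.
  rewrite (_ : 2 * (q * ((om z)%:C * (ee z)%:C)) * (normc w ^+ 2)%:C = (2 * om z * ee z * normc w ^+ 2)%:C * q); last first.
    by rewrite !rmorphM /= (rmorph_nat (real_complex R)); ring.
  rewrite -!rmorphM !ReRM ReJ /=; ring.
have iF := cI_csupp cE sE; rewrite EF; split; first exact: iF.1.
by rewrite -Re_cint iE.
Qed.
End TwistedReal.

Section BumpSums.
Variables (R : realType) (a : R[i]).
Local Notation C := R[i].
Implicit Types (z : C) (f : nat -> R).

Definition bsum f i n z : R := \sum_(k < n) f k * bump a 1 (i + k) z.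
Lemma bsumS f i n z : bsum f i n.+1 z = bsum f i n z + f n * bump a 1 (i + n) z.
Proof. by rewrite /bsum big_ord_recr. Qed.
Lemma bsum0 f i z : bsum f i 0 z = 0. Proof. by rewrite /bsum big_ord0. Qed.
Lemma ctn_bsum f i n : ctn (fun z => (bsum f i n z)%:C).
Proof.
elim: n => [|n IH]; first by under eq_fun do rewrite bsum0; exact: ctn_cst.
under eq_fun do rewrite bsumS rmorphD rmorphM /=.
by apply: ctnD; [exact: IH|apply: ctnM; [exact: ctn_cst|apply: ctnR; exact: continuous_bump]].
Qed.
Lemma bsum_ge0 f i n z : (forall k, 0 <= f k) -> 0 <= bsum f i n z.
Proof. by move=> f0; apply: sumr_ge0 => k _; rewrite mulr_ge0 ?bump_ge0. Qed.

(** [Lsum] is a truncation of -log |z - a|^2 (the logarithmic twist of Ohsawa and Takegoshi): its z-derivative is - conj (z - a) [Ssum], its mixed derivative a difference of two mollifiers.  [Tsum] is the derivative of [Ssum] in |z - a|^2. *)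
Definition Lsum := bsum (fun k => k.+4%:R^-1) 4.
Definition Ssum := bsum (fun=> 1) 3.
Definition Tsum := bsum (fun k => - k.+3%:R) 2.

Lemma wirt_Lsum n z : wirt (fun w => (Lsum n w)%:C) z (- ((z - a)^* * (Ssum n z)%:C)) (- ((z - a) * (Ssum n z)%:C)).
Proof.
rewrite /Lsum /Ssum; elim: n => [|n IH].
  by apply: (wirt_eq _ _ _ (wirt_cst 0 z)) => [w||]; rewrite bsum0 ?mulr0 ?oppr0.
apply: (wirt_eq _ _ _ (wirtD IH (wirtZ (n.+4%:R^-1)%:C (wirt_bump a 1 n.+2 z)))) => [w||].
- by rewrite bsumS rmorphD -rmorphM.
- rewrite bsumS mulrA -rmorphM mul1r mulr1 mulrN mulKf ?pnatr_eq0// rmorphN rmorphD /= -[(3 + n)%N]/(n.+3); ring.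
- rewrite bsumS mulrA -rmorphM mul1r mulr1 mulrN mulKf ?pnatr_eq0// rmorphN rmorphD /= -[(3 + n)%N]/(n.+3); ring.
Qed.
Lemma wirt_Ssum n z : wirt (fun w => (w - a) * (Ssum n w)%:C) z (rho n.+2 a z - rho 2 a z)%:C
  ((z - a) * (z - a) * (Tsum n z)%:C).
Proof.
rewrite /Ssum /Tsum; elim: n => [|n IH].
  by apply: (wirt_eq _ _ _ (wirt_cst 0 z)) => [w||]; rewrite ?bsum0 ?mulr0 ?subrr.
apply: (wirt_eq _ _ _ (wirtD IH (wirtJ (wirt_conjbump n.+1 a z)))) => [w||].
- by rewrite conjM conjK conjR bsumS mul1r rmorphD mulrDr.
- by rewrite -rmorphB conjR -rmorphD; congr (_%:C); ring.
- rewrite !conjM !conjK conjR bsumS mulr1 rmorphD mulNr /=; ring.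
Qed.
(** A telescoping sum: [Ssum] behaves like 1 / |z - a|^2 without its singularity. *)
Lemma dist2_Ssum n z : dist2 a z * Ssum n z = bump a 1 3 z - bump a 1 n.+3 z.
Proof.
rewrite /Ssum; elim: n => [|n IH]; first by rewrite bsum0 mulr0 subrr.
by rewrite bsumS mul1r mulrDr IH bump_mul; ring.
Qed.
Lemma Ssum_ge0 n z : 0 <= Ssum n z. Proof. exact: bsum_ge0. Qed.
Lemma Lsum_ge0 n z : 0 <= Lsum n z. Proof. by apply: bsum_ge0 => k; rewrite invr_ge0. Qed.
Lemma dist2_Lsum n z : dist2 a z * Lsum n z <= 1.
Proof.
apply: (@le_trans _ _ (dist2 a z * Ssum n z)).
  rewrite ler_wpM2l ?dist2_ge0//; apply: ler_sum => k _.
  rewrite mul1r -[leRHS]mul1r; apply: ler_pM => //; rewrite ?invr_ge0 ?bump_ge0//.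
    by rewrite invf_le1// ler1n.
  rewrite /bump -[(4 + k)%N]/((3 + k).+1) exprS ler_piMl ?exprn_ge0 ?pp_ge0//.
  by have := bump_le1 a 1 z ler01; rewrite /bump expr1.
rewrite dist2_Ssum; have := bump_ge0 a 1 n.+3 z; have := bump_le1 a 3 z (@ler01 R); lra.
Qed.
End BumpSums.

(** * Peak functions by the Ohsawa-Takegoshi method *)

Section HarmonicSums.
Variable R : realType.
Lemma harmonic_unbounded (c : nat) (A : R) : exists N : nat, A <= \sum_(k < N) (k + c.+1)%:R^-1.
Proof.
pose S n : R := \sum_(k < n) (k + c.+1)%:R^-1.
have dbl n : (c < n)%N -> S n + 4^-1 <= S (n + n)%N.
  move=> cn; rewrite /S big_split_ord /= lerD2l.
  apply: (@le_trans _ _ (\sum_(k < n) (4 * n%:R : R)^-1)).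
    have n0 : n%:R != 0 :> R by rewrite pnatr_eq0; case: n cn.
    rewrite sumr_const card_ord -[leRHS]mulr_natr (_ : (4 * n%:R)^-1 * n%:R = 4^-1)//; by field.
  have n1 : (0 < n)%N by case: n cn.
  apply: ler_sum => k _; rewrite lef_pV2 ?posrE ?mulr_gt0 ?ltr0n ?addn_gt0 ?n1//.
  rewrite -natrM ler_nat (leq_trans (leq_add (leq_add (leqnn n) (ltnW (ltn_ord k))) cn))//.
  by rewrite addnn -mul2n -[X in (_ + X)%N]mul1n -mulnDl leq_mul2r orbT.
have dyadic j : j%:R / 4 <= S (2 ^ j * c.+1)%N.
  elim: j => [|j IH]; first by rewrite mul0r; apply: sumr_ge0 => k _; rewrite invr_ge0.
  have := dbl (2 ^ j * c.+1)%N ltac:(by rewrite leq_pmull// expn_gt0).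
  rewrite addnn -mul2n mulnA -expnS; apply: le_trans.
  by rewrite -natr1 mulrDl mul1r lerD2r.
exists (2 ^ (Num.truncn (4 * `|A|)).+1 * c.+1)%N; apply: le_trans (dyadic _).
rewrite ler_pdivlMr//; apply: le_trans (ltW (truncnS_gt _)).
by rewrite mulrC ler_wpM2l// ler_norm.
Qed.
Lemma cvgC_sq (s : nat -> R[i]) l (K : R) : 0 < K -> (forall n, normc (s n - l) ^+ 2 <= K / n.+1%:R) -> cvgC s l.
Proof.
move=> K0 H e e0; have [N HN] := lim_div_succ K0 (exprn_gt0 2 e0); exists N => n Nn.
by rewrite -(@ler_pXn2r _ 2)// ?nnegrE ?normc_ge0 ?(ltW e0)// (le_trans (H n))// HN.
Qed.
(** A linear growth cannot be dominated by a square root; the hypothesis is an explicit threshold. *)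
Lemma sqrt_linear (d A q h : R) : 0 < d -> 0 <= A -> 0 <= q -> 2 * A / d + 4 * q / d ^+ 2 + 1 <= h ->
  d * h <= A + Num.sqrt (q * h) -> False.
Proof.
move=> d0 A0 q0 Yh; have d2 : 0 < d ^+ 2 by rewrite exprn_gt0.
have a0 : 0 <= 2 * A / d by apply: divr_ge0; [exact: mulr_ge0|exact: ltW].
have b0 : 0 <= 4 * q / d ^+ 2 by apply: divr_ge0; [exact: mulr_ge0|exact: ltW].
have h1 : 1 <= h by lra.
have hA : 2 * A / d <= h by lra.
have hq : 4 * q / d ^+ 2 <= h - 1 by lra.
rewrite ler_pdivrMr// in hA; rewrite ler_pdivrMr// in hq; have h0 : 0 <= h := le_trans ler01 h1.
move=> hd; have {hd} : d * h / 2 <= Num.sqrt (q * h) by lra.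
rewrite -(@ler_pXn2r _ 2)// ?nnegrE ?sqrtr_ge0 ?divr_ge0 ?mulr_ge0 ?(ltW d0)// [in leRHS]sqr_sqrtr ?mulr_ge0// => hd.
have h2 : 4 * q * h <= (h - 1) * d ^+ 2 * h by rewrite ler_wpM2r.
have h3 : 0 < d ^+ 2 * h by rewrite mulr_gt0// (lt_le_trans ltr01).
move: hd; rewrite expr_div_n exprMn; lra.
Qed.
Lemma peak_exp_bound (m t : R) : 0 < m -> 0 <= t -> (1 + t) ^+ 3 * expR (- (m * t)) <= (1 + 3 / m) ^+ 3.
Proof.
move=> m0 t0; have mt0 : 0 <= m * t by rewrite mulr_ge0// ltW.
have h : 1 + t <= (1 + 3 / m) * expR (m * t / 3).
  apply: (@le_trans _ _ ((1 + 3 / m) * (1 + m * t / 3))).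
    rewrite (_ : (1 + 3 / m) * (1 + m * t / 3) = 1 + t + (m * t / 3 + 3 / m)); last by field; rewrite gt_eqF.
    by rewrite lerDl addr_ge0// divr_ge0// ltW.
  by rewrite ler_wpM2l ?expR_ge1Dx// addr_ge0// divr_ge0// ltW.
rewrite expRN ler_pdivrMr ?expR_gt0// (_ : m * t = 3%:R * (m * t / 3)); last by field.
have q0 : 0 <= 1 + 3 / m by rewrite addr_ge0// divr_ge0// ltW.
rewrite expRM_natl -exprMn; apply: lerXn2r; rewrite ?nnegrE//; first exact: addr_ge0.
by rewrite mulr_ge0 ?expR_ge0.
Qed.
End HarmonicSums.

Section PeakFunctions.
Variables (R : realType) (phi : R[i] -> R) (p s r : R[i] -> R[i]) (m : R) (a : R[i]).
Local Notation C := R[i].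
Local Notation Re := (@complex.Re R).
Local Notation mass := (@mass R).
Hypotheses (hphi : forall z, wirt (fun w => (phi w)%:C) z (p z) (p z)^*)
  (hp : forall z, wirt p z (s z) (r z)) (cs : ctn s) (cr : ctn r)
  (m0 : 0 < m) (hm : forall z, m <= Re (r z)).
Implicit Types (z : C) (n : nat).

(** Half of the curvature is moved into a Gaussian factor, which will supply the decay of the peak function. *)
Definition psi z : R := phi z - m / 2 * dist2 a z.
Definition ee z : R := expR (2 * psi z).
(** The twist: bounded below by 3 / m, with a truncated logarithmic pole at [a].  [domega] is its z-derivative and [kappa] the resulting weight for dbar. *)
Definition omega n z : R := 3 / m + 2^-1 * Lsum a n z.
Definition domega n z : C := - ((2^-1)%:C * ((z - a)^* * (Ssum a n z)%:C)).
Definition kappa n z : R := ee z * (omega n z + normc (domega n z) ^+ 2).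
Let cp : ctn p := ctn_wirt hp cs cr.
Let cphi : ctn (fun z => (phi z)%:C) := ctn_wirt hphi cp (ctnJ cp).

Lemma wirt_psi z : wirt (fun w => (psi w)%:C) z (p z - (m / 2)%:C * (z - a)^*) (p z - (m / 2)%:C * (z - a)^*)^*.
Proof.
apply: (wirt_eq _ _ _ (wirtB (hphi z) (wirtZ (m / 2)%:C (wirt_dist2 a z)))) => [w||].
- by rewrite -rmorphM -rmorphB.
- by [].
- by rewrite conjD conjN conjM conjR conjK.
Qed.
Lemma ctn_psi : ctn (fun z => (psi z)%:C).
Proof.
apply: (ctn_wirt wirt_psi); last apply: ctnJ.
  by apply: ctnB; [exact: cp|apply: ctnM; [exact: ctn_cst|apply: ctnJ; exact: (C2_ctn (C2_sub a))]].
by apply: ctnB; [exact: cp|apply: ctnM; [exact: ctn_cst|apply: ctnJ; exact: (C2_ctn (C2_sub a))]].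
Qed.
Lemma weight_psi : weight (fun z => expR (- 2 * psi z)).
Proof.
split=> [z|]; first exact: expR_gt0.
have ce : ctn (fun z => (- 2 * expR (- 2 * psi z))%:C).
  by under eq_fun do rewrite rmorphM /=; apply: ctnM; [exact: ctn_cst|exact: (@ctn_exp R psi _ ctn_psi)].
have cP : ctn (fun z => p z - (m / 2)%:C * (z - a)^*).
  by apply: ctnB; [exact: cp|apply: ctnM; [exact: ctn_cst|apply: ctnJ; exact: (C2_ctn (C2_sub a))]].
exists (fun z => (- 2 * expR (- 2 * psi z))%:C * (p z - (m / 2)%:C * (z - a)^*)),
  (fun z => (- 2 * expR (- 2 * psi z))%:C * (p z - (m / 2)%:C * (z - a)^*)^*); split.
- by move=> z; exact: (wirt_exp (- 2) (wirt_psi z)).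
- by apply: ctnM; [exact: ce|exact: cP].
- by apply: ctnM; [exact: ce|exact: (ctnJ cP)].
Qed.
Lemma ctn_ee : ctn (fun z => (ee z)%:C). Proof. exact: (@ctn_exp R psi _ ctn_psi). Qed.
Lemma ee_gt0 z : 0 < ee z. Proof. exact: expR_gt0. Qed.

Lemma domega_sq n z : normc (domega n z) ^+ 2 = 4^-1 * (dist2 a z * Ssum a n z ^+ 2).
Proof.
rewrite /domega normcN !normcM normc_conj !normc_real !exprMn !real_normK ?num_real// /dist2.
by rewrite (_ : 2^-1 ^+ 2 = 4^-1 :> R)//; field.
Qed.
Lemma omega_ge n z : 3 / m <= omega n z.
Proof. by rewrite lerDl mulr_ge0// Lsum_ge0. Qed.
Lemma kappa_ge0 n z : 0 <= kappa n z.
Proof.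
rewrite /kappa mulr_ge0 ?expR_ge0// addr_ge0 ?sqr_ge0//.
by apply: le_trans (omega_ge n z); rewrite divr_ge0// ltW.
Qed.
Lemma ctn_domega n : ctn (domega n).
Proof.
apply: ctnN; apply: ctnM; first exact: ctn_cst.
by apply: ctnM; [apply: ctnJ; exact: (C2_ctn (C2_sub a))|exact: ctn_bsum].
Qed.
Lemma ctn_kappa n : ctn (fun z => (kappa n z)%:C).
Proof.
rewrite (_ : (fun z => _) = fun z => (ee z)%:C * ((3 / m)%:C + (2^-1)%:C * (Lsum a n z)%:C + domega n z * (domega n z)^*)).
  apply: ctnM; first exact: ctn_ee.
  apply: ctnD; last by apply: ctnM; [exact: ctn_domega|apply: ctnJ; exact: ctn_domega].
  by apply: ctnD; [exact: ctn_cst|apply: ctnM; [exact: ctn_cst|exact: ctn_bsum]].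
by apply/funext => z; rewrite mulJ -!rmorphM -!rmorphD -rmorphM.
Qed.
(** The logarithm and the derivative of the twist are of size at most 1 / |z - a|^2, so multiplication by |z - a|^2 removes the pole uniformly in [n]. *)
Lemma kappa_bound n z : dist2 a z * (omega n z + normc (domega n z) ^+ 2) <= (3 / m + 1) * (1 + dist2 a z).
Proof.
rewrite domega_sq /omega; have := dist2_Lsum a n z; have := dist2_Ssum a n z.
have := bump_ge0 a 1 n.+3 z; have := bump_le1 a 3 z (@ler01 R); have := dist2_ge0 a z; have := Ssum_ge0 a n z.
set t := dist2 a z; set S := Ssum a n z; set L := Lsum a n z; move: (bump _ _ _ _) (bump _ _ _ _) => b c S0 t0 b1 c0 tS tL.
have q0 : 0 <= 3 / m by rewrite divr_ge0// ltW.
have tS0 : 0 <= t * S by rewrite mulr_ge0.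
have tS1 : t * S <= 1 by lra.
have h : (t * S) ^+ 2 <= 1 by rewrite expr_le1.
rewrite [leLHS](_ : _ = 3 / m * t + 2^-1 * (t * L) + 4^-1 * (t * S) ^+ 2); last by ring.
by move: (3 / m) q0 => q q0; nra.
Qed.

(** In the twisted identity the curvature term is at least 3 e |c|^2, because the curvature of [psi] is at least m / 2 and [omega] at least 3 / m; this absorbs the mollifier [rho 2] from the derivative of the twist and, after completing a square, the first-order term.  The mollifier [rho n.+2], concentrated at [a], remains on the good side. *)
Lemma ohsawa_takegoshi n (c : C -> C) : C2C c -> csupp c ->
  rI (fun z => 2^-1 * rho n.+2 a z * ee z * normc (c z) ^+ 2) /\
  intR (fun z => 2^-1 * rho n.+2 a z * ee z * normc (c z) ^+ 2) <= wnorm2 (kappa n) (db c).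
Proof.
move=> hc sc; have [d1 _ _ _ _] := hc; have cb := C2_db hc; have cc := C2_ctn hc.
have [_ sb] := csupp_dz d1 sc.
have hO z : wirt (fun w => (omega n w)%:C) z (domega n z) (domega n z)^*.
  apply: (wirt_eq _ _ _ (wirtD (wirt_cst (3 / m)%:C z) (wirtZ (2^-1)%:C (wirt_Lsum a n z)))) => [w||].
  - by rewrite -rmorphM -rmorphD.
  - by rewrite add0r mulrN.
  - by rewrite add0r mulrN /domega conjN !conjM !conjR conjK.
have hZ z : wirt (fun w => (domega n w)^*) z (2^-1 * (rho 2 a z - rho n.+2 a z))%:C
   (- ((2^-1)%:C * ((z - a) * (z - a) * (Tsum a n z)%:C))).
  apply: (wirt_eq _ _ _ (wirtN (wirtZ (2^-1)%:C (wirt_Ssum a n z)))) => [w||//].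
  - by rewrite /domega conjN !conjM !conjR conjK.
  - by rewrite -rmorphM -rmorphN; congr (_%:C); ring.
pose P z := p z - (m / 2)%:C * (z - a)^*.
have hP z : wirt P z (s z) (r z - (m / 2)%:C).
  apply: (wirt_eq _ _ _ (wirtB (hp z) (wirtZ (m / 2)%:C (wirtJ (wirt_sub a z))))) => [//||].
  - by rewrite conj0 mulr0 subr0.
  - by rewrite conj1 mulr1.
have he z : wirt (fun w => (ee w)%:C) z (2 * P z * (ee z)%:C) (2 * (P z)^* * (ee z)%:C).
  apply: (wirt_eq _ _ _ (wirt_exp 2 (wirt_psi z))) => [//||];
  by rewrite rmorphM (rmorph_nat (real_complex R)) mulrAC.
have cX : ctn (fun z => - ((2^-1)%:C * ((z - a) * (z - a) * (Tsum a n z)%:C))).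
  have csub : ctn (fun z => z - a) := C2_ctn (C2_sub a).
  by apply: ctnN; apply: ctnM; [exact: ctn_cst|apply: ctnM; [apply: ctnM|exact: ctn_bsum]].
have cY : ctn (fun z => (2^-1 * (rho 2 a z - rho n.+2 a z))%:C).
  under eq_fun do rewrite rmorphM rmorphB /=.
  by apply: ctnM; [exact: ctn_cst|apply: ctnB; apply: ctnR; exact: continuous_rho].
have cr' : ctn (fun z => r z - (m / 2)%:C) by apply: ctnB; [exact: cr|exact: ctn_cst].
have [iE E0] := twisted_real hO hZ he hP hc ctn_ee cY cX cs cr' (or_introl sc).
have i1 : rI (fun z => 2^-1 * rho n.+2 a z * ee z * normc (c z) ^+ 2).
  apply: rI_csupp; last by have [q H] := sc; exists q => z /H ->; rewrite normc0 expr0n mulr0.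
  apply: ctnRr; rewrite (_ : (fun z => _) = fun z => (2^-1)%:C * (rho n.+2 a z)%:C * (ee z)%:C * (c z * (c z)^*)).
    apply: ctnM; last by apply: ctnM; [exact: cc|exact: ctnJ].
    by apply: ctnM; [apply: ctnM; [exact: ctn_cst|apply: ctnR; exact: continuous_rho]|exact: ctn_ee].
  by apply/funext => z; rewrite mulJ -!rmorphM.
have i2 : rI (fun z => normc (db c z) ^+ 2 * kappa n z).
  apply: rI_csupp; last by have [q H] := sb; exists q => z /H ->; rewrite normc0 expr0n mul0r.
  apply: ctnRr; rewrite (_ : (fun z => _) = fun z => (db c z * (db c z)^*) * (kappa n z)%:C).
    by apply: ctnM; [apply: ctnM; [exact: cb|exact: ctnJ]|exact: ctn_kappa].
  by apply/funext => z; rewrite mulJ -!rmorphM.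
split => //; rewrite -subr_ge0 -[leRHS]subr0 -[X in _ - X]E0 /wnorm2 -intRB// -intRB//; last exact: rIB.
apply: intR_ge0 => z; rewrite /kappa.
have := omega_ge n z; have := hm z; have := ee_gt0 z; have := bump_le1 a 2 z (@ler01 R); rewrite -/(rho 2 a z) [rho 2 a z]/rho.
rewrite ReD ReN /=; set om := omega n z; set e := ee z; set D := normc (dz c z + _); set A := normc (db c z); set B := normc (c z).
have := Re_le (domega n z * (c z)^* * db c z); rewrite !normcM normc_conj -/A -/B.
set Zn := normc (domega n z); set x := Re (_ * db c z); set q := Re (r z); set b := bump _ _ _ _; set rr := rho _ _ _.
move=> hx b1 e0 hq hom; have hx' := le_trans (ler_norm x) hx.
have om0 : 0 <= om by apply: le_trans hom; rewrite divr_ge0// ltW.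
(* the curvature of psi times the lower bound of the twist: 2 (m / 2) (3 / m) = 3 *)
have h1 : 3 <= 2 * (q - m / 2) * om.
  have h2 : m * (3 / m) <= 2 * (q - m / 2) * om by apply: ler_pM => //; [exact: ltW|rewrite divr_ge0// ltW|lra].
  by move: h2; rewrite mulrC divfK// gt_eqF.
have B2 := sqr_ge0 B; have D2 : 0 <= om * D ^+ 2 by rewrite mulr_ge0// sqr_ge0.
have h3 : 3 * B ^+ 2 <= 2 * (q - m / 2) * om * B ^+ 2 by rewrite ler_wpM2r.
(* the square that absorbs the first-order term 2 Re (Z conj c c_b) *)
have h4 := sqr_ge0 (Zn * A - B).
have h5 : b * B ^+ 2 <= B ^+ 2 by rewrite ler_piMl.
have -> : A ^+ 2 * (e * (om + Zn ^+ 2)) - 2^-1 * rr * e * B ^+ 2 - (om * e * A ^+ 2 - om * e * D ^+ 2 - 2 * (q - m / 2) * om * e * B ^+ 2 + 2^-1 * (3 * b - rr) * e * B ^+ 2 + 2 * e * x)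
  = e * (Zn ^+ 2 * A ^+ 2 + om * D ^+ 2 + 2 * (q - m / 2) * om * B ^+ 2 - 2^-1 * 3 * (b * B ^+ 2) - 2 * x) by ring.
apply: mulr_ge0; [exact: ltW|]; have : Zn * B * A = (Zn * A) * B by ring.
move: (2 * _ * om * _) h3 => y h3; move: (om * _) D2 => w D2; move: (b * _) h5 => v h5.
move=> e1; rewrite e1 in hx'; rewrite -exprMn; move: (Zn * A) hx' h4 => u hx' h4; lra.
Qed.

(** The weight of the Fock space times (1 + |z - a|^2)^2: finiteness of this norm is the decay of the peak function away from [a]. *)
Definition peak_weight z : R := fweight phi z * (1 + dist2 a z) ^+ 2.
Definition peakC : R := (3 / m + 1) * (1 + 3 / m) ^+ 3.

Lemma weight_peak : weight peak_weight.
Proof.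
split=> [z|]; first by rewrite mulr_gt0 ?expR_gt0// exprn_gt0// ltr_wpDr ?dist2_ge0.
have cE : ctn (fun z => (expR (- 2 * phi z))%:C) := @ctn_exp R phi _ cphi.
have cE2 : ctn (fun z => (- 2 * expR (- 2 * phi z))%:C).
  by under eq_fun do rewrite rmorphM /=; apply: ctnM; [exact: ctn_cst|exact: cE].
have cN : ctn (fun z => 1 + (dist2 a z)%:C) by apply: ctnD; [exact: ctn_cst|apply: ctnR; exact: continuous_dist2].
have csub : ctn (fun z => z - a) := C2_ctn (C2_sub a).
have hN z : wirt (fun w => 1 + (dist2 a w)%:C) z (z - a)^* (z - a).
  by apply: (wirt_eq _ _ _ (wirtD (wirt_cst 1 z) (wirt_dist2 a z))) => [//||]; rewrite add0r.
have h z := wirtM (wirt_exp (- 2) (hphi z)) (wirtM (hN z) (hN z)).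
eexists; eexists; split.
- move=> z; apply: (wirt_eq _ _ _ (h z)); [|reflexivity|reflexivity].
  by move=> w; rewrite /peak_weight /fweight -mulNr -[1 + _]/(1%:C + (dist2 a w)%:C) -rmorphD -!rmorphM expr2.
- have cpb := ctnJ cp; have csb := ctnJ csub; rewrite /=; ctn_tac.
- have cpb := ctnJ cp; have csb := ctnJ csub; rewrite /=; ctn_tac.
Qed.

(** The Gaussian factor exp(- m |z - a|^2) that separates [psi] from [phi] beats the polynomial factors. *)
Lemma peak_weight_kappa n z : dist2 a z * kappa n z * peak_weight z <= peakC.
Proof.
have t0 := dist2_ge0 a z; rewrite /kappa /peak_weight /ee.
have -> : dist2 a z * (expR (2 * psi z) * (omega n z + normc (domega n z) ^+ 2)) * (expR (- (2 * phi z)) * (1 + dist2 a z) ^+ 2)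
   = dist2 a z * (omega n z + normc (domega n z) ^+ 2) * (expR (2 * psi z) * expR (- (2 * phi z)) * (1 + dist2 a z) ^+ 2) by ring.
rewrite -expRD (_ : 2 * psi z + - (2 * phi z) = - (m * dist2 a z)); last by rewrite /psi; field.
apply: (@le_trans _ _ ((3 / m + 1) * (1 + dist2 a z) * (expR (- (m * dist2 a z)) * (1 + dist2 a z) ^+ 2))).
  by rewrite ler_wpM2r ?kappa_bound// mulr_ge0 ?expR_ge0 ?sqr_ge0.
rewrite /peakC -mulrA ler_wpM2l//; first by rewrite addr_ge0// divr_ge0// ltW.
have := peak_exp_bound m0 t0; congr (_ <= _); ring.
Qed.

Lemma peak_weight_le z : dist2 a z <= 1 -> peak_weight z <= 4 * expR (- 2 * psi z).
Proof.
move=> t1; have t0 := dist2_ge0 a z; rewrite /peak_weight mulrC; apply: ler_pM; rewrite ?sqr_ge0 ?expR_ge0//.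
  have : (1 + dist2 a z) ^+ 2 <= 2 ^+ 2 by rewrite lerXn2r ?nnegrE//; lra.
  by move/le_trans; apply; lra.
by rewrite ler_expR /psi; have := mulr_ge0 (ltW m0) t0; lra.
Qed.

(** The functional approximates the evaluation of [c] at [a], and it is bounded in terms of dbar c alone: this is the estimate that solves the dbar-equation with a point singularity. *)
Lemma delta_functional_bound n (c : C -> C) : C2C c -> csupp c ->
  normc (cint (fun z => (rho n.+2 a z)%:C * c z)) ^+ 2 <=
    2 * intR (fun z => expR (- 2 * psi z) * rho n.+2 a z) * wnorm2 (kappa n) (db c).
Proof.
move=> hc sc; have [i1 le1] := ohsawa_takegoshi n hc sc; have i2 := rI_wrho n.+1 a weight_psi.
have cc := C2_ctn hc; have crho : ctn (fun z => (rho n.+2 a z)%:C) by apply: ctnR; exact: continuous_rho.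
have iL : cI (fun z => (rho n.+2 a z)%:C * c z).
  by apply: cI_csupp; [apply: ctnM; [exact: crho|exact: cc]|apply: csuppMr; exact: sc].
have [|||| _ h] := @pointwise_CS R (fun z => 2^-1 * rho n.+2 a z * ee z * normc (c z) ^+ 2)
     (fun z => 2 * (expR (- 2 * psi z) * rho n.+2 a z)) (fun z => rho n.+2 a z * normc (c z)) _ _ _ _ i1 (rIZ 2 i2).
- by apply: measurable_funM; [apply: continuous_measurableC; exact: continuous_rho|apply: mnormc; exact: ctn_measurable].
- move=> z; apply: mulr_ge0; last exact: sqr_ge0.
  apply: mulr_ge0; last by apply: ltW; exact: ee_gt0.
  by apply: mulr_ge0 => //; exact: rho_ge0.
- by move=> z; apply: mulr_ge0 => //; apply: mulr_ge0; [exact: expR_ge0|exact: rho_ge0].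
- move=> z; rewrite le_eqVlt; apply/orP; left; apply/eqP.
  rewrite mulNr expRN -/(ee z); have := ee_gt0 z; move: (ee z) (rho _ _ _) (normc _) => e x y e0; field.
  by rewrite gt_eqF.
rewrite mulrC; apply: (@le_trans _ _ (intR (fun z => rho n.+2 a z * normc (c z)) ^+ 2)).
  have x0 : 0 <= intR (fun z => rho n.+2 a z * normc (c z)).
    by apply: intR_ge0 => z; rewrite mulr_ge0 ?rho_ge0 ?normc_ge0.
  rewrite lerXn2r ?nnegrE ?normc_ge0//; apply: (le_trans (normc_cint iL)).
  rewrite le_eqVlt; apply/orP; left; apply/eqP; congr intR; apply/funext => z.
  by rewrite normcM normc_real ger0_norm ?rho_ge0.
apply: (le_trans h); rewrite intRZ//; apply: ler_wpM2r => //.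
by apply: mulr_ge0 => //; apply: intR_ge0 => z; apply: mulr_ge0; [exact: expR_ge0|exact: rho_ge0].
Qed.

Lemma L2w_csupp (ka : C -> R) (F : C -> C) : ctn (fun z => (ka z)%:C) -> ctn F -> csupp F -> L2w ka F.
Proof.
move=> ck cF sF; split; first by apply: ctn_measurable; exact: cF.
apply: rI_csupp; last by have [q H] := sF; exists q => z /H ->; rewrite normc0 expr0n mul0r.
apply: ctnRr; rewrite (_ : (fun z => _) = fun z => (F z * (F z)^*) * (ka z)%:C).
  by apply: ctnM; [apply: ctnM; [exact: cF|apply: ctnJ; exact: cF]|exact: ck].
by apply/funext => z; rewrite mulJ -!rmorphM.
Qed.
Lemma kappa_pweight n : pweight (kappa n).
Proof.
split; first exact: kappa_ge0.
by apply: continuous_measurableC; apply: ctnRr; exact: ctn_kappa.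
Qed.

(** If [v] represents the functional, then [weak_sol n v] solves dbar u = - rho weakly; [peak_approx] multiplies it by z - a and corrects by a cut-off, so that the value at [a] stays 1 while the function becomes holomorphic. *)
Definition weak_sol n (v : C -> C) z : C := (v z)^* * (kappa n z)%:C.
Definition peak_approx n (v : C -> C) z : C := (bump a 1 n.+3 z)%:C - (z - a) * weak_sol n v z.

Lemma weak_sol_sq n v z : dist2 a z * normc (weak_sol n v z) ^+ 2 * peak_weight z <= peakC * (normc (v z) ^+ 2 * kappa n z).
Proof.
rewrite /weak_sol normcM normc_conj normc_real exprMn real_normK ?num_real//.
rewrite (_ : dist2 a z * (normc (v z) ^+ 2 * kappa n z ^+ 2) * peak_weight z = dist2 a z * kappa n z * peak_weight z * (normc (v z) ^+ 2 * kappa n z)); last by ring.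
rewrite ler_wpM2r ?peak_weight_kappa//; apply: mulr_ge0; [exact: sqr_ge0|exact: kappa_ge0].
Qed.
Lemma ctn_weak_sol n v : ctn v -> ctn (fun z => (z - a) * weak_sol n v z).
Proof.
move=> cv; apply: ctnM; first exact: (C2_ctn (C2_sub a)).
by apply: ctnM; [apply: ctnJ; exact: cv|exact: ctn_kappa].
Qed.
Lemma csupp_weak_sol n v : csupp v -> csupp (fun z => (z - a) * weak_sol n v z).
Proof. by move=> [q H]; exists q => z /H vz; rewrite /weak_sol vz conj0 mul0r mulr0. Qed.
Lemma ctn_peak_weight : ctn (fun z => (peak_weight z)%:C). Proof. exact: weight_ctn weight_peak. Qed.

Lemma peak_approx_L2 n v : ctn v -> csupp v -> L2w peak_weight (peak_approx n v).
Proof.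
move=> cv sv; apply: L2w_csupp; first exact: ctn_peak_weight.
  by apply: ctnB; [apply: ctnR; exact: continuous_bump|exact: ctn_weak_sol].
apply: csuppD; first exact: csupp_bumpC.
by apply: csupp_comp (csupp_weak_sol n sv); exact: oppr0.
Qed.
(** Only the weak solution depends on [v]; so a Cauchy sequence of representatives gives a Cauchy sequence of approximants. *)
Lemma peak_approx_diff n v v' : ctn v -> csupp v -> ctn v' -> csupp v' ->
  wnorm2 peak_weight (fun z => peak_approx n v z - peak_approx n v' z) <= peakC * wnorm2 (kappa n) (fun z => v z - v' z).
Proof.
move=> cv sv cv' sv'; have lv := L2w_csupp (@ctn_kappa n) cv sv; have lv' := L2w_csupp (@ctn_kappa n) cv' sv'.
have ld := L2w_B (kappa_pweight n) lv lv'; have lp := weight_pweight weight_peak.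
have lw := L2w_B lp (peak_approx_L2 n cv sv) (peak_approx_L2 n cv' sv').
rewrite /wnorm2 -intRZ; last exact: ld.2.
apply: intR_le; [exact: lw.2|apply: rIZ; exact: ld.2|move=> z].
apply: le_trans (weak_sol_sq n (fun z => v z - v' z) z).
rewrite (_ : peak_approx n v z - peak_approx n v' z = - ((z - a) * weak_sol n (fun z => v z - v' z) z)); last first.
  by rewrite /peak_approx /weak_sol conjD conjN; ring.
by rewrite normcN normcM exprMn.
Qed.
Lemma peak_approx_bound n v : ctn v -> csupp v ->
  wnorm2 peak_weight (peak_approx n v) <= 8 * intR (fun z => expR (- 2 * psi z) * rho n.+2 a z) + 2 * peakC * wnorm2 (kappa n) v.
Proof.
move=> cv sv; have lv := L2w_csupp (@ctn_kappa n) cv sv; have lw := peak_approx_L2 n cv sv.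
have i2 := rI_wrho n.+1 a weight_psi.
rewrite /wnorm2 -!intRZ//; last exact: lv.2.
rewrite -intRD; [|exact: rIZ|apply: rIZ; exact: lv.2].
apply: intR_le; [exact: lw.2|apply: rID; apply: rIZ; [exact: i2|exact: lv.2]|move=> z].
have h := weak_sol_sq n v z; have p0 : 0 <= peak_weight z by apply: ltW; exact: weight_peak.1.
rewrite /peak_approx; set b := bump a 1 n.+3 z; set y := (z - a) * weak_sol n v z.
have h1 : normc (b%:C - y) ^+ 2 <= 2 * b ^+ 2 + 2 * normc y ^+ 2.
  have := le_normcB b%:C y; rewrite normc_real => h1.
  have h2 : normc (b%:C - y) ^+ 2 <= (`|b| + normc y) ^+ 2.
    by rewrite lerXn2r ?nnegrE ?addr_ge0 ?normc_ge0.
  have : b ^+ 2 = `|b| ^+ 2 by rewrite real_normK ?num_real.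
  by have := sqr_ge0 (`|b| - normc y); move=> h3 h4; rewrite h4; lra.
have h2 : b ^+ 2 * peak_weight z <= 4 * (expR (- 2 * psi z) * rho n.+2 a z).
  have [t1|t1] := leP (dist2 a z) 1; last first.
    rewrite /b bump0 ?mul1r ?(ltW t1)// expr0n mul0r.
    by apply: mulr_ge0 => //; apply: mulr_ge0; [exact: expR_ge0|exact: rho_ge0].
  rewrite mulrC mulrA; apply: ler_pM => //; [exact: sqr_ge0|exact: peak_weight_le|].
  have b0 : 0 <= b by exact: bump_ge0. have b1 : b <= 1 by exact: bump_le1.
  rewrite /rho; apply: (@le_trans _ _ (bump a 1 n.+2 z)); last by rewrite ler_peMl ?bump_ge0// ler1n.
  apply: (@le_trans _ _ b); first by rewrite expr2 ler_piMl.
  rewrite /b /bump exprS ler_piMl ?exprn_ge0 ?pp_ge0//.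
  by have := bump_le1 a 1 z (@ler01 R); rewrite /bump expr1.
have h3 : normc y ^+ 2 * peak_weight z <= peakC * (normc (v z) ^+ 2 * kappa n z).
  by apply: le_trans h; rewrite /y normcM exprMn.
apply: (@le_trans _ _ ((2 * b ^+ 2 + 2 * normc y ^+ 2) * peak_weight z)); first by rewrite ler_wpM2r.
lra.
Qed.
(** Measures the failure of holomorphy: it is the defect of [v] as a representative of the functional on (z - a) F. *)
Lemma peak_approx_test n v F : C2C F -> csupp F -> ctn v -> csupp v ->
  cint (fun z => peak_approx n v z * db F z) =
  cint (fun z => (rho n.+2 a z)%:C * ((z - a) * F z)) - wdot (kappa n) (db (fun z => (z - a) * F z)) v.
Proof.
move=> hF sF cv sv; have [d1 _ _ _ _] := hF; have cF := C2_ctn hF; have cz := C2_dz hF; have cb := C2_db hF.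
have [_ sb] := csupp_dz d1 sF; have csub : ctn (fun z => z - a) := C2_ctn (C2_sub a).
have cbm k : ctn (fun z => (bump a 1 k z)%:C) by apply: ctnR; exact: continuous_bump.
have hd z : db (fun z => (z - a) * F z) z = (z - a) * db F z.
  by rewrite (dbE (wirtM (wirt_sub a z) (d1 z))) mul0r addr0.
have crho : ctn (fun z => (rho n.+2 a z)%:C) by apply: ctnR; exact: continuous_rho.
have [|||_ i0] := divergence (fun z => wirtM (wirt_bump a 1 n.+1 z) (d1 z)).
- by have := cbm n.+3; have := cbm n.+2; have csj := ctnJ csub => c1 c2; ctn_tac.
- by have := cbm n.+3; have := cbm n.+2 => c1 c2; ctn_tac.
- by apply: csuppMr; exact: sF.
have i1 : cI (fun z => (bump a 1 n.+3 z)%:C * db F z).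
  by apply: cI_csupp; [apply: ctnM; [exact: cbm|exact: cb]|apply: csuppMr; exact: sb].
have i2 : cI (fun z => (z - a) * weak_sol n v z * db F z).
  by apply: cI_csupp; [apply: ctnM; [exact: ctn_weak_sol|exact: cb]|apply: csuppMr; exact: sb].
have i3 : cI (fun z => (rho n.+2 a z)%:C * ((z - a) * F z)).
  apply: cI_csupp; last by apply: csuppMr; apply: csuppMr; exact: sF.
  by apply: ctnM; [exact: crho|apply: ctnM; [exact: csub|exact: cF]].
have -> : wdot (kappa n) (db (fun z => (z - a) * F z)) v = cint (fun z => (z - a) * weak_sol n v z * db F z).
  by apply: eq_cint => z; rewrite hd /weak_sol; ring.
have {}i0 : cint (fun z => (bump a 1 n.+3 z)%:C * db F z) - cint (fun z => (rho n.+2 a z)%:C * ((z - a) * F z)) = 0.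
  rewrite -cintB// -[RHS]i0; apply: eq_cint => z; rewrite /rho mulr1 rmorphN; ring.
rewrite -[X in _ = X - _]addr0 -i0 addrCA subrr addr0 -cintB//.
by apply: eq_cint => z; rewrite /peak_approx mulrBl.
Qed.

Lemma bump_lip n z : 1 - bump a 1 n z <= n%:R * dist2 a z.
Proof.
have t0 := dist2_ge0 a z; elim: n => [|n IH]; first by rewrite /bump expr0 subrr mul0r.
rewrite /bump exprS -/(bump a 1 n z); have := bump_ge0 a 1 n z; have := bump_le1 a n z (@ler01 R).
have : 1 - dist2 a z <= pp (1 - 1 * dist2 a z) by rewrite mul1r /pp le_max lexx.
set x := pp _; set b := bump a 1 n z in IH *; set t := dist2 a z in IH t0 * => x1 b1 b0.
have h1 : 0 <= b * (x - (1 - t)) by rewrite mulr_ge0// subr_ge0.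
have h2 : 0 <= (1 - b) * t by rewrite mulr_ge0// subr_ge0.
rewrite -[n.+1%:R]natr1; lra.
Qed.

(** The integral of [Ssum], a partial harmonic sum times [mass]; it tends to infinity, which is what makes the test against [Ssum] sensitive to the value at [a]. *)
Definition hsum N : R := \sum_(k < N) mass / k.+4%:R.
Lemma cint_Ssum N (w : C -> C) : locI w ->
  cint (fun z => w z * (Ssum a N z)%:C) = \sum_(k < N) (k.+4%:R^-1)%:C * cint (fun z => w z * (rho k.+3 a z)%:C).
Proof.
move=> lw; rewrite (_ : (fun z => _) = fun z => \sum_(k < N) (k.+4%:R^-1)%:C * (w z * (rho k.+3 a z)%:C)).
  rewrite cint_sum; first by apply: eq_bigr => k _; rewrite cintZ//; exact: cI_rho.
  by move=> k; apply: cIZ; exact: cI_rho.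
apply/funext => z; rewrite /Ssum /bsum rmorph_sum mulr_sumr; apply: eq_bigr => k _.
rewrite mul1r (_ : bump a 1 (3 + k) z = k.+4%:R^-1 * rho k.+3 a z); last by rewrite /rho mulKf ?pnatr_eq0.
by rewrite rmorphM /=; ring.
Qed.
Lemma int_Ssum N : intR (Ssum a N) = hsum N /\ rI (Ssum a N).
Proof.
have e : Ssum a N = fun z => \sum_(k < N) k.+4%:R^-1 * rho k.+3 a z.
  by apply/funext => z; apply: eq_bigr => k _; rewrite /rho mulKf ?pnatr_eq0// mul1r.
rewrite e; split; last by apply: rI_sum => k; apply: rIZ; exact: rI_rho.
rewrite intR_sum; last by move=> k; apply: rIZ; exact: rI_rho.
by apply: eq_bigr => k _; rewrite intRZ ?rho_int 1?mulrC//; exact: rI_rho.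
Qed.
Lemma dist2_Ssum_le1 N z : dist2 a z * Ssum a N z <= isq a 1 z.
Proof.
rewrite dist2_Ssum; have [t1|t1] := leP (normc (z - a)) 1.
  by rewrite isq1//; have := bump_ge0 a 1 N.+3 z; have := bump_le1 a 3 z (@ler01 R); lra.
by rewrite !bump0 ?subrr ?isq_ge0// mul1r /dist2 expr_ge1 ?normc_ge0 ?ltW.
Qed.
Lemma Ssum_out N z : 1 < normc (z - a) -> Ssum a N z = 0.
Proof.
by move=> t1; apply: big1 => k _; rewrite bump0 ?mulr0// mul1r /dist2 expr_ge1 ?normc_ge0 ?ltW.
Qed.

(** Tested against the almost singular kernel [Ssum], the cut-off gives [hsum] up to a constant, and the weak solution, multiplied by z - a, contributes only the square root of [hsum]. *)
Lemma peak_approx_kernel n : exists A1 A2 : R, [/\ 0 < A1, 0 < A2 & forall N v, ctn v -> csupp v ->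
  normc (cint (fun z => peak_approx n v z * (Ssum a N z)%:C) - (hsum N)%:C) <= A1 + Num.sqrt (A2 * wnorm2 (kappa n) v * hsum N)].
Proof.
have [A2 A20 HA2] := ctn_bounded (normc a + 1) (@ctn_kappa n).
exists (n.+3%:R * 4), A2; split => // N v cv sv.
have [hE iS] := int_Ssum N; have cS : ctn (fun z => (Ssum a N z)%:C) by exact: ctn_bsum.
have sS : csupp (fun z => (Ssum a N z)%:C).
  by exists (normc a + 1) => z zr; rewrite Ssum_out//; have := lerB_normc z a; lra.
have lv := L2w_csupp (@ctn_kappa n) cv sv.
have cb : ctn (fun z => (bump a 1 n.+3 z)%:C) by apply: ctnR; exact: continuous_bump.
have i1 : cI (fun z => ((bump a 1 n.+3 z)%:C - 1) * (Ssum a N z)%:C).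
  by apply: cI_csupp; [apply: ctnM; [apply: ctnB; [exact: cb|exact: ctn_cst]|exact: cS]|apply: csuppMr; exact: sS].
have i2 : cI (fun z => (z - a) * weak_sol n v z * (Ssum a N z)%:C).
  by apply: cI_csupp; [apply: ctnM; [exact: ctn_weak_sol|exact: cS]|apply: csuppMr; exact: sS].
have i3 : cI (fun z => (Ssum a N z)%:C) by apply: cI_csupp.
have -> : cint (fun z => peak_approx n v z * (Ssum a N z)%:C) - (hsum N)%:C =
   cint (fun z => ((bump a 1 n.+3 z)%:C - 1) * (Ssum a N z)%:C) - cint (fun z => (z - a) * weak_sol n v z * (Ssum a N z)%:C).
  rewrite -hE -cintR -!cintB//; first by apply: eq_cint => z; rewrite /peak_approx; ring.
  have -> : (fun z => peak_approx n v z * (Ssum a N z)%:C) = fun z => ((bump a 1 n.+3 z)%:C - 1) * (Ssum a N z)%:C - (z - a) * weak_sol n v z * (Ssum a N z)%:C + (Ssum a N z)%:C.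
    by apply/funext => z; rewrite /peak_approx; ring.
  by apply: cID => //; exact: cIB.
apply: (le_trans (le_normcB _ _)); apply: lerD.
  apply: (le_trans (normc_cint i1)); rewrite (_ : 4 = intR (isq a 1)); last by rewrite intR_sq//; ring.
  rewrite -intRZ; last exact: rI_sq.
  apply: intR_le; [exact: cI_norm|by apply: rIZ; exact: rI_sq|move=> z].
  rewrite normcM -rmorphB !normc_real distrC ger0_norm; last by rewrite subr_ge0 bump_le1.
  rewrite (ger0_norm (Ssum_ge0 _ _ _)); apply: (@le_trans _ _ (n.+3%:R * dist2 a z * Ssum a N z)).
    by rewrite ler_wpM2r ?Ssum_ge0// bump_lip.
  by rewrite -mulrA ler_wpM2l// dist2_Ssum_le1.
rewrite -ler_sqr ?nnegrE ?normc_ge0 ?sqrtr_ge0//.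
have h0 : 0 <= hsum N by rewrite -hE; apply: intR_ge0 => z; exact: Ssum_ge0.
have q0 := wnorm2_ge0 v (kappa_pweight n).
rewrite [in leRHS]sqr_sqrtr; last by apply: mulr_ge0 => //; apply: mulr_ge0 => //; exact: ltW.
have [|||| _ h] := @pointwise_CS R (fun z => normc (v z) ^+ 2 * kappa n z) (fun z => A2 * Ssum a N z)
   (fun z => normc ((z - a) * weak_sol n v z * (Ssum a N z)%:C)) _ _ _ _ lv.2 (rIZ A2 iS).
- by apply: mnormc; apply: ctn_measurable; apply: ctnM; [exact: ctn_weak_sol|exact: cS].
- by move=> z; apply: mulr_ge0; [exact: sqr_ge0|exact: kappa_ge0].
- by move=> z; rewrite mulr_ge0 ?Ssum_ge0// ltW.
- move=> z; have [t1|t1] := leP (normc (z - a)) 1; last first.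
    by rewrite Ssum_out// mulr0 normc0 expr0n !mulr0.
  rewrite /weak_sol !normcM normc_conj !normc_real (ger0_norm (kappa_ge0 n z)) (ger0_norm (Ssum_ge0 _ _ _)).
  have := HA2 z _; rewrite normc_real (ger0_norm (kappa_ge0 n z)) => /(_ _)/Wrap[].
    by rewrite -(subrK a z) (le_trans (le_normcD _ _))// addrC lerD2l.
  move=> kA; have tS := dist2_Ssum_le1 N z; rewrite isq1// /dist2 in tS.
  have S0 := Ssum_ge0 a N z; have k0 := kappa_ge0 n z.
  set V := normc (v z); set k := kappa n z in kA k0 *; set S := Ssum a N z in tS S0 *; set t := normc (z - a) in tS *.
  rewrite (_ : (t * (V * k) * S) ^+ 2 = (V ^+ 2 * k) * (k * ((t ^+ 2 * S) * S))); last by ring.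
  have V0 : 0 <= V ^+ 2 * k by apply: mulr_ge0 => //; exact: sqr_ge0.
  rewrite ler_wpM2l//; apply: ler_pM => //; last by rewrite ler_piMl.
  by apply: mulr_ge0 => //; apply: mulr_ge0 => //; exact: sqr_ge0.
have x0 : 0 <= intR (fun z => normc ((z - a) * weak_sol n v z * (Ssum a N z)%:C)) by apply: intR_ge0 => z; exact: normc_ge0.
apply: (@le_trans _ _ (intR (fun z => normc ((z - a) * weak_sol n v z * (Ssum a N z)%:C)) ^+ 2)).
  by rewrite lerXn2r ?nnegrE ?normc_ge0//; exact: normc_cint.
apply: (le_trans h); rewrite intRZ// hE /wnorm2; rewrite le_eqVlt; apply/orP; left; apply/eqP; ring.
Qed.

(** Take the weak limit of [peak_approx] along representatives of the functional supplied by [riesz].  To see that the value at [a] is 1, test against [Ssum]: the error grows at most like the square root of the partial harmonic sums, while W(a) - 1 is multiplied by these sums. *)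
Theorem peak_function : exists W : C -> C,
  [/\ hol W, W a = 1, L2w peak_weight W & wnorm2 peak_weight W <= (32 + 64 * peakC) * mass * expR (- (2 * phi a))].
Proof.
(* the index n only has to be large enough for the mean of exp(-2 psi) to be at most twice its value *)
have [n0 HN0] := weight_approx (normc a) weight_psi.
have [n HN] : exists n, intR (fun z => expR (- 2 * psi z) * rho n.+2 a z) <= 2 * mass * expR (- 2 * psi a).
  by exists n0; apply: (HN0 n0.+1 (leqW (leqnn _)) a); exact: lexx.
rewrite /(psi a) dist2_self mulr0 subr0 mulNr in HN; set ea := expR (- (2 * phi a)) in HN *.
have m1 := mass_gt0 R; have ea0 : 0 < ea by exact: expR_gt0.
set I := intR _ in HN; pose K : R := 4 * mass * ea; have K0 : 0 < K by rewrite /K !mulr_gt0.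
have C0 : 0 < peakC by rewrite /peakC mulr_gt0// ?exprn_gt0// addr_gt0// divr_gt0.
have pk := kappa_pweight n; have ppw := weight_pweight weight_peak.
pose X := {c : C -> C | C2C c /\ csupp c}; pose V (x : X) := proj1_sig x; pose T (x : X) := db (V x).
have hV x : C2C (V x) := (proj2_sig x).1; have sV x : csupp (V x) := (proj2_sig x).2.
have dV x : diff (V x) by have [] := hV x.
have cT x : ctn (T x) := C2_db (hV x); have sT x : csupp (T x) := (csupp_dz (dV x) (sV x)).2.
pose L x := cint (fun z => (rho n.+2 a z)%:C * V x z).
have lT x : L2w (kappa n) (T x) := L2w_csupp (@ctn_kappa n) (@cT x) (sT x).
have iL x : cI (fun z => (rho n.+2 a z)%:C * V x z).
  apply: cI_csupp; last by apply: csuppMr; exact: sV.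
  by apply: ctnM; [apply: ctnR; exact: continuous_rho|exact: C2_ctn].
have t0 : C2C (fun _ : C => 0 : C) /\ csupp (fun _ : C => 0 : C) by split; [exact: C2_cst|exists 0].
have [||x_ [xB xC xE]] := riesz (X := X) (T := T) (L := L) (exist (fun c : C -> C => C2C c /\ csupp c) _ t0) pk _ lT K0.
- move=> x y b; have hz : C2C (fun w => V x w + b * V y w) /\ csupp (fun w => V x w + b * V y w).
    by split; [apply: C2D; [|apply: C2Z]; exact: hV|apply: csuppD; [|apply: csuppMr]; exact: sV].
  exists (exist (fun c : C -> C => C2C c /\ csupp c) _ hz); split.
    by move=> w; exact: (dbE (wirtD (dV x w) (wirtZ b (dV y w)))).
  rewrite /L -(cintZ b (iL y)) -(cintD (iL x) (cIZ b (iL y))).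
  by apply: eq_cint => z /=; ring.
- move=> x; apply: (le_trans (delta_functional_bound n (hV x) (sV x))); rewrite -/I; apply: ler_wpM2r; first exact: wnorm2_ge0.
  by rewrite /K; lra.
pose w_ i := peak_approx n (T (x_ i)).
have lw i : L2w peak_weight (w_ i) := peak_approx_L2 n (@cT (x_ i)) (sT (x_ i)).
have wC i j : wnorm2 peak_weight (fun z => w_ i z - w_ j z) <= 2 * peakC * K / i.+1%:R + 2 * peakC * K / j.+1%:R.
  apply: (le_trans (peak_approx_diff n (@cT (x_ i)) (sT (x_ i)) (@cT (x_ j)) (sT (x_ j)))).
  apply: (@le_trans _ _ (peakC * (2 * (K / i.+1%:R + K / j.+1%:R)))); first by rewrite ler_wpM2l ?xC// ltW.
  by rewrite le_eqVlt; apply/orP; left; apply/eqP; ring.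
have [|||W [hW Wr iW leW]] := @weak_limit R peak_weight w_ ((16 + 8 * 4 * peakC) * mass * ea) weight_peak lw.
- move=> i; apply: (le_trans (peak_approx_bound n (@cT (x_ i)) (sT (x_ i)))); rewrite -/I.
  have := xB i; set q := wnorm2 _ _ => qK.
  have : peakC * q <= peakC * (4 * K) by rewrite ler_wpM2l// ltW.
  rewrite /K; lra.
- have C2K : 0 < 2 * peakC * K by apply: mulr_gt0 => //; exact: mulr_gt0.
  exact: (L2w_kernel_cauchy weight_peak lw wC (lim_div_succ C2K)).
- move=> F hF sF; have [y yE] : exists y : X, V y = fun z => (z - a) * F z.
    have hz : C2C (fun z => (z - a) * F z) /\ csupp (fun z => (z - a) * F z).
      split; last by apply: csuppMr; exact: sF.
      by apply: C2M; [exact: C2_sub|exact: hF].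
    by exists (exist (fun c : C -> C => C2C c /\ csupp c) _ hz).
  have q0 := wnorm2_ge0 (T y) pk; have K1 : 0 < K * (wnorm2 (kappa n) (T y) + 1) by apply: mulr_gt0 => //; rewrite ltr_wpDl.
  apply: (cvgC_sq K1) => i; rewrite subr0 /w_ (peak_approx_test n hF sF (@cT (x_ i)) (sT (x_ i))).
  have := xE i y; rewrite {1 2}/T /L yE -normcN opprB => /le_trans; apply.
  by rewrite mulrAC ler_wpM2r ?invr_ge0// ler_wpM2l ?lerDl// ltW.
exists W; split => //; last first.
- by apply: (le_trans leW); rewrite le_eqVlt; apply/orP; left; apply/eqP; ring.
- by split => //; apply: ctn_measurable; exact: hol_ctn.
(* identify W a: tested against Ssum, W gives W a times hsum *)
have [A1 [A2 [A10 A20 HA]]] := peak_approx_kernel n.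
have lim N : normc (W a - 1) * hsum N <= A1 + Num.sqrt (A2 * (4 * K) * hsum N).
  have [hE iS] := int_Ssum N; have h0 : 0 <= hsum N by rewrite -hE; apply: intR_ge0 => z; exact: Ssum_ge0.
  have c : cvgC (fun i => cint (fun z => w_ i z * (Ssum a N z)%:C)) (W a * (hsum N)%:C).
    rewrite /hsum rmorph_sum mulr_sumr.
    have c1 : cvgC (fun i => \sum_(k < N) (k.+4%:R^-1)%:C * cint (fun z => w_ i z * (rho k.+3 a z)%:C)) (\sum_(k < N) W a * (mass / k.+4%:R)%:C).
      elim: N {hE iS h0} => [|N IH]; first by rewrite big_ord0; apply: (cvgC_eq _ (@cvgC_cst R 0)) => i; rewrite big_ord0.
      have e : W a * (mass / N.+4%:R)%:C = (N.+4%:R^-1)%:C * (W a * mass%:C) by rewrite rmorphM /=; ring.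
      rewrite big_ord_recr [X in cvgC _ (_ + X)]e.
      by apply: (cvgC_eq _ (cvgCD IH (cvgCZ (N.+4%:R^-1)%:C (Wr N.+1 a)))) => i; rewrite big_ord_recr.
    by apply: (cvgC_eq _ c1) => i; rewrite cint_Ssum//; exact: (L2w_locI weight_peak).
  have := cvgC_le (cvgCB c (@cvgC_cst R (hsum N)%:C)) (B := A1 + Num.sqrt (A2 * (4 * K) * hsum N)).
  rewrite (_ : W a * (hsum N)%:C - (hsum N)%:C = (W a - 1) * (hsum N)%:C); last by ring.
  rewrite normcM normc_real (ger0_norm h0); apply => i.
  apply: (le_trans (HA N _ (@cT (x_ i)) (sT (x_ i)))); rewrite lerD2l ler_wsqrtr//.
  by rewrite ler_wpM2r// ler_wpM2l ?xB// ltW.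
apply/eqP; rewrite -subr_eq0; apply: contraT; rewrite -normc_gt0 => d0; exfalso.
set d := normc _ in d0 lim; have q0 : 0 <= A2 * (4 * K) by apply: mulr_ge0; [exact: ltW|apply: mulr_ge0 => //; exact: ltW].
pose Y := 2 * A1 / d + 4 * (A2 * (4 * K)) / d ^+ 2 + 1.
have [N HN'] := harmonic_unbounded 3 (Y / mass).
apply: (sqrt_linear d0 (ltW A10) q0 _ (lim N)); move: HN'; rewrite ler_pdivrMr// mulr_suml => /le_trans; apply.
by apply: ler_sum => k _; rewrite mulrC addn4.
Qed.
End PeakFunctions.

(** * The Bochner identity: sub-mean values and Caccioppoli *)

Section Bochner.
Variables (R : realType) (phi : R[i] -> R) (p s r : R[i] -> R[i]).
Local Notation C := R[i].
Local Notation Re := (@complex.Re R).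
Local Notation mass := (@mass R).
Hypotheses (hphi : forall z, wirt (fun w => (phi w)%:C) z (p z) (p z)^*)
  (hp : forall z, wirt p z (s z) (r z)) (cs : ctn s) (cr : ctn r).
Implicit Types (z a : C) (n : nat) (g : C -> C) (M : R).
Let cp : ctn p := ctn_wirt hp cs cr.
Let cphi : ctn (fun z => (phi z)%:C) := ctn_wirt hphi cp (ctnJ cp).

(** The weight of [phi - M |z - a|^2], whose curvature is nonpositive when M bounds the Laplacian coefficient of [phi]. *)
Definition bexp a M z : R := expR (- 2 * (phi z - M * dist2 a z)).
Lemma hol_C2 g : hol g -> exists g' : C -> C, [/\ forall z, cdiff g z (g' z), C2C g, ctn g', dz g = g' & db g = fun=> 0].
Proof.
move=> hg; have [g' [g'' [d1 d2 c1 c2]]] := hol_derivative hg; exists g'.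
have c0 : ctn (fun _ : C => 0 : C) by exact: ctn_cst.
have [h [e1 e2 _ _ _]] := C2P (fun z => cdiff_wirt (d1 z)) (fun z => cdiff_wirt (d2 z)) (fun z => wirt_cst 0 z) c2 c0 c0.
by split.
Qed.
Lemma wirt_bphi a M z : wirt (fun w => (phi w - M * dist2 a w)%:C) z (p z - M%:C * (z - a)^*) (p z - M%:C * (z - a)^*)^*.
Proof.
apply: (wirt_eq _ _ _ (wirtB (hphi z) (wirtZ M%:C (wirt_dist2 a z)))) => [w||].
- by rewrite -rmorphM -rmorphB.
- by [].
- by rewrite conjD conjN conjM conjR conjK.
Qed.
Lemma ctn_bexp a M : ctn (fun z => (bexp a M z)%:C).
Proof.
apply: (@ctn_exp R (fun z => phi z - M * dist2 a z)); under eq_fun do rewrite rmorphB rmorphM /=.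
by apply: ctnB; [exact: cphi|apply: ctnM; [exact: ctn_cst|apply: ctnR; exact: continuous_dist2]].
Qed.

(** The twisted identity with the bump as twist and the holomorphic function [g] in place of the test function; compactness of the support now comes from the twist. *)
Lemma bochner a M n g g' : (forall z, cdiff g z (g' z)) -> C2C g -> dz g = g' -> db g = (fun=> 0) ->
  let D z := g' z - 2 * (p z - M%:C * (z - a)^*) * g z in
  let E z := - (bump a 1 n.+3 z * bexp a M z * normc (D z) ^+ 2)
    + 2 * (Re (r z) - M) * bump a 1 n.+3 z * bexp a M z * normc (g z) ^+ 2
    + n.+3%:R * (rho n.+1 a z - rho n.+2 a z) * bexp a M z * normc (g z) ^+ 2 in
  rI E /\ intR E = 0.
Proof.
move=> d1 hg e1 e2 D E.
have csub : ctn (fun z => z - a) := C2_ctn (C2_sub a).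
pose Z z : C := (- (n.+3%:R * 1 * bump a 1 n.+2 z))%:C * (z - a)^*.
pose yy z : R := n.+3%:R * (rho n.+1 a z - rho n.+2 a z).
pose X z : C := - n.+3%:R%:C * ((z - a)^* * ((- (n.+2%:R * 1 * bump a 1 n.+1 z))%:C * (z - a)^*))^*.
pose P z : C := - (p z - M%:C * (z - a)^*).
have cb k : ctn (fun z => (bump a 1 k z)%:C) by apply: ctnR; exact: continuous_bump.
have hO z : wirt (fun w => (bump a 1 n.+3 w)%:C) z (Z z) (Z z)^*.
  by apply: (wirt_eq _ _ _ (wirt_bump a 1 n.+1 z)) => [//|//|]; rewrite /Z conjM conjR conjK.
have hZ z : wirt (fun w => (Z w)^*) z (yy z)%:C (X z).
  apply: (wirt_eq _ _ _ (wirtZ (- n.+3%:R%:C) (wirtJ (wirt_conjbump n a z)))) => [w||//].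
  - rewrite /Z !conjM conjK !conjR mulr1; move: (n.+3%:R : R) (bump _ _ _ _) => k b.
    by rewrite [in RHS]rmorphN [in RHS]rmorphM /=; ring.
  - by rewrite -rmorphB conjR -rmorphN -rmorphM; congr (_%:C); rewrite /yy; ring.
have he z : wirt (fun w => (bexp a M w)%:C) z (2 * P z * (bexp a M z)%:C) (2 * (P z)^* * (bexp a M z)%:C).
  apply: (wirt_eq _ _ _ (wirt_exp (- 2) (wirt_bphi a M z))) => [//||];
  by rewrite /P ?conjN rmorphM rmorphN (rmorph_nat (real_complex R)); ring.
have hP z : wirt P z (- s z) (- (r z - M%:C)).
  apply: (wirt_eq _ _ _ (wirtN (wirtB (hp z) (wirtZ M%:C (wirtJ (wirt_sub a z)))))) => [//||].
  - by rewrite conj0 mulr0 subr0.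
  - by rewrite conj1 mulr1.
have cX : ctn X by have csj := ctnJ csub; have c1 := cb n.+1; rewrite /X; ctn_tac.
have cY : ctn (fun z => (yy z)%:C).
  rewrite /yy; under eq_fun do rewrite rmorphM rmorphB /=.
  by apply: ctnM; [exact: ctn_cst|apply: ctnB; apply: ctnR; exact: continuous_rho].
have cr' : ctn (fun z => - (r z - M%:C)) by apply: ctnN; apply: ctnB; [exact: cr|exact: ctn_cst].
have cs' : ctn (fun z => - s z) by apply: ctnN; exact: cs.
have sb : csupp (bump a 1 n.+3) by exact: csupp_bump.
have [iE E0] := twisted_real hO hZ he hP hg (@ctn_bexp a M) cY cX cs' cr' (or_intror sb).
have EE : E = fun z => bump a 1 n.+3 z * bexp a M z * normc (db g z) ^+ 2 -
   bump a 1 n.+3 z * bexp a M z * normc (dz g z + 2 * P z * g z) ^+ 2 -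
   2 * Re (- (r z - M%:C)) * bump a 1 n.+3 z * bexp a M z * normc (g z) ^+ 2 +
   yy z * bexp a M z * normc (g z) ^+ 2 + 2 * bexp a M z * Re (Z z * (g z)^* * db g z).
  apply/funext => z; rewrite e1 e2 mulr0 normc0 ReN ReD ReN /= expr0n /= /E /D.
  rewrite (_ : g' z + 2 * P z * g z = g' z - 2 * (p z - M%:C * (z - a)^*) * g z); last by rewrite /P; ring.
  by rewrite /yy; ring.
by rewrite EE.
Qed.

Local Notation th := (fweight phi).
Lemma bexp0 a : bexp a 0 = th.
Proof. by apply/funext => z; rewrite /bexp /fweight mul0r subr0 mulNr. Qed.
Lemma ctn_G a M g : ctn g -> ctn (fun z => (bexp a M z * normc (g z) ^+ 2)%:C).
Proof.
move=> cg; rewrite (_ : (fun z => _) = fun z => (bexp a M z)%:C * (g z * (g z)^*)).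
  by apply: ctnM; [exact: ctn_bexp|apply: ctnM; [exact: cg|apply: ctnJ; exact: cg]].
by apply/funext => z; rewrite mulJ -rmorphM.
Qed.
Lemma rI_G a M n g : ctn g -> rI (fun z => rho n.+1 a z * (bexp a M z * normc (g z) ^+ 2)).
Proof.
move=> cg; apply: rI_csupp; last by have [q H] := csupp_rho n a; exists q => z /H ->; rewrite mul0r.
apply: ctnRr; under eq_fun do rewrite rmorphM /=; apply: ctnM; last exact: ctn_G.
by apply: ctnR; exact: continuous_rho.
Qed.
Lemma bexp_ge0 a M z : 0 <= bexp a M z. Proof. exact: expR_ge0. Qed.

Lemma rI_bth a n g : ctn g -> rI (fun z => bump a 1 n.+1 z * (normc (g z) ^+ 2 * th z)).
Proof.
move=> cg; have := rIZ n.+2%:R^-1 (rI_G a 0 n cg); congr rI; apply/funext => z.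
by rewrite bexp0 /rho (mulrC (th z)) -mulrA mulKf// pnatr_eq0.
Qed.
(** For a weight of nonpositive curvature the Bochner integrand has a sign, and the derivative of the bump is a difference of mollifiers: means over more concentrated mollifiers are smaller. *)
Lemma submean_step a M n g : hol g -> (forall z, Re (r z) <= M) ->
  intR (fun z => rho n.+2 a z * (bexp a M z * normc (g z) ^+ 2)) <= intR (fun z => rho n.+1 a z * (bexp a M z * normc (g z) ^+ 2)).
Proof.
move=> hg hM; have [g' [d1 hC _ e1 e2]] := hol_C2 hg; have cg := C2_ctn hC.
have [iE E0] := bochner a M n d1 hC e1 e2.
have i1 := rI_G a M n cg; have i2 := rI_G a M n.+1 cg.
rewrite -subr_ge0 -intRB// -(pmulr_rge0 _ (_ : 0 < n.+3%:R))// -intRZ//; last exact: rIB.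
rewrite -[leRHS]subr0 -[X in _ - X]E0 -intRB//; last by apply: rIZ; exact: rIB.
apply: intR_ge0 => z; set x := normc (g' z - _).
have b0 := bump_ge0 a 1 n.+3 z; have e0 := bexp_ge0 a M z; have h := hM z.
rewrite [leRHS](_ : _ = bump a 1 n.+3 z * bexp a M z * (x ^+ 2 + 2 * (M - Re (r z)) * normc (g z) ^+ 2)); last by ring.
apply: mulr_ge0; first exact: mulr_ge0.
apply: addr_ge0; first exact: sqr_ge0.
by apply: mulr_ge0; [rewrite mulr_ge0// subr_ge0|exact: sqr_ge0].
Qed.

(** Iterating [submean_step], the value at [a] is at most a mean; passing from [phi - M |z - a|^2] to [phi] costs exp(2M) on the unit disc. *)
Lemma submean a M g : hol g -> 0 <= M -> (forall z, Re (r z) <= M) ->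
  mass * (normc (g a) ^+ 2 * expR (- (2 * phi a))) <=
    4 * expR (2 * M) * intR (fun z => bump a 1 3 z * (normc (g z) ^+ 2 * th z)).
Proof.
move=> hg M0 hM; have cg := hol_ctn hg; pose G z := bexp a M z * normc (g z) ^+ 2.
have Ga : G a = normc (g a) ^+ 2 * expR (- (2 * phi a)).
  by rewrite /G /bexp dist2_self mulr0 subr0 mulNr mulrC.
pose x n := intR (fun z => rho n.+3 a z * G z).
have x0 n : x n <= x 0%N.
  by elim: n => // n; apply: le_trans; exact: submean_step.
have h1 : mass * G a <= x 0%N.
  apply/ler_addgt0Pr => e e0; have [N HN] := approx_id a (@ctn_G a M _ cg) e0.
  have := HN N.+2 (leqW (leqW (leqnn N))).
  rewrite (_ : (fun z => (G z)%:C * (rho N.+3 a z)%:C) = fun z => (rho N.+3 a z * G z)%:C); last first.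
    by apply/funext => z; rewrite mulrC -rmorphM.
  rewrite cintR -rmorphM -rmorphB normc_real -/(x N) => h.
  by move: h; rewrite ler_norml => /andP[h _]; have := x0 N; rewrite /G; lra.
rewrite -Ga; apply: (le_trans h1); rewrite /x -intRZ; last exact: rI_bth.
apply: intR_le; [exact: rI_G|by apply: rIZ; exact: rI_bth|move=> z].
have [t1|t1] := leP (dist2 a z) 1; last first.
  by rewrite /rho !bump0 ?mul1r ?(ltW t1)// !(mulr0, mul0r).
have h : bexp a M z <= expR (2 * M) * th z.
  rewrite -expRD ler_expR; have : M * dist2 a z <= M * 1 by rewrite ler_wpM2l.
  lra.
have b0 := bump_ge0 a 1 3 z.
rewrite /rho /G [leRHS](_ : _ = 4 * bump a 1 3 z * (expR (2 * M) * th z * normc (g z) ^+ 2)); last by ring.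
apply: ler_wpM2l; first by rewrite mulr_ge0.
by apply: ler_wpM2r => //; exact: sqr_ge0.
Qed.

(** Paired with a multiple of [g] it gives a weighted mean of that multiple of |g|^2 around [a]; [dbar_eta] is its dbar-derivative. *)
Definition eta a g z : C := (g z)^* * ((bump a 1 3 z)%:C * (th z)%:C).
Definition dbar_eta a g g' z : C := (th z)%:C * ((bump a 1 3 z)%:C * (g' z - 2 * p z * g z)^* - (3 * bump a 1 2 z)%:C * (z - a) * (g z)^*).

Lemma eta_test a g g' : (forall z, cdiff g z (g' z)) -> ctn g' ->
  [/\ exists q, (forall z, wirt (eta a g) z (q z) (dbar_eta a g g' z)) /\ ctn q, ctn (dbar_eta a g g'), csupp (eta a g) &
  forall z, 1 <= dist2 a z -> dbar_eta a g g' z = 0].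
Proof.
move=> d1 cg'; have cg : ctn g by apply: cdiff_ctn => z; exists (g' z).
have csub : ctn (fun z => z - a) := C2_ctn (C2_sub a).
have cb k : ctn (fun z => (bump a 1 k z)%:C) by apply: ctnR; exact: continuous_bump.
have ct : ctn (fun z => (th z)%:C) by rewrite -(bexp0 a); exact: ctn_bexp.
have ct2 : ctn (fun z => (- 2 * th z)%:C).
  by under eq_fun do rewrite rmorphM /=; apply: ctnM; [exact: ctn_cst|exact: ct].
have ht z : wirt (fun w => (th w)%:C) z ((- 2 * th z)%:C * p z) ((- 2 * th z)%:C * (p z)^*).
  by apply: (wirt_eq _ _ _ (wirt_exp (- 2) (hphi z))) => [w||]; rewrite /fweight !mulNr.
have h z := wirtM (wirtJ (cdiff_wirt (d1 z))) (wirtM (wirt_bump a 1 1 z) (ht z)).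
have c1 := cb 1%N; have c2 := cb 2%N; have c3 := cb 3%N.
have csj := ctnJ csub; have cgj := ctnJ cg; have cgj' := ctnJ cg'; have cpj := ctnJ cp.
split.
- eexists; split.
    move=> z; apply: (wirt_eq _ _ _ (h z)) => [//||]; first reflexivity.
    rewrite /dbar_eta conjD conjN !conjM conj2 (_ : (- (3 * 1 * bump a 1 2 z))%:C = - (3 * bump a 1 2 z)%:C); last by rewrite mulr1 rmorphN.
    rewrite (_ : (- 2 * th z)%:C = - 2 * (th z)%:C); last by rewrite rmorphM rmorphN (rmorph_nat (real_complex R)).
    ring.
  rewrite /=; ctn_tac.
- rewrite /dbar_eta; ctn_tac.
- by apply: csuppMr; apply: csuppMl; exact: csupp_bumpC.
- by move=> z t1; rewrite /dbar_eta !bump0 ?mul1r// mulr0 !mul0r subr0 mulr0.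
Qed.

(** A Caccioppoli inequality: the Bochner identity for M = 0 and the bump of exponent 6, the square of the cut-off, bounds the weighted derivative g_z - 2 p g by [g] itself. *)
Lemma dbar_eta_bound a g g' M : (forall z, cdiff g z (g' z)) -> C2C g -> dz g = g' -> db g = (fun=> 0) -> ctn g' -> 0 <= M -> (forall z, Re (r z) <= M) ->
  L2w th g -> wnorm2 (fun z => (th z)^-1) (dbar_eta a g g') <= (4 * M + 80) * wnorm2 th g.
Proof.
move=> d1 hC e1 e2 cg' M0 hM lg; have cg := C2_ctn hC.
have [iE E0] := bochner a 0 3 d1 hC e1 e2; clear e1 e2.
have [_ cde _ de0] := eta_test a d1 cg'.
have sde : csupp (dbar_eta a g g').
  exists (normc a + 1) => z zr; apply: de0; have := lerB_normc z a => h.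
  by rewrite /dist2 expr_ge1 ?normc_ge0//; lra.
have cti : ctn (fun z => ((th z)^-1)%:C).
  rewrite (_ : (fun z => _) = fun z => (expR (2 * phi z))%:C); first exact: (@ctn_exp R phi).
  by apply/funext => z; rewrite /fweight expRN invrK.
have ld := L2w_csupp cti cde sde.
rewrite /wnorm2 -intRZ; last exact: lg.2.
rewrite -[leLHS]addr0 -{1}(mulr0 2) -E0 -intRZ// -intRD; [|exact: ld.2|exact: rIZ].
apply: intR_le; [by apply: rID; [exact: ld.2|exact: rIZ]|by apply: rIZ; exact: lg.2|move=> z].
rewrite /dbar_eta; have t0 : 0 < th z by exact: expR_gt0.
have -> : bexp a 0 z = th z by rewrite bexp0.
rewrite subr0 mul0r subr0.
set D := g' z - 2 * p z * g z; set b3 := bump a 1 3 z; set b2 := bump a 1 2 z; set G := normc (g z).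
rewrite normcM normc_real (ger0_norm (ltW t0)) exprMn.
rewrite (_ : th z ^+ 2 * _ * (th z)^-1 = th z * normc (b3%:C * D^* - (3 * b2)%:C * (z - a) * (g z)^*) ^+ 2); last by field; rewrite gt_eqF.
have b30 : 0 <= b3 by exact: bump_ge0. have b20 : 0 <= b2 by exact: bump_ge0.
have h1 := le_normcB (b3%:C * D^*) ((3 * b2)%:C * (z - a) * (g z)^*).
rewrite !normcM !normc_conj !normc_real (ger0_norm b30) (ger0_norm (mulr_ge0 (ler0n _ 3) b20)) -/G in h1.
have b6 : bump a 1 6 z = b3 ^+ 2 by rewrite /b3 /bump -exprM.
have b2t : b2 * normc (z - a) <= 1.
  have : dist2 a z * bump a 1 4 z <= 1 by rewrite bump_mul; have := bump_ge0 a 1 5 z; have := bump_le1 a 4 z (@ler01 R); lra.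
  rewrite (_ : bump a 1 4 z = b2 ^+ 2) /dist2; last by rewrite /b2 /bump -exprM.
  rewrite -exprMn mulrC; set y := b2 * _ => y2; rewrite leNgt; apply/negP => y1; nra.
set N := normc (_ - _) in h1 *; set DD := normc D in h1 *; set t := normc (z - a) in h1 b2t *.
have G0 : 0 <= G by exact: normc_ge0. have DD0 : 0 <= DD by exact: normc_ge0.
have h2 : N <= b3 * DD + 3 * G.
  have h5 : b2 * t * G <= G by rewrite ler_piMl.
  by apply: (le_trans h1); rewrite lerD2l -(mulrA 3) -(mulrA 3) ler_wpM2l.
have h3 : N ^+ 2 <= 2 * (b3 ^+ 2 * DD ^+ 2) + 18 * G ^+ 2.
  have : N ^+ 2 <= (b3 * DD + 3 * G) ^+ 2.
    by rewrite lerXn2r ?nnegrE ?normc_ge0// (le_trans (normc_ge0 _) h2).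
  by have := sqr_ge0 (b3 * DD - 3 * G); rewrite -exprMn; lra.
have r4 : rho 4 a z - rho 5 a z <= 5.
  have := rho_ge0 5 a z; have := bump_le1 a 4 z (@ler01 R); rewrite (_ : rho 4 a z = 5 * bump a 1 4 z)//; lra.
have b61 := bump_le1 a 6 z (@ler01 R); have b60 := bump_ge0 a 1 6 z.
have hr : Re (r z) * bump a 1 6 z <= M.
  apply: (@le_trans _ _ (M * bump a 1 6 z)); first by rewrite ler_wpM2r.
  by rewrite ler_piMr.
rewrite -b6 in h3; move: hr r4 b60 b61 h3 t0; set q := Re _; set b := bump a 1 6 z; set v := rho _ _ _ - _.
move: (th z) (N ^+ 2) (DD ^+ 2) (G ^+ 2) (sqr_ge0 G) => e x y w w0 hr hv b0 b1 hx e0.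
have k1 : q * b * w <= M * w by rewrite ler_wpM2r.
have k2 : v * w <= 5 * w by rewrite ler_wpM2r.
rewrite [leRHS](_ : _ = e * ((4 * M + 80) * w)); last by ring.
rewrite [leLHS](_ : _ = e * (x + 2 * (- (b * y) + 2 * (q * b * w) + 6 * (v * w)))); last by ring.
rewrite ler_wpM2l ?(ltW e0)//; lra.
Qed.
End Bochner.

(** * Traces and approximation by matrices of low rank *)

Section TraceBound.
Variable R : realType.
Local Notation C := R[i].

Definition star m n (A : 'M[C]_(m, n)) : 'M[C]_(n, m) := (map_mx (@conjc R) A)^T.
Lemma starE m n (A : 'M[C]_(m, n)) i j : star A i j = (A j i)^*. Proof. by rewrite !mxE. Qed.
Lemma dotE n (v w : 'rV[C]_n) : (v *m star w) 0 0 = \sum_i v 0 i * (w 0 i)^*.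
Proof. by rewrite mxE; apply: eq_bigr => i _; rewrite starE. Qed.
Lemma dot_norm n (v : 'rV[C]_n) : (v *m star v) 0 0 = (\sum_i normc (v 0 i) ^+ 2)%:C.
Proof. by rewrite dotE rmorph_sum; apply: eq_bigr => i _; rewrite mulJ. Qed.
Lemma dotJ n (v w : 'rV[C]_n) : (w *m star v) 0 0 = ((v *m star w) 0 0)^*.
Proof.
by rewrite !dotE rmorph_sum; apply: eq_bigr => i _; apply: complexP; rewrite !(ReM, ImM, ReJ, ImJ) /=; ring.
Qed.

(** A dimension count: the kernel of [H] and the orthogonal of [k] vectors meet. *)
Lemma ker_vector N (H : 'M[C]_N) k (A : 'M[C]_(k, N)) : (\rank H + k < N)%N ->
  exists v : 'rV[C]_N, [/\ \sum_i normc (v 0 i) ^+ 2 = 1, v *m H = 0 & v *m star A = 0].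
Proof.
move=> rk; pose M := row_mx H (star A).
have rM : (\rank M < N)%N.
  apply: leq_ltn_trans rk; rewrite -mxrank_tr tr_row_mx -addsmxE.
  apply: leq_trans (mxrank_adds_leqif _ _) _; rewrite mxrank_tr leq_add2l.
  by apply: leq_trans (rank_leq_row _) _.
have : kermx M != 0 by rewrite -mxrank_eq0 mxrank_ker subn_eq0 -ltnNge.
case/rowV0Pn => v /sub_kermxP; rewrite mul_mx_row => /eqP; rewrite row_mx_eq0 => /andP[/eqP v1 /eqP v2] v0.
pose s : R := \sum_i normc (v 0 i) ^+ 2.
have s0 : 0 < s.
  rewrite lt_def sumr_ge0 ?andbT//; last by move=> i _; exact: sqr_ge0.
  apply: contraNneq v0 => s0; apply/eqP/rowP => i; rewrite mxE; apply: eq0_normc; apply/eqP.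
  rewrite -sqrf_eq0; have/eqP := s0; rewrite psumr_eq0 => [/allP/(_ i)|j _]; last exact: sqr_ge0.
  by rewrite mem_index_enum => /(_ isT).
exists ((Num.sqrt s)^-1%:C *: v); split; [|by rewrite -scalemxAl v1 scaler0|by rewrite -scalemxAl v2 scaler0].
rewrite (eq_bigr (fun i => s^-1 * normc (v 0 i) ^+ 2)) => [|i _]; first by rewrite -mulr_sumr mulVf// gt_eqF.
rewrite mxE normcM normc_real ger0_norm ?invr_ge0 ?sqrtr_ge0// exprMn exprVn [Num.sqrt _ ^+ 2]sqr_sqrtr//.
exact: ltW.
Qed.

(** Chosen greedily: at step i + 1 the matrix has rank at most N - i - 1 and i vectors have been chosen. *)
Lemma orthonormal_kernels N (H : nat -> 'M[C]_N) : (forall j, (\rank (H j) <= j)%N) ->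
  forall k, (k <= N)%N -> exists w : nat -> 'rV[C]_N,
    (forall i, (i < k)%N -> w i *m H (N - i.+1)%N = 0) /\
    (forall i l, (i < k)%N -> (l < k)%N -> (w i *m star (w l)) 0 0 = (i == l)%:R).
Proof.
move=> rH; elim=> [|k IH] kN; first by exists (fun=> 0).
have [w [w1 w2]] := IH (ltnW kN).
have [|v [v1 v2 v3]] := @ker_vector N (H (N - k.+1)%N) k (\matrix_(i < k) w i).
  by apply: leq_ltn_trans (leq_add (rH _) (leqnn k)) _; rewrite addnC -ltn_subRL subnSK// ltn_subrL; move: kN; case: (N).
have vw i : (i < k)%N -> (v *m star (w i)) 0 0 = 0.
  move=> ik; have e := congr1 (fun X : 'rV_k => X 0 (Ordinal ik)) v3; rewrite !mxE in e; rewrite mxE -[RHS]e.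
  by apply: eq_bigr => j _; rewrite !mxE.
have vv : (v *m star v) 0 0 = 1 by rewrite dot_norm v1.
exists (fun i => if i == k then v else w i); split=> [i|i l].
  by rewrite ltnS leq_eqVlt => /orP[/eqP->|ik]; rewrite ?eqxx// (ltn_eqF ik); exact: w1.
rewrite !ltnS leq_eqVlt => /orP[/eqP->|ik]; rewrite leq_eqVlt => /orP[/eqP->|lk].
- by rewrite !eqxx.
- by rewrite eqxx (ltn_eqF lk) eq_sym (ltn_eqF lk) vw.
- by rewrite eqxx (ltn_eqF ik) dotJ vw// conj0.
- by rewrite (ltn_eqF ik) (ltn_eqF lk); exact: w2.
Qed.

(** In the orthonormal basis of [orthonormal_kernels] the i-th diagonal entry of [G] is that of G - H_j, because the i-th vector is in the kernel of H_j with j = N - i - 1. *)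
Theorem trace_bound N (G : 'M[C]_N) (H : nat -> 'M[C]_N) (t : nat -> R) : (forall j, (\rank (H j) <= j)%N) ->
  (forall j (w : 'rV[C]_N), \sum_i normc (w 0 i) ^+ 2 = 1 -> normc ((w *m (G - H j) *m star w) 0 0) <= t j) ->
  normc (\tr G) <= \sum_(j < N) t j.
Proof.
move=> rH bH; have [w [w1 w2]] := orthonormal_kernels rH (leqnn N).
pose W : 'M[C]_N := \matrix_(i < N) w i.
have WE (i l : 'I_N) (X : 'M[C]_N) : (W *m X *m star W) i l = (w i *m X *m star (w l)) 0 0.
  rewrite !mxE; apply: eq_bigr => j _; rewrite !mxE; congr (_ * _).
  by apply: eq_bigr => k _; rewrite !mxE.
have W1 : W *m star W = 1%:M.
  apply/matrixP => i l; have := WE i l 1%:M; rewrite !mulmx1 => ->.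
  by rewrite w2// mxE -val_eqE.
have -> : \tr G = \sum_i (W *m G *m star W) i i.
  by rewrite -[RHS]/(\tr (W *m G *m star W)) -mulmxA mxtrace_mulC -mulmxA (mulmx1C W1) mulmx1.
rewrite [leRHS](reindex_inj rev_ord_inj) /=.
apply: (le_trans (@le_normc_sum R _ _ _ _)); apply: ler_sum => i _.
rewrite WE (_ : w i *m G *m star (w i) = w i *m (G - H (N - i.+1)%N) *m star (w i)); last first.
  by rewrite mulmxBr w1// subr0.
apply: bH; apply: (@complexI R); rewrite -dot_norm w2// eqxx.
by [].
Qed.
End TraceBound.

(** * Lattice sums *)

Section LatticeSums.
Variable R : realType.
Local Notation C := R[i].
Local Notation Re := (@complex.Re R).
Local Notation Im := (@complex.Im R).

(** A bounded increasing function whose increments dominate 1 / (1 + u^2), so that sums over a grid of step 2 telescope. *)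
Definition sigmoid (u : R) : R := u / (1 + `|u|).
Lemma sigmoid_abs u : `|sigmoid u| <= 1.
Proof.
rewrite /sigmoid normrM normrV ?unitfE; last by rewrite gt_eqF// ltr_wpDr.
rewrite (ger0_norm (_ : 0 <= 1 + `|u|)) ?addr_ge0// ler_pdivrMr ?mul1r ?lerDr//.
Qed.
Lemma sigmoid_step (u : R) : (1 + u ^+ 2)^-1 <= 3 / 2 * (sigmoid (u + 1) - sigmoid (u - 1)).
Proof.
have s0 : 0 < 1 + u ^+ 2 by rewrite ltr_wpDr// sqr_ge0.
have key (x : R) : 1 <= x -> (1 + x ^+ 2)^-1 <= 3 / 2 * ((x + 1) / (1 + (x + 1)) - (x - 1) / (1 + (x - 1))).
  move=> x1; have -> : 3 / 2 * ((x + 1) / (1 + (x + 1)) - (x - 1) / (1 + (x - 1))) = (x * (x + 2) / 3)^-1.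
    by field; repeat (apply/andP; split); apply: lt0r_neq0; lra.
  rewrite lef_pV2 ?posrE; [|by rewrite ltr_wpDr// sqr_ge0|by rewrite divr_gt0// mulr_gt0//; lra].
  by rewrite ler_pdivrMr//; nra.
rewrite /sigmoid; have [u1|u1] := leP 1 u.
  by rewrite (ger0_norm (_ : 0 <= u + 1)) ?(ger0_norm (_ : 0 <= u - 1)); [exact: key|lra|lra].
have [u2|u2] := leP u (- 1).
  have := key (- u) ltac:(lra); rewrite sqrrN.
  rewrite (ler0_norm (_ : u + 1 <= 0)) ?(ler0_norm (_ : u - 1 <= 0)); [|lra|lra].
  move/le_trans; apply; rewrite le_eqVlt; apply/orP; left; apply/eqP; field.
  by repeat (apply/andP; split); apply: lt0r_neq0; lra.
rewrite (ger0_norm (_ : 0 <= u + 1)) ?(ler0_norm (_ : u - 1 <= 0)); [|lra|lra].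
rewrite -[leLHS]mul1r ler_pdivrMr//.
have -> : (u + 1) / (1 + (u + 1)) - (u - 1) / (1 - (u - 1)) = (4 - 2 * u ^+ 2) / (4 - u ^+ 2).
  by field; repeat (apply/andP; split); apply: lt0r_neq0; nra.
have d0 : 0 < 4 - u ^+ 2 by nra.
have v1 : u ^+ 2 < 1 by nra.
move: (u ^+ 2) v1 (sqr_ge0 u) d0 => v v1 v0 d0.
rewrite (_ : 3 / 2 * _ * _ = (3 / 2 * (4 - 2 * v) * (1 + v)) / (4 - v)); last by field; lra.
by rewrite ler_pdivlMr// mul1r; nra.
Qed.
Lemma sum_1d (x : R) n : \sum_(j < n) (1 + (x - 2 * (j + 4)%:R) ^+ 2)^-1 <= 3.
Proof.
have step k : \sum_(j < k) (1 + (x - 2 * (j + 4)%:R) ^+ 2)^-1 <= 3 / 2 * (sigmoid (2 * (k + 4)%:R - x - 1) - sigmoid (2 * 4 - x - 1)).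
  elim: k => [|k IH]; first by rewrite big_ord0 add0n subrr mulr0.
  rewrite big_ord_recr /=; apply: (le_trans (lerD IH (_ : _ <= 3 / 2 * (sigmoid (2 * (k + 4)%:R - x + 1) - sigmoid (2 * (k + 4)%:R - x - 1))))).
    by rewrite (_ : (x - 2 * (k + 4)%:R) ^+ 2 = (2 * (k + 4)%:R - x) ^+ 2); [exact: sigmoid_step|ring].
  rewrite -mulrDr; apply: ler_wpM2l => //; rewrite addrC addrA subrK lerD2r.
  by rewrite (_ : 2 * (k.+1 + 4)%:R - x - 1 = 2 * (k + 4)%:R - x + 1)// addSn -natr1; ring.
apply: (le_trans (step n)).
have := sigmoid_abs (2 * (n + 4)%:R - x - 1); have := sigmoid_abs (2 * 4 - x - 1).
by rewrite !ler_norml => /andP[h1 h2] /andP[h3 h4]; lra.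
Qed.

(** The shift by 4 keeps the points at distance at least 8 from the origin. *)
Definition lattice_pt (i j : nat) : C := (2 * (i + 4)%:R) +i* (2 * (j + 4)%:R).
(** (1 + x^2 + y^2)^2 is at least (1 + x^2)(1 + y^2), so the sum is at most a product of two one-dimensional sums. *)
Lemma lattice_sum n (z : C) : \sum_(x : 'I_n * 'I_n) ((1 + dist2 (lattice_pt x.1 x.2) z) ^+ 2)^-1 <= 9.
Proof.
pose F (x : R) (j : nat) : R := (1 + (x - 2 * (j + 4)%:R) ^+ 2)^-1.
apply: (@le_trans _ _ (\sum_(x : 'I_n * 'I_n) F (Re z) x.1 * F (Im z) x.2)).
  apply: ler_sum => x _; rewrite /F -invfM.
  have e : dist2 (lattice_pt x.1 x.2) z = (Re z - 2 * (x.1 + 4)%:R) ^+ 2 + (Im z - 2 * (x.2 + 4)%:R) ^+ 2.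
    by rewrite /dist2 normc_sq ReD ImD ReN ImN.
  rewrite e; set u := (_ - _) ^+ 2; set v := (_ - _) ^+ 2.
  have u0 : 0 <= u by exact: sqr_ge0. have v0 : 0 <= v by exact: sqr_ge0.
  rewrite lef_pV2 ?posrE; [nra|rewrite exprn_gt0//; lra|rewrite mulr_gt0//; lra].
rewrite -(pair_bigA _ (fun i j : 'I_n => F (Re z) i * F (Im z) j)) /=.
under eq_bigr do rewrite -mulr_sumr.
rewrite -mulr_suml; have h1 := sum_1d (Re z) n; have h2 := sum_1d (Im z) n.
have F0 (x : R) : 0 <= \sum_(j < n) F x j.
  by apply: sumr_ge0 => j _; rewrite invr_ge0 addr_ge0 ?sqr_ge0.
by rewrite (_ : 9 = 3 * 3); [exact: ler_pM|ring].
Qed.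
(** In row i there are i points of norm comparable to i, which contribute 1 / i. *)
Lemma lattice_diverges (A : R) : exists n, A <= \sum_(x : 'I_n * 'I_n) (normc (lattice_pt x.1 x.2) ^+ 2)^-1.
Proof.
have [n Hn] := harmonic_unbounded 3 (32 * A); exists n.
rewrite -(pair_bigA _ (fun i j : 'I_n => (normc (lattice_pt i j) ^+ 2)^-1)) /=.
have {}Hn : A <= \sum_(i < n) (32 * (i + 4)%:R)^-1.
  rewrite -(ler_pM2l (_ : 0 < 32 :> R))// mulr_sumr; apply: (le_trans Hn); apply: ler_sum => k _.
  by rewrite invfM mulVKf.
apply: (le_trans Hn); apply: ler_sum => i _.
apply: (@le_trans _ _ (\sum_(j < n | (j <= i)%N) (8 * (i + 4)%:R ^+ 2)^-1)).
  rewrite -(big_ord_widen n (fun=> (8 * (i + 4)%:R ^+ 2)^-1) (ltn_ord i)) sumr_const card_ord -[leRHS]mulr_natr.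
  have i0 : 0 < (i + 4)%:R :> R by rewrite ltr0n addn_gt0 orbT.
  have : (i + 4)%:R <= 4 * i.+1%:R :> R by rewrite -natrM ler_nat mulnS addnC leq_add2l leq_pmull.
  move=> i1; apply: (@le_trans _ _ ((8 * (i + 4)%:R ^+ 2)^-1 * ((i + 4)%:R / 4))).
    by rewrite le_eqVlt; apply/orP; left; apply/eqP; field; rewrite gt_eqF.
  by rewrite ler_wpM2l ?invr_ge0 ?mulr_ge0 ?sqr_ge0// ler_pdivrMr// mulrC.
rewrite [leRHS](bigID (fun j : 'I_n => (j <= i)%N)) /= -[leLHS]addr0 lerD//; last first.
  by apply: sumr_ge0 => j _; rewrite invr_ge0 sqr_ge0.
apply: ler_sum => j ji; have e : normc (lattice_pt i j) ^+ 2 = (2 * (i + 4)%:R) ^+ 2 + (2 * (j + 4)%:R) ^+ 2 by rewrite normc_sq.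
have i0 : 0 < (i + 4)%:R :> R by rewrite ltr0n addn_gt0 orbT.
have j0 : 0 < (j + 4)%:R :> R by rewrite ltr0n addn_gt0 orbT.
have ij : (j + 4)%:R <= (i + 4)%:R :> R by rewrite ler_nat leq_add2r.
rewrite e lef_pV2 ?posrE; [nra|by rewrite mulr_gt0// exprn_gt0|].
by rewrite addr_gt0// exprn_gt0// mulr_gt0.
Qed.
End LatticeSums.

(** * Operators on the Fock space and Schatten classes *)

Section OperatorTrace.
Variables (R : realType) (phi : R[i] -> R).
Hypothesis phi_C2 : C2 phi.
Local Notation C := R[i].
Local Notation mu := (@lebesgueC R).
Local Notation th := (fweight phi).
Local Notation wt := (fweight_weight phi_C2).
Local Notation pk := (weight_pweight wt).
Implicit Types (g h u : C -> C) (D K T : (C -> C) -> C -> C).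

Lemma intR_ae (u v : C -> R) : measurable_fun setT u -> measurable_fun setT v ->
  {ae mu, forall z, u z = v z} -> intR u = intR v.
Proof.
move=> mu_ mv_ e; rewrite /intR /Rintegral; congr fine.
apply: ae_eq_integral => //; [exact/measurable_EFinP|exact/measurable_EFinP|].
by apply: filterS e => z e _ /=; rewrite e.
Qed.

(** Operators are defined up to null sets, so their values may only be tested through integrals. *)
Lemma cint_ae (F G : C -> C) : measurable_fun setT F -> measurable_fun setT G ->
  {ae mu, forall z, F z = G z} -> cint F = cint G.
Proof.
move=> mF mG e; rewrite /cint; congr (_ +i* _); apply: intR_ae; try exact: mRe; try exact: mIm;
  by apply: filterS e => z ->.
Qed.

Lemma L2w_sum (ka : C -> R) (I : Type) (r : seq I) (x : I -> C) (e : I -> C -> C) : pweight ka ->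
  (forall k, L2w ka (e k)) -> L2w ka (fun z => \sum_(k <- r) x k * e k z).
Proof.
move=> kappa he; elim: r => [|k r IH].
  under eq_fun do rewrite big_nil.
  by split; [exact: mcst|under eq_fun do rewrite normc0 expr0n mul0r; exact: rI0].
by under eq_fun do rewrite big_cons addrC; exact: L2w_lin.
Qed.

Lemma F2_0 : F2 phi (fun=> 0).
Proof.
apply/(F2P phi_C2); split; first by apply: (@wirt_hol R _ (fun=> 0)); [exact: wirt_cst|exact: ctn_cst].
by split; [exact: mcst|under eq_fun do rewrite normc0 expr0n mul0r; exact: rI0].
Qed.

Lemma F2_lin (a : C) g h : F2 phi g -> F2 phi h -> F2 phi (fun z => a * g z + h z).
Proof.
move=> /(F2P phi_C2) [hg lg] /(F2P phi_C2) [hh lh]; apply/(F2P phi_C2).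
have -> : (fun z => a * g z + h z) = (fun z => h z + a * g z) by apply/funext => z; rewrite addrC.
by split; [exact: hol_lin|exact: (L2w_lin a pk)].
Qed.

Lemma F2_sum (I : Type) (r : seq I) (x : I -> C) (e : I -> C -> C) : (forall k, F2 phi (e k)) ->
  F2 phi (fun z => \sum_(k <- r) x k * e k z).
Proof.
move=> he; elim: r => [|k r IH]; first by under eq_fun do rewrite big_nil; exact: F2_0.
by under eq_fun do rewrite big_cons; exact: F2_lin.
Qed.

(** What remains of the definition of a bounded operator once the bound is dropped; it is stable under differences with bounded operators. *)
Definition ae_linear D := (forall g, F2 phi g -> L2 phi (D g)) /\
  forall (a : C) g h, F2 phi g -> F2 phi h ->
    {ae mu, forall z, D (fun w => a * g w + h w) z = a * D g z + D h z}.

Lemma ae_linear_sub D K : ae_linear D -> bounded_linear_op phi K -> ae_linear (fun g z => D g z - K g z).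
Proof.
move=> [D1 D2] [K1 K2 _]; split=> [g hg|a g h hg hh].
  by apply/(L2P phi_C2); apply: L2w_B; [exact: pk|apply/(L2P phi_C2)|apply/(L2P phi_C2)]; auto.
apply: filterS2 (D2 a g h hg hh) (K2 a g h hg hh) => z -> ->; ring.
Qed.

Lemma ae_linear_sum D (I : Type) (r : seq I) (x : I -> C) (e : I -> C -> C) : ae_linear D ->
  (forall k, F2 phi (e k)) ->
  {ae mu, forall z, D (fun w => \sum_(k <- r) x k * e k w) z = \sum_(k <- r) x k * D (e k) z}.
Proof.
move=> [D1 D2] he; elim: r => [|k r IH].
  have := D2 (-1) _ _ F2_0 F2_0.
  rewrite (_ : (fun w : C => -1 * 0 + 0) = fun=> 0); last by apply/funext => w; rewrite mulr0 addr0.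
  have -> : (fun w : C => \sum_(k <- [::]) x k * e k w) = fun=> 0 by apply/funext => w; rewrite big_nil.
  by apply: filterS => z ->; rewrite big_nil mulN1r addNr.
have -> : (fun w => \sum_(k <- k :: r) x k * e k w) = (fun w => x k * e k w + \sum_(k <- r) x k * e k w).
  by apply/funext => w; rewrite big_cons.
apply: filterS2 (D2 (x k) (e k) _ (he k) (F2_sum r x he)) IH => z -> ->; by rewrite big_cons.
Qed.

(** The dual of L2 with weight [th] is L2 with weight 1 / [th] for the bilinear pairing. *)
Lemma pairing u d : L2w th u -> L2w (fun z => (th z)^-1) d ->
  cI (fun z => u z * d z) /\ normc (cint (fun z => u z * d z)) ^+ 2 <= wnorm2 th u * wnorm2 (fun z => (th z)^-1) d.
Proof.
move=> lu ld; pose v z := (d z)^* * ((th z)^-1)%:C.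
have t0 z : th z != 0 by rewrite gt_eqF// expR_gt0.
have e z : normc (v z) ^+ 2 * th z = normc (d z) ^+ 2 * (th z)^-1.
  rewrite /v normcM normc_conj normc_real ger0_norm ?invr_ge0 ?expR_ge0//; field; exact: t0.
have lv : L2w th v.
  split; last by under eq_fun do rewrite e; exact: ld.2.
  apply: mcM; first exact: (mcJ ld.1).
  exact: ctn_measurable (weight_inv_ctn wt).
have E : (fun z => u z * (v z)^* * (th z)%:C) = (fun z => u z * d z).
  apply/funext => z; rewrite /v conjM conjK conjR -!mulrA -rmorphM mulVf ?t0// mulr1//.
have := wdot_cI pk lu lv; have := wdot_CS pk lu lv; rewrite /wdot E; split => //.
by have -> : wnorm2 (fun z => (th z)^-1) d = wnorm2 th v by apply: eq_Rintegral => z _; rewrite e.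
Qed.

Lemma opnorm_wnorm2 D (t : R) g : (opnorm phi D <= t%:E)%E -> F2 phi g -> L2w th (D g) ->
  wnorm2 th g <= 1 -> wnorm2 th (D g) <= t ^+ 2.
Proof.
move=> ht hg lD q1.
have : (normphi phi (D g) <= t%:E)%E.
  apply: le_trans ht; apply: ereal_sup_ubound; exists g => //; split=> //.
  rewrite (normphiE phi_C2) ?lee_fin; last by case/(F2P phi_C2): hg.
  by rewrite -sqrtr1; apply: ler_wsqrtr.
rewrite (normphiE phi_C2)// lee_fin => h.
by rewrite -[leLHS]sqr_sqrtr ?wnorm2_ge0//; [rewrite ler_pXn2r// nnegrE; [exact: sqrtr_ge0|exact: le_trans h]|exact: pk].
Qed.

(** For p <= 1 summability of the p-th powers is stronger than summability: s = s^p s^(1-p), and the second factor is bounded. *)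
Lemma summable_root (s_ : nat -> \bar R) (p : R) : 0 < p -> p <= 1 -> (forall j, 0 <= s_ j)%E ->
  (\sum_(0 <= j <oo) (s_ j `^ p) < +oo)%E ->
  exists2 s : nat -> R, forall j, s_ j = (s j)%:E /\ 0 <= s j & exists S, forall N, \sum_(j < N) s j <= S.
Proof.
move=> p0 p1 s0 hs.
have p_n0 : p != 0 by rewrite gt_eqF.
have part N : (\sum_(0 <= j < N) (s_ j `^ p) <= \sum_(0 <= j <oo) (s_ j `^ p))%E.
  by apply: nneseries_lim_ge => n _ _; exact: poweR_ge0.
have tot0 : (0 <= \sum_(0 <= j <oo) (s_ j `^ p))%E by apply: nneseries_ge0 => n _ _; exact: poweR_ge0.
set S := (\sum_(0 <= j <oo) (s_ j `^ p))%E in part tot0 hs.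
have [S1 S1E] : exists x, S = x%:E by exists (fine S); rewrite fineK// ge0_fin_numE.
have sp j : (s_ j `^ p <= S)%E.
  apply: le_trans (part j.+1); rewrite big_nat_recr//=.
  by apply: leeDr; apply: sume_ge0 => i _; exact: poweR_ge0.
have fs j : s_ j \is a fin_num.
  by rewrite ge0_fin_numE//; apply: lty_poweRy p_n0 _; exact: le_lt_trans (sp j) hs.
exists (fun j => fine (s_ j)) => [j|]; first by rewrite fineK// fine_ge0.
pose Sb := 1 + S1; have S10 : 0 <= S1 by rewrite -lee_fin -S1E.
exists (Sb `^ ((1 - p) / p) * S1) => N.
have sE j : (s_ j `^ p)%E = ((fine (s_ j)) `^ p)%:E by rewrite -[in LHS](fineK (fs j)) poweR_EFin.
have bd j : fine (s_ j) <= Sb `^ ((1 - p) / p) * (fine (s_ j)) `^ p.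
  have x0 : 0 <= fine (s_ j) by rewrite fine_ge0.
  have [->|xn0] := eqVneq (fine (s_ j)) 0; first by rewrite mulr_ge0// powR_ge0.
  have xp : (fine (s_ j)) `^ p <= Sb.
    by rewrite /Sb; have := sp j; rewrite sE S1E lee_fin; lra.
  rewrite -[leLHS](powRr1 x0) -[X in _ `^ X](subrK p) powRD; last by rewrite xn0 implybT.
  apply: ler_wpM2r; first exact: powR_ge0.
  rewrite [in leLHS](_ : 1 - p = p * ((1 - p) / p)); last by field.
  rewrite powRrM; apply: ge0_ler_powR; rewrite ?nnegrE ?powR_ge0//.
  - by rewrite mulr_ge0 ?invr_ge0; lra.
  - by rewrite /Sb; lra.
apply: le_trans (ler_sum _ (fun (j : 'I_N) _ => bd j)) _; rewrite -mulr_sumr.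
apply: ler_wpM2l; first exact: powR_ge0.
have := part N; rewrite S1E big_mkord (eq_bigr (fun j : 'I_N => ((fine (s_ j)) `^ p)%:E)) => [|j _]; last exact: sE.
by rewrite sumEFin lee_fin.
Qed.

Lemma geo_sum (x : R) N : 0 <= x -> x < 1 -> \sum_(j < N) x ^+ j <= (1 - x)^-1.
Proof.
move=> x0 x1; have y0 : 0 < 1 - x by rewrite subr_gt0.
rewrite -[leRHS]mul1r ler_pdivlMr// mulrC; have := subrX1 x N; rewrite -opprB -[x - 1]opprB mulNr => /oppr_inj <-.
by rewrite gerBl exprn_ge0.
Qed.

Lemma opnorm_ge0 D : (0 <= opnorm phi D)%E.
Proof.
apply: le_trans (ereal_sup_ubound _); last first.
  exists (fun=> 0); [split; first exact: F2_0|by []].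
  have l0 : L2w th (fun=> 0) by case/(F2P phi_C2): F2_0.
  rewrite (normphiE phi_C2)// lee_fin (_ : wnorm2 _ _ = 0) ?sqrtr0//.
  rewrite /wnorm2; under eq_fun do rewrite normc0 expr0n mul0r; exact: intR0.
exact: poweR_ge0.
Qed.

(** Near-optimal approximants of rank j, with errors summable in j: the geometric sequence pays for the infimum not being attained. *)
Lemma schatten_approx T (p : R) : 0 < p -> p <= 1 -> Schatten phi p T ->
  exists (K : nat -> (C -> C) -> C -> C) (t : nat -> R) (S : R),
    (forall j, [/\ bounded_linear_op phi (K j), rank_le phi j (K j), 0 <= t j &
       (opnorm phi (fun g z => T g z - K j g z)%R <= (t j)%:E)%E]) /\
    forall N, \sum_(j < N) t j <= S.
Proof.
move=> p0 p1 hS.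
have s0 j : (0 <= singular_value phi T j)%E.
  by apply: le_ereal_inf_tmp => _ [K _ <-]; exact: opnorm_ge0.
have [s sE [S hs]] := summable_root p0 p1 s0 hS.
have ex j : exists K, [/\ bounded_linear_op phi K, rank_le phi j K &
    (opnorm phi (fun g z => T g z - K g z)%R <= (s j + 2^-1 ^+ j)%:E)%E].
  have : (singular_value phi T j < (s j + 2^-1 ^+ j)%:E)%E.
    by rewrite (sE j).1 lte_fin ltrDl exprn_gt0// invr_gt0.
  by case/ereal_inf_lt => _ [K [K1 K2] <-] /ltW; exists K.
have [K hK] := choice ex.
exists K, (fun j => s j + 2^-1 ^+ j), (S + (1 - 2^-1)^-1); split=> [j|N].
  by have [h1 h2 h3] := hK j; split=> //; apply: addr_ge0; [exact: (sE j).2|rewrite exprn_ge0].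
by rewrite big_split /=; apply: lerD; [exact: hs|by apply: geo_sum; lra].
Qed.

(** The matrix factors through the [j] functions that span the range. *)
Lemma rank_matrix (j N : nat) K (e d : 'I_N -> C -> C) : bounded_linear_op phi K -> rank_le phi j K ->
  (forall k, F2 phi (e k)) -> (forall k, L2w (fun z => (th z)^-1) (d k)) ->
  (\rank (\matrix_(k < N, l < N) cint (fun z => K (e k) z * d l z))%R <= j)%N.
Proof.
move=> [K1 _ _] [ep hep hK] he hd.
have [c hc] := choice (fun k => hK (e k) (he k)).
have -> : \matrix_(k, l) cint (fun z => K (e k) z * d l z) =
   (\matrix_(k < N, i < j) c k i) *m (\matrix_(i < j, l < N) cint (fun z => ep i z * d l z)).
  apply/matrixP => k l; rewrite !mxE.
  under eq_bigr do rewrite !mxE.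
  have le i : L2w th (ep i) by apply/(L2P phi_C2).
  have ci i : cI (fun z => ep i z * d l z) := (pairing (le i) (hd l)).1.
  have lK : L2w th (K (e k)) by apply/(L2P phi_C2); auto.
  under eq_bigr do rewrite -(cintZ _ (ci _)).
  rewrite -cint_sum; last by move=> i; exact: cIZ.
  apply: cint_ae.
  - exact: cI_meas (pairing lK (hd l)).1.
  - by apply: cI_meas; apply: cI_sum => i; exact: cIZ.
  - apply: filterS (hc k) => z ->; rewrite mulr_suml; apply: eq_bigr => i _; ring.
exact: mulmx_max_rank.
Qed.

(** The matrix of the pairings of [T] differs from that of an approximant of rank j, on unit vectors, by at most sqrt(A B) times the approximation error, by the two Bessel bounds; then [trace_bound] applies. *)
Theorem schatten_trace T (p : R) : 0 < p -> p <= 1 -> ae_linear T -> Schatten phi p T ->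
  exists S : R, forall (N : nat) (e d : 'I_N -> C -> C) (A B : R), 0 < A -> 0 <= B ->
    (forall k, F2 phi (e k)) -> (forall k, L2w (fun z => (th z)^-1) (d k)) ->
    (forall c : 'I_N -> C, wnorm2 th (fun z => \sum_k c k * e k z) <= A * \sum_k normc (c k) ^+ 2) ->
    (forall c : 'I_N -> C, wnorm2 (fun z => (th z)^-1) (fun z => \sum_k c k * d k z) <= B * \sum_k normc (c k) ^+ 2) ->
    normc (\sum_k cint (fun z => T (e k) z * d k z)) <= Num.sqrt (A * B) * S.
Proof.
move=> p0 p1 lT hS.
have [K [t [S [hK St]]]] := schatten_approx p0 p1 hS.
exists S => N e d A B A0 B0 he hd hA hB.
pose G := \matrix_(k < N, l < N) cint (fun z => T (e k) z * d l z).
pose H j := \matrix_(k < N, l < N) cint (fun z => K j (e k) z * d l z).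
have -> : \sum_k cint (fun z => T (e k) z * d k z) = \tr G by apply: eq_bigr => k _; rewrite mxE.
apply: le_trans (_ : \sum_(j < N) Num.sqrt (A * B) * t j <= _); last first.
  by rewrite -mulr_sumr; apply: ler_wpM2l; [exact: sqrtr_ge0|exact: St].
apply: (@trace_bound R N G H (fun j => Num.sqrt (A * B) * t j)) => [j|j w w1].
  by have [h1 h2 _ _] := hK j; exact: rank_matrix.
have [h1 h2 t0 ht] := hK j.
pose D g z := T g z - K j g z.
have lD : ae_linear D := ae_linear_sub lT h1.
have lDe k : L2w th (D (e k)) by apply/(L2P phi_C2); exact: lD.1.
have cD k l : cI (fun z => D (e k) z * d l z) := (pairing (lDe k) (hd l)).1.
have GH k l : (G - H j) k l = cint (fun z => D (e k) z * d l z).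
  have lTe : L2w th (T (e k)) by apply/(L2P phi_C2); exact: lT.1.
  have lKe : L2w th (K j (e k)) by apply/(L2P phi_C2); case: h1 => h _ _; exact: h.
  rewrite !mxE -cintB; [|exact: (pairing lTe (hd l)).1|exact: (pairing lKe (hd l)).1].
  by apply: eq_cint => z; rewrite /D; ring.
pose x k := w 0 k * ((Num.sqrt A)^-1)%:C.
pose g z := \sum_k x k * e k z.
pose dd z := \sum_l (w 0 l)^* * d l z.
have hg : F2 phi g by exact: F2_sum.
have lDg : L2w th (D g) by apply/(L2P phi_C2); exact: lD.1.
have sA : 0 < Num.sqrt A by rewrite sqrtr_gt0.
have qg : wnorm2 th g <= 1.
  apply: le_trans (hA x) _.
  rewrite (_ : \sum_k normc (x k) ^+ 2 = A^-1) ?divff ?gt_eqF//.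
  rewrite -[RHS]mul1r -w1 mulr_suml; apply: eq_bigr => k _.
  rewrite /x normcM normc_real ger0_norm ?invr_ge0 ?sqrtr_ge0// exprMn exprVn [in LHS]sqr_sqrtr//; exact: ltW.
have ldd : L2w (fun z => (th z)^-1) dd.
  have pi : pweight (fun z => (th z)^-1).
    split=> [z|]; first by rewrite invr_ge0 expR_ge0.
    by apply: continuous_measurableC; apply: ctnRr; exact: weight_inv_ctn wt.
  exact: (L2w_sum (index_enum _) (fun l => (w 0 l)^*) pi hd).
have [_ CS] := pairing lDg ldd.
have qD := opnorm_wnorm2 ht hg lDg qg.
have qd : wnorm2 (fun z => (th z)^-1) dd <= B.
  apply: le_trans (hB _) _; rewrite (_ : \sum_k _ = 1) ?mulr1//.
  by rewrite -w1; apply: eq_bigr => k _; rewrite normc_conj.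
have E : (w *m (G - H j) *m star w) 0 0 = (Num.sqrt A)%:C * cint (fun z => D g z * dd z).
  rewrite (cint_ae (G := fun z => \sum_k \sum_l x k * (w 0 l)^* * (D (e k) z * d l z))).
  - rewrite cint_sum; last by move=> k; apply: cI_sum => l; exact: cIZ.
    rewrite mulr_sumr mxE.
    rewrite (eq_bigr (fun l => \sum_k w 0 k * (G - H j) k l * (w 0 l)^*)) => [|l _]; last first.
      by rewrite mxE starE mulr_suml.
    rewrite exchange_big /=; apply: eq_bigr => k _.
    rewrite cint_sum; last by move=> l; exact: cIZ.
    rewrite mulr_sumr; apply: eq_bigr => l _; rewrite cintZ// GH /x.
    rewrite -[w 0 k * _ * _ * _]mulrA; set q := cint _.
    rewrite (_ : (Num.sqrt A)%:C * (w 0 k * ((Num.sqrt A)^-1)%:C * ((w 0 l)^* * q)) = (Num.sqrt A)%:C * ((Num.sqrt A)^-1)%:C * (w 0 k * ((w 0 l)^* * q))); last by ring.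
    by rewrite -rmorphM divff ?gt_eqF// mul1r; ring.
  - exact: cI_meas (pairing lDg ldd).1.
  - by apply: cI_meas; apply: cI_sum => k; apply: cI_sum => l; exact: cIZ.
  - apply: filterS (ae_linear_sum (index_enum _) x lD he) => z ez.
    rewrite ez mulr_suml; apply: eq_bigr => k _; rewrite /dd mulr_sumr; apply: eq_bigr => l _; ring.
rewrite E normcM normc_real ger0_norm ?(ltW sA)// sqrtrM ?(ltW A0)// -mulrA.
apply: ler_wpM2l; first exact: ltW.
rewrite -(@ler_pXn2r _ 2)// ?nnegrE ?normc_ge0//; last exact: mulr_ge0 (sqrtr_ge0 _) t0.
apply: le_trans CS _; rewrite exprMn sqr_sqrtr// [leRHS]mulrC.
apply: ler_pM => //; [exact: wnorm2_ge0 pk|].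
by apply: intR_ge0 => z; rewrite mulr_ge0 ?sqr_ge0// invr_ge0 expR_ge0.
Qed.
End OperatorTrace.

(** * A smoothing of 1/z *)

Section ReciprocalSymbol.
Variable R : realType.
Local Notation C := R[i].
Local Notation Re := (@complex.Re R).
Local Notation Im := (@complex.Im R).
Implicit Types z a : C.

(** |z|^2 made positive near the origin by a term that vanishes outside the unit disc. *)
Definition den z : R := dist2 0 z + bump 0 1 2 z.

Lemma den_ge z : 3 / 4 <= den z.
Proof.
rewrite /den /bump mul1r; have := dist2_ge0 0 z; move: (dist2 0 z) => t t0.
have [t1|t1] := leP t 1; first by rewrite pp_pos ?subr_ge0//; have := sqr_ge0 (t - 2^-1); nra.
by have := exprn_ge0 2 (pp_ge0 (1 - t)); lra.
Qed.

Lemma den_gt0 z : 0 < den z.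
Proof. by have := den_ge z; lra. Qed.

Lemma den_far z : 1 <= dist2 0 z -> den z = dist2 0 z.
Proof. by move=> h; rewrite /den bump0 ?mul1r// addr0. Qed.

Lemma ctn_den : ctn (fun z => (den z)%:C).
Proof. by rewrite /den; ctn_tac. Qed.

Lemma ctn_denV : ctn (fun z => ((den z)^-1)%:C).
Proof. by apply: ctnRV; [exact: ctn_den|move=> z; rewrite gt_eqF// den_gt0]. Qed.

(** Equal to 1/z outside the unit disc. *)
Definition recip z : C := z^* * ((den z)^-1)%:C.

Lemma recipJ z : (recip z)^* = z * ((den z)^-1)%:C.
Proof. by rewrite /recip conjM conjK conjR. Qed.

Lemma ctn_recip : ctn recip.
Proof. by apply: ctnM; [exact: ctnJ (@ctn_id R)|exact: ctn_denV]. Qed.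

Lemma recip_mul z : z * recip z = 1 - (bump 0 1 2 z / den z)%:C.
Proof.
have e : z * z^* = (dist2 0 z)%:C by rewrite dist2E subr0.
rewrite /recip mulrA e -rmorphM -(rmorph1 (real_complex R)) -rmorphB; congr _%:C.
by rewrite /den; field; rewrite gt_eqF// den_gt0.
Qed.

Lemma recip_le z : normc (recip z) <= 2.
Proof.
rewrite -(@ler_pXn2r _ 2)// ?nnegrE ?normc_ge0// /recip normcM normc_conj normc_real ger0_norm ?invr_ge0 ?(ltW (den_gt0 z))//.
rewrite exprMn exprVn ler_pdivrMr ?exprn_gt0 ?den_gt0//.
have := den_ge z; have : dist2 0 z <= den z by rewrite /den lerDl bump_ge0.
rewrite {1}/dist2 subr0; have := sqr_ge0 (normc z); move: (normc z ^+ 2) (den z) => t d; nra.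
Qed.

(** The dbar-derivative of the conjugate; it is - conj z ^ -2 outside the unit disc. *)
Definition dbrecip z : C := - (z ^+ 2 * ((den z ^+ 2)^-1 * (1 - 2 * bump 0 1 1 z))%:C).

Lemma wirt_recipJ : exists2 q : C -> C, ctn q /\ ctn dbrecip &
  forall z, wirt (fun w => (recip w)^*) z (q z) (dbrecip z).
Proof.
have dn z : den z != 0 by rewrite gt_eqF// den_gt0.
pose k z : R := (den z ^+ 2)^-1 * (1 - 2 * bump 0 1 1 z).
have ck : ctn (fun z => (k z)%:C).
  have -> : (fun z => (k z)%:C) = (fun z => ((den z)^-1)%:C ^+ 2 * (1%:C + (- (2%:C * (bump 0 1 1 z)%:C)))).
    by apply/funext => z; rewrite -rmorphXn -!(rmorphM, rmorphB) exprVn.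
  have cd := ctn_denV; ctn_tac.
have kE z : (k z)%:C = (den z ^- 2)%:C * (1 - 2 * bump 0 1 1 z)%:C by rewrite -rmorphM.
exists (fun z => z * (- (k z)%:C * z^*) + ((den z)^-1)%:C).
  split; last by apply: ctnN; apply: ctnM; [exact: ctnX (@ctn_id R)|exact: ck].
  by apply: ctnD ctn_denV; ctn_tac.
move=> z.
have hd : wirt (fun w => (den w)%:C) z ((1 - 2 * bump 0 1 1 z)%:C * z^*) ((1 - 2 * bump 0 1 1 z)%:C * z).
  have h1 := wirt_dist2 0 z; have h2 := wirt_bump 0 1 0 z.
  apply: (wirt_eq _ _ _ (wirtD h1 h2)) => [w||]; first by rewrite -rmorphD.
    by rewrite subr0 -[X in X + _]mul1r -mulrDl; congr (_ * _); rewrite -(rmorph1 (real_complex R)) -rmorphD; congr _%:C; ring.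
  by rewrite subr0 -[X in X + _]mul1r -mulrDl; congr (_ * _); rewrite -(rmorph1 (real_complex R)) -rmorphD; congr _%:C; ring.
have hi : wirt (fun w => ((den w)^-1)%:C) z ((- (den z)^-2)%:C * ((1 - 2 * bump 0 1 1 z)%:C * z^*)) ((- (den z)^-2)%:C * ((1 - 2 * bump 0 1 1 z)%:C * z)).
  apply: (wirtR (f := fun x => x^-1) hd).
  have := is_deriveV (f := id) (v := 1) (x := den z) (t := 1) (dn z).
  by rewrite /GRing.scale /= mulr1; exact.
apply: (wirt_eq _ _ _ (wirtM (wirt_id z) hi)) => [w||].
- by rewrite recipJ.
- rewrite mul1r kE rmorphN; congr (_ + _); set x := (den z ^- 2)%:C; set y := (1 - _)%:C; ring.
- rewrite mul0r addr0 /dbrecip -/(k z) kE rmorphN; set x := (den z ^- 2)%:C; set y := (1 - _)%:C; ring.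
Qed.

Lemma bounded_Linfty (f : C -> C) (B : R) : measurable_fun setT f -> (forall z, normc (f z) <= B) -> Linfty f.
Proof.
move=> mf hB; split => //; rewrite unlock /=; case: ifP => _; last exact: ltry.
apply: le_lt_trans (ltry B); apply/ess_sup_inf.ess_supP; apply: aeW => z /=.
by rewrite lee_fin ger0_norm ?normc_ge0.
Qed.

(** Near a distant point [a] the argument of conj z ^ -2 varies little, so one phase, that of (conj a)^2, makes its real part comparable to |a|^-2 on a whole disc. *)
Lemma recip_phase a z : 64 <= dist2 0 a -> dist2 a z <= 1 ->
  1 <= dist2 0 z /\ 4^-1 * (dist2 0 a)^-1 <= Re ((a^* ^+ 2 * ((dist2 0 a)^-1)%:C) * - dbrecip z).
Proof.
have Z1 : 64 <= dist2 0 a -> dist2 a z <= 1 -> 31 <= dist2 0 z /\ dist2 0 z <= 2 * dist2 0 a + 2.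
  rewrite /dist2 !normc_sq !subr0; case: a z => a1 a2 [z1 z2] /= h1 h2.
  have := sqr_ge0 (2 * a1 - z1); have := sqr_ge0 (2 * a2 - z2).
  have := sqr_ge0 (2 * z1 - a1); have := sqr_ge0 (2 * z2 - a2); split; nra.
move=> ha hz; have [Zl Zu] := Z1 ha hz; have Z1' : 1 <= dist2 0 z by lra.
split => //; rewrite /dbrecip opprK den_far// bump0 ?mul1r// mulr0 subr0 mulr1.
set A := dist2 0 a in ha Zu *; set Z := dist2 0 z in Zl Zu Z1' *.
rewrite (_ : _ * _ * _ = (A^-1 * (Z ^+ 2)^-1)%:C * (a^* * z) ^+ 2); last by rewrite rmorphM; ring.
rewrite ReRM.
have A0 : 0 < A by lra. have Z0 : 0 < Z by lra.
have key : Z ^+ 2 <= 4 * Re ((a^* * z) ^+ 2).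
  rewrite expr2 ReM.
  have E1 : Re (a^* * z) ^+ 2 + Im (a^* * z) ^+ 2 = A * Z.
    by rewrite /A /Z /dist2 !subr0 -exprMn -[normc a]normc_conj -normcM normc_sq.
  have E2 : Im (a^* * z) ^+ 2 <= A.
    rewrite (_ : a^* * z = (normc a ^+ 2)%:C + a^* * (z - a)); last by rewrite -mulJ; ring.
    rewrite ImD /= add0r.
    apply: le_trans (_ : normc (a^* * (z - a)) ^+ 2 <= _); first by rewrite normc_sq lerDr sqr_ge0.
    by rewrite normcM normc_conj exprMn /A /dist2 subr0 -[leRHS]mulr1; apply: ler_wpM2l hz; exact: sqr_ge0.
  rewrite -!expr2; move: E1 E2; move: (Re _ ^+ 2) (Im _ ^+ 2) => X Y E1 E2; nra.
rewrite mulrAC -[leRHS]mulrA [leLHS]mulrC; apply: ler_wpM2l; first by rewrite invr_ge0 ltW.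
by rewrite ler_pdivlMr ?(exprn_gt0 2 Z0)// ler_pdivrMl.
Qed.
End ReciprocalSymbol.

(** * Bessel families *)

Section Bessel.
Variable R : realType.
Local Notation C := R[i].
Implicit Types (z a : C) (ka kb : C -> R).

(** Sum the squares (al u - l)^2 / u with l = (sum of al) / K; this avoids dividing by the sum of the inverse weights. *)
Lemma weighted_CS (I : finType) (al u : I -> R) (K : R) : 0 < K -> (forall i, 0 < u i) ->
  \sum_i (u i)^-1 <= K -> (\sum_i al i) ^+ 2 <= K * \sum_i al i ^+ 2 * u i.
Proof.
move=> K0 u0 hK; pose S := \sum_i al i; pose l := S / K.
have : 0 <= \sum_i (u i)^-1 * (al i * u i - l) ^+ 2.
  by apply: sumr_ge0 => i _; rewrite mulr_ge0 ?sqr_ge0// invr_ge0 ltW.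
rewrite (eq_bigr (fun i => al i ^+ 2 * u i - 2 * l * al i + l ^+ 2 * (u i)^-1)) => [|i _]; last first.
  by field; rewrite gt_eqF.
rewrite big_split /= sumrB -!mulr_sumr -/S => h.
have h2 : l ^+ 2 * \sum_i (u i)^-1 <= l ^+ 2 * K by apply: ler_wpM2l hK; exact: sqr_ge0.
have e1 : l ^+ 2 * K = S ^+ 2 / K by rewrite /l; field; rewrite gt_eqF.
have e2 : 2 * l * S = 2 * (S ^+ 2 / K) by rewrite /l; field; rewrite gt_eqF.
rewrite mulrC -ler_pdivrMr// -/S; lra.
Qed.

(** Peaks with quadratic decay around separated points are almost orthogonal: pointwise Cauchy-Schwarz with the weights (1 + |z - a|^2)^2, whose inverses have bounded sum. *)
Lemma bessel (I : finType) (a : I -> C) ka (x : I -> C -> C) (K B : R) : pweight ka -> 0 < K ->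
  (forall z, \sum_i ((1 + dist2 (a i) z) ^+ 2)^-1 <= K) ->
  (forall i, L2w (fun z => ka z * (1 + dist2 (a i) z) ^+ 2) (x i)) ->
  (forall i, wnorm2 (fun z => ka z * (1 + dist2 (a i) z) ^+ 2) (x i) <= B) ->
  forall c : I -> C, wnorm2 ka (fun z => \sum_i c i * x i z) <= K * B * \sum_i normc (c i) ^+ 2.
Proof.
move=> [ka0 mka] K0 hK hx hB c.
pose Y i z : R := K * normc (c i) ^+ 2 * (normc (x i z) ^+ 2 * (ka z * (1 + dist2 (a i) z) ^+ 2)).
have iY i : rI (Y i) by apply: rIZ; exact: (hx i).2.
have le z : normc (\sum_i c i * x i z) ^+ 2 * ka z <= \sum_i Y i z.
  rewrite (eq_bigr (fun i => K * (normc (c i * x i z) ^+ 2 * (1 + dist2 (a i) z) ^+ 2) * ka z)) => [|i _]; last first.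
    by rewrite /Y normcM; ring.
  rewrite -mulr_suml -mulr_sumr; apply: ler_wpM2r => //.
  have u0 i : 0 < (1 + dist2 (a i) z) ^+ 2 by rewrite exprn_gt0// ltr_wpDr ?dist2_ge0.
  apply: le_trans; last exact: (weighted_CS (fun i => normc (c i * x i z)) K0 u0 (hK z)).
  rewrite ler_pXn2r ?nnegrE ?normc_ge0 ?sumr_ge0// => [|i _]; last exact: normc_ge0.
  exact: le_normc_sum.
have iS : rI (fun z => \sum_i Y i z) by exact: rI_sum.
have mS : measurable_fun setT (fun z => normc (\sum_i c i * x i z) ^+ 2 * ka z).
  apply: measurable_funM mka; apply: mnormc2; apply: mcsum => i; apply: mcM (hx i).1; exact: mcst.
have iL : rI (fun z => normc (\sum_i c i * x i z) ^+ 2 * ka z).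
  by apply: rI_le mS _ iS => z; rewrite ger0_norm; [exact: le|rewrite mulr_ge0 ?sqr_ge0].
apply: le_trans (intR_le iL iS le) _; rewrite intR_sum// mulr_sumr; apply: ler_sum => i _.
rewrite intRZ; last exact: (hx i).2.
rewrite [leRHS]mulrAC; apply: ler_wpM2l; last exact: hB.
by apply: mulr_ge0; [exact: ltW|exact: sqr_ge0].
Qed.

Lemma L2w_le ka kb (w : C -> C) : pweight ka -> (forall z, ka z <= kb z) -> L2w kb w ->
  L2w ka w /\ wnorm2 ka w <= wnorm2 kb w.
Proof.
move=> [ka0 mka] hk [mw iw].
have le z : normc (w z) ^+ 2 * ka z <= normc (w z) ^+ 2 * kb z by apply: ler_wpM2l => //; exact: sqr_ge0.
have iA : rI (fun z => normc (w z) ^+ 2 * ka z).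
  apply: rI_le iw => [|z]; first by apply: measurable_funM mka; exact: mnormc2.
  by rewrite ger0_norm; [exact: le|rewrite mulr_ge0 ?sqr_ge0].
by split; [|exact: intR_le iA iw le].
Qed.

Lemma le_mul_dist2 (x : R) a z : 0 <= x -> x <= x * (1 + dist2 a z) ^+ 2.
Proof. by move=> x0; apply: ler_peMr => //; rewrite exprn_ege1// lerDl dist2_ge0. Qed.

Lemma L2w_bounded ka (F w : C -> C) (B : R) : pweight ka -> measurable_fun setT F -> (forall z, normc (F z) <= B) ->
  L2w ka w -> L2w ka (fun z => F z * w z) /\ wnorm2 ka (fun z => F z * w z) <= B ^+ 2 * wnorm2 ka w.
Proof.
move=> [ka0 mka] mF hB [mw iw].
have le z : normc (F z * w z) ^+ 2 * ka z <= B ^+ 2 * (normc (w z) ^+ 2 * ka z).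
  rewrite normcM exprMn -mulrA; apply: ler_wpM2r; first by rewrite mulr_ge0 ?sqr_ge0.
  rewrite ler_pXn2r// ?nnegrE ?normc_ge0//; exact: le_trans (normc_ge0 _) (hB z).
have mP : measurable_fun setT (fun z => F z * w z) by exact: mcM.
have iP : rI (fun z => normc (F z * w z) ^+ 2 * ka z).
  apply: rI_le (rIZ (B ^+ 2) iw) => [|z]; first by apply: measurable_funM mka; exact: mnormc2.
  by rewrite ger0_norm; [exact: le|rewrite mulr_ge0 ?sqr_ge0].
by split; [|rewrite /wnorm2 -(intRZ _ iw); apply: intR_le iP (rIZ _ iw) le].
Qed.
End Bessel.

Section HankelLinear.
Variables (R : realType) (phi : R[i] -> R).
Hypothesis phi_C2 : C2 phi.
Local Notation C := R[i].
Local Notation th := (fweight phi).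
Local Notation pk := (weight_pweight (fweight_weight phi_C2)).

Lemma hankel_ae_linear (F : C -> C) (B : R) : measurable_fun setT F -> (forall z, normc (F z) <= B) ->
  ae_linear phi (hankel phi F).
Proof.
move=> mF hB.
have l g : F2 phi g -> L2w th (fun z => F z * g z).
  by case/(F2P phi_C2) => _ lg; exact: (L2w_bounded pk mF hB lg).1.
split=> [g hg|a g h hg hh].
  apply/(L2P phi_C2); apply: L2w_B pk (l g hg) _.
  by have [] := fproj_specP phi_C2 (l g hg).
apply: aeW => z; rewrite /hankel.
have -> : (fun w => F w * (a * g w + h w)) = (fun w => F w * h w + a * (F w * g w)) by apply/funext => w; ring.
rewrite (fproj_lin phi_C2 a (l h hh) (l g hg)); ring.
Qed.
End HankelLinear.

(** * The conjugate symbol: divergence of the trace *)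

Section ConjugateSide.
Variables (R : realType) (phi : R[i] -> R) (p s r : R[i] -> R[i]) (m M : R).
Hypothesis phi_C2 : C2 phi.
Local Notation C := R[i].
Local Notation Re := (@complex.Re R).
Local Notation mass := (@mass R).
Local Notation th := (fweight phi).
Local Notation wt := (fweight_weight phi_C2).
Local Notation pk := (weight_pweight wt).
Hypotheses (hphi : forall z, wirt (fun w => (phi w)%:C) z (p z) (p z)^*)
  (hp : forall z, wirt p z (s z) (r z)) (cs : ctn s) (cr : ctn r).
Hypotheses (m0 : 0 < m) (M0 : 0 < M) (hm : forall z, m <= Re (r z)) (hM : forall z, Re (r z) <= M).
Implicit Types (z a : C) (g : C -> C).
Local Notation conjrecip := (fun z => (recip z)^*).

(** The projection part is entire and drops out by [hol_div]; on the other part integrate by parts, which moves dbar to the symbol because [g] is entire. *)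
Lemma hankel_test a g g' : (forall z, cdiff g z (g' z)) -> ctn g' -> L2w th g ->
  cint (fun z => hankel phi conjrecip g z * dbar_eta phi p a g g' z) =
  cint (fun z => g z * (- dbrecip z * eta phi a g z)).
Proof.
move=> hg cg' lg.
have [[q [hq cq]] cd se _] := eta_test hphi hp cs cr a hg cg'.
have [_ sd] := wirt_csupp hq se.
have ce := ctn_wirt hq cq cd.
have gh : hol g by move=> z; exists (g' z).
have cg : ctn g := cdiff_ctn gh.
have [q' [cq' cb] hb] := @wirt_recipJ R.
have cJ : ctn conjrecip := ctnJ (@ctn_recip R).
have mJ : measurable_fun setT conjrecip := ctn_measurable cJ.
have bJ z : normc (conjrecip z) <= 2 by rewrite normc_conj recip_le.
have lJ : L2w th (fun z => conjrecip z * g z) := (L2w_bounded pk mJ bJ lg).1.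
have [hP lP _] := fproj_specP phi_C2 lJ.
set P := fock_proj phi _ in hP lP.
have P0 : cint (fun z => P z * dbar_eta phi p a g g' z) = 0 := hol_div hP hq cq cd se.
have i1 : cI (fun z => P z * dbar_eta phi p a g g' z) := locI_mul (ctn_locI (cdiff_ctn hP)) cd sd.
have i2 : cI (fun z => conjrecip z * g z * dbar_eta phi p a g g' z) := locI_mul (ctn_locI (ctnM cJ cg)) cd sd.
rewrite (eq_cint (G := fun z => conjrecip z * g z * dbar_eta phi p a g g' z - P z * dbar_eta phi p a g g' z)) => [|z]; last first.
  by rewrite /hankel mulrBl.
rewrite cintB// P0 subr0.
have hF z := wirtM (hb z) (hq z).
have := hol_div gh hF _ _ (csuppMr _ se).
have c1 : ctn (fun z => conjrecip z * q z + q' z * eta phi a g z) by apply: ctnD; apply: ctnM.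
have c2 : ctn (fun z => conjrecip z * dbar_eta phi p a g g' z + dbrecip z * eta phi a g z) by apply: ctnD; apply: ctnM.
move=> /(_ c1 c2) h0.
have i3 : cI (fun z => g z * (dbrecip z * eta phi a g z)).
  have -> : (fun z => g z * (dbrecip z * eta phi a g z)) = (fun z => g z * dbrecip z * eta phi a g z) by apply/funext => z; rewrite mulrA.
  exact: locI_mul (ctn_locI (ctnM cg cb)) ce se.
have : cint (fun z => conjrecip z * g z * dbar_eta phi p a g g' z) + cint (fun z => g z * (dbrecip z * eta phi a g z)) = 0.
  by rewrite -cintD// -[RHS]h0; apply: eq_cint => z; ring.
move/eqP; rewrite addr_eq0 => /eqP ->; rewrite -cintN//; apply: eq_cint => z; ring.
Qed.

(** The pairing is bounded below by [recip_phase] and the sub-mean value property, the test function is bounded above by [dbar_eta_bound].  Its support lies in the unit disc around [a], where (1 + |z - a|^2)^2 <= 4. *)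
Lemma hankel_lower a g : hol g -> L2w th g -> 64 <= dist2 0 a ->
  exists d : C -> C, [/\ L2w (fun z => (th z)^-1 * (1 + dist2 a z) ^+ 2) d,
    wnorm2 (fun z => (th z)^-1 * (1 + dist2 a z) ^+ 2) d <= 4 * (4 * M + 80) * wnorm2 th g &
    mass / (16 * expR (2 * M)) * (normc (g a) ^+ 2 * th a) * (dist2 0 a)^-1 <= Re (cint (fun z => hankel phi conjrecip g z * d z))].
Proof.
move=> gh lg a64.
have [g' [hg C2g cg' dzg dbg]] := hol_C2 gh.
have [[q [hq cq]] cd se sd] := eta_test hphi hp cs cr a hg cg'.
have [_ sd'] := wirt_csupp hq se.
have cg : ctn g := cdiff_ctn gh.
pose D := dbar_eta phi p a g g'.
(* the phase that compensates conj z ^ -2 near a *)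
pose om : C := a^* ^+ 2 * ((dist2 0 a)^-1)%:C.
have N0 : 0 < dist2 0 a by lra.
have om1 : normc om = 1.
  rewrite /om normcM normcX normc_conj normc_real ger0_norm ?invr_ge0 ?(ltW N0)//.
  by rewrite -{1}[a]subr0 divff// gt_eqF.
have cw : ctn (fun z => ((th z)^-1 * (1 + dist2 a z) ^+ 2)%:C).
  have -> : (fun z => ((th z)^-1 * (1 + dist2 a z) ^+ 2)%:C) = (fun z => ((th z)^-1)%:C * (1%:C + (dist2 a z)%:C) ^+ 2).
    by apply/funext => z; rewrite rmorphM rmorphXn rmorphD.
  by have ct := weight_inv_ctn wt; ctn_tac.
have lD : L2w (fun z => (th z)^-1 * (1 + dist2 a z) ^+ 2) D := L2w_csupp cw cd sd'.
have lD1 : L2w (fun z => (th z)^-1) D := L2w_csupp (weight_inv_ctn wt) cd sd'.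
have ti z : 0 <= (th z)^-1 by rewrite invr_ge0 expR_ge0.
have pw' : pweight (fun z => (th z)^-1 * (1 + dist2 a z) ^+ 2).
  split=> [z|]; first by rewrite mulr_ge0 ?sqr_ge0.
  by apply: continuous_measurableC; exact: ctnRr.
exists (fun z => om * D z); split.
- exact: L2w_Z.
- rewrite wnorm2_Z// om1 expr1n mul1r.
  apply: le_trans (_ : 4 * wnorm2 (fun z => (th z)^-1) D <= _); last first.
    by rewrite -mulrA; apply: ler_wpM2l => //; exact: (dbar_eta_bound hphi hp cs cr a hg C2g dzg dbg cg' (ltW M0) hM lg).
  rewrite /wnorm2 -(intRZ _ lD1.2); apply: intR_le lD.2 (rIZ _ lD1.2) _ => z.
  have [h|h] := leP 1 (dist2 a z).
    by rewrite /D sd// normc0 expr0n !mul0r mulr0.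
  rewrite mulrA [leRHS]mulrC; apply: ler_wpM2l; first by rewrite mulr_ge0 ?sqr_ge0.
  by have := dist2_ge0 a z; nra.
have lJ : L2w th (hankel phi conjrecip g).
  apply/(L2P phi_C2); apply: (hankel_ae_linear phi_C2 (B := 2) _ _).1; last by apply/(F2P phi_C2).
  - exact: ctn_measurable (ctnJ (@ctn_recip R)).
  - by move=> z; rewrite normc_conj recip_le.
have iJ := (pairing phi_C2 lJ lD1).1.
have -> : cint (fun z => hankel phi conjrecip g z * (om * D z)) = om * cint (fun z => hankel phi conjrecip g z * D z).
  by rewrite -cintZ//; apply: eq_cint => z; ring.
rewrite (hankel_test a hg cg' lg).
pose w z : R := bump a 1 3 z * (normc (g z) ^+ 2 * th z).
have [_ [_ cb] _] := @wirt_recipJ R.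
have ce := ctn_wirt hq cq cd.
have iE : cI (fun z => g z * (- dbrecip z * eta phi a g z)).
  have -> : (fun z => g z * (- dbrecip z * eta phi a g z)) = (fun z => g z * - dbrecip z * eta phi a g z) by apply/funext => z; rewrite mulrA.
  by apply: locI_mul (ctn_locI (ctnM cg (ctnN cb))) ce se.
rewrite -cintZ// Re_cint.
have iw : rI w := rI_bth hphi hp cs cr a 2 cg.
apply: le_trans (_ : 4^-1 * (dist2 0 a)^-1 * intR w <= _).
  have := submean hphi hp cs cr a gh (ltW M0) hM; rewrite -/w => h.
  have e0 : 0 < expR (2 * M) by exact: expR_gt0.
  have i0 : 0 < (dist2 0 a)^-1 by rewrite invr_gt0.
  rewrite [leLHS](_ : _ = 4^-1 * (dist2 0 a)^-1 * ((4 * expR (2 * M))^-1 * (mass * (normc (g a) ^+ 2 * th a)))); last first.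
    by field; rewrite !gt_eqF.
  apply: ler_wpM2l; first by rewrite mulr_ge0// ltW.
  by rewrite ler_pdivrMl// mulr_gt0.
rewrite -(intRZ _ iw); apply: intR_le (rIZ _ iw) (cIZ om iE).1 _ => z.
have [h|h] := leP 1 (dist2 a z).
  by rewrite /w /eta bump0 ?mul1r// !mul0r !mulr0.
have [_ ph] := recip_phase a64 (ltW h).
rewrite (_ : om * _ = (w z)%:C * (om * - dbrecip z)); last first.
  have -> : (w z)%:C = (bump a 1 3 z)%:C * (g z * (g z)^* * (th z)%:C) by rewrite mulJ -!rmorphM.
  rewrite /eta; set b := (bump _ _ _ _)%:C; set t := (th z)%:C; ring.
rewrite ReRM mulrC; apply: ler_wpM2l; last exact: ph.
by rewrite /w mulr_ge0 ?bump_ge0// mulr_ge0 ?sqr_ge0 ?expR_ge0.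
Qed.

(** The peak function scaled to have weighted modulus 1 at its centre. *)
Lemma fock_peak a : exists g : C -> C, [/\ hol g, L2w th g, normc (g a) ^+ 2 * th a = 1,
  L2w (fun z => th z * (1 + dist2 a z) ^+ 2) g & wnorm2 (fun z => th z * (1 + dist2 a z) ^+ 2) g <= (32 + 64 * peakC m) * mass] .
Proof.
have [W [hW W1 lW qW]] := peak_function a hphi hp cs cr m0 hm.
have pp : pweight (peak_weight phi a) := weight_pweight (weight_peak a hphi hp cs cr).
exists (fun z => (expR (phi a))%:C * W z).
have l2 : L2w (peak_weight phi a) (fun z => (expR (phi a))%:C * W z) by exact: L2w_Z.
split => //.
- by move=> z; have [l hl] := hW z; exists ((expR (phi a))%:C * l); exact: cdiffZ.
- by apply: (L2w_le pk _ l2).1 => z; apply: le_mul_dist2; exact: expR_ge0.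
- rewrite W1 mulr1 normc_real ger0_norm ?expR_ge0// -expRM_natl -expRD mulr2n.
  by rewrite (_ : _ + _ = 0) ?expR0//; ring.
- rewrite -/(peak_weight phi a) (wnorm2_Z _ pp lW) normc_real ger0_norm ?expR_ge0//.
  apply: le_trans (ler_wpM2l (sqr_ge0 _) qW) _.
  rewrite mulrCA -expRM_natl -expRD (_ : 2%:R * phi a + - (2 * phi a) = 0) ?expR0 ?mulr1//; ring.
Qed.

(** Peaks and test functions at the points of a finite lattice are two Bessel families with bounds independent of the size of the lattice; the trace is at least a constant times the sum of |a|^-2. *)
Theorem hankel_conj_not_schatten (q : R) : 0 < q -> q <= 1 -> ~ Schatten phi q (hankel phi conjrecip).
Proof.
move=> q0 q1 hS.
have aeL : ae_linear phi (hankel phi conjrecip).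
  apply: (hankel_ae_linear phi_C2 (B := 2)); first exact: ctn_measurable (ctnJ (@ctn_recip R)).
  by move=> z; rewrite normc_conj recip_le.
have [S hT] := schatten_trace phi_C2 q0 q1 aeL hS.
pose Ce := (32 + 64 * peakC m) * mass; pose c0 := mass / (16 * expR (2 * M)).
pose A := 9 * Ce; pose B := 9 * (4 * (4 * M + 80) * Ce).
have mass0 := mass_gt0 R.
have M80 : 0 <= 4 * (4 * M + 80) by rewrite mulr_ge0// addr_ge0// mulr_ge0// ltW.
have Ce0 : 0 < Ce.
  by rewrite mulr_gt0// ltr_wpDr// mulr_ge0// /peakC mulr_ge0 ?exprn_ge0// addr_ge0// divr_ge0// ltW.
have B0 : 0 <= B by apply: mulr_ge0 => //; apply: mulr_ge0 M80 (ltW Ce0).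
have c00 : 0 < c0 by rewrite divr_gt0// mulr_gt0// expR_gt0.
(* large enough for the lower bound of the trace to exceed its upper bound *)
have [n hn] := lattice_diverges ((Num.sqrt (A * B) * S + 1) / c0).
pose I := ('I_n * 'I_n)%type; pose N := #|{: I}|.
pose a (k : 'I_N) : C := lattice_pt R (enum_val k).1 (enum_val k).2.
have sumE (F : I -> R) : \sum_x F x = \sum_(k < N) F (enum_val k).
  exact: reindex (onW_bij _ (enum_val_bij I)).
have a64 k : 64 <= dist2 0 (a k).
  rewrite /a /dist2 subr0 normc_sq /= -![_%:R]/(_%:R) !natrD.
  by have := ler0n R (enum_val k).1; have := ler0n R (enum_val k).2; nra.
have [e he] := choice (fun k => fock_peak (a k)).
have hd' k : exists d : C -> C, [/\ L2w (fun z => (th z)^-1 * (1 + dist2 (a k) z) ^+ 2) d,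
    wnorm2 (fun z => (th z)^-1 * (1 + dist2 (a k) z) ^+ 2) d <= 4 * (4 * M + 80) * Ce &
    c0 * (dist2 0 (a k))^-1 <= Re (cint (fun z => hankel phi conjrecip (e k) z * d z))].
  have [h1 h2 h3 h4 h5] := he k; have [d [d1 d2 d3]] := hankel_lower h1 h2 (a64 k).
  exists d; split => //; last by rewrite h3 mulr1 in d3.
  apply: (le_trans d2); apply: (ler_wpM2l M80).
  by apply: le_trans h5; apply: (L2w_le pk _ h4).2 => z; apply: le_mul_dist2; exact: expR_ge0.
have [d hd] := choice hd'.
have pi : pweight (fun z => (th z)^-1).
  split=> [z|]; first by rewrite invr_ge0 expR_ge0.
  by apply: continuous_measurableC; apply: ctnRr; exact: weight_inv_ctn wt.
have latt z : \sum_k ((1 + dist2 (a k) z) ^+ 2)^-1 <= 9.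
  by have := lattice_sum n z; rewrite sumE.
have ldi k : L2w (fun z => (th z)^-1) (d k).
  by have [ld _ _] := hd k; apply: (L2w_le pi _ ld).1 => z; apply: le_mul_dist2; exact: pi.1.
have h : normc (\sum_k cint (fun z => hankel phi conjrecip (e k) z * d k z)) <= Num.sqrt (A * B) * S.
  apply: hT.
  - by rewrite mulr_gt0.
  - exact: B0.
  - by move=> k; apply/(F2P phi_C2); have [h1 h2 _ _ _] := he k; split; [exact: h1|exact: h2].
  - exact: ldi.
  - move=> c; apply: (bessel pk _ latt); [by []|move=> k..].
      by have [_ _ _ h4 _] := he k; exact: h4.
    by have [_ _ _ _ h5] := he k; exact: h5.
  - move=> c; apply: (bessel pi _ latt); [by []|move=> k..].
      by have [h1 _ _] := hd k; exact: h1.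
    by have [_ h2 _] := hd k; exact: h2.
have : \sum_k c0 * (dist2 0 (a k))^-1 <= Num.sqrt (A * B) * S.
  apply: (le_trans _ h).
  apply: le_trans (_ : \sum_k Re (cint (fun z => hankel phi conjrecip (e k) z * d k z)) <= _).
    by apply: ler_sum => k _; have [_ _ hk] := hd k; exact: hk.
  apply: (le_trans _ (le_trans (ler_norm _) (Re_le _))); rewrite le_eqVlt; apply/orP; left; apply/eqP.
  by elim/big_ind2: _ => [//|x1 x2 y1 y2 -> ->|//]; rewrite ReD.
rewrite -mulr_sumr (_ : \sum_k (dist2 0 (a k))^-1 = \sum_(x : 'I_n * 'I_n) (normc (lattice_pt R x.1 x.2) ^+ 2)^-1).
  move=> h'; move: hn; rewrite ler_pdivrMr// mulrC => hn; lra.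
by rewrite sumE; apply: eq_bigr => k _; rewrite /dist2 subr0.
Qed.
End ConjugateSide.

(** * Taylor quotients *)

Section TaylorQuotients.
Variable R : realType.
Local Notation C := R[i].
Local Notation Re := (@complex.Re R).
Implicit Types (z a c h : C) (u v : C -> C).

(** The difference quotient with its removable singularity filled. *)
Definition divq a u z : C := if z == a then dz u a else (u z - u a) / (z - a).

Lemma divqE a u z : u z = u a + (z - a) * divq a u z.
Proof.
rewrite /divq; have [->|za] := eqVneq z a; first by rewrite subrr mul0r addr0.
by rewrite mulrC divfK ?subr_eq0// addrC subrK.
Qed.

Lemma hol_dz u : hol u -> forall z, cdiff u z (dz u z).
Proof. by move=> hu z; have [l hl] := hu z; rewrite (dzE (cdiff_wirt hl)). Qed.

Lemma divq_lin a u v c : hol u -> hol v ->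
  divq a (fun z => u z + c * v z) = fun z => divq a u z + c * divq a v z.
Proof.
move=> hu hv; apply/funext => z; rewrite /divq; case: eqP => _; last by ring.
apply: dzE; apply: (wirtD (q := 0) (q' := c * 0)); first exact: cdiff_wirt (hol_dz hu a).
by apply: wirtZ; exact: cdiff_wirt (hol_dz hv a).
Qed.

(** At [a] itself one needs the expansion of [u] to second order, which follows from the one of its derivative to first order by the mean value inequality. *)
Lemma divq_hol a u : hol u -> hol (divq a u).
Proof.
move=> hu z; have cu := hol_dz hu; have [->|za] := eqVneq z a; last first.
  have [|l hl] := @derive_cdiff R (fun w => (u w - u a) * (w - a)^-1) z.
    apply: derivableM.
      apply: derivableB; last exact: derivable_cst.
      by apply: ex_derive; exact: cdiff_derive (cu z).
    apply: derivableV; first by rewrite subr_eq0.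
    by apply: derivableB; [exact: derivable_id|exact: derivable_cst].
  exists l => e /hl [d d0 hd]; exists (Num.min d (normc (z - a))).
    by rewrite lt_min d0 normc_gt0 subr_eq0.
  move=> h; rewrite lt_min => /andP[h1 h2].
  rewrite /divq (negbTE za) ifF; first exact: hd.
  apply/negbTE/eqP => e1; move: h2; rewrite -e1 (_ : z - (z + h) = - h) ?normcN ?ltxx//; ring.
have [u1 [u2 [h1 h2 _ c2]]] := hol_derivative hu.
have e1 w : dz u w = u1 w := dzE (cdiff_wirt (h1 w)).
exists (2^-1 * u2 a) => e e0.
have e64 : 0 < e / 64 by rewrite divr_gt0.
have [d d0 hd] := (ctnP _).1 c2 a (e / 64) e64; exists d => // h hh.
rewrite /divq eqxx; have [h0|h0] := eqVneq h 0.
  by rewrite h0 addr0 eqxx subrr mulr0 subr0 normc0 mulr0.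
rewrite ifF; last by rewrite -subr_eq0 addrAC subrr add0r (negbTE h0).
pose F w := u w - u1 a * (w - a) - 2^-1 * u2 a * ((w - a) * (w - a)).
have hF w : wirt F w (u1 w - u1 a - u2 a * (w - a)) 0.
  have k := wirtB (wirtB (cdiff_wirt (h1 w)) (wirtZ (u1 a) (wirt_sub a w))) (wirtZ (2^-1 * u2 a) (wirtM (wirt_sub a w) (wirt_sub a w))).
  by apply: (wirt_eq _ _ _ k) => [x //||]; [field|ring].
have := wirt_mvt (z := a) (h := h) (L := 8 * (e / 64 * normc h)) hF _; rewrite /F.
have -> : a + h - a = h by ring.
rewrite subrr !mulr0 !subr0 => /(_ _) B.
have {}B : normc (u (a + h) - u1 a * h - 2^-1 * u2 a * (h * h) - u a) <= e * normc h ^+ 2.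
  rewrite (_ : e * _ = 8 * (8 * (e / 64 * normc h) * normc h)); last by field.
  apply: B => w hw; split; last first.
    by rewrite normc0 !mulr_ge0 ?normc_ge0 ?divr_ge0// ltW.
  have := wirt_taylor (z := a) (h := w - a) (L := e / 64) (fun x => cdiff_wirt (h2 x)).
  rewrite mul0r !subr0 (_ : a + (w - a) = w); last by ring.
  move=> T; apply: le_trans (T _) _.
    move=> x hx; split; last by rewrite normc0 ltW.
    by apply/ltW/hd; apply: le_lt_trans hx _; apply: le_lt_trans hw hh.
  by rewrite ler_pM2l// ler_pM2l.
rewrite (_ : _ - _ = h^-1 * (u (a + h) - u1 a * h - 2^-1 * u2 a * (h * h) - u a)); last first.
  by rewrite e1; field.
by rewrite normcM normcV mulrC ler_pdivrMr ?normc_gt0//; apply: (le_trans B); rewrite expr2 mulrA.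
Qed.

(** The quotient of the N-th Taylor remainder at 0 by z^N; its value at 0 is the N-th Taylor coefficient. *)
Definition taylor_quot N u : C -> C := iter N (divq 0) u.

Lemma taylor_quot_hol N u : hol u -> hol (taylor_quot N u).
Proof. by move=> hu; elim: N => //= N IH; exact: divq_hol. Qed.

Lemma taylor_quot_lin N u v c : hol u -> hol v -> taylor_quot N (fun z => u z + c * v z) = fun z => taylor_quot N u z + c * taylor_quot N v z.
Proof.
by move=> hu hv; elim: N => [//|N IH]; rewrite /taylor_quot iterS -/(taylor_quot N _) IH divq_lin//; exact: taylor_quot_hol.
Qed.

Lemma taylorE N u z : u z = \sum_(i < N) taylor_quot i u 0 * z ^+ i + z ^+ N * taylor_quot N u z.
Proof.
elim: N => [|N IH]; first by rewrite big_ord0 add0r expr0 mul1r.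
rewrite IH big_ord_recr /= -addrA; congr (_ + _).
by rewrite [in LHS](divqE 0 (taylor_quot N u) z) subr0 exprSr; ring.
Qed.

Lemma ctnXz N : ctn (fun z : C => z ^+ N).
Proof. exact: ctnX (@ctn_id R). Qed.

(** u = (z - a) Q with Q entire, and (z - a) times a bump is a dbar-derivative. *)
Lemma bump_mean0 a (s : R) n u : 0 < s -> hol u -> u a = 0 -> cint (fun z => u z * (bump a s n.+1 z)%:C) = 0.
Proof.
move=> s0 hu u0; have hQ := divq_hol a hu.
pose k : R := - (n.+2%:R * s).
have k0 : k%:C != 0 :> C by rewrite fmorph_eq0 oppr_eq0 mulf_neq0 ?pnatr_eq0// gt_eqF.
have cz : ctn (fun z => z - a) by apply: ctnB; [exact: ctn_id|exact: ctn_cst].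
have cb : ctn (fun z => (- (n.+2%:R * s * bump a s n.+1 z))%:C).
  rewrite (_ : (fun z => _) = fun z => k%:C * (bump a s n.+1 z)%:C); first by ctn_tac.
  by apply/funext => z; rewrite -rmorphM mulNr.
have := hol_div hQ (fun z => wirt_bump a s n z) (ctnM cb (ctnJ cz)) (ctnM cb cz) (csupp_bumpC a n.+1 s0).
rewrite (eq_cint (G := fun z => k%:C * (u z * (bump a s n.+1 z)%:C))) => [|z]; last first.
  by rewrite [in RHS](divqE a u z) u0 add0r /k -mulNr rmorphM; ring.
rewrite cintZ => [/eqP|]; first by rewrite mulf_eq0 (negbTE k0) => /eqP.
by apply: locI_mul (ctn_locI (cdiff_ctn hu)) _ (csupp_bumpC a n s0); ctn_tac.
Qed.

Lemma dist2_bump a (s : R) n z : s * dist2 a z * bump a s n.+1 z = bump a s n.+1 z - bump a s n.+2 z.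
Proof. by rewrite /bump; have := pp_mul (1 - s * dist2 a z) n; rewrite mulrBl mul1r => <-; ring. Qed.

(** Powers of |z|^2 times a bump are combinations of bumps. *)
Lemma radial_mean0 (s : R) i n u : 0 < s -> hol u -> u 0 = 0 ->
  cint (fun z => u z * (dist2 0 z ^+ i * bump 0 s n.+1 z)%:C) = 0.
Proof.
move=> s0 hu u0; have lu := ctn_locI (cdiff_ctn hu).
elim: i n => [|i IH] n.
  by under eq_cint => z do rewrite expr0 mul1r; exact: bump_mean0.
have cI_ k : cI (fun z => u z * (dist2 0 z ^+ i * bump 0 s k.+1 z)%:C).
  apply: locI_mul lu _ _; first by ctn_tac.
  by have [r hr] := csupp_bump (0 : C) k s0; exists r => z /hr ->; rewrite mulr0.
rewrite (eq_cint (G := fun z => (s^-1)%:C * (u z * (dist2 0 z ^+ i * bump 0 s n.+1 z)%:C - u z * (dist2 0 z ^+ i * bump 0 s n.+2 z)%:C))) => [|z]; last first.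
  rewrite -mulrBr -rmorphB mulrCA -rmorphM; congr (_ * _%:C).
  by rewrite -mulrBr -dist2_bump exprSr; field; rewrite gt_eqF.
rewrite cintZ; last exact: cIB.
by rewrite cintB// !IH subr0 mulr0.
Qed.

(** conj z ^ i z^N u is |z|^(2i) times an entire function vanishing at 0. *)
Lemma monomial_orth (s : R) i N n u : 0 < s -> hol u -> (i < N)%N ->
  cint (fun z => (z ^+ i)^* * (z ^+ N * u z) * (bump 0 s n.+1 z)%:C) = 0.
Proof.
move=> s0 hu iN.
have hv : hol (fun z => z ^+ (N - i) * u z).
  elim: (N - i)%N => [|k IH]; first by under eq_fun do rewrite expr0 mul1r.
  have [u1 [_ [h1 _ c1 _]]] := hol_derivative IH.
  under eq_fun do rewrite exprS -mulrA.
  apply: (@wirt_hol R _ (fun z => z * u1 z + 1 * (z ^+ k * u z))) => [z|].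
    apply: (wirt_eq _ _ _ (wirtM (wirt_id z) (cdiff_wirt (h1 z)))) => //; by rewrite mulr0 mul0r addr0.
  by apply: ctnD; apply: ctnM; [exact: ctn_id|exact: c1|exact: ctn_cst|exact: cdiff_ctn IH].
rewrite -[RHS](radial_mean0 i n s0 hv); last by rewrite expr0n subn_eq0 leqNgt iN mul0r.
apply: eq_cint => z.
have e : (dist2 0 z ^+ i * bump 0 s n.+1 z)%:C = (z * z^*) ^+ i * (bump 0 s n.+1 z)%:C.
  by rewrite rmorphM rmorphXn /=; congr (_ ^+ _ * _); rewrite dist2E subr0.
by rewrite e conjX exprMn -{1}(subnK (ltnW iN)) exprD; ring.
Qed.

(** Pythagoras: for a radial weight the Taylor polynomial is orthogonal to the remainder. *)
Lemma remainder_L2 (s : R) N u : 0 < s -> hol u ->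
  intR (fun z => normc (z ^+ N * taylor_quot N u z) ^+ 2 * bump 0 s 1 z) <= intR (fun z => normc (u z) ^+ 2 * bump 0 s 1 z).
Proof.
move=> s0 hu; pose P z := \sum_(i < N) taylor_quot i u 0 * z ^+ i; pose r z := z ^+ N * taylor_quot N u z.
have cu := cdiff_ctn hu.
have cr : ctn r by apply: ctnM; [exact: ctnXz|exact: cdiff_ctn (taylor_quot_hol N hu)].
have PE : P = fun z => u z - r z by apply/funext => z; rewrite /P /r [u z](taylorE N); ring.
have cP : ctn P by rewrite PE; exact: ctnB.
have sb := csupp_bump (0 : C) 0 s0.
have iF (F : C -> C) : ctn F -> rI (fun z => normc (F z) ^+ 2 * bump 0 s 1 z).
  move=> cF; apply: rI_csupp; last by have [r0 hr] := sb; exists r0 => z /hr ->; rewrite mulr0.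
  apply: ctnRr; rewrite (_ : (fun z => _) = fun z => F z * (F z)^* * (bump 0 s 1 z)%:C).
    by apply: ctnM; [apply: ctnM cF (ctnJ cF)|ctn_tac].
  by apply/funext => z; rewrite mulJ -rmorphM.
have iX : cI (fun z => (P z)^* * r z * (bump 0 s 1 z)%:C).
  by apply: locI_mul (ctn_locI (ctnM (ctnJ cP) cr)) _ (csupp_bumpC 0 0 s0); ctn_tac.
have X0 : cint (fun z => (P z)^* * r z * (bump 0 s 1 z)%:C) = 0.
  have ii (i : 'I_N) : cI (fun z => (z ^+ i)^* * (z ^+ N * taylor_quot N u z) * (bump 0 s 1 z)%:C).
    have cc : ctn (fun z => (z ^+ i)^* * (z ^+ N * taylor_quot N u z)) := ctnM (ctnJ (@ctnXz i)) cr.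
    by apply: locI_mul (ctn_locI cc) _ (csupp_bumpC 0 0 s0); ctn_tac.
  rewrite (eq_cint (G := fun z => \sum_(i < N) (taylor_quot i u 0)^* * ((z ^+ i)^* * (z ^+ N * taylor_quot N u z) * (bump 0 s 1 z)%:C))).
    rewrite cint_sum => [|i]; last exact: cIZ.
    by apply: big1 => i _; rewrite cintZ// monomial_orth ?mulr0//; exact: taylor_quot_hol.
  move=> z; rewrite -mulrA rmorph_sum mulr_suml; apply: eq_bigr => i _.
  by rewrite -[X in X * _]/((taylor_quot i u 0 * z ^+ i)^*) conjM /r; ring.
have E z : normc (u z) ^+ 2 * bump 0 s 1 z =
   normc (P z) ^+ 2 * bump 0 s 1 z + normc (r z) ^+ 2 * bump 0 s 1 z + 2 * Re ((P z)^* * r z * (bump 0 s 1 z)%:C).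
  rewrite (_ : u z = P z + r z); last by rewrite PE subrK.
  by case: (P z) (r z) => x1 y1 [x2 y2]; rewrite !normc_sq /=; ring.
under [leRHS]eq_Rintegral => z _ do rewrite E.
rewrite -/(intR _) intRD; [|exact: rID (iF P cP) (iF r cr)|exact: rIZ iX.1].
rewrite intRD ?intRZ; [|exact: iX.1|exact: iF|exact: iF].
have := congr1 Re X0; rewrite Re_cint => ->; rewrite mulr0 addr0 lerDr.
by apply: intR_ge0 => z; rewrite mulr_ge0 ?sqr_ge0 ?bump_ge0.
Qed.
End TaylorQuotients.

(** * Means over an annulus and Taylor remainders *)

Section AnnulusMean.
Variable R : realType.
Local Notation C := R[i].
Local Notation Re := (@complex.Re R).
Local Notation mass := (@mass R).
Implicit Types (z a : C) (u v : C -> C) (t : R).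

(** Equal to 1 up to 9 and to 0 from 10 on; its derivative - [cut'] is supported between, so that [cut'] of |z - a|^2 lives in an annulus around [a]. *)
Definition cut t : R := pp (1 - pp (t - 9) ^+ 2) ^+ 2.
Definition cut' t : R := 4 * (pp (1 - pp (t - 9) ^+ 2) * pp (t - 9)).

Lemma is_derive_cut t : is_derive t (1:R) cut (- cut' t).
Proof.
have d1 : is_derive t (1:R) (fun x => x - 9) 1.
  by apply: (is_derive_fun (f := fun x => -9 + x * 1)) (is_derive_affine (-9) 1 t) => // x; ring.
have d2 := is_derive_comp' (g := fun x => x - 9) (is_derive_pp2 (t - 9)) d1.
have d3 : is_derive t (1:R) (fun x => 1 - pp (x - 9) ^+ 2) (0 - 2 * pp (t - 9) * 1) by apply: is_deriveB' d2.
apply: (is_derive_fun (l := 2 * pp (1 - pp (t - 9) ^+ 2) * (0 - 2 * pp (t - 9) * 1))) (is_derive_comp' (g := fun x => 1 - pp (x - 9) ^+ 2) (is_derive_pp2 _) d3) => //.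
by rewrite /cut'; ring.
Qed.

Lemma cut'_ge0 t : 0 <= cut' t.
Proof. by rewrite /cut' !mulr_ge0 ?pp_ge0. Qed.

Lemma cut'_supp t : cut' t != 0 -> 9 < t < 10.
Proof.
rewrite /cut'; apply: contraR; rewrite negb_and -!leNgt => /orP[h|h].
  by rewrite [pp (t - 9)]pp_neg ?subr_le0// !mulr0.
rewrite [pp (1 - _)]pp_neg ?mul0r ?mulr0// subr_le0 pp_pos; last by lra.
by nra.
Qed.

Lemma cut'_le4 t : cut' t <= 4.
Proof.
have [->|/cut'_supp /andP[h1 h2]] := eqVneq (cut' t) 0; first by [].
rewrite /cut' [pp (t - 9)]pp_pos; last by lra.
have s0 := sqr_ge0 (t - 9); have s1 : (t - 9) ^+ 2 <= 1 by nra.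
rewrite pp_pos ?subr_ge0//; move: ((t - 9) ^+ 2) s0 s1 => y s0 s1; nra.
Qed.

Lemma cut_out t : 10 <= t -> cut t = 0.
Proof. by move=> h; rewrite /cut [pp (1 - _)]pp_neg ?expr0n// subr_le0 pp_pos; nra. Qed.

Lemma cut_in t : t <= 9 -> cut t = 1.
Proof. by move=> h; rewrite /cut [pp (t - 9)]pp_neg ?subr_le0// expr0n subr0 pp_pos ?expr1n. Qed.

Lemma wirt_cut a z : wirt (fun w => (cut (dist2 a w))%:C) z ((- cut' (dist2 a z))%:C * (z - a)^*) ((- cut' (dist2 a z))%:C * (z - a)).
Proof. exact: wirtR (wirt_dist2 a z) (is_derive_cut _). Qed.

Lemma ctn_cut' a : ctn (fun z => (cut' (dist2 a z))%:C).
Proof.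
have cp (f : C -> R) : ctn (fun z => (f z)%:C) -> ctn (fun z => (pp (f z))%:C).
  by move=> cf; apply: ctnR; exact: continuous_compR (@continuous_pp R) (ctnRr cf).
have c1 : ctn (fun z => (pp (dist2 a z - 9))%:C).
  by apply: (cp (fun z => dist2 a z + - 9)); apply: ctnRD; [exact: ctnR (@continuous_dist2 R a)|exact: ctn_cst].
have c2 : ctn (fun z => (pp (1 - pp (dist2 a z - 9) ^+ 2))%:C).
  apply: (cp (fun z => 1 + - pp (dist2 a z - 9) ^+ 2)); apply: ctnRD; first exact: ctn_cst.
  by apply: (@ctnRN R (fun z => pp (dist2 a z - 9) ^+ 2)); exact: (@ctnRX R (fun z => pp (dist2 a z - 9))).
by rewrite /cut'; apply: ctnRM; [exact: ctn_cst|exact: ctnRM].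
Qed.

Lemma dist2_far a z (x : R) : 2 * (x + normc a ^+ 2) < normc z ^+ 2 -> x < dist2 a z.
Proof.
rewrite /dist2 !normc_sq; case: a z => a1 a2 [z1 z2] /= h.
have := sqr_ge0 (z1 - 2 * a1); have := sqr_ge0 (z2 - 2 * a2); nra.
Qed.

Lemma csupp_far a (F : C -> C) (x : R) : 0 <= x -> (forall z, x < dist2 a z -> F z = 0) -> csupp F.
Proof.
move=> x0 hF; exists (2 * (x + normc a ^+ 2) + 1) => z hz; apply: hF; apply: dist2_far.
by have := sqr_ge0 (normc a); nra.
Qed.

Lemma csupp_cut a : csupp (fun z => (cut (dist2 a z))%:C).
Proof. by apply: (@csupp_far a _ 10) => // z /ltW h; rewrite cut_out. Qed.

Lemma csupp_cut' a : csupp (fun z => (cut' (dist2 a z))%:C).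
Proof.
apply: (@csupp_far a _ 10) => // z h; rewrite (_ : cut' _ = 0)//; apply/eqP.
by apply: contraTT h => /cut'_supp /andP[_]; rewrite -leNgt => /ltW.
Qed.

(** u - u(a) = (z - a) Q with Q entire, and (z - a) times the kernel is the dbar-derivative of the cut-off. *)
Lemma annulus_mean a u : hol u ->
  cint (fun z => u z * (cut' (dist2 a z))%:C) = u a * (intR (fun z => cut' (dist2 a z)))%:C.
Proof.
move=> hu; have hQ := divq_hol a hu; have lu := ctn_locI (cdiff_ctn hu).
have cz : ctn (fun z : C => z - a) by apply: ctnB; [exact: ctn_id|exact: ctn_cst].
have ck : ctn (fun z => (- cut' (dist2 a z))%:C) by apply: ctnRN; exact: ctn_cut'.
have iu : cI (fun z => u z * (cut' (dist2 a z))%:C) := locI_mul lu (@ctn_cut' a) (csupp_cut' a).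
have ic : cI (fun z => u a * (cut' (dist2 a z))%:C) := locI_mul (ctn_locI (@ctn_cst R (u a))) (@ctn_cut' a) (csupp_cut' a).
have h := hol_div hQ (wirt_cut a) (ctnM ck (ctnJ cz)) (ctnM ck cz) (csupp_cut a).
have i1 : cI (fun z => (cut' (dist2 a z))%:C) := cI_csupp (@ctn_cut' a) (csupp_cut' a).
rewrite -cintR -cintZ//; apply/eqP; rewrite -subr_eq0 -cintB// -oppr_eq0 -cintN; last exact: cIB.
rewrite -[X in _ == X]h; apply/eqP/eq_cint => z.
by rewrite [u z](divqE a u z) rmorphN; ring.
Qed.

(** Differentiating (z - a) times the cut-off shows that the integral of |z - a|^2 times the kernel is the integral of the cut-off; and |z - a|^2 <= 10 on the support. *)
Lemma annulus_mass a : mass / 20 <= intR (fun z => cut' (dist2 a z)).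
Proof.
have cz : ctn (fun z : C => z - a) by apply: ctnB; [exact: ctn_id|exact: ctn_cst].
have ck := @ctn_cut' a.
have cc : ctn (fun z => (cut (dist2 a z))%:C).
  by apply: (ctn_wirt (wirt_cut a)); [apply: ctnM (ctnRN ck) (ctnJ cz)|apply: ctnM (ctnRN ck) cz].
have ic : rI (fun z => cut (dist2 a z)) := (cI_csupp cc (csupp_cut a)).1.
have ik : rI (fun z => cut' (dist2 a z)) := (cI_csupp ck (csupp_cut' a)).1.
have sk : csupp (fun z => (dist2 a z * cut' (dist2 a z))%:C).
  by have [x hx] := csupp_cut' a; exists x => z /hx /(congr1 Re) /= ->; rewrite mulr0.
have ct : ctn (fun z => (dist2 a z * cut' (dist2 a z))%:C) by apply: ctnRM; [exact: (@ctnR R (dist2 a) (@continuous_dist2 R a))|].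
have it : rI (fun z => dist2 a z * cut' (dist2 a z)) := (cI_csupp ct sk).1.
have e1 : intR (fun z => dist2 a z * cut' (dist2 a z)) = intR (fun z => cut (dist2 a z)).
  have hw z := wirtM (wirt_sub a z) (wirt_cut a z).
  have c1 : ctn (fun z => (z - a) * ((- cut' (dist2 a z))%:C * (z - a)^*) + 1 * (cut (dist2 a z))%:C).
    by apply: ctnD; apply: ctnM; [exact: cz|apply: ctnM (ctnRN ck) (ctnJ cz)|exact: ctn_cst|exact: cc].
  have c2 : ctn (fun z => (z - a) * ((- cut' (dist2 a z))%:C * (z - a)) + 0 * (cut (dist2 a z))%:C).
    by apply: ctnD; apply: ctnM; [exact: cz|apply: ctnM (ctnRN ck) cz|exact: ctn_cst|exact: cc].
  have [h _] := divergence hw c1 c2 (csuppMr _ (csupp_cut a)).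
  apply/eqP; rewrite eq_sym -subr_eq0 -intRB//; apply/eqP.
  have := congr1 Re h; rewrite /= => <-; apply: eq_Rintegral => z _.
  have -> : (z - a) * ((- cut' (dist2 a z))%:C * (z - a)^*) + 1 * (cut (dist2 a z))%:C = (cut (dist2 a z) - dist2 a z * cut' (dist2 a z))%:C.
    by rewrite mulrCA -dist2E -rmorphM mul1r -rmorphD; congr _%:C; ring.
  by [].
have i1 : intR (bump a 1 1) = mass / 2.
  by rewrite -(rho_int 0 a) /rho intRZ; [field|apply: rI_csupp; [exact: continuous_bump|exact: csupp_bump]].
have : intR (bump a 1 1) <= intR (fun z => cut (dist2 a z)).
  apply: intR_le ic _; first by apply: rI_csupp; [exact: continuous_bump|exact: csupp_bump].
  move=> z; have [h|h] := leP (dist2 a z) 9; first by rewrite cut_in//; exact: bump_le1.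
  by rewrite bump0 ?mul1r; [exact: sqr_ge0|lra].
rewrite -e1 i1 => h.
have : intR (fun z => dist2 a z * cut' (dist2 a z)) <= intR (fun z => 10 * cut' (dist2 a z)).
  apply: intR_le it (rIZ 10 ik) _ => z.
  have [->|/cut'_supp /andP[_ /ltW h2]] := eqVneq (cut' (dist2 a z)) 0; first by rewrite !mulr0.
  by apply: ler_wpM2r h2; exact: cut'_ge0.
by rewrite intRZ// => h2; lra.
Qed.

(** For |a| <= 1 the annulus around [a] lies between the circles of radius 2 and 5.  There the quotient is at most 2^-N times the remainder, whose norm is controlled by [remainder_L2]. *)
Lemma tail_bound : exists2 B : R, 0 < B & forall u N a, hol u -> normc a <= 1 ->
  normc (taylor_quot N u a) ^+ 2 <= B * 4^-1 ^+ N * intR (fun z => normc (u z) ^+ 2 * bump 0 25^-1 1 z).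
Proof.
have m0 := mass_gt0 R.
(* on the support of the kernel it is at most 4, and the bump of radius 5 is at least 3 / 25 *)
have [K K0 hK] : exists2 K : R, 0 < K & 16 <= 3 / 25 * K by exists 200; lra.
have Is : rI (fun z : C => K * isq 0 5 z) by apply: rIZ; exact: rI_sq.
exists ((20 / mass) ^+ 2 * intR (fun z : C => K * isq 0 5 z)).
  rewrite intRZ ?intR_sq//; last exact: rI_sq.
  by rewrite mulr_gt0 ?exprn_gt0 ?divr_gt0// !mulr_gt0.
move=> u N a hu a1; pose v := taylor_quot N u; have hv : hol v := taylor_quot_hol N hu.
pose r z := z ^+ N * v z.
have cr : ctn r by apply: ctnM; [exact: ctnXz|exact: cdiff_ctn hv].
have s0 : 0 < 25^-1 :> R by [].
have geo z : cut' (dist2 a z) != 0 -> [/\ 2 <= normc z, normc z <= 5 & 3 / 25 <= bump 0 25^-1 1 z].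
  move=> /cut'_supp /andP[h1 h2].
  have n3 : 3 <= normc (z - a).
    by rewrite -(@ler_pXn2r _ 2)// ?nnegrE ?normc_ge0//; rewrite /dist2 in h1; lra.
  have z22 : normc z ^+ 2 <= 22.
    rewrite leNgt; apply/negP => h; have : 10 < dist2 a z; last by lra.
    by apply: dist2_far; have := normc_ge0 a; nra.
  split.
  - have := le_normcB z a; lra.
  - by rewrite -(@ler_pXn2r _ 2)// ?nnegrE ?normc_ge0//; lra.
  - by rewrite /bump expr1 /dist2 subr0 pp_pos; lra.
have iW : rI (fun z => normc (r z) ^+ 2 * bump 0 25^-1 1 z).
  apply: rI_csupp.
    apply: ctnRr; rewrite (_ : (fun z => _) = fun z => r z * (r z)^* * (bump 0 25^-1 1 z)%:C).
      by apply: ctnM; [apply: ctnM cr (ctnJ cr)|ctn_tac].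
    by apply/funext => z; rewrite mulJ -rmorphM.
  by have [x hx] := csupp_bump (0 : C) 0 s0; exists x => z /hx ->; rewrite mulr0.
pose X z := normc (r z) * cut' (dist2 a z).
have mX : measurable_fun setT X.
  apply: measurable_funM; first exact: mnormc (ctn_measurable cr).
  by apply: continuous_measurableC; apply: ctnRr; exact: ctn_cut'.
have [iX cs] : rI X /\ intR X ^+ 2 <= intR (fun z => normc (r z) ^+ 2 * bump 0 25^-1 1 z) * intR (fun z : C => K * isq 0 5 z).
  apply: (pointwise_CS mX _ _ _ iW Is) => z; [exact: mulr_ge0 (sqr_ge0 _) (bump_ge0 _ _ _ _)|exact: mulr_ge0 (ltW K0) (isq_ge0 _ _ _)|].
  rewrite /X; have [->|h] := eqVneq (cut' (dist2 a z)) 0.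
    by rewrite mulr0 expr0n; apply: mulr_ge0; [apply: mulr_ge0; [exact: sqr_ge0|exact: bump_ge0]|exact: mulr_ge0 (ltW K0) (isq_ge0 _ _ _)].
  have [_ h5 hb] := geo z h; rewrite isq1 ?subr0// exprMn -[leRHS]mulrA; apply: ler_wpM2l; first exact: sqr_ge0.
  have := cut'_ge0 (dist2 a z); have := cut'_le4 (dist2 a z); nra.
have iv : cI (fun z => v z * (cut' (dist2 a z))%:C) := locI_mul (ctn_locI (cdiff_ctn hv)) (@ctn_cut' a) (csupp_cut' a).
have le1 : normc (v a) * (mass / 20) <= 2^-1 ^+ N * intR X.
  apply: le_trans (_ : normc (v a) * intR (fun z => cut' (dist2 a z)) <= _).
    by apply: ler_wpM2l (annulus_mass a); exact: normc_ge0.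
  have e0 : 0 <= intR (fun z => cut' (dist2 a z)) by apply: intR_ge0 => z; exact: cut'_ge0.
  rewrite -[X in _ * X <= _](ger0_norm e0) -normc_real -normcM -(annulus_mean a hv).
  apply: le_trans (normc_cint iv) _; rewrite -(intRZ _ iX); apply: intR_le (cI_norm iv) (rIZ _ iX) _ => z.
  rewrite normcM normc_real ger0_norm ?cut'_ge0//.
  rewrite [leRHS](_ : _ = (2^-1 ^+ N * normc (r z)) * cut' (dist2 a z)); last by rewrite /X; ring.
  have [->|h] := eqVneq (cut' (dist2 a z)) 0; first by rewrite !mulr0.
  apply: ler_wpM2r; first exact: cut'_ge0.
  have [h2 _ _] := geo z h; rewrite /r normcM normcX mulrA -exprMn.
  by apply: ler_peMl; [exact: normc_ge0|apply: exprn_ege1; lra].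
have X0 : 0 <= intR X by apply: intR_ge0 => z; rewrite mulr_ge0 ?normc_ge0 ?cut'_ge0.
have le2 : (normc (v a) * (mass / 20)) ^+ 2 <= 4^-1 ^+ N * intR X ^+ 2.
  rewrite (_ : 4^-1 ^+ N = (2^-1 ^+ N) ^+ 2); last by rewrite -exprM mulnC exprM; congr (_ ^+ _); field.
  rewrite -exprMn ler_pXn2r// ?nnegrE; [exact: mulr_ge0 (normc_ge0 _) (ltW (divr_gt0 m0 _))|].
  by rewrite mulr_ge0 ?exprn_ge0.
have le3 := remainder_L2 N s0 hu.
have q0 : 0 <= 4^-1 ^+ N :> R by rewrite exprn_ge0.
have i0 : 0 <= intR (fun z : C => K * isq 0 5 z) by apply: intR_ge0 => z; exact: mulr_ge0 (ltW K0) (isq_ge0 _ _ _).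
rewrite -/v (_ : normc (v a) ^+ 2 = (20 / mass) ^+ 2 * (normc (v a) * (mass / 20)) ^+ 2); last first.
  by field; rewrite gt_eqF.
rewrite -[leRHS]mulrA -[leRHS]mulrA; apply: ler_wpM2l; first exact: sqr_ge0.
apply: (le_trans le2); rewrite [leRHS]mulrCA; apply: ler_wpM2l; first exact: q0.
by apply: (le_trans cs); rewrite [leLHS]mulrC; apply: ler_wpM2l; [exact: i0|exact: le3].
Qed.
End AnnulusMean.

(** * The symbol: exponential decay of the singular values *)

Section ReciprocalSide.
Variables (R : realType) (phi : R[i] -> R) (p s r : R[i] -> R[i]) (M : R).
Hypothesis phi_C2 : C2 phi.
Local Notation C := R[i].
Local Notation Re := (@complex.Re R).
Local Notation mass := (@mass R).
Local Notation th := (fweight phi).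
Local Notation wt := (fweight_weight phi_C2).
Local Notation pk := (weight_pweight wt).
Local Notation recip := (@recip R).
Hypotheses (hphi : forall z, wirt (fun w => (phi w)%:C) z (p z) (p z)^*)
  (hp : forall z, wirt p z (s z) (r z)) (cs : ctn s) (cr : ctn r).
Hypotheses (M0 : 0 < M) (hM : forall z, Re (r z) <= M).
Implicit Types (z a : C) (g h u : C -> C) (N : nat).

Lemma powRX (y t : R) n : 0 <= y -> (y `^ t) ^+ n = (y ^+ n) `^ t.
Proof. by move=> y0; rewrite -(powR_mulrn n (powR_ge0 y t)) -(powR_mulrn n y0) powRAC. Qed.

Lemma wnorm2_D2 (ka : C -> R) u v : pweight ka -> L2w ka u -> L2w ka v ->
  wnorm2 ka (fun z => u z + v z) <= 2 * wnorm2 ka u + 2 * wnorm2 ka v.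
Proof.
move=> kappa lu lv; have := L2w_lin 1 kappa lu lv; under eq_fun do rewrite mul1r; move=> [_ iL].
rewrite /wnorm2 -(intRZ _ lu.2) -(intRZ _ lv.2) -intRD; [|exact: rIZ lu.2|exact: rIZ lv.2].
apply: intR_le iL (rID (rIZ _ lu.2) (rIZ _ lv.2)) _ => z.
rewrite [leRHS](_ : _ = (2 * normc (u z) ^+ 2 + 2 * normc (v z) ^+ 2) * ka z); last by ring.
apply: ler_wpM2r; first exact: kappa.1.
rewrite !normc_sq; case: (u z) (v z) => x1 y1 [x2 y2]; rewrite [complex.Re _]/= [complex.Im _]/= /=.
by have := sqr_ge0 (x1 - x2); have := sqr_ge0 (y1 - y2); nra.
Qed.

(** The complementary projection; the Hankel operator is [coproj] after multiplication by the symbol. *)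
Definition coproj h z : C := h z - fock_proj phi h z.

Lemma coproj_L2 h : L2w th h -> L2w th (coproj h) /\ wnorm2 th (coproj h) <= wnorm2 th h.
Proof.
move=> lh; have [_ lP _] := fproj_specP phi_C2 lh.
by split; [exact: (L2w_B pk lh lP)|exact: fproj_contr].
Qed.

Lemma coproj_lin u v (c : C) : L2w th u -> L2w th v ->
  coproj (fun z => u z + c * v z) = fun z => coproj u z + c * coproj v z.
Proof. by move=> lu lv; apply/funext => z; rewrite /coproj fproj_lin//; ring. Qed.

Lemma coproj_sum (I : Type) (l : seq I) (c : I -> C) (h : I -> C -> C) u : L2w th u -> (forall i, L2w th (h i)) ->
  coproj (fun z => u z + \sum_(i <- l) c i * h i z) = fun z => coproj u z + \sum_(i <- l) c i * coproj (h i) z.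
Proof.
move=> lu lh; elim: l => [|i l IH].
  have -> : (fun z => u z + \sum_(i <- [::]) c i * h i z) = u by apply/funext => z; rewrite big_nil addr0.
  by apply/funext => z; rewrite big_nil addr0.
have -> : (fun z => u z + \sum_(j <- i :: l) c j * h j z) = (fun z => (u z + \sum_(j <- l) c j * h j z) + c i * h i z).
  by apply/funext => z; rewrite big_cons; ring.
rewrite coproj_lin//; last first.
  have := L2w_lin 1 pk lu (L2w_sum l c pk lh); by under eq_fun do rewrite mul1r.
by rewrite IH; apply/funext => z; rewrite big_cons; ring.
Qed.

Lemma opnorm_le D (B : R) : 0 <= B -> (forall g, F2 phi g -> L2w th (D g) /\ wnorm2 th (D g) <= B * wnorm2 th g) ->
  (opnorm phi D <= (Num.sqrt B)%:E)%E.
Proof.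
move=> B0 hD; apply: ge_ereal_sup => _ [g [hg g1] <-].
have [lD qD] := hD g hg; have lg : L2w th g by case/(F2P phi_C2): hg.
rewrite (normphiE phi_C2)// lee_fin; apply: ler_wsqrtr; apply: (le_trans qD).
rewrite -[leRHS]mulr1; apply: ler_wpM2l => //.
move: g1; rewrite (normphiE phi_C2)// lee_fin => g1.
by rewrite -[leLHS]sqr_sqrtr ?(wnorm2_ge0 g pk)// exprn_ile1 ?sqrtr_ge0.
Qed.

Lemma bounded_of_wnorm2 D (B : R) : 0 <= B -> (forall g, F2 phi g -> L2w th (D g) /\ wnorm2 th (D g) <= B * wnorm2 th g) ->
  exists B' : R, forall g, F2 phi g -> (normphi phi (D g) <= B'%:E * normphi phi g)%E.
Proof.
move=> B0 hD; exists (Num.sqrt B) => g hg.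
have [lD qD] := hD g hg; have lg : L2w th g by case/(F2P phi_C2): hg.
rewrite !(normphiE phi_C2)// -EFinM lee_fin -sqrtrM//; exact: ler_wsqrtr.
Qed.

(** The defect 1 - z [recip]. *)
Definition chi z : R := bump 0 1 2 z / den z.

Lemma chi_ge0 z : 0 <= chi z.
Proof. by rewrite /chi divr_ge0 ?bump_ge0// ltW// den_gt0. Qed.

Lemma chi_le z : chi z <= isq 0 1 z.
Proof.
have [h|h] := leP 1 (dist2 0 z).
  by rewrite /chi bump0 ?mul1r// mul0r isq_ge0.
rewrite isq1; last first.
  by rewrite -(@ler_pXn2r _ 2)// ?nnegrE ?normc_ge0// expr1n; exact: ltW.
by rewrite /chi ler_pdivrMr ?den_gt0// mul1r /den lerDr dist2_ge0.
Qed.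

Lemma ctn_chi : ctn (fun z => (chi z)%:C).
Proof. by apply: ctnRM; [apply: ctnR; exact: continuous_bump|exact: ctn_denV]. Qed.

Lemma L2w_chi u : ctn u -> L2w th (fun z => (chi z)%:C * u z).
Proof.
move=> cu; apply: (L2w_csupp (weight_ctn wt)); first exact: ctnM ctn_chi cu.
have [x hx] := csupp_bump (0 : C) 1 (@ltr01 R); exists x => z /hx h.
by rewrite /chi h mul0r mul0r.
Qed.

Lemma test_weight_bound : exists2 B : R, 0 < B & forall u, ctn u -> L2w th u ->
  intR (fun z => normc (u z) ^+ 2 * bump 0 25^-1 1 z) <= B * wnorm2 th u.
Proof.
have s0 : 0 < 25^-1 :> R by [].
have t0 z : 0 < th z by exact: expR_gt0.
have ck : continuous ((fun z => (th z)^-1 * bump 0 25^-1 1 z) : C^o -> R).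
  by apply: ctnRr; apply: ctnRM; [exact: weight_inv_ctn wt|apply: ctnR; exact: continuous_bump].
have sk : csupp (fun z => (th z)^-1 * bump 0 25^-1 1 z).
  by have [x hx] := csupp_bump (0 : C) 0 s0; exists x => z /hx ->; rewrite mulr0.
have [x [B [_ B0 hB]]] := csupp_bounded ck sk; exists B => // u cu [mu_ iu].
have le z : bump 0 25^-1 1 z <= B * th z.
  rewrite mulrC -ler_pdivrMl// -[leLHS]/((th z)^-1 * bump 0 25^-1 1 z).
  apply: le_trans (ler_norm _) _; apply: (le_trans (hB z)).
  by rewrite -[leRHS]mulr1; apply: ler_wpM2l (isq_le1 _ _ _); exact: ltW.
rewrite /wnorm2 -(intRZ _ iu); apply: intR_le (rIZ _ iu) _ => [|z].
  apply: (L2w_rI wt (conj mu_ iu)); [exact: continuous_bump|exact: csupp_bump|by move=> z; exact: bump_ge0].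
by rewrite mulrCA; apply: ler_wpM2l; [exact: sqr_ge0|exact: le].
Qed.

(** The sub-mean value property makes evaluation at the origin continuous. *)
Lemma fock_eval : exists2 B : R, 0 < B & forall g, hol g -> L2w th g -> normc (g 0) ^+ 2 <= B * wnorm2 th g.
Proof.
have m0 := mass_gt0 R; have t0 : 0 < th 0 by exact: expR_gt0.
exists ((mass * th 0)^-1 * (4 * expR (2 * M))).
  by rewrite mulr_gt0 ?invr_gt0 ?mulr_gt0 ?expR_gt0.
move=> g hg lg; rewrite -mulrA ler_pdivlMl; last exact: mulr_gt0.
rewrite [leLHS](_ : _ = mass * (normc (g 0) ^+ 2 * th 0)); last by ring.
apply: le_trans (submean hphi hp cs cr 0 hg (ltW M0) hM) _.
apply: ler_wpM2l; first by rewrite mulr_ge0 ?expR_ge0.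
apply: intR_le (rI_bth hphi hp cs cr 0 2 (cdiff_ctn hg)) lg.2 _ => z.
by apply: ler_piMl; [rewrite mulr_ge0 ?sqr_ge0 ?expR_ge0|exact: bump_le1].
Qed.

Section Approximants.
Variable g0 : C -> C.
Hypotheses (hg0 : hol g0) (lg0 : L2w th g0) (g01 : g0 0 = 1).

Definition vanish0 g z : C := g z - g 0 * g0 z.

Lemma vanish0_hol g : hol g -> hol (vanish0 g).
Proof.
move=> hg; have := hol_lin (- g 0) hg hg0; rewrite /vanish0.
by under [X in _ -> hol X]eq_fun do rewrite -mulNr.
Qed.

Lemma vanish0_L2 g : L2w th g -> L2w th (vanish0 g).
Proof. by move=> lg; apply: L2w_B pk lg (L2w_Z _ pk lg0). Qed.

Lemma vanish0E g z : vanish0 g z = z * taylor_quot 1 (vanish0 g) z.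
Proof. by rewrite [LHS](taylorE 1) big_ord1 /taylor_quot /= {1}/vanish0 g01 mulr1 subrr mul0r add0r expr1. Qed.

(** With q the quotient of g - g(0) g0 by z: recip (g - g(0) g0) = recip z q = (1 - chi) q. *)
Lemma recip_g g z : recip z * g z = (taylor_quot 1 (vanish0 g) z + g 0 * (recip z * g0 z)) - (chi z)%:C * taylor_quot 1 (vanish0 g) z.
Proof.
have -> : recip z * g z = recip z * vanish0 g z + g 0 * (recip z * g0 z) by rewrite /vanish0; ring.
have -> : recip z * vanish0 g z = (z * recip z) * taylor_quot 1 (vanish0 g) z by rewrite [in LHS]vanish0E; ring.
by rewrite recip_mul -/(chi z); ring.
Qed.

Lemma recip_L2 g : L2w th g -> L2w th (fun z => recip z * g z) /\ wnorm2 th (fun z => recip z * g z) <= 4 * wnorm2 th g.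
Proof.
move=> lg; rewrite (_ : 4 = 2 ^+ 2); last by ring.
exact: (L2w_bounded pk (ctn_measurable (@ctn_recip R)) (@recip_le R) lg).
Qed.

(** By [recip_g] it is a combination of bounded multiples of [g] and [g0] and of a function of compact support. *)
Lemma quotient_L2 g : hol g -> L2w th g -> L2w th (taylor_quot 1 (vanish0 g)).
Proof.
move=> hg lg; have ct : ctn (taylor_quot 1 (vanish0 g)) := cdiff_ctn (taylor_quot_hol 1 (vanish0_hol hg)).
have l1 := L2w_lin (- g 0) pk (recip_L2 lg).1 (recip_L2 lg0).1.
have := L2w_lin 1 pk l1 (L2w_chi ct); congr (L2w _ _); apply/funext => z.
by rewrite recip_g; ring.
Qed.

Definition rest i : C -> C := coproj (fun z => (chi z)%:C * z ^+ i).
(** The Hankel operator with the Taylor polynomial in place of the quotient: [g] enters only through its value and N Taylor coefficients. *)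
Definition approx N g z : C := g 0 * hankel phi recip g0 z + \sum_(i < N) - taylor_quot i.+1 (vanish0 g) 0 * rest i z.

Lemma rest_L2 i : L2w th (rest i).
Proof. exact: (coproj_L2 (L2w_chi (@ctnXz R i))).1. Qed.

(** The quotient itself is in the Fock space, so [coproj] annihilates it. *)
Lemma hankel_approx N g : hol g -> L2w th g ->
  hankel phi recip g = fun z => approx N g z + - coproj (fun w => (chi w)%:C * (w ^+ N * taylor_quot N.+1 (vanish0 g) w)) z.
Proof.
move=> hg lg; set v := taylor_quot 1 (vanish0 g).
have hv : hol v := taylor_quot_hol 1 (vanish0_hol hg).
have lv : L2w th v := quotient_L2 hg lg.
have tlS i : taylor_quot i v = taylor_quot i.+1 (vanish0 g) by rewrite /v /taylor_quot -iterD addn1.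
pose e z := (chi z)%:C * (z ^+ N * taylor_quot N v z).
have le : L2w th e by apply: L2w_chi; apply: ctnM; [exact: ctnXz|exact: cdiff_ctn (taylor_quot_hol N hv)].
have l0 := (recip_L2 lg0).1.
have l1 : L2w th (fun z => v z + g 0 * (recip z * g0 z)) := L2w_lin _ pk lv l0.
have l2 := L2w_lin (-1) pk l1 le.
have -> : hankel phi recip g = coproj (fun z => recip z * g z) by [].
have -> : (fun z => recip z * g z) = (fun z => (v z + g 0 * (recip z * g0 z) + -1 * e z) +
    \sum_(i < N) - taylor_quot i.+1 (vanish0 g) 0 * ((chi z)%:C * z ^+ i)).
  apply/funext => z; rewrite recip_g -/v {2}[v z](taylorE N) mulrDr.
  have -> : (chi z)%:C * (\sum_(i < N) taylor_quot i v 0 * z ^+ i) = - \sum_(i < N) - taylor_quot i.+1 (vanish0 g) 0 * ((chi z)%:C * z ^+ i).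
    rewrite mulr_sumr -sumrN; apply: eq_bigr => i _; rewrite tlS; ring.
  by rewrite /e; ring.
rewrite coproj_sum// => [|i]; last exact: L2w_chi (@ctnXz R i).
rewrite coproj_lin// coproj_lin//.
apply/funext => z; rewrite /approx /e tlS.
rewrite {1}/coproj fproj_fix// subrr add0r mulN1r addrAC -/(hankel phi recip g0).
by [].
Qed.

(** The error is [coproj] of chi z^N times a Taylor quotient, with chi supported in the unit disc, where [tail_bound] applies. *)
Lemma approx_error : exists2 B : R, 0 < B & forall N g, F2 phi g ->
  L2w th (fun z => hankel phi recip g z - approx N g z) /\
  wnorm2 th (fun z => hankel phi recip g z - approx N g z) <= B * 4^-1 ^+ N * wnorm2 th g.
Proof.
have [B1 B10 hB1] := @tail_bound R.
have [B2 B20 hB2] := test_weight_bound.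
have [B3 B30 hB3] := fock_eval.
pose k z := th z * (2 * bump 0 4^-1 1 z).
have k0 z : 0 <= k z by rewrite mulr_ge0 ?expR_ge0// mulr_ge0 ?bump_ge0.
have ik : rI k.
  apply: rI_csupp.
    apply: ctnRr; apply: ctnRM; first exact: weight_ctn wt.
    by apply: ctnRM; [exact: ctn_cst|apply: ctnR; exact: continuous_bump].
  have [x hx] : csupp (bump (0 : C) 4^-1 1) by apply: csupp_bump.
  by exists x => z /hx h; rewrite /k h !mulr0.
have J0 : 0 <= intR k by exact: intR_ge0.
have q0 : 0 <= wnorm2 th g0 := wnorm2_ge0 g0 pk.
exists (B1 * B2 * (2 + 2 * (B3 * wnorm2 th g0)) * (1 + intR k)).
  by rewrite !mulr_gt0// ltr_wpDr// !mulr_ge0// ltW.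
move=> N g /(F2P phi_C2) [hg lg]; set u := vanish0 g.
have hu : hol u := vanish0_hol hg; have lu : L2w th u := vanish0_L2 lg.
have qg0 : 0 <= wnorm2 th g := wnorm2_ge0 g pk; have qu0 : 0 <= wnorm2 th u := wnorm2_ge0 u pk.
(* subtracting g(0) g0 costs a constant, since evaluation at 0 is continuous *)
have qu : wnorm2 th u <= (2 + 2 * (B3 * wnorm2 th g0)) * wnorm2 th g.
  have -> : u = fun z => g z + - g 0 * g0 z by apply/funext => z; rewrite /u /vanish0 mulNr.
  apply: le_trans (wnorm2_D2 pk lg (L2w_Z _ pk lg0)) _; rewrite (wnorm2_Z (- g 0) pk lg0) normcN [leRHS]mulrDl; apply: lerD => //.
  rewrite [leRHS](_ : _ = 2 * (B3 * wnorm2 th g * wnorm2 th g0)); last by ring.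
  by apply: ler_wpM2l => //; apply: ler_wpM2r; [exact: q0|exact: hB3].
set h := fun w => (chi w)%:C * (w ^+ N * taylor_quot N.+1 u w).
have lh : L2w th h by apply: L2w_chi; apply: ctnM; [exact: ctnXz|exact: cdiff_ctn (taylor_quot_hol N.+1 hu)].
pose D := B1 * 4^-1 ^+ N * (B2 * wnorm2 th u).
have p0 : 0 <= 4^-1 ^+ N :> R by rewrite exprn_ge0.
have D0 : 0 <= D.
  by apply: mulr_ge0; apply: mulr_ge0; [exact: ltW|exact: p0|exact: ltW|exact: qu0].
have hD z : normc z <= 1 -> normc (taylor_quot N.+1 u z) ^+ 2 <= D.
  move=> z1; apply: le_trans (hB1 u N.+1 z hu z1) _; rewrite /D; apply: ler_pM.
  - by apply: mulr_ge0; [exact: ltW|rewrite exprn_ge0].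
  - by apply: intR_ge0 => x; rewrite mulr_ge0 ?sqr_ge0 ?bump_ge0.
  - apply: ler_wpM2l; first exact: ltW.
    by rewrite exprS; apply: ler_piMl; [exact: p0|lra].
  - exact: hB2 (cdiff_ctn hu) lu.
have qh : wnorm2 th h <= D * intR k.
  rewrite /wnorm2 -(intRZ _ ik); apply: intR_le lh.2 (rIZ D ik) _ => z.
  have [n1|n1] := leP 1 (dist2 0 z).
    by rewrite /h /chi bump0 ?mul1r// !mul0r normc0 expr0n mul0r; exact: mulr_ge0.
  have z1 : normc z <= 1.
    by rewrite -(@ler_pXn2r _ 2)// ?nnegrE ?normc_ge0// expr1n -[z]subr0; exact: ltW.
  rewrite /k [leRHS](_ : _ = D * (2 * bump 0 4^-1 1 z) * th z); last by ring.
  apply: ler_wpM2r; first exact: expR_ge0.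
  apply: le_trans (_ : D * 1 <= _); last first.
    by apply: (ler_wpM2l D0); rewrite /bump expr1 pp_pos; lra.
  rewrite mulr1; apply: le_trans (hD z z1); rewrite ler_pXn2r// ?nnegrE ?normc_ge0//.
  rewrite /h !normcM mulrA; apply: ler_piMl; first exact: normc_ge0.
  rewrite normc_real ger0_norm ?chi_ge0// normcX; apply: mulr_ile1.
  - exact: chi_ge0.
  - by rewrite exprn_ge0 ?normc_ge0.
  - exact: le_trans (chi_le z) (isq_le1 _ _ _).
  - by apply: exprn_ile1; [exact: normc_ge0|].
have [lc qc] := coproj_L2 lh.
have -> : (fun z => hankel phi recip g z - approx N g z) = fun z => -1 * coproj h z.
  by apply/funext => z; rewrite (hankel_approx N hg lg) -/u -/h; ring.
split; first exact: (L2w_Z (-1) pk lc).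
rewrite (wnorm2_Z (-1) pk lc) normcN normc1 expr1n mul1r; apply: (le_trans qc); apply: (le_trans qh).
rewrite [leRHS](_ : _ = (B1 * 4^-1 ^+ N * (B2 * ((2 + 2 * (B3 * wnorm2 th g0)) * wnorm2 th g))) * (1 + intR k)); last by ring.
apply: ler_pM => //; last by rewrite lerDr.
rewrite /D; apply: ler_wpM2l; first by apply: mulr_ge0 => //; exact: ltW.
by apply: ler_wpM2l qu; exact: ltW.
Qed.

(** Boundedness comes for free from that of the Hankel operator and of the error. *)
Lemma approx_bounded N : bounded_linear_op phi (approx N).
Proof.
have [B B0 hB] := approx_error.
have lA g : F2 phi g -> L2w th (approx N g).
  move=> hg; have [lE _] := hB N g hg; move/(F2P phi_C2) : hg => [hg lg].
  have lH : L2w th (hankel phi recip g) := (coproj_L2 (recip_L2 lg).1).1.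
  have := L2w_B pk lH lE; congr (L2w _ _); apply/funext => z; ring.
split=> [g hg|a g h /(F2P phi_C2)[hg lg] /(F2P phi_C2)[hh lh]|]; first by apply/(L2P phi_C2); exact: lA.
  apply: aeW => z; rewrite /approx.
  have hvg := vanish0_hol hg; have hvh := vanish0_hol hh.
  have -> : vanish0 (fun w => a * g w + h w) = (fun w => vanish0 h w + a * vanish0 g w).
    by apply/funext => w; rewrite /vanish0; ring.
  rewrite (eq_bigr (fun i : 'I_N => a * (- taylor_quot i.+1 (vanish0 g) 0 * rest i z) + - taylor_quot i.+1 (vanish0 h) 0 * rest i z)) => [|i _].
    by rewrite big_split /= -mulr_sumr; ring.
  by rewrite taylor_quot_lin//; ring.
have q0 : 0 <= 4^-1 ^+ N :> R by rewrite exprn_ge0.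
have K0 : 0 <= 2 * 4 + 2 * (B * 4^-1 ^+ N) by rewrite addr_ge0// !mulr_ge0// ltW.
apply: (bounded_of_wnorm2 K0) => g hg; split; first exact: lA.
have [lE qE] := hB N g hg; move/(F2P phi_C2) : hg => [hg lg].
have [lH qH] := coproj_L2 (recip_L2 lg).1; have [_ qR] := recip_L2 lg.
have -> : approx N g = fun z => hankel phi recip g z + -1 * (hankel phi recip g z - approx N g z).
  by apply/funext => z; ring.
apply: le_trans (wnorm2_D2 pk lH (L2w_Z (-1) pk lE)) _.
rewrite (wnorm2_Z (-1) pk lE) normcN normc1 expr1n mul1r [leRHS]mulrDl -mulrA -[2 * _ * _]mulrA.
apply: lerD; apply: ler_wpM2l => //; exact: (le_trans qH qR).
Qed.

Lemma approx_rank N : rank_le phi N.+1 (approx N).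
Proof.
pose e (i : 'I_N.+1) := oapp (fun k : 'I_N => rest k) (hankel phi recip g0) (unlift ord0 i).
exists e => [i|g hg].
  apply/(L2P phi_C2); rewrite /e; case: (unlift ord0 i) => [k|] /=; first exact: rest_L2.
  exact: (coproj_L2 (recip_L2 lg0).1).1.
exists (fun i => oapp (fun k : 'I_N => - taylor_quot k.+1 (vanish0 g) 0) (g 0) (unlift ord0 i)).
apply: aeW => z; rewrite big_ord_recl /e unlift_none /approx /=; congr (_ + _).
by apply: eq_bigr => i _; rewrite liftK.
Qed.

(** The case j = 0 is the bound on the norm of the operator; for j = N + 1 use [approx N]. *)
Lemma recip_singular : exists2 D : R, 0 < D & forall j, (singular_value phi (hankel phi recip) j <= (D * 2^-1 ^+ j)%:E)%E.
Proof.
have [B B0 hB] := approx_error.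
exists (2 * Num.sqrt B + 2) => [|j]; first by rewrite ltr_wpDl// mulr_ge0 ?sqrtr_ge0.
have q0 k : 0 <= 2^-1 ^+ k :> R by rewrite exprn_ge0.
case: j => [|N].
  apply: le_trans (_ : (Num.sqrt 4)%:E <= _)%E; last first.
    rewrite lee_fin expr0 mulr1 (_ : 4 = 2 ^+ 2); last by ring.
    by rewrite sqrtr_sqr ger0_norm// lerDr mulr_ge0 ?sqrtr_ge0.
  apply: le_trans (_ : opnorm phi (fun g z => hankel phi recip g z - 0)%R <= _)%E.
    apply: ereal_inf_lbound; exists (fun _ _ => 0) => //; split.
      have l0 : L2w th (fun=> 0) by case/(F2P phi_C2) : (F2_0 phi_C2).
      split=> [g _|a g h _ _|]; first exact/(L2P phi_C2).
        by apply: aeW => z; rewrite mulr0 addr0.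
      apply: (@bounded_of_wnorm2 _ 1) => // g /(F2P phi_C2)[_ lg]; split => //.
      rewrite mul1r (_ : wnorm2 th (fun=> 0) = 0) ?(wnorm2_ge0 g pk)//.
      by rewrite /wnorm2; under eq_fun do rewrite normc0 expr0n mul0r; exact: intR0.
    exists (fun (_ : 'I_0) _ => 0) => [[]//|g _]; exists (fun=> 0).
    by apply: aeW => z; rewrite big_ord0.
  apply: opnorm_le => // g /(F2P phi_C2)[hg lg].
  have -> : (fun z => hankel phi recip g z - 0) = hankel phi recip g by apply/funext => z; rewrite subr0.
  have [lH qH] := coproj_L2 (recip_L2 lg).1; split; first exact: lH.
  exact: le_trans qH (recip_L2 lg).2.
apply: le_trans (_ : (Num.sqrt (B * 4^-1 ^+ N))%:E <= _)%E.
  apply: le_trans (_ : opnorm phi (fun g z => hankel phi recip g z - approx N g z)%R <= _)%E.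
    by apply: ereal_inf_lbound; exists (approx N) => //; split; [exact: approx_bounded|exact: approx_rank].
  apply: opnorm_le => [|g hg]; first by rewrite mulr_ge0 ?exprn_ge0// ltW.
  exact: hB.
rewrite lee_fin sqrtrM ?(ltW B0)// (_ : 4^-1 ^+ N = (2^-1 ^+ N) ^+ 2 :> R); last by rewrite -exprM mulnC exprM; congr (_ ^+ _); field.
rewrite sqrtr_sqr ger0_norm// exprS mulrA; apply: ler_wpM2r; first exact: q0.
by rewrite mulrDl; lra.
Qed.
End Approximants.

Theorem hankel_recip_schatten (q : R) : 0 < q -> (exists2 g0, hol g0 /\ L2w th g0 & g0 0 != 0) -> Schatten phi q (hankel phi recip).
Proof.
move=> q0 [h [hh lh] h0].
have hg0 : hol (fun z => (h 0)^-1 * h z).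
  by move=> z; have [l hl] := hh z; exists ((h 0)^-1 * l); exact: cdiffZ.
have [D D0 hD] := recip_singular hg0 (L2w_Z _ pk lh) (mulVf h0).
pose x : R := 2^-1 `^ q.
have x0 : 0 <= x by exact: powR_ge0.
have x1 : x < 1.
  have -> : 1 = (1 : R) `^ q by rewrite powR1.
  by apply: gt0_ltr_powR; rewrite ?nnegrE//; lra.
have s0 j : (0 <= singular_value phi (hankel phi recip) j)%E.
  by apply: le_ereal_inf_tmp => _ [K _ <-]; exact: opnorm_ge0.
have le j : (singular_value phi (hankel phi recip) j `^ q <= (D `^ q * x ^+ j)%:E)%E.
  have -> : D `^ q * x ^+ j = (D * 2^-1 ^+ j) `^ q.
    rewrite powRM ?exprn_ge0 ?(ltW D0)//; congr (_ * _).
    exact: powRX.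
  rewrite -poweR_EFin; apply: gt0_ler_poweR => //; first exact: ltW.
  - by rewrite in_itv /= s0 leey.
  - by rewrite in_itv /= leey andbT lee_fin mulr_ge0 ?exprn_ge0// ltW.
apply: le_lt_trans (ltry (D `^ q * (1 - x)^-1)).
apply: lime_le; first by apply: is_cvg_nneseries => j _ _; exact: poweR_ge0.
apply: nearW => N; apply: le_trans (lee_sum _ (fun j _ => le j)) _.
rewrite sumEFin lee_fin big_mkord -mulr_sumr; apply: ler_wpM2l; first exact: powR_ge0.
exact: geo_sum.
Qed.
End ReciprocalSide.

(** * Failure of the Berger-Coburn phenomenon *)

Theorem theorem7 (R : realType) (phi : R[i] -> R) (m M p : R)
  (phi_ge0 : forall z : R[i], 0 <= phi z)
  (phi_C2 : C2 phi)
  (m_gt0 : 0 < m) (M_gt0 : 0 < M)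
  (phi_ddbar : forall z : R[i],
     m * ddbar (fun w : R[i] => normc w ^+ 2) z <= ddbar phi z
       <= M * ddbar (fun w : R[i] => normc w ^+ 2) z)
  (p_gt0 : 0 < p) (p_le1 : p <= 1) :
  ~ Berger_Coburn phi p /\
  exists f : R[i] -> R[i],
    [/\ Linfty f,
        Schatten phi p (hankel phi f) &
        ~ Schatten phi p (hankel phi (fun z : R[i] => ((f z)^*)%C))].
Proof.
have [P [s [r [hphi hP hr cP [cs cr]]]]] := C2_potential phi_C2.
have hm z : m <= complex.Re (r z).
  by have /andP[h _] := phi_ddbar z; rewrite hr; rewrite ddbar_normc2 mulr1 in h.
have hM z : complex.Re (r z) <= M.
  by have /andP[_ h] := phi_ddbar z; rewrite hr; rewrite ddbar_normc2 mulr1 in h.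
have Lf : Linfty (@recip R) := bounded_Linfty (ctn_measurable (@ctn_recip R)) (@recip_le R).
have Sf : Schatten phi p (hankel phi (@recip R)).
  apply: (hankel_recip_schatten phi_C2 hphi hP cs cr M_gt0 hM p_gt0).
  have [g [hg lg g1 _ _]] := fock_peak phi_C2 hphi hP cs cr m_gt0 hm 0.
  exists g => //; apply/negP => /eqP g0; move: g1; rewrite g0 normc0 expr0n mul0r => /esym/eqP.
  by rewrite oner_eq0.
have nSf := hankel_conj_not_schatten phi_C2 hphi hP cs cr m_gt0 M_gt0 hm hM p_gt0 p_le1.
have nSf' : ~ Schatten phi p (hankel phi (fun z => ((recip z)^*)%C)) := nSf.
split; last by exists (@recip R); split; [exact: Lf|exact: Sf|exact: nSf'].
move=> bc; have [h _] := bc _ Lf; exact: nSf' (h Sf).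
Qed.
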